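(* Consider the map $K : l^2_\gamma \to l^2_{-\gamma}$ with $K_{i,j} = i\wedge j = \min(i,j)$, $i,j\ge 1$, and assume $\gamma > \frac{7}{2}$. Then there exists a unique path distribution $F_K$ on $l^2_{-\gamma}$ such that $$\widehat{F}_K(\xi) = e^{-\frac{i}{2}\langle K\xi,\xi\rangle},$$ given by $F_K = D\mu$, where $$D = \prod_{i=1}^\infty \left(1 - \frac{\beta_i}{2}\frac{\partial^2}{\partial x_i^2}\right)$$ with positive constants $\beta_i$, and where $\mu$ is a bounded Radon measure strongly concentrated on $l^2_{-\gamma}$ with respect to the weak topology.
   Context: For real $\gamma$, $l^2_\gamma = \{(\xi_i)_{i=1}^\infty \in \mathbb{R}^\infty : \sum_{i=1}^\infty i^\gamma \xi_i^2 < +\infty\}$ is a Hilbert space with inner product $(\xi,\zeta)_\gamma = \sum_i i^\gamma \xi_i\zeta_i$. The spaces $l^2_\gamma$ and $l^2_{-\gamma}$ are dual with respect to the bracket $\langle \xi, x\rangle = \sum_{i=1}^\infty \xi_i x_i$ ($\xi\in l^2_\gamma$, $x\in l^2_{-\gamma}$), and $\langle K\xi,\xi\rangle = \sum_{i,j} K_{i,j}\xi_i\xi_j$ for $\xi\in l^2_\gamma$. A path distribution is a generalised distribution on a space of paths (here sequences $x=(x_i)_{i\ge1}\in l^2_{-\gamma}$) obtained as a derivative $F = D\mu$ of a bounded, in general complex-valued, measure $\mu$, with $D$ a differential operator of the form displayed in the claim; it acts on suitable functions $\varphi$ by $\langle \varphi, F\rangle = \langle D\varphi,\mu\rangle = \int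 (D\varphi)\,d\mu$. Its Fourier transform is $\widehat F(\xi) = \langle e^{i\langle \xi,\cdot\rangle}, F\rangle$, $\xi\in l^2_\gamma$. The $\beta_i$ are positive constants, not further specified in the statement. ''Strongly concentrated on $l^2_{-\gamma}$ with respect to the weak topology'' means defining a Radon measure on $l^2_{-\gamma}$ equipped with its weak topology (which is the case if, for every $\epsilon>0$, the total mass is concentrated on a weakly compact set up to $\epsilon$). *)

(* Defs.v *)
From HB Require Import structures.
From mathcomp Require Import all_boot all_order all_algebra.
From mathcomp Require Import complex.
From mathcomp Require Import ring lra.
From mathcomp Require Import all_classical all_reals all_analysis.

Set Implicit Arguments.
Unset Strict Implicit.
Unset Printing Implicit Defensive.

Import Order.TTheory GRing.Theory Num.Theory.
Import numFieldNormedType.Exports.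

Local Open Scope classical_set_scope.
Local Open Scope ring_scope.

Section Weight.
Context {R : realType}.

(* Sequences (xi_i), i >= 1, are encoded as functions on nat, the value at
   [i] being the coordinate of index [i.+1]. *)
Definition l2weight (a : R) (i : nat) : R := i.+1%:R `^ a.

Definition l2_mem (a : R) : {pred nat -> R} :=
  fun x => `[< cvgn (series (fun i => l2weight a i * x i ^+ 2)) >].

End Weight.

Record l2 (R : realType) (a : R) := L2 {
  l2seq : nat -> R ;
  l2seqP : l2seq \in l2_mem a }.

Section L2Space.
Context (R : realType) (a : R).
Local Notation w := (l2weight a).
Implicit Types x y : nat -> R.

Lemma l2weight_gt0 i : 0 < w i.
Proof. by rewrite powR_gt0. Qed.

Lemma l2weight_ge0 i : 0 <= w i.
Proof. exact/ltW/l2weight_gt0. Qed.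

Lemma l2_memE x :
  (x \in l2_mem a) <-> cvgn (series (fun i => w i * x i ^+ 2)).
Proof. by split => [/asboolP|H]; [|apply/asboolP]. Qed.

Lemma l2_submod_closed : submod_closed (l2_mem a).
Proof.
split.
  apply/l2_memE; rewrite (_ : series _ = (fun=> 0)); first exact: is_cvg_cst.
  apply/funext => n; rewrite /series /= big1 // => i _.
  by rewrite -[(0 : nat -> R) i]/(0 : R) expr0n mulr0.
move=> k x y /l2_memE hx /l2_memE hy; apply/l2_memE.
pose f := fun i => (2 * k ^+ 2) * (w i * x i ^+ 2) + 2 * (w i * y i ^+ 2).
apply: (@series_le_cvg _ _ f).
- by move=> i; rewrite mulr_ge0 ?l2weight_ge0 ?sqr_ge0.
- move=> i; have h z : 0 <= w i * z ^+ 2 by rewrite mulr_ge0 ?l2weight_ge0 ?sqr_ge0.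
  by rewrite /f addr_ge0 // mulr_ge0 ?h // mulr_ge0 ?sqr_ge0.
- move=> i; rewrite /f /= -[(_ + _) i]/(k * x i + y i).
  have -> : 2 * k ^+ 2 * (w i * x i ^+ 2) + 2 * (w i * y i ^+ 2) =
     w i * (2 * (k * x i) ^+ 2 + 2 * y i ^+ 2) by ring.
  apply: ler_wpM2l; first exact: l2weight_ge0.
  have := sqr_ge0 (k * x i - y i); nra.
- rewrite (_ : f = (2 * k ^+ 2) *: (fun i => w i * x i ^+ 2)
     + 2 *: (fun i => w i * y i ^+ 2)) //.
  by apply: is_cvg_seriesD; apply: is_cvg_seriesZ.
Qed.

HB.instance Definition _ :=
  GRing.isSubmodClosed.Build R (nat -> R) (l2_mem a) l2_submod_closed.

HB.instance Definition _ := [isSub of l2 a for @l2seq R a].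
HB.instance Definition _ := [Choice of l2 a by <:].
HB.instance Definition _ := [SubChoice_isSubLmodule of l2 a by <:].

Implicit Types u v : l2 a.

Definition l2inner u v : R :=
  limn (series (fun i => w i * (l2seq u i * l2seq v i))).

Definition l2norm u : R := Num.sqrt (l2inner u u).

Lemma l2_sqr_cvg u : cvgn (series (fun i => w i * l2seq u i ^+ 2)).
Proof. by apply/l2_memE; exact: l2seqP. Qed.

Lemma l2inner_cvg u v :
  cvgn (series (fun i => w i * (l2seq u i * l2seq v i))).
Proof.
apply: normed_cvg.
pose f := (fun i => w i * l2seq u i ^+ 2) + (fun i => w i * l2seq v i ^+ 2).
apply: (@series_le_cvg _ _ f).
- by move=> i; exact: normr_ge0.
- by move=> i; rewrite /f addr_ge0 // mulr_ge0 ?l2weight_ge0 ?sqr_ge0.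
- move=> i; rewrite /= normrM (ger0_norm (l2weight_ge0 i)) -[f i]/(_ + _).
  rewrite -mulrDr ler_wpM2l ?l2weight_ge0 // normrM.
  rewrite -(real_normK (num_real (l2seq u i))) -(real_normK (num_real (l2seq v i))).
  have := sqr_ge0 (`|l2seq u i| - `|l2seq v i|).
  have := sqr_ge0 (`|l2seq u i|); have := sqr_ge0 (`|l2seq v i|); nra.
- by apply: is_cvg_seriesD; exact: l2_sqr_cvg.
Qed.

Lemma l2innerC u v : l2inner u v = l2inner v u.
Proof. by rewrite /l2inner; under eq_fun do rewrite (mulrC (l2seq u _)). Qed.

Lemma l2innerDZ k u v v' :
  l2inner u (k *: v + v') = k * l2inner u v + l2inner u v'.
Proof.
rewrite /l2inner -[_ * _]/(k *: _) -(lim_seriesZ _ (@l2inner_cvg u v)).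
rewrite -lim_seriesD; first last.
- exact: l2inner_cvg.
- by apply: is_cvg_seriesZ; exact: l2inner_cvg.
congr (limn (series _)); apply/funext => i.
rewrite -[LHS]/(w i * (l2seq u i * (k * l2seq v i + l2seq v' i))).
rewrite -[RHS]/(k * (w i * (l2seq u i * l2seq v i))
  + w i * (l2seq u i * l2seq v' i)).
by ring.
Qed.

Lemma l2inner_ge0 u : 0 <= l2inner u u.
Proof.
apply: limr_ge; first exact: l2inner_cvg.
by apply: nearW => n; rewrite sumr_ge0 // => i _;
  rewrite mulr_ge0 ?l2weight_ge0 // -expr2 sqr_ge0.
Qed.

Lemma l2inner_eq0 u : l2inner u u = 0 -> u = 0.
Proof.
move=> u0; apply/val_inj/funext => i /=.
have nd : nondecreasing_seq (series (fun i => w i * (l2seq u i * l2seq u i))).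
  apply/nondecreasing_seqP => n; rewrite -subr_ge0 seriesSB.
  by rewrite mulr_ge0 ?l2weight_ge0 // -expr2 sqr_ge0.
have h m := nondecreasing_cvgn_le nd (@l2inner_cvg u u) m.
rewrite -/(l2inner u u) u0 in h.
have h0 : 0 <= series (fun i => w i * (l2seq u i * l2seq u i)) i.
  by rewrite sumr_ge0 // => j _; rewrite mulr_ge0 ?l2weight_ge0 // -expr2 sqr_ge0.
have := h i.+1; rewrite seriesSr => h1.
have : w i * (l2seq u i * l2seq u i) <= 0 by lra.
rewrite pmulr_rle0 ?l2weight_gt0 // -expr2 => h2.
by apply/eqP; rewrite -sqrf_eq0 eq_le h2 sqr_ge0.
Qed.

Lemma l2_CauchySchwarz u v : l2inner u v <= l2norm u * l2norm v.
Proof.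
have quad t : 0 <= l2inner u u + 2 * t * l2inner u v + t ^+ 2 * l2inner v v.
  have := l2inner_ge0 (t *: v + u).
  rewrite l2innerDZ (l2innerC _ v) (l2innerC _ u) !l2innerDZ (l2innerC v u).
  by congr (_ <= _); ring.
have [v0|v0] := eqVneq (l2inner v v) 0.
  have z : v = 0 := l2inner_eq0 v0.
  have : l2inner u v = 0.
    have := l2innerDZ (-1) u v v; rewrite scaleN1r addNr z; lra.
  by move=> ->; rewrite mulr_ge0 ?sqrtr_ge0.
have vgt : 0 < l2inner v v by rewrite lt_neqAle eq_sym v0 l2inner_ge0.
rewrite /l2norm -sqrtrM ?l2inner_ge0 //.
apply: (le_trans (ler_norm _)); rewrite -sqrtr_sqr ler_sqrt; last first.
  by rewrite mulr_ge0 ?l2inner_ge0.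
have := quad (- (l2inner u v / l2inner v v)).
rewrite -(pmulr_rge0 _ vgt).
have -> : l2inner v v * (l2inner u u + 2 * - (l2inner u v / l2inner v v) * l2inner u v +
    (- (l2inner u v / l2inner v v)) ^+ 2 * l2inner v v) =
    l2inner u u * l2inner v v - l2inner u v ^+ 2 by field.
by rewrite subr_ge0.
Qed.

Lemma l2normD u v : l2norm (u + v) <= l2norm u + l2norm v.
Proof.
rewrite -(ler_sqr) ?nnegrE ?addr_ge0 ?sqrtr_ge0 // sqrrD.
rewrite /l2norm !sqr_sqrtr ?l2inner_ge0 // -!/(l2norm _).
have := l2_CauchySchwarz u v.
have -> : l2inner (u + v) (u + v) = l2inner u u + 2 * l2inner u v + l2inner v v.
  rewrite -{1}(scale1r u) -[X in l2inner _ (X + _)](scale1r u) l2innerDZ.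
  rewrite (l2innerC _ u) (l2innerC _ v) !l2innerDZ (l2innerC v u); ring.
rewrite -mulr_natl; lra.
Qed.

Lemma l2normZ (k : R) u : l2norm (k *: u) = `|k| * l2norm u.
Proof.
rewrite /l2norm -sqrtr_sqr -sqrtrM ?sqr_ge0 //; congr Num.sqrt.
have i0 (x : l2 a) : l2inner x 0 = 0.
  by have := l2innerDZ (-1) x x x; rewrite scaleN1r addNr; lra.
rewrite -[k *: u]addr0 l2innerDZ i0 l2innerC l2innerDZ i0; ring.
Qed.

Lemma l2norm0_eq0 u : l2norm u = 0 -> u = 0.
Proof.
by move/eqP; rewrite sqrtr_eq0 => h; apply: l2inner_eq0;
  apply/eqP; rewrite eq_le h l2inner_ge0.
Qed.

HB.instance Definition _ :=
  Lmodule_isNormed.Build R (l2 a) l2normD l2normZ l2norm0_eq0.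

End L2Space.

Section Coordinates.
Context (R : realType) (a : R).

Lemma l2unit_subproof (i : nat) :
  (fun j => (j == i)%:R : R) \in l2_mem a.
Proof.
apply/l2_memE; apply: nondecreasing_is_cvgn.
  apply/nondecreasing_seqP => n; rewrite -subr_ge0 seriesSB.
  by rewrite mulr_ge0 ?l2weight_ge0 ?sqr_ge0.
exists (l2weight a i) => _ [n _ <-]; rewrite /series /=.
have h j : l2weight a j * ((j == i)%:R : R) ^+ 2 =
    if j == i then l2weight a i else 0.
  by have [->|_] := eqVneq j i; rewrite ?expr1n ?mulr1 // expr0n mulr0.
under eq_bigr do rewrite h.
have [ni|ni] := ltnP i n.
  rewrite big_mkord -big_mkcond /= (big_pred1 (Ordinal ni)) //.
rewrite big_mkord big1 ?l2weight_ge0 // => j _.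
by rewrite ltn_eqF // (leq_trans (ltn_ord j)).
Qed.

Definition l2unit (i : nat) : l2 a := L2 (l2unit_subproof i).

End Coordinates.

(* The bracket of the duality between [l2 gamma] and [l2 (- gamma)]. *)
Definition bracket (R : realType) (gamma : R)
    (xi : l2 gamma) (x : l2 (- gamma)) : R :=
  limn (series (fun i => l2seq xi i * l2seq x i)).

Section MinKernel.
Context {R : realType} (gamma : R).

Definition minK (i j : nat) : R := (minn i.+1 j.+1)%:R.

Definition minK_row (xi : nat -> R) (i : nat) : R :=
  limn (series (fun j => minK i j * xi j)).

Lemma cvg_riemannR32 p : 3 / 2 <= p -> cvgn (series (fun i => i.+1%:R `^ (- p) : R)).
Proof.
move=> hp.
apply: (@series_le_cvg _ _ (fun i => i.+1%:R `^ (- (3 / 2)))).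
- by move=> i; exact: powR_ge0.
- by move=> i; exact: powR_ge0.
- by move=> i; apply: ler_powR; [rewrite ler1n|lra].
apply: nondecreasing_is_cvgn.
  apply/nondecreasing_seqP => n; rewrite -subr_ge0 seriesSB; exact: powR_ge0.
have E n : (n.+1%:R : R) `^ (- (3 / 2)) = (Num.sqrt n.+1%:R ^+ 3)^-1.
  rewrite powRN; congr (_^-1).
  have -> : 3 / 2 = 2^-1 * 3%:R :> R by rewrite mulrC.
  by rewrite powRrM powR_mulrn ?powR_ge0 // powR12_sqrt.
have B n : series (fun i => (i.+1%:R : R) `^ (- (3 / 2))) n.+1 <=
    3 - 2 / Num.sqrt n.+1%:R.
  elim: n => [|n IH].
    by rewrite /series /= big_nat1 E sqrtr1 expr1n invr1; lra.
  rewrite seriesSr E; apply: (le_trans (lerD IH (lexx _))).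
  set s := Num.sqrt n.+1%:R; set t := Num.sqrt n.+2%:R.
  have s0 : 0 < s by rewrite sqrtr_gt0.
  have t0 : 0 < t by rewrite sqrtr_gt0.
  have st : s <= t by rewrite ler_sqrt ?ler_nat.
  have ts : t ^+ 2 = s ^+ 2 + 1.
    by rewrite !sqr_sqrtr // -natr1.
  have pos : 0 < s * t ^+ 3 * (s + t) by rewrite !mulr_gt0 ?exprn_gt0 ?addr_gt0.
  rewrite -subr_ge0 -(pmulr_rge0 _ pos).
  have -> : s * t ^+ 3 * (s + t) *
      (3 - 2 / t - (3 - 2 / s + (t ^+ 3)^-1)) =
      (s + t) * (2 * t ^+ 2 * (t - s)) - s * (s + t).
    by field; rewrite ?gt_eqF.
  have -> : (s + t) * (2 * t ^+ 2 * (t - s)) = 2 * t ^+ 2 * (t ^+ 2 - s ^+ 2) by ring.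
  rewrite ts; nra.
exists 3 => _ [n _ <-]; case: n => [|n].
  by rewrite /series /= big_geq.
apply: (le_trans (B n)).
have : 0 <= 2 / Num.sqrt (n.+1%:R : R) by rewrite divr_ge0 ?sqrtr_ge0.
lra.
Qed.

Context (hgamma : 7 / 2 < gamma).

Lemma minK_row_le (xi : l2 gamma) i j :
  `|minK i j * l2seq xi j| <=
  j.+1%:R `^ (- (gamma - 2)) + l2weight gamma j * l2seq xi j ^+ 2.
Proof.
set p := (j.+1%:R : R) `^ _; set q := l2weight gamma j * _.
have p0 : 0 <= p by exact: powR_ge0.
have q0 : 0 <= q by rewrite mulr_ge0 ?l2weight_ge0 ?sqr_ge0.
have pq : p * q = (j.+1%:R * `|l2seq xi j|) ^+ 2.
  rewrite exprMn real_normK ?num_real // /q mulrA; congr (_ * _).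
  rewrite /p /l2weight -powRD; last by rewrite pnatr_eq0 implybT.
  by rewrite (_ : - (gamma - 2) + gamma = 2%:R) ?powR_mulrn //; ring.
apply: (@le_trans _ _ (j.+1%:R * `|l2seq xi j|)).
  rewrite normrM ler_wpM2r // ger0_norm ?ler0n // ler_nat.
  exact: geq_minr.
set A := _ * `|_| in pq *.
have A0 : 0 <= A by rewrite mulr_ge0.
rewrite -(@ler_pXn2r _ 2) ?nnegrE ?addr_ge0 // -pq; nra.
Qed.

Lemma minK_bound_cvg (xi : l2 gamma) :
  cvgn (series (fun j => (j.+1%:R : R) `^ (- (gamma - 2)) +
    l2weight gamma j * l2seq xi j ^+ 2)).
Proof.
have h1 : cvgn (series (fun j => (j.+1%:R : R) `^ (- (gamma - 2)))).
  by apply: cvg_riemannR32; move: hgamma; lra.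
exact: is_cvg_seriesD h1 (@l2_sqr_cvg _ _ xi).
Qed.

Lemma minK_row_cvg (xi : l2 gamma) i :
  cvgn [normed series (fun j => minK i j * l2seq xi j)].
Proof.
apply: (series_le_cvg _ _ _ (@minK_bound_cvg xi)) => j.
- exact: normr_ge0.
- by rewrite addr_ge0 ?powR_ge0 // mulr_ge0 ?l2weight_ge0 ?sqr_ge0.
- exact: minK_row_le.
Qed.

Lemma minK_map_subproof (xi : l2 gamma) :
  minK_row (l2seq xi) \in l2_mem (- gamma).
Proof.
pose C := limn (series (fun j => (j.+1%:R : R) `^ (- (gamma - 2)) +
    l2weight gamma j * l2seq xi j ^+ 2)).
have hC i : `|minK_row (l2seq xi) i| <= C.
  apply: (le_trans (lim_series_norm (@minK_row_cvg xi i))).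
  apply: lim_series_le; [exact: minK_row_cvg|exact: minK_bound_cvg|].
  by move=> j; exact: minK_row_le.
apply/l2_memE; apply: (@series_le_cvg _ _ (C ^+ 2 *: (fun i => l2weight (- gamma) i))).
- by move=> i; rewrite mulr_ge0 ?l2weight_ge0 ?sqr_ge0.
- by move=> i; apply: mulr_ge0; rewrite ?l2weight_ge0 ?sqr_ge0.
- move=> i; rewrite -[leRHS]/(C ^+ 2 * l2weight (- gamma) i) mulrC.
  rewrite ler_wpM2r ?l2weight_ge0 // -(real_normK (num_real (minK_row _ _))).
  by rewrite lerXn2r ?nnegrE // (le_trans _ (hC i)).
- by apply: is_cvg_seriesZ; apply: cvg_riemannR32; move: hgamma; lra.
Qed.

Definition minK_map (xi : l2 gamma) : l2 (- gamma) := L2 (minK_map_subproof xi).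

End MinKernel.

(* The space [l2 (- gamma)] with its weak topology: the initial topology for
   the linear forms [bracket xi], [xi] ranging over the dual [l2 gamma]. *)
Definition l2weak (R : realType) (gamma : R) : Type :=
  initial_topology (fun x : l2 (- gamma) =>
    (fun xi => bracket xi x) : prod_topology (fun _ : l2 gamma => R)).

HB.instance Definition _ (R : realType) (gamma : R) :=
  Topological.on (l2weak gamma).
HB.instance Definition _ (R : realType) (gamma : R) :=
  Pointed.on (l2weak gamma).

Definition l2borel (R : realType) (gamma : R) : measurableType _ :=
  g_sigma_algebraType (@open (l2weak gamma)).

Section ComplexMeasure.
Context d (T : measurableType d) (R : realType).
Local Open Scope ereal_scope.

Definition hahn_pos (nu : {charge set T -> \bar R}) : set T :=
  sval (cid (Hahn_decomposition nu)).

Definition hahn_neg (nu : {charge set T -> \bar R}) : set T :=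
  sval (cid (svalP (cid (Hahn_decomposition nu)))).

Lemma hahn_pos_neg (nu : {charge set T -> \bar R}) :
  hahn_decomposition nu (hahn_pos nu) (hahn_neg nu).
Proof. exact: (svalP (cid (svalP (cid (Hahn_decomposition nu))))). Qed.

Definition total_variation (nu : {charge set T -> \bar R}) :
    {measure set T -> \bar R} := charge_variation (hahn_pos_neg nu).

Definition charge_int (nu : {charge set T -> \bar R}) (f : T -> R) : R :=
  (\int[jordan_pos (hahn_pos_neg nu)]_x f x -
   \int[jordan_neg (hahn_pos_neg nu)]_x f x)%R.

(* A bounded complex measure, given by its real and imaginary parts; charges
   are finite-valued, hence of finite total variation. *)
Record cmeasure := CMeasure {
  cmeasure_re : {charge set T -> \bar R} ;
  cmeasure_im : {charge set T -> \bar R} }.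

Definition cmeasure_int (mu : cmeasure) (f : T -> R[i]) : R[i] :=
  let u x := complex.Re (f x) in let v x := complex.Im (f x) in
  Complex
    (charge_int (cmeasure_re mu) u - charge_int (cmeasure_im mu) v)%R
    (charge_int (cmeasure_re mu) v + charge_int (cmeasure_im mu) u)%R.

End ComplexMeasure.

Section PathDistribution.
Context {R : realType} (gamma : R).
Local Notation X := (l2 (- gamma)).

Definition weak_radon (m : {measure set (l2borel gamma) -> \bar R}) : Prop :=
  forall (B : set (l2borel gamma)) (e : R), measurable B -> 0 < e ->
  exists K : set (l2weak gamma),
    [/\ compact K, K `<=` B & (m (B `\` K) < e%:E)%E].

(* The variation of a complex measure dominates those of its real and imaginary
   parts and is dominated by their sum, so it is Radon iff both of these are. *)
Definition strongly_concentrated (mu : cmeasure (l2borel gamma) R) : Prop :=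
  weak_radon (total_variation (cmeasure_re mu)) /\
  weak_radon (total_variation (cmeasure_im mu)).

Definition pderiv (i : nat) (u : X -> R) : X -> R :=
  fun x => 'D_(l2unit (- gamma) i) u x.

Definition D_factor (beta : nat -> R) (i : nat) (u : X -> R) : X -> R :=
  fun x => u x - beta i / 2 * pderiv i (pderiv i u) x.

Definition D_partial (beta : nat -> R) (n : nat) (u : X -> R) : X -> R :=
  iteri n (D_factor beta) u.

Definition D_prod (beta : nat -> R) (u : X -> R) : X -> R :=
  fun x => limn (fun n => D_partial beta n u x).

(* The test functions on which [D_prod beta] acts: all partial derivatives of
   order at most 2 in each variable exist and are bounded and continuous (for
   the norm), and the partial products converge uniformly. Continuity excludes
   tail functions, on which the action would depend on the choice of [beta]. *)
Definition smooth2 (u : X -> R) : Prop :=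
  forall s : seq nat, (forall j, (count_mem j s <= 2)%N) ->
  let v := foldr pderiv u s in
  [/\ continuous v,
      exists M, forall x, `|v x| <= M &
      forall i, (count_mem i s < 2)%N ->
        forall x, derivable v x (l2unit (- gamma) i)].

Definition suitable_real (beta : nat -> R) (u : X -> R) : Prop :=
  smooth2 u /\
  {uniform, (fun n => D_partial beta n u) @ \oo --> D_prod beta u}.

(* [D_prod beta] has real coefficients: it acts on the real and imaginary
   parts separately. *)
Definition suitable (beta : nat -> R) (phi : X -> R[i]) : Prop :=
  suitable_real beta (fun x => complex.Re (phi x)) /\
  suitable_real beta (fun x => complex.Im (phi x)).

Definition D_op (beta : nat -> R) (phi : X -> R[i]) : X -> R[i] :=
  fun x => Complex (D_prod beta (fun y => complex.Re (phi y)) x)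
                   (D_prod beta (fun y => complex.Im (phi y)) x).

(* [PathDistribution beta_gt0 mu] presents the distribution [D mu]. Distinct
   presentations may give the same functional on test functions, so equality of
   path distributions is [pd_eq], not Leibniz equality. *)
Record path_distribution := PathDistribution {
  pd_beta : nat -> R ;
  pd_beta_gt0 : forall i, 0 < pd_beta i ;
  pd_measure : cmeasure (l2borel gamma) R }.

Definition pd_dom (F : path_distribution) (phi : X -> R[i]) : Prop :=
  suitable (pd_beta F) phi.

Definition pd_act (F : path_distribution) (phi : X -> R[i]) : R[i] :=
  cmeasure_int (pd_measure F) (D_op (pd_beta F) phi).

Definition pd_eq (F G : path_distribution) : Prop :=
  forall phi, pd_dom F phi -> pd_dom G phi -> pd_act F phi = pd_act G phi.

Definition cis (t : R) : R[i] := Complex (cos t) (sin t).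

Definition wave (xi : l2 gamma) : X -> R[i] := fun x => cis (bracket xi x).

Definition has_fourier (F : path_distribution) (psi : l2 gamma -> R[i]) : Prop :=
  forall xi, pd_dom F (wave xi) /\ pd_act F (wave xi) = psi xi.

End PathDistribution.

(* Main.v *)
(* Existence. In finitely many variables, [e^(-i<K xi,xi>/2) = L (wave xi)] for an
   oscillatory Gaussian functional; after division by
   [prod (1 + beta_i xi_i^2 / 2) = D (wave xi)] it is an average, over independent random
   variances, of damped oscillatory Gaussians. Each of them is an iterated convolution with
   one-dimensional complex Gaussian kernels along the eigenvectors of the quadratic form, so
   its total mass is a product of one-dimensional masses, bounded uniformly in the number of
   variables for a suitable [beta] when [gamma > 7/2]; the same domination gives tightness on
   the balls of [l2 (- gamma)], which are weakly compact. A compactness argument on a countable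
   coding of the coordinates turns the consistent family of functionals into a measure.

   Uniqueness. [1 - (b/2) d^2/dx_k^2] is inverted by the average against the kernel
   [c/2 e^(-c|t|)], [c^2 = 2/b]. So [1 - (b0/2) d^2/dx_k^2] applied to [z] is an average of
   translates of [1 - (b/2) d^2/dx_k^2] applied to [z], and the first [m] factors of two
   presentations can be exchanged one variable at a time; a bounded functional of [m] variables
   is determined by its values on waves. Uniform convergence of the products and continuity
   of the limit allow [m] to tend to infinity. *)
From HB Require Import structures.
From mathcomp Require Import all_boot all_order all_algebra.
From mathcomp Require Import complex.
From mathcomp Require Import ring lra.
From mathcomp Require Import all_classical all_reals all_analysis measurable_realfun.
Require Import Defs.

Set Implicit Arguments.
Unset Strict Implicit.
Unset Printing Implicit Defensive.

Import Order.TTheory GRing.Theory Num.Theory.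
Import numFieldNormedType.Exports.

Local Open Scope classical_set_scope.
Local Open Scope ring_scope.

(** No integral over several variables is ever formed. A finite-dimensional functional is a linear
    form, continuous under bounded pointwise limits ([sfun]), on the class [cyl n] generated by
    waves. It is determined by its values on waves by mere induction on the class, and this
    induction stands in for Fubini and for Fourier inversion. Total masses are replaced by
    domination: every oscillatory functional lies below a positive one whose Fourier transform is
    explicit.

    The number 7/2 arises from two competing demands on [beta]. With variance [beta_i s_i] in
    direction [i], the mass of the oscillatory Gaussian is at most the product of the
    [sqrt (1 + i / (beta_i s_i))]. Averaged over an exponential [s_i], one factor is at most
    [1 + C (i / beta_i)^(3/4)], so [beta] must grow fast. Tightness in [l2 (- gamma)] asks for a
    finite sum of [i^(- gamma) beta_i], so [beta] must not grow too fast. With [beta_i = i^(5/2)]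
    the first sum is that of [i^(-9/8)] and the second that of [i^(5/2 - gamma)], which converges
    exactly for [gamma > 7/2]. *)

Local Notation Re := complex.Re.
Local Notation Im := complex.Im.
Local Notation normc := Normc.normc.

(** * Limits and integrals of complex-valued functions, by components *)

Section ComplexLimits.
Context {R : realType}.
Implicit Types (a b z : R[i]) (u v : nat -> R[i]).

Lemma ReD a b : Re (a + b) = Re a + Re b. Proof. by case: a b => ? ? []. Qed.
Lemma ImD a b : Im (a + b) = Im a + Im b. Proof. by case: a b => ? ? []. Qed.
Lemma ReN a : Re (- a) = - Re a. Proof. by case: a. Qed.
Lemma ImN a : Im (- a) = - Im a. Proof. by case: a. Qed.
Lemma ReM a b : Re (a * b) = Re a * Re b - Im a * Im b.
Proof. by case: a b => ? ? []. Qed.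
Lemma ImM a b : Im (a * b) = Re a * Im b + Im a * Re b.
Proof. by case: a b => ? ? []. Qed.
Lemma Re_real (x : R) : Re (x%:C)%C = x. Proof. by []. Qed.
Lemma Im_real (x : R) : Im (x%:C)%C = 0. Proof. by []. Qed.
Definition ReImE := (ReD, ImD, ReN, ImN, ReM, ImM, Re_real, Im_real).

Lemma complex_eq a b : Re a = Re b -> Im a = Im b -> a = b.
Proof. by case: a b => ? ? [? ?] /= -> ->. Qed.

Lemma normc_ge0 z : 0 <= normc z. Proof. by case: z => ? ?; exact: sqrtr_ge0. Qed.

Lemma Re_le_normc z : `|Re z| <= normc z.
Proof.
case: z => x y /=; rewrite -sqrtr_sqr ler_sqrt ?addr_ge0 ?sqr_ge0 //.
by rewrite lerDl sqr_ge0.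
Qed.

Lemma Im_le_normc z : `|Im z| <= normc z.
Proof.
case: z => x y /=; rewrite -sqrtr_sqr ler_sqrt ?addr_ge0 ?sqr_ge0 //.
by rewrite lerDr sqr_ge0.
Qed.

Lemma normc_le_ReIm z : normc z <= `|Re z| + `|Im z|.
Proof.
case: z => x y /=.
rewrite -[leRHS]ger0_norm ?addr_ge0 // -sqrtr_sqr ler_sqrt ?sqr_ge0 //.
rewrite sqrrD !real_normK ?num_real //.
by rewrite lerD2r lerDl mulrn_wge0 // mulr_ge0.
Qed.

Lemma normc_real (x : R) : normc (x%:C)%C = `|x|.
Proof. by rewrite /= expr0n /= addr0 sqrtr_sqr. Qed.

Definition ccvg u z := (Re (u k) @[k --> \oo] --> Re z) /\ (Im (u k) @[k --> \oo] --> Im z).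

Lemma ccvg_cst z : ccvg (fun=> z) z.
Proof. by split; exact: cvg_cst. Qed.

Lemma ccvg_unique u a b : ccvg u a -> ccvg u b -> a = b.
Proof.
by move=> [h1 h2] [h3 h4]; apply: complex_eq;
  [exact: (cvg_unique _ h1 h3) | exact: (cvg_unique _ h2 h4)].
Qed.

Lemma ccvgD u v a b : ccvg u a -> ccvg v b -> ccvg (fun k => u k + v k) (a + b).
Proof.
move=> [h1 h2] [h3 h4]; split.
- by under eq_fun do rewrite ReD; rewrite ReD; exact: cvgD.
- by under eq_fun do rewrite ImD; rewrite ImD; exact: cvgD.
Qed.

Lemma ccvgM u v a b : ccvg u a -> ccvg v b -> ccvg (fun k => u k * v k) (a * b).
Proof.
move=> [h1 h2] [h3 h4]; split.
- by under eq_fun do rewrite ReM; rewrite ReM; apply: cvgB; exact: cvgM.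
- by under eq_fun do rewrite ImM; rewrite ImM; apply: cvgD; exact: cvgM.
Qed.

Lemma ccvgZ u a z : ccvg u z -> ccvg (fun k => a * u k) (a * z).
Proof. by move=> h; apply: ccvgM h; exact: ccvg_cst. Qed.

Lemma ccvg_real (u : nat -> R) (l : R) : u k @[k --> \oo] --> l ->
  ccvg (fun k => ((u k)%:C)%C) (l%:C)%C.
Proof. by move=> h; split => //=; exact: cvg_cst. Qed.

Lemma normcE_ReIm z : normc z = Num.sqrt (Re z ^+ 2 + Im z ^+ 2).
Proof. by case: z. Qed.

Lemma ccvg_normc u z : ccvg u z -> normc (u k) @[k --> \oo] --> normc z.
Proof.
move=> [h1 h2]; rewrite normcE_ReIm; under eq_fun do rewrite normcE_ReIm.
apply: (continuous_cvg _ (@sqrt_continuous R _)).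
by apply: cvgD; apply: (continuous_cvg _ (@exprn_continuous _ 2 _)).
Qed.

Lemma ccvg_normc_le u z M : ccvg u z -> (forall k, normc (u k) <= M) -> normc z <= M.
Proof.
move=> /ccvg_normc h1 h2; rewrite -(cvg_lim _ h1) //.
by apply: limr_le; [apply/cvg_ex; eexists; exact: h1 | apply: nearW].
Qed.
End ComplexLimits.

Section ComplexIntegral.
Context d (T : measurableType d) {R : realType}.
Variable m : {measure set T -> \bar R}.
Implicit Types (f g w : T -> R[i]).

Definition cint f : R[i] := Complex (\int[m]_x Re (f x)) (\int[m]_x Im (f x)).

Definition cmeas f := measurable_fun setT (fun x => Re (f x)) /\
  measurable_fun setT (fun x => Im (f x)).

Definition cbounded f := exists M, forall x, normc (f x) <= M.

Local Notation rintegrable h := (m.-integrable setT (EFin \o h)).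

Lemma rintegrableD (f g : T -> R) : rintegrable f -> rintegrable g ->
  rintegrable (fun x => f x + g x).
Proof. by move=> h1 h2; exact: (integrableD measurableT h1 h2). Qed.

Lemma rintegrableB (f g : T -> R) : rintegrable f -> rintegrable g ->
  rintegrable (fun x => f x - g x).
Proof. by move=> h1 h2; exact: (integrableB measurableT h1 h2). Qed.

Lemma rintegrableZ (a : R) (f : T -> R) : rintegrable f -> rintegrable (fun x => a * f x).
Proof. by move=> h1; exact: (integrableZl measurableT a h1). Qed.

Definition cintegrable f := rintegrable (fun x => Re (f x)) /\ rintegrable (fun x => Im (f x)).

Lemma cmeas_lin a f g : cmeas f -> cmeas g -> cmeas (fun x => a * f x + g x).
Proof.
move=> [h1 h2] [h3 h4]; split.
- under eq_fun do rewrite ReD ReM.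
  by apply: measurable_funD => //; apply: measurable_funB; apply: measurable_funM.
- under eq_fun do rewrite ImD ImM.
  by apply: measurable_funD => //; apply: measurable_funD; apply: measurable_funM.
Qed.

Lemma cmeasM f g : cmeas f -> cmeas g -> cmeas (fun x => f x * g x).
Proof.
move=> [h1 h2] [h3 h4]; split.
- by under eq_fun do rewrite ReM; apply: measurable_funB; apply: measurable_funM.
- by under eq_fun do rewrite ImM; apply: measurable_funD; apply: measurable_funM.
Qed.

Lemma cmeas_cvg (F : nat -> T -> R[i]) f : (forall k, cmeas (F k)) ->
  (forall x, ccvg (F ^~ x) (f x)) -> cmeas f.
Proof.
move=> mF h; split.
- by apply: (@measurable_fun_cvg _ _ _ _ (fun k x => Re (F k x))) => [k|x _]; [case: (mF k)|case: (h x)].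
- by apply: (@measurable_fun_cvg _ _ _ _ (fun k x => Im (F k x))) => [k|x _]; [case: (mF k)|case: (h x)].
Qed.

Lemma cintegrable_meas f : cintegrable f -> cmeas f.
Proof.
by move=> [/integrableP[h1 _] /integrableP[h2 _]]; split; apply/measurable_EFinP.
Qed.

Lemma cintegrable_lin a f g : cintegrable f -> cintegrable g ->
  cintegrable (fun x => a * f x + g x).
Proof.
move=> [h1 h2] [h3 h4]; split.
- rewrite (_ : (fun x => _) = (fun x => Re a * Re (f x) - Im a * Im (f x) + Re (g x))).
    by apply: rintegrableD => //; apply: rintegrableB; exact: rintegrableZ.
  by apply/funext => x; rewrite ReD ReM.
- rewrite (_ : (fun x => _) = (fun x => Re a * Im (f x) + Im a * Re (f x) + Im (g x))).
    by apply: rintegrableD => //; apply: rintegrableD; exact: rintegrableZ.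
  by apply/funext => x; rewrite ImD ImM.
Qed.

Lemma cint_lin a f g : cintegrable f -> cintegrable g ->
  cint (fun x => a * f x + g x) = a * cint f + cint g.
Proof.
move=> [h1 h2] [h3 h4]; apply: complex_eq; rewrite /= ?ReImE /=.
- under eq_Rintegral do rewrite ReD ReM.
  rewrite RintegralD ?RintegralB ?RintegralZl //; try exact: rintegrableZ.
  by apply: rintegrableB; exact: rintegrableZ.
- under eq_Rintegral do rewrite ImD ImM.
  rewrite RintegralD ?RintegralD ?RintegralZl //; try exact: rintegrableZ.
  by apply: rintegrableD; exact: rintegrableZ.
Qed.

Lemma bounded_integrableM (r h : T -> R) M : m.-integrable setT (EFin \o r) ->
  measurable_fun setT h -> (forall x, `|h x| <= M) ->
  m.-integrable setT (EFin \o (fun x => r x * h x)).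
Proof.
move=> ir mh hM.
have M0 : 0 <= M by rewrite (le_trans _ (hM point)).
apply: (@le_integrable _ _ _ m setT measurableT _ (fun x => (M * r x)%:E)).
- apply/measurable_EFinP; apply: measurable_funM => //.
  by case/integrableP: ir => /measurable_EFinP.
- move=> x _; rewrite lee_fin !normrM (ger0_norm M0) mulrC.
  by rewrite ler_wpM2r.
- by apply: (integrableZl measurableT M ir).
Qed.

Lemma cintegrableM w f : cintegrable w -> cmeas f -> cbounded f ->
  cintegrable (fun x => w x * f x).
Proof.
move=> [h1 h2] [h3 h4] [M fM].
have rM x : `|Re (f x)| <= M by rewrite (le_trans (Re_le_normc _)).
have iM x : `|Im (f x)| <= M by rewrite (le_trans (Im_le_normc _)).
split.
- rewrite (_ : (fun x => _) = (fun x => Re (w x) * Re (f x) - Im (w x) * Im (f x))).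
    by apply: rintegrableB; [exact: (bounded_integrableM _ _ rM) | exact: (bounded_integrableM _ _ iM)].
  by apply/funext => x; rewrite ReM.
- rewrite (_ : (fun x => _) = (fun x => Re (w x) * Im (f x) + Im (w x) * Re (f x))).
    by apply: rintegrableD; [exact: (bounded_integrableM _ _ iM) | exact: (bounded_integrableM _ _ rM)].
  by apply/funext => x; rewrite ImM.
Qed.

Lemma Rintegral_cvg (F : nat -> T -> R) (f g : T -> R) : (forall k, measurable_fun setT (F k)) ->
  m.-integrable setT (EFin \o g) -> (forall k x, `|F k x| <= g x) ->
  (forall x, F ^~ x @ \oo --> f x) ->
  \int[m]_x F k x @[k --> \oo] --> \int[m]_x f x.
Proof.
move=> mF ig Fg Ff.
have mf : measurable_fun setT f by apply: (measurable_fun_cvg mF) => x _; exact: Ff.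
have [|||||i0 _ c] := @dominated_convergence _ _ _ m setT measurableT
  (fun k x => (F k x)%:E) (EFin \o f) (EFin \o g).
- by move=> k; apply/measurable_EFinP.
- exact/measurable_EFinP.
- by apply: aeW => x _; apply: cvg_EFin; [by apply: nearW|exact: Ff].
- exact: ig.
- by apply: aeW => x n _; rewrite lee_fin; exact: Fg.
apply: fine_cvg; rewrite fineK //; exact: integrable_fin_num.
Qed.

Lemma cint_cvg w (F : nat -> T -> R[i]) f M : cintegrable w ->
  (forall k, cmeas (F k)) -> (forall k x, normc (F k x) <= M) ->
  (forall x, ccvg (F ^~ x) (f x)) ->
  ccvg (fun k => cint (fun x => w x * F k x)) (cint (fun x => w x * f x)).
Proof.
move=> iw mF FM Ff; have [h1 h2] := iw.
have M0 : 0 <= M by rewrite (le_trans _ (FM 0 point)) ?normc_ge0.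
have mw := cintegrable_meas iw.
pose g x := M * (`|Re (w x)| + `|Im (w x)|).
have ig : m.-integrable setT (EFin \o g).
  by apply: rintegrableZ; apply: rintegrableD; exact: integrable_norm.
have b k x : normc (w x * F k x) <= g x.
  rewrite Normc.normcM mulrC ler_pM ?normc_ge0 //; exact: normc_le_ReIm.
have c x := ccvgM (ccvg_cst (w x)) (Ff x).
split => /=.
- apply: (@Rintegral_cvg (fun k x => Re (w x * F k x)) _ g) => // [k|k x|x].
  + by case: (cmeasM mw (mF k)).
  + exact: le_trans (Re_le_normc _) (b k x).
  + by case: (c x).
- apply: (@Rintegral_cvg (fun k x => Im (w x * F k x)) _ g) => // [k|k x|x].
  + by case: (cmeasM mw (mF k)).
  + exact: le_trans (Im_le_normc _) (b k x).
  + by case: (c x).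
Qed.

(** Multiplying by the conjugate [a] of the integral turns it into the real number [|cint f|^2], and
    the real part of [a f] is pointwise at most [|a| g]. Dividing by [|cint f|], which is positive
    outside the trivial case, gives the sharp constant 1. The componentwise bound would lose a
    factor, and that factor would accumulate over iterated convolutions. *)
Lemma normc_cint_le f (g : T -> R) : cintegrable f -> m.-integrable setT (EFin \o g) ->
  (forall x, normc (f x) <= g x) -> normc (cint f) <= \int[m]_x g x.
Proof.
move=> fi ig fg.
have [z0|z0] := eqVneq (cint f) 0.
  rewrite z0 Normc.normc0; apply: Rintegral_ge0 => x _.
  exact: le_trans (normc_ge0 _) (fg x).
pose a := (cint f)^*%C.
have nz : 0 < normc (cint f).
  by rewrite lt_neqAle normc_ge0 andbT eq_sym; apply: contra_neq z0; exact: Normc.eq0_normc.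
rewrite -(ler_pM2l nz) -expr2.
have -> : normc (cint f) ^+ 2 = Re (a * cint f).
  rewrite normcE_ReIm sqr_sqrtr ?addr_ge0 ?sqr_ge0 // /a; case: (cint f) => x y /=; ring.
have -> : a * cint f = cint (fun x => a * f x + 0).
  rewrite cint_lin //; last by split; exact: integrable0.
  rewrite [X in _ = _ + X](_ : _ = 0) ?addr0 //.
  by apply: complex_eq; rewrite /= Rintegral_cst //= mul0r.
have i2 := cintegrable_lin a fi (conj (integrable0 m setT) (integrable0 m setT) : cintegrable (fun=> 0)).
rewrite -RintegralZl //; apply: le_Rintegral => //.
- exact: (proj1 i2).
- exact: rintegrableZ.
move=> x _; rewrite addr0 (le_trans (ler_norm _)) // (le_trans (Re_le_normc _)) //.
rewrite Normc.normcM ler_pM ?normc_ge0 //.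
by rewrite /a; case: (cint f) => p q /=; rewrite sqrrN.
Qed.

Lemma cmeas_normc f : cmeas f -> measurable_fun setT (fun x => normc (f x)).
Proof.
move=> [h1 h2]; under eq_fun do rewrite normcE_ReIm.
apply: (measurableT_comp (continuous_measurable_fun (@sqrt_continuous R))).
by apply: measurable_funD; apply: measurable_funX.
Qed.

Lemma cintegrable_normc f : cintegrable f -> rintegrable (fun x => normc (f x)).
Proof.
move=> fi; have [h1 h2] := fi.
apply: (@le_integrable _ _ _ m setT measurableT _ (EFin \o (fun x => `|Re (f x)| + `|Im (f x)|))) => //.
- by apply/measurable_EFinP; apply: cmeas_normc; exact: cintegrable_meas.
- move=> x _; rewrite lee_fin (ger0_norm (normc_ge0 _)) (le_trans (normc_le_ReIm _)) //; exact: ler_norm.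
- exact: rintegrableD (integrable_norm h1) (integrable_norm h2).
Qed.

Lemma Re_cint_le f g : cintegrable f -> cintegrable g ->
  (forall x, Re (f x) <= Re (g x)) -> Re (cint f) <= Re (cint g).
Proof. by move=> [f1 _] [g1 _] fg; apply: le_Rintegral. Qed.
End ComplexIntegral.

Section Cis.
Context {R : realType}.
Implicit Types (a b : R).

Lemma cisD a b : cis (a + b) = cis a * cis b.
Proof. by apply: complex_eq; rewrite ?ReM ?ImM /= ?cosD ?sinD //; ring. Qed.

Lemma cis0 : cis (0 : R) = 1.
Proof. by apply: complex_eq; rewrite /= ?cos0 ?sin0. Qed.

Lemma normc_cis a : normc (cis a) = 1.
Proof. by rewrite /= cos2Dsin2 sqrtr1. Qed.

Lemma conj_cis a : (cis a)^*%C = cis (- a).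
Proof. by apply: complex_eq; rewrite /= ?cosN ?sinN. Qed.

Lemma cis_measurable d (T : measurableType d) (f : T -> R) :
  measurable_fun setT f -> cmeas (fun x => cis (f x)).
Proof.
move=> mf; split => /=.
- by apply: (measurableT_comp _ mf); apply: continuous_measurable_fun; exact: continuous_cos.
- by apply: (measurableT_comp _ mf); apply: continuous_measurable_fun; exact: continuous_sin.
Qed.

Lemma ccvg_cis (u : nat -> R) a : u k @[k --> \oo] --> a -> ccvg (fun k => cis (u k)) (cis a).
Proof.
by move=> h; split => /=; [apply: (continuous_cvg _ (@continuous_cos R _) h)|
  apply: (continuous_cvg _ (@continuous_sin R _) h)].
Qed.
End Cis.

(** * Cylinder functions generated by waves, and functionals on them *)

Section Cylinder.
Context {R : realType}.
Local Notation T := (nat -> R).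
Implicit Types (x v xi : T) (f g : T -> R[i]).

Definition cwave n xi x : R[i] := cis (\sum_(i < n) xi i * x i).

(** Plays the role of the bounded Borel functions of the first [n] coordinates. Defining the class
    by generation makes the monotone class argument an induction principle: a property of waves that
    is stable under linear combinations and bounded pointwise limits holds on the whole class. *)
Inductive cyl n : (T -> R[i]) -> Prop :=
| cyl_wave xi : cyl n (cwave n xi)
| cyl_lin a f g : cyl n f -> cyl n g -> cyl n (fun x => a * f x + g x)
| cyl_lim (F : nat -> T -> R[i]) f M : (forall k, cyl n (F k)) ->
    (forall k x, normc (F k x) <= M) -> (forall x, ccvg (F ^~ x) (f x)) -> cyl n f.

Lemma eq_cyl n f g : f =1 g -> cyl n f -> cyl n g.
Proof. by move=> /funext ->. Qed.

Lemma cyl_bounded n f : cyl n f -> exists M, forall x, normc (f x) <= M.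
Proof.
elim=> [xi|a {}f g _ [M hM] _ [N hN]|F {}f M _ _ FM Ff].
- by exists 1 => x; rewrite normc_cis.
- exists (normc a * M + N) => x; rewrite (le_trans (le_normcD _ _)) //.
  by rewrite Normc.normcM lerD // ler_wpM2l // normc_ge0.
- by exists M => x; apply: ccvg_normc_le (Ff x) _.
Qed.

Lemma cyl_cst n a : cyl n (fun=> a).
Proof.
have w1 : cyl n (fun=> 1).
  by apply: (eq_cyl _ (cyl_wave n (fun=> 0))) => x; rewrite /cwave big1 ?cis0 // => i _; rewrite mul0r.
by apply: (eq_cyl _ (cyl_lin (a - 1) w1 w1)) => x /=; ring.
Qed.

Lemma cylD n f g : cyl n f -> cyl n g -> cyl n (fun x => f x + g x).
Proof. by move=> hf hg; apply: (eq_cyl _ (cyl_lin 1 hf hg)) => x; rewrite mul1r. Qed.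

Lemma cylZ n a f : cyl n f -> cyl n (fun x => a * f x).
Proof. by move=> hf; apply: (eq_cyl _ (cyl_lin a hf (cyl_cst n 0))) => x; rewrite addr0. Qed.

Lemma cylB n f g : cyl n f -> cyl n g -> cyl n (fun x => f x - g x).
Proof. by move=> hf hg; apply: (eq_cyl _ (cyl_lin (-1) hg hf)) => x; ring. Qed.

(** Two inductions: first on [f] against a fixed wave, since a product of waves is a wave, then on
    [g] with [f] fixed. The limit step of the second one needs the bound of [f]. *)
Lemma cylM n f g : cyl n f -> cyl n g -> cyl n (fun x => f x * g x).
Proof.
have W xi : cyl n f -> cyl n (fun x => f x * cwave n xi x).
  elim=> [eta|a {}f {}g _ hf _ hg|F {}f M _ hF FM Ff].
  - apply: (eq_cyl _ (cyl_wave n (fun i => eta i + xi i))) => x.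
    rewrite /cwave -cisD -big_split /=; congr cis; apply: eq_bigr => i _; exact: mulrDl.
  - by apply: (eq_cyl _ (cyl_lin a hf hg)) => x /=; ring.
  - apply: (@cyl_lim n _ _ M hF) => [k x|x]; first by rewrite Normc.normcM normc_cis mulr1.
    by apply: ccvgM (Ff x) (ccvg_cst _).
move=> hf; elim=> [xi|a {}g h _ hg _ hh|F {}g M _ hF FM Fg].
- exact: W.
- by apply: (eq_cyl _ (cyl_lin a hg hh)) => x /=; ring.
- have [N hN] := cyl_bounded hf.
  apply: (@cyl_lim n _ _ (N * M) hF) => [k x|x].
    by rewrite Normc.normcM ler_pM ?normc_ge0.
  by apply: ccvgM (Fg x); exact: ccvg_cst.
Qed.

Lemma cyl_conj n f : cyl n f -> cyl n (fun x => (f x)^*%C).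
Proof.
elim=> [xi|a {}f g _ hf _ hg|F {}f M _ hF FM Ff].
- apply: (eq_cyl _ (cyl_wave n (fun i => - xi i))) => x.
  by rewrite conj_cis -sumrN; congr cis; apply: eq_bigr => i _; rewrite mulNr.
- apply: (eq_cyl _ (cyl_lin (a^*%C) hf hg)) => x.
  by apply: complex_eq; case: a (f x) (g x) => ? ? [? ?] [? ?] /=; ring.
- apply: (@cyl_lim n _ _ M hF) => [k x|x].
    by have := FM k x; case: (F k x) => p q /=; rewrite sqrrN.
  case: (Ff x) => h1 h2; split.
    have -> : Re (f x)^*%C = Re (f x) by case: (f x).
    by rewrite (_ : (fun k => _) = (fun k => Re (F k x))) //; apply/funext => k; case: (F k x).
  have -> : Im (f x)^*%C = - Im (f x) by case: (f x).
  rewrite (_ : (fun k => _) = (fun k => - Im (F k x))); first exact: cvgN.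
  by apply/funext => k; case: (F k x).
Qed.

Definition trunc n x : T := fun i => if (i < n)%N then x i else 0.

Lemma cwave_trunc n k xi x : cwave k xi (trunc n x) = cwave k (trunc n xi) x.
Proof.
rewrite /cwave; congr cis; apply: eq_bigr => i _; rewrite /trunc.
by case: ifP => _ //; rewrite mulr0 mul0r.
Qed.

Lemma cwave_widen n k xi x : (n <= k)%N -> cwave k (trunc n xi) x = cwave n xi x.
Proof.
move=> nk; rewrite /cwave (big_ord_widen k (fun i => xi i * x i) nk) [in RHS]big_mkcond /=; congr cis.
by apply: eq_bigr => i _; rewrite /trunc; case: ifP => // _; rewrite mul0r.
Qed.

Lemma cyl_trunc n k f : cyl k f -> cyl n (f \o trunc n).
Proof.
elim=> [xi|a {}f g _ hf _ hg|F {}f M _ hF FM Ff].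
- have [nk|/ltnW kn] := leqP n k.
    apply: (eq_cyl _ (cyl_wave n xi)) => x.
    by rewrite /= cwave_trunc cwave_widen.
  apply: (eq_cyl _ (cyl_wave n (trunc k xi))) => x.
  rewrite /= cwave_widen // /cwave; congr cis; apply: eq_bigr => i _.
  by rewrite /trunc (leq_trans (ltn_ord i) kn).
- exact: cyl_lin.
- by apply: (@cyl_lim n _ _ M hF) => [k' x|x]; [exact: FM|exact: Ff].
Qed.

Lemma cyl_widen n k f : (n <= k)%N -> cyl n f -> cyl k f.
Proof.
move=> nk; elim=> [xi|a {}f g _ hf _ hg|F {}f M _ hF FM Ff].
- by apply: (eq_cyl _ (cyl_wave k (trunc n xi))) => x; rewrite cwave_widen.
- exact: cyl_lin.
- exact: (@cyl_lim k _ _ M hF).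
Qed.

Lemma cyl_dep n f x y : cyl n f -> (forall i, (i < n)%N -> x i = y i) -> f x = f y.
Proof.
move=> + xy; elim=> [xi|a {}f g _ hf _ hg|F {}f M _ hF FM Ff].
- by rewrite /cwave; congr cis; apply: eq_bigr => i _; rewrite xy.
- by rewrite hf hg.
- by apply: (ccvg_unique (Ff x)); under eq_fun do rewrite hF; exact: Ff.
Qed.

Lemma cyl_meas d (S : measurableType d) (phi : S -> T) n f :
  (forall i, measurable_fun setT (fun s => phi s i)) -> cyl n f -> cmeas (f \o phi).
Proof.
move=> mphi; elim=> [xi|a {}f g _ hf _ hg|F {}f M _ hF FM Ff].
- by apply: cis_measurable; apply: measurable_sum => i; exact: measurable_funM.
- exact: cmeas_lin.
- by apply: (cmeas_cvg hF) => s; exact: Ff.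
Qed.

Definition sfun n (L : (T -> R[i]) -> R[i]) :=
  (forall a f g, cyl n f -> cyl n g -> L (fun x => a * f x + g x) = a * L f + L g) /\
  (forall (F : nat -> T -> R[i]) f M, (forall k, cyl n (F k)) ->
    (forall k x, normc (F k x) <= M) -> (forall x, ccvg (F ^~ x) (f x)) ->
    ccvg (fun k => L (F k)) (L f)).

(** The limit clause of [cyl] is matched by the continuity of both functionals, so agreement on
    waves propagates by induction. This is the injectivity of the Fourier transform for [sfun]. *)
Lemma sfun_uniq n L1 L2 f : sfun n L1 -> sfun n L2 ->
  (forall xi, L1 (cwave n xi) = L2 (cwave n xi)) -> cyl n f -> L1 f = L2 f.
Proof.
move=> [l1 c1] [l2 c2] h; elim=> [xi|a {}f g cf hf cg hg|F {}f M cF hF FM Ff].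
- exact: h.
- by rewrite l1 // l2 // hf hg.
- by apply: (ccvg_unique (c1 F f M cF FM Ff)); under eq_fun do rewrite hF; exact: c2 cF FM Ff.
Qed.

Lemma sfun_widen n k L : (n <= k)%N -> sfun k L -> sfun n L.
Proof.
move=> nk [l c]; split=> [a f g hf hg|F f M cF].
  by apply: l; exact: (cyl_widen nk).
by apply: c => j; exact: (cyl_widen nk).
Qed.

Lemma sfun_int d (S : measurableType d) (m : {measure set S -> \bar R}) (w : S -> R[i]) (phi : S -> T) n :
  (forall i, measurable_fun setT (fun s => phi s i)) -> cintegrable m w ->
  sfun n (fun f => cint m (fun s => w s * f (phi s))).
Proof.
move=> mphi iw; split=> [a f g cf cg|F f M cF FM Ff].
  have [Bf hf] := cyl_bounded cf; have [Bg hg] := cyl_bounded cg.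
  rewrite -cint_lin; first by congr cint; apply/funext => s; ring.
  - by apply: cintegrableM => //; [exact: (cyl_meas mphi cf) | exists Bf => s; exact: hf].
  - by apply: cintegrableM => //; [exact: (cyl_meas mphi cg) | exists Bg => s; exact: hg].
by apply: (@cint_cvg _ _ _ m w (fun k s => F k (phi s)) (f \o phi) M iw) => [k|k s|s];
  [exact: (cyl_meas mphi (cF k)) | exact: FM | exact: Ff].
Qed.

Definition line x v (t : R) : T := fun i => x i + t * v i.

Lemma line_measurable x v i : measurable_fun setT (fun t => line x v t i).
Proof. by apply: measurable_funD => //; exact: measurable_funM. Qed.

Definition conv (w : R -> R[i]) v f x : R[i] :=
  cint lebesgue_measure (fun t => w t * f (line x v t)).

(** A wave is a character, hence an eigenfunction of every translation average; the eigenvalue is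
    the Fourier transform of [w] at the frequency of the wave along [v]. *)
Lemma conv_wave w v n xi x : cintegrable lebesgue_measure w ->
  conv w v (cwave n xi) x =
  cint lebesgue_measure (fun t => w t * cis (t * \sum_(i < n) xi i * v i)) * cwave n xi x.
Proof.
move=> iw; rewrite /conv mulrC.
have i2 : cintegrable lebesgue_measure (fun t => w t * cis (t * \sum_(i < n) xi i * v i)).
  apply: cintegrableM => //; last by exists 1 => t; rewrite normc_cis.
  by apply: cis_measurable; exact: measurable_funM.
have i0 : cintegrable (@lebesgue_measure R) (fun=> 0) by split; exact: integrable0.
have -> : cwave n xi x * cint lebesgue_measure (fun t => w t * cis (t * \sum_(i < n) xi i * v i)) =
  cint lebesgue_measure (fun t => cwave n xi x * (w t * cis (t * \sum_(i < n) xi i * v i)) + 0).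
  rewrite cint_lin // [X in _ = _ + X](_ : _ = 0) ?addr0 //.
  by apply: complex_eq; rewrite /= Rintegral_cst //= mul0r.
congr cint; apply/funext => t; rewrite addr0 /cwave /line.
have -> : \sum_(i < n) xi i * (x i + t * v i) =
   \sum_(i < n) xi i * x i + t * \sum_(i < n) xi i * v i.
  by rewrite mulr_sumr -big_split /=; apply: eq_bigr => i _; ring.
rewrite cisD; ring.
Qed.

Lemma normc_conv_le w v n f (g : T -> R) x : cintegrable lebesgue_measure w -> cyl n f ->
  cyl n (fun y => ((g y)%:C)%C) -> (forall y, normc (f y) <= g y) ->
  normc (conv w v f x) <= \int[lebesgue_measure]_t (normc (w t) * g (line x v t)).
Proof.
move=> iw cf cg fg; have [Bf hBf] := cyl_bounded cf; have [Bg hBg] := cyl_bounded cg.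
have mf := cyl_meas (@line_measurable x v) cf.
have mg := (cyl_meas (@line_measurable x v) cg).1.
apply: normc_cint_le => [||t].
- by apply: cintegrableM => //; exists Bf => t; exact: hBf.
- apply: (bounded_integrableM (cintegrable_normc iw) mg (M := Bg)) => t.
  by rewrite -normc_real; exact: hBg.
- by rewrite Normc.normcM ler_wpM2l // normc_ge0.
Qed.

(** Stability of the class under averages along a line is what allows convolutions to be iterated
    without product measures. In the limit step the uniform bound is multiplied by the [L^1] norm
    [I] of [w]. *)
Lemma cyl_conv w v n f : cintegrable lebesgue_measure w -> cyl n f -> cyl n (conv w v f).
Proof.
move=> iw; have S x := @sfun_int _ _ lebesgue_measure w (line x v) n (@line_measurable x v) iw.
elim=> [xi|a {}f g cf hf cg hg|F {}f M cF hF FM Ff].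
- by apply: (eq_cyl _ (cylZ _ (cyl_wave n xi))) => x; rewrite conv_wave.
- by apply: (eq_cyl _ (cyl_lin a hf hg)) => x; rewrite /conv (S x).1.
- pose I := \int[lebesgue_measure]_t normc (w t).
  have iN : lebesgue_measure.-integrable setT (EFin \o (fun t => normc (w t))).
    exact: cintegrable_normc.
  have iNM : lebesgue_measure.-integrable setT (EFin \o (fun t => M * normc (w t))) by exact: rintegrableZ.
  apply: (@cyl_lim n _ _ (M * I) hF) => [k x|x]; last exact: (S x).2 cF FM Ff.
  have [B hB] := cyl_bounded (cF k).
  rewrite /I -RintegralZl //; apply: normc_cint_le => // [|t].
    apply: cintegrableM => //; last by exists B.
    exact: (cyl_meas (@line_measurable x v) (cF k)).
  by rewrite Normc.normcM mulrC ler_wpM2r ?normc_ge0.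
Qed.
End Cylinder.

Section RealCylinder.
Context {R : realType}.
Local Notation T := (nat -> R).
Implicit Types (x y : T) (f g : T -> R).

Definition rcyl n f := cyl n (fun x => ((f x)%:C)%C).

Lemma eq_rcyl n f g : f =1 g -> rcyl n f -> rcyl n g.
Proof. by move=> /funext ->. Qed.

Lemma rcyl_cst n (a : R) : rcyl n (fun=> a).
Proof. exact: cyl_cst. Qed.

Lemma rcylD n f g : rcyl n f -> rcyl n g -> rcyl n (fun x => f x + g x).
Proof. by move=> h1 h2; apply: (eq_cyl _ (cylD h1 h2)) => x; rewrite -rmorphD. Qed.

Lemma rcylB n f g : rcyl n f -> rcyl n g -> rcyl n (fun x => f x - g x).
Proof. by move=> h1 h2; apply: (eq_cyl _ (cylB h1 h2)) => x; rewrite -rmorphB. Qed.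

Lemma rcylM n f g : rcyl n f -> rcyl n g -> rcyl n (fun x => f x * g x).
Proof. by move=> h1 h2; apply: (eq_cyl _ (cylM h1 h2)) => x; rewrite -rmorphM. Qed.

Lemma rcylZ n (a : R) f : rcyl n f -> rcyl n (fun x => a * f x).
Proof. exact/rcylM/rcyl_cst. Qed.

Lemma rcylX n f k : rcyl n f -> rcyl n (fun x => f x ^+ k).
Proof.
move=> hf; elim: k => [|k IH]; first exact: (eq_rcyl _ (rcyl_cst n 1)).
by apply: (eq_rcyl _ (rcylM hf IH)) => x; rewrite exprS.
Qed.

Lemma rcyl_sum n (I : Type) (r : seq I) (F : I -> T -> R) :
  (forall i, rcyl n (F i)) -> rcyl n (fun x => \sum_(i <- r) F i x).
Proof.
move=> h; elim: r => [|i r IH]; first by apply: (eq_rcyl _ (rcyl_cst n 0)) => x; rewrite big_nil.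
by apply: (eq_rcyl _ (rcylD (h i) IH)) => x; rewrite big_cons.
Qed.

Lemma rcyl_prod n (I : Type) (r : seq I) (F : I -> T -> R) :
  (forall i, rcyl n (F i)) -> rcyl n (fun x => \prod_(i <- r) F i x).
Proof.
move=> h; elim: r => [|i r IH]; first by apply: (eq_rcyl _ (rcyl_cst n 1)) => x; rewrite big_nil.
by apply: (eq_rcyl _ (rcylM (h i) IH)) => x; rewrite big_cons.
Qed.

Lemma rcyl_cvg n (F : nat -> T -> R) f M : (forall k, rcyl n (F k)) ->
  (forall k x, `|F k x| <= M) -> (forall x, F ^~ x @ \oo --> f x) -> rcyl n f.
Proof.
move=> hF FM Ff; apply: (cyl_lim hF) => [k x|x]; first by rewrite normc_real; exact: FM.
exact: ccvg_real (Ff x).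
Qed.

Lemma cyl_Re n (f : T -> R[i]) : cyl n f -> rcyl n (fun x => Re (f x)).
Proof.
move=> cf; apply: (eq_cyl _ (cylZ ((2^-1)%:C)%C (cylD cf (cyl_conj cf)))) => x.
by case: (f x) => a b; apply: complex_eq => /=; field.
Qed.

Lemma cyl_Im n (f : T -> R[i]) : cyl n f -> rcyl n (fun x => Im (f x)).
Proof.
move=> cf; apply: (eq_cyl _ (cylZ (Complex 0 (- 2^-1)) (cylB cf (cyl_conj cf)))) => x.
by case: (f x) => a b; apply: complex_eq => /=; field.
Qed.

Lemma cyl_of_ReIm n (f : T -> R[i]) : rcyl n (fun x => Re (f x)) ->
  rcyl n (fun x => Im (f x)) -> cyl n f.
Proof.
move=> h1 h2; apply: (eq_cyl _ (cylD h1 (cylZ (Complex 0 1) h2))) => x.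
by case: (f x) => a b; apply: complex_eq => /=; ring.
Qed.

Lemma rcyl_sin n i (a b : R) : (i < n)%N -> rcyl n (fun x => sin (a * x i + b)).
Proof.
move=> ni.
have := cyl_Im (cylZ (cis b) (cyl_wave n (fun j => if j == i then a else 0))).
apply: eq_cyl => x; rewrite /cwave -cisD /= addrC; congr (sin (_ + _))%:C%C.
rewrite (bigD1 (Ordinal ni)) //= eqxx big1 ?addr0 // => j ji.
by rewrite ifF ?mul0r //; apply: contraNF ji => /eqP ji; apply/eqP/val_inj.
Qed.

(** An odd cubic mapping [[-1, 1]] to itself, with fixed points [-1], [0] and [1], which moves every
    other point away from [0]. Its iterates are therefore polynomials converging on [[-1, 1]] to the
    sign function, and polynomials preserve cylinder functions. *)
Definition sgstep (s : R) := (3 * s - s ^+ 3) / 2.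

Lemma sgstep_itv s : 0 <= s <= 1 -> s <= sgstep s <= 1.
Proof.
move=> /andP[s0 s1]; rewrite /sgstep; apply/andP; split.
  have h : 0 <= s * (1 - s ^+ 2) by rewrite mulr_ge0 // subr_ge0 expr_le1.
  rewrite -subr_ge0; have -> : (3 * s - s ^+ 3) / 2 - s = s * (1 - s ^+ 2) / 2 by field.
  by rewrite divr_ge0.
have h : 0 <= (1 - s) ^+ 2 * (2 + s) by rewrite mulr_ge0 ?sqr_ge0 ?addr_ge0.
rewrite -subr_ge0.
have -> : 1 - (3 * s - s ^+ 3) / 2 = (1 - s) ^+ 2 * (2 + s) / 2 by field.
by rewrite divr_ge0.
Qed.

Lemma sgstepN s : sgstep (- s) = - sgstep s.
Proof. by rewrite /sgstep; ring. Qed.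

Lemma iter_sgstepN k s : iter k sgstep (- s) = - iter k sgstep s.
Proof. by elim: k => //= k ->; rewrite sgstepN. Qed.

Lemma iter_sgstep_itv k s : 0 <= s <= 1 -> s <= iter k sgstep s <= 1.
Proof.
move=> /[dup] /andP[s0 s1] _; elim: k => [|k /andP[h1 h2]] /=; first by rewrite lexx.
have /andP[h3 h4] := sgstep_itv (introT andP (conj (le_trans s0 h1) h2)).
by rewrite (le_trans h1 h3).
Qed.

Lemma iter_sgstep_bound k s : `|s| <= 1 -> `|iter k sgstep s| <= 1.
Proof.
wlog s0 : s / 0 <= s => [h|].
  have [/h//|/ltW s0 s1] := leP 0 s.
  by rewrite -[s]opprK iter_sgstepN normrN; apply: h; rewrite ?oppr_ge0 ?normrN.
rewrite ger0_norm // => s1; have /andP[h1 h2] := iter_sgstep_itv k (introT andP (conj s0 s1)).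
by rewrite ger0_norm // (le_trans s0).
Qed.

Lemma iter_sgstep_cvg s : `|s| <= 1 -> iter k sgstep s @[k --> \oo] --> Num.sg s.
Proof.
wlog s0 : s / 0 <= s => [h|].
  have [/h//|/ltW s0 s1] := leP 0 s.
  rewrite -[s]opprK sgrN; under eq_fun do rewrite iter_sgstepN.
  by apply: cvgN; apply: h; rewrite ?oppr_ge0 ?normrN.
rewrite ger0_norm // => s1; have itv k := iter_sgstep_itv k (introT andP (conj s0 s1)).
move: s0; rewrite le_eqVlt => /predU1P[s0|s0].
  rewrite -s0 sgr0; apply: cvg_near_cst; apply: nearW => k; elim: k => //= k ->.
  by rewrite /sgstep expr0n /= mulr0 subr0 mul0r.
rewrite gtr0_sg //.
have nd : nondecreasing_seq (fun k => iter k sgstep s).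
  apply/nondecreasing_seqP => k /=; have /andP[h1 h2] := itv k.
  by have /andP[] := sgstep_itv (introT andP (conj (le_trans (ltW s0) h1) h2)).
have cv : cvgn (fun k => iter k sgstep s).
  by apply: nondecreasing_is_cvgn nd _; exists 1 => _ [k _ <-]; have /andP[] := itv k.
move: (cv); set l := limn _ => cl.
have sl : s <= l by apply: (limr_ge cv); apply: nearW => k; have /andP[] := itv k.
(* The limit is a fixed point, and it is positive because the iterates start at [s > 0] and
   increase; the only positive fixed point is [1]. *)
have E : l = sgstep l.
  apply: (cvg_unique _ (_ : (iter k.+1 sgstep s) @[k --> \oo] --> l)) => //.
    by rewrite (cvg_shiftS (fun k => iter k sgstep s)).
  rewrite /= /sgstep; apply: cvgMr_tmp; apply: cvgB; first exact: cvgMl_tmp.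
  exact: (continuous_cvg _ (@exprn_continuous _ 3 _) cl).
have l0 : 0 < l by exact: lt_le_trans sl.
suff -> : 1 = l by [].
have : l * ((1 - l) * (1 + l)) = 0.
  by have : 2 * (sgstep l - l) = 0; [rewrite -E subrr mulr0|move=> <-; rewrite /sgstep; field].
move/eqP; rewrite mulf_eq0 gt_eqF //= mulf_eq0 (gt_eqF (addr_gt0 _ l0)) // orbF subr_eq0.
by move/eqP.
Qed.

(** As soon as [|z| / (k + 1) < pi] the sine has the sign of its argument, so the sequence is
    eventually constant. *)
Lemma sin_div_sg (z : R) : Num.sg (sin (z / k.+1%:R)) @[k --> \oo] --> Num.sg z.
Proof.
wlog z0 : z / 0 <= z => [h|].
  have [/h//|/ltW z0] := leP 0 z.
  rewrite -[z]opprK sgrN; under eq_fun do rewrite mulNr sinN sgrN.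
  by apply: cvgN; apply: h; rewrite oppr_ge0.
move: z0; rewrite le_eqVlt => /predU1P[<-|z0].
  by under eq_fun do rewrite mul0r sin0; rewrite sgr0; exact: cvg_cst.
rewrite gtr0_sg //; apply: cvg_near_cst; near=> k; rewrite gtr0_sg // sin_gt0_pi //.
rewrite divr_gt0 //= ltr_pdivrMr // mulrC -ltr_pdivrMr ?pi_gt0 //.
have : z / pi < k%:R by near: k; exact: nbhs_infty_gtr.
by move=> /lt_trans; apply; rewrite ltr_nat.
Unshelve. all: by end_near.
Qed.
End RealCylinder.

Section HalfLines.
Context {R : realType}.
Local Notation T := (nat -> R).

(** Two successive limits lead from waves to the sign: iterating [sgstep] on a sine gives the sign
    of that sine, and stretching the period to infinity gives the sign of [x i - c] itself. *)
Lemma rcyl_sg n i (c : R) : (i < n)%N -> rcyl n (fun x : T => Num.sg (x i - c)).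
Proof.
move=> ni.
have step N : rcyl n (fun x : T => Num.sg (sin ((x i - c) / N.+1%:R))).
  have S1 (x : T) : `|sin ((x i - c) / N.+1%:R)| <= 1.
    by rewrite ler_norml sin_geN1 sin_le1.
  apply: (@rcyl_cvg _ n (fun k x => iter k sgstep (sin ((x i - c) / N.+1%:R))) _ 1).
  - elim=> [|k IH] /=; last first.
      apply: (eq_rcyl _ (rcylZ 2^-1 (rcylB (rcylZ 3 IH) (rcylX 3 IH)))) => x.
      by rewrite /sgstep mulrC.
    apply: (eq_rcyl _ (rcyl_sin (N.+1%:R^-1) (- (c / N.+1%:R)) ni)) => x.
    by rewrite mulrBl (mulrC (x i)).
  - by move=> k x; exact: iter_sgstep_bound.
  - by move=> x; exact: iter_sgstep_cvg.
apply: (rcyl_cvg step (M := 1)) => [k x|x]; last exact: sin_div_sg.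
by rewrite normr_sg lern1 leq_b1.
Qed.

(** With [s] the sign of [x i - c], the indicator is the polynomial [1 - (s^2 - s) / 2], which is
    right also at [s = 0], so that the half-line is closed. *)
Lemma rcyl_ge n i (c : R) : (i < n)%N -> rcyl n (fun x : T => (c <= x i)%R%:R).
Proof.
move=> ni; have h := rcyl_sg c ni.
apply: (eq_rcyl _ (rcylB (rcyl_cst n 1) (rcylZ 2^-1 (rcylB (rcylX 2 h) h)))) => x.
rewrite -subr_ge0; case: sgrP => _ /=; rewrite ?expr0n ?expr1n /= ?sqrrN ?expr1n; lra.
Qed.

Lemma rcyl_le n i (c : R) : (i < n)%N -> rcyl n (fun x : T => (x i <= c)%R%:R).
Proof.
move=> ni; have h := rcyl_sg c ni.
apply: (eq_rcyl _ (rcylB (rcyl_cst n 1) (rcylZ 2^-1 (rcylD (rcylX 2 h) h)))) => x.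
rewrite -subr_le0; case: sgrP => _ /=; rewrite ?expr0n ?expr1n /= ?sqrrN ?expr1n; lra.
Qed.
End HalfLines.

(** * Greedy coding of real sequences by binary sequences *)
Section Greedy.
Context {R : realType}.
Local Notation T := (nat -> R).
Implicit Types (x y p : T) (s : seq bool).

(* Question [k] concerns the coordinate [qi k] and tests whether the current
   approximation of it may be pushed away from [0] by [qe k]; every pair
   (coordinate, increment [+-1/(j+1)]) is the subject of infinitely many questions. *)
Definition question (k : nat) : nat * nat * nat * bool := odflt (0%N, 0%N, 0%N, false) (unpickle k).
Definition qi (k : nat) : nat := minn (question k).1.1.1 k.
Definition qe (k : nat) : R := (-1) ^+ (question k).2 / (question k).1.1.2.+1%:R.

Definition upd p i (c : R) : T := fun j => if j == i then c else p j.

(* A node of the tree lists the answers, the latest one first. *)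
Fixpoint pt s : T := if s is b :: s' then
    let i := qi (size s') in let e := qe (size s') in
    if b && (0 <= pt s' i * e) then upd (pt s') i (pt s' i + e) else pt s'
  else fun=> 0.

(** The first condition says that adding [e] does not move the approximation towards [0] (at [0]
    both directions are allowed), the second that the moved approximation does not overshoot [x]. *)
Definition test s x : bool :=
  let i := qi (size s) in let e := qe (size s) in
  (0 <= pt s i * e) && (0 <= (x i - (pt s i + e)) * e).

Fixpoint code x k : seq bool := if k is k'.+1 then test (code x k') x :: code x k' else [::].

(** Indicator of the event that the first [size s] answers for [x] are those of [s], written as a
    product of tests so that it is visibly a real cylinder function. *)
Fixpoint chi s x : R := if s is b :: s' then
  chi s' x * (if b then (test s' x)%:R else 1 - (test s' x)%:R) else 1.

Fixpoint strings k : seq (seq bool) := if k is k'.+1 then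
  [seq true :: s | s <- strings k'] ++ [seq false :: s | s <- strings k'] else [:: [::]].

Lemma size_code x k : size (code x k) = k.
Proof. by elim: k => //= k ->. Qed.

Lemma sum_stringsS (V : nmodType) (F : seq bool -> V) k :
  \sum_(s <- strings k.+1) F s = \sum_(s <- strings k) (F (true :: s) + F (false :: s)).
Proof. by rewrite /= big_cat !big_map /= big_split. Qed.

(** Strings grow at the head, so [sum_stringsS] splits on the latest answer. Here the split is on
    the first answer given after [s], the one next to [s] in [d ++ s]; this is the form in which
    additive weights are summed over descendants of [s]. *)
Lemma sum_strings_shift (V : nmodType) (F : seq bool -> V) k s :
  \sum_(d <- strings k.+1) F (d ++ s) =
  \sum_(d <- strings k) F (d ++ true :: s) + \sum_(d <- strings k) F (d ++ false :: s).
Proof.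
elim: k F => [|k IH] F; first by rewrite /= !big_cons !big_nil !addr0.
rewrite sum_stringsS (IH (fun d => F (true :: d) + F (false :: d))).
by rewrite !sum_stringsS.
Qed.

Lemma size_strings k s : s \in strings k -> size s = k.
Proof.
elim: k s => [|k IH] s; first by rewrite inE => /eqP ->.
by rewrite mem_cat => /orP[] /mapP[d /IH <- ->].
Qed.

Lemma eq_big_strings (V : nmodType) (F G : seq bool -> V) k :
  (forall s, size s = k -> F s = G s) -> \sum_(s <- strings k) F s = \sum_(s <- strings k) G s.
Proof. by move=> h; apply: eq_big_seq => s /size_strings; exact: h. Qed.

Lemma ler_sum_strings (F G : seq bool -> R) k :
  (forall s, size s = k -> F s <= G s) -> \sum_(s <- strings k) F s <= \sum_(s <- strings k) G s.
Proof.
move=> h; rewrite big_seq [leRHS]big_seq.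
by apply: ler_sum => s /size_strings; exact: h.
Qed.

(** The cap in [qi] ensures [qi k <= k]: the question asked at a node [s] with [size s < n] concerns
    one of the first [n] coordinates. Thus the answers up to depth [n] are functions of [n]
    coordinates. *)
Lemma test_rcyl n s : (size s < n)%N -> rcyl n (fun x => (test s x)%:R).
Proof.
move=> sn; have qn : (qi (size s) < n)%N by rewrite (leq_ltn_trans (geq_minr _ _)).
rewrite /test; case: (0 <= _) => /=; last exact: rcyl_cst.
set e := qe _; set c := pt s _ + e.
have [e0|e0] := leP 0 e; last first.
  by apply: (eq_rcyl _ (rcyl_le c qn)) => x; rewrite nmulr_lge0 // subr_le0.
have {e0} : 0 < e by rewrite lt_neqAle e0 andbT eq_sym mulf_neq0 ?invr_eq0 ?signr_eq0 ?pnatr_eq0.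
by move=> e0; apply: (eq_rcyl _ (rcyl_ge c qn)) => x; rewrite pmulr_lge0 // subr_ge0.
Qed.

Lemma chi_rcyl n s : (size s <= n)%N -> rcyl n (chi s).
Proof.
elim: s => [|b s IH] /= sn; first exact: rcyl_cst.
apply: rcylM; first exact/IH/ltnW.
by case: b => //; [|apply: rcylB; first exact: rcyl_cst]; exact: test_rcyl.
Qed.

Lemma chi_ge0 s x : 0 <= chi s x.
Proof.
elim: s => //= b s IH; rewrite mulr_ge0 //; case: b; first by rewrite ler0n.
by rewrite subr_ge0 lern1 leq_b1.
Qed.

Lemma chi_split s x : chi s x = chi (true :: s) x + chi (false :: s) x.
Proof. by rewrite /= -mulrDr addrC subrK mulr1. Qed.

Lemma sum_chi (F : seq bool -> R) k x : \sum_(s <- strings k) F s * chi s x = F (code x k).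
Proof.
elim: k F => [|k IH] F; first by rewrite /= big_seq1 mulr1.
rewrite sum_stringsS /=.
rewrite -(IH (fun s => F (test s x :: s))); apply: eq_bigr => s _.
by case: (test s x); rewrite ?subrr ?subr0 ?mulr1 ?mulr0 ?addr0 ?add0r.
Qed.

(* [q] lies further away from [0] than [p], on the same side. *)
Definition beyond (p q : R) := (0 <= p <= q) || (q <= p <= 0).

Lemma pt_beyond b s j : beyond (pt s j) (pt (b :: s) j).
Proof.
rewrite /= /beyond; case: ifP => [/andP[_]|_]; last by case: (leP 0 (pt s j)) => h; rewrite lexx ?h ?(ltW h).
rewrite /upd; case: eqP => [->|_]; last by case: (leP 0 (pt s j)) => h; rewrite lexx ?h ?(ltW h).
set p := pt s _; set e := qe _ => pe.
have e0 : e != 0 by rewrite mulf_neq0 ?invr_eq0 ?signr_eq0 ?pnatr_eq0.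
have [ep|en] := ltP 0 e.
  by move: pe; rewrite pmulr_lge0 // => ->; rewrite lerDl ltW.
have {e0} en : e < 0 by rewrite lt_neqAle e0.
by move: pe; rewrite nmulr_lge0 // => ->; rewrite gerDl (ltW en) orbT.
Qed.

Lemma pt_code_beyond x k j : beyond (pt (code x k) j) (x j).
Proof.
elim: k => [|k]; first by rewrite /beyond /=; case: (leP 0 (x j)) => [_|/ltW ->]; rewrite lexx ?orbT.
rewrite [code x k.+1]/= [pt (_ :: _)]/=; set s := code x k => IH.
case: ifP => [/andP[t pe]|_] //; rewrite /upd; case: eqP => [ji|_] //.
move: t pe; rewrite /test -ji; set p := pt s j; set e := qe _.
move=> /andP[_ t] pe; rewrite /beyond.
have e0 : e != 0 by rewrite mulf_neq0 ?invr_eq0 ?signr_eq0 ?pnatr_eq0.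
have [ep|en] := ltP 0 e.
  move: pe t; rewrite !pmulr_lge0 // subr_ge0 => p0 ->.
  by rewrite addr_ge0 // ltW.
have {e0} en : e < 0 by rewrite lt_neqAle e0.
move: pe t; rewrite !nmulr_lge0 // subr_le0 => p0 ->.
have -> : p + e <= 0 by rewrite -(addr0 0) lerD // ltW.
by rewrite orbT.
Qed.

(** A sequence that only moves away from [0] never changes side, so both its positive part [v] and
    its negative part [w] are nondecreasing. *)
Lemma beyond_cvg (u : nat -> R) M : (forall k, beyond (u k) (u k.+1)) ->
  (forall k, `|u k| <= M) -> cvgn u.
Proof.
move=> bu uM.
pose v k := Num.max (u k) 0; pose w k := Num.max (- u k) 0.
have cv : cvgn v.
  apply: nondecreasing_is_cvgn.
    apply/nondecreasing_seqP => k; rewrite /v; have /orP[/andP[h1 h2]|/andP[h1 h2]] := bu k.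
      by rewrite ge_max !le_max h2 lexx orbT.
    by rewrite ge_max !le_max h2 lexx !orbT.
  by exists M => _ [k _ <-]; rewrite /v ge_max (le_trans (ler_norm _) (uM k)) (le_trans _ (uM k)).
have cw : cvgn w.
  apply: nondecreasing_is_cvgn.
    apply/nondecreasing_seqP => k; rewrite /w; have /orP[/andP[h1 h2]|/andP[h1 h2]] := bu k.
      by rewrite ge_max !le_max oppr_le0 h1 lexx !orbT.
    by rewrite ge_max !le_max lerN2 h1 lexx orbT.
  exists M => _ [k _ <-]; rewrite /w ge_max; apply/andP; split; apply: le_trans (uM k) => //.
  by rewrite -normrN ler_norm.
rewrite (_ : u = (fun k => v k - w k)); first exact: is_cvgB.
apply/funext => k; rewrite /v /w /Num.max; case: ltgtP => h; case: ltgtP => h';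
  rewrite ?subr0 ?sub0r ?opprK //; move: h'; rewrite ?oppr_lt0 ?oppr_gt0; lra.
Qed.

(** The third component of a question is a free counter [l], read by neither [qi] nor [qe]. Its
    codes are pairwise distinct, so they cannot all stay below [maxn i N]; beyond that value the cap
    in [qi] is inactive. *)
Lemma question_unbounded i j (b : bool) N : exists k, [/\ (N <= k)%N, qi k = i & qe k = (-1) ^+ b / j.+1%:R].
Proof.
pose f (l : nat) := pickle (i, j, l, b).
have fi : injective f by move=> l l' /(pcan_inj pickleK) [].
have [l hl] : exists l, (maxn i N <= f l)%N.
  apply: contrapT => /forallNP h.
  have {}h l : (f l < maxn i N)%N by rewrite ltnNge; apply/negP; exact: h.
  pose g (l : 'I_(maxn i N).+1) : 'I_(maxn i N) := Ordinal (h l).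
  have gi : injective g by move=> a c [] /fi /val_inj.
  by have := max_card (mem (codom g)); rewrite card_codom // !card_ord ltnn.
exists (f l); have q : question (f l) = (i, j, l, b) by rewrite /question pickleK.
split; first exact: leq_trans (leq_maxr _ _) hl.
  by rewrite /qi q; apply/minn_idPl; exact: leq_trans (leq_maxl _ _) hl.
by rewrite /qe q.
Qed.

Lemma pt_code_cvg x j : pt (code x k) j @[k --> \oo] --> x j.
Proof.
have bx k := pt_code_beyond x k j.
have bu k : beyond (pt (code x k) j) (pt (code x k.+1) j) by exact: pt_beyond.
have cv : cvgn (fun k => pt (code x k) j).
  apply: (@beyond_cvg _ `|x j|) => // k; have /orP[/andP[h1 h2]|/andP[h1 h2]] := bx k.
    by rewrite !ger0_norm // (le_trans h1).
  by rewrite !ler0_norm ?lerN2 // (le_trans h1).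
move: (cv); set l := limn _ => cl.
suff -> : x j = l by [].
(* If the increment [e] for coordinate [j] passed its test at all late steps, each of the infinitely
   many questions about it would move the approximation by exactly [e], against convergence. Below,
   a gap between [l] and [x j] would let some [e] of size at most the gap pass forever. *)
have stuck (b : bool) (m : nat) : let e := (-1) ^+ b / m.+1%:R in
    ~ (\forall k \near \oo, 0 <= pt (code x k) j * e /\ 0 <= (x j - (pt (code x k) j + e)) * e).
  move=> e [N0 _ hN0].
  have d0 : (fun k => pt (code x k.+1) j - pt (code x k) j) @ \oo --> 0.
    by rewrite -(subrr l); apply: cvgB => //; rewrite (cvg_shiftS (fun k => pt (code x k) j)).
  have e0 : 0 < `|e| by rewrite normr_gt0 mulf_neq0 ?invr_eq0 ?signr_eq0 ?pnatr_eq0.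
  have /cvgrPdist_lt /(_ _ e0) [N1 _ hN1] := d0.
  have [k [kN qik qek]] := question_unbounded j m b (maxn N0 N1).
  have [t1 t2] := hN0 k (leq_trans (leq_maxl _ _) kN).
  have := hN1 k (leq_trans (leq_maxr _ _) kN).
  rewrite /= /test size_code qik qek -/e t1 t2 /= /upd eqxx sub0r normrN addrAC subrr add0r.
  by rewrite ltxx.
have inv (d : R) : 0 < d -> exists m : nat, m.+1%:R^-1 <= d.
  move=> d0.
  by exists (Num.truncn d^-1); rewrite invf_ple ?posrE ?ltr0n // ltW // truncnS_gt.
apply/eqP; apply/negPn/negP => xl.
have [x0|x0] := leP 0 (x j).
  have ux k : 0 <= pt (code x k) j <= x j.
    have /orP[//|/andP[h1 h2]] := bx k; have e0 : x j = 0 by apply/eqP; rewrite eq_le x0 (le_trans h1).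
    by move: h1; rewrite e0 h2 => ->.
  have lx : l < x j.
    rewrite lt_neqAle eq_sym xl /=; apply: (limr_le cv); apply: nearW => k.
    by have /andP[] := ux k.
  have nd : nondecreasing_seq (fun k => pt (code x k) j).
    apply/nondecreasing_seqP => k; have /orP[/andP[]//|/andP[h1 h2]] := bu k.
    have /andP[h3 _] := ux k; have /andP[h4 _] := ux k.+1.
    by rewrite (le_trans h2).
  have ul k : pt (code x k) j <= l by exact: (nondecreasing_cvgn_le nd cv k).
  have [m hm] := inv (x j - l) ltac:(by rewrite subr_gt0).
  apply: (stuck false m); apply: nearW => k; rewrite expr0 mul1r.
  have /andP[u0 _] := ux k.
  rewrite !mulr_ge0 ?invr_ge0 ?ler0n // subr_ge0.
  by rewrite (le_trans (lerD (ul k) hm)) // addrC subrK.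
have ux k : x j <= pt (code x k) j <= 0.
  have /orP[/andP[h1 h2]|//] := bx k.
  by have := lt_le_trans x0 (le_trans h1 h2); rewrite ltxx.
have lx : x j < l.
  rewrite lt_neqAle xl /=; apply: (limr_ge cv); apply: nearW => k.
  by have /andP[] := ux k.
have nd : nonincreasing_seq (fun k => pt (code x k) j).
  apply/nonincreasing_seqP => k; have /orP[/andP[h1 h2]|/andP[]//] := bu k.
  have /andP[_ h3] := ux k; have /andP[_ h4] := ux k.+1.
  by rewrite (le_trans h4).
have ul k : l <= pt (code x k) j by exact: (nonincreasing_cvgn_ge nd cv k).
have [m hm] := inv (l - x j) ltac:(by rewrite subr_gt0).
apply: (stuck true m); apply: nearW => k; rewrite expr1 mulN1r.
have /andP[_ u0] := ux k.
rewrite !mulrN -!mulNr !mulr_ge0 ?invr_ge0 ?ler0n ?oppr_ge0 // subr_le0.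
by rewrite lerBrDr (le_trans _ (ul k)) // addrC -lerBrDr.
Qed.

(** Since nothing is asked of the coordinates of index at least [n], such an [F] cannot depend on
    them; see [cont_n_trunc]. *)
Definition cont_n n (F : T -> R) := forall x (e : R), 0 < e ->
  exists2 d, 0 < d & forall y, (forall i, (i < n)%N -> `|x i - y i| < d) -> `|F x - F y| < e.

Lemma cont_n_cvg n F x (u : nat -> T) : cont_n n F ->
  (forall i, (i < n)%N -> u k i @[k --> \oo] --> x i) -> F (u k) @[k --> \oo] --> F x.
Proof.
move=> cF ux; apply/cvgrPdist_lt => e e0.
have [d d0 hd] := cF x e e0.
have : \forall k \near \oo, forall i : 'I_n, `|x i - u k i| < d.
  by apply: filter_forall => i; have /cvgrPdist_lt /(_ _ d0) := ux i (ltn_ord i).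
by apply: filterS => k h; apply: hd => i ni; have := h (Ordinal ni).
Qed.

Lemma rcyl_code n (F : T -> R) k : (k <= n)%N -> rcyl n (fun x => F (pt (code x k))).
Proof.
move=> kn; apply: (eq_rcyl (f := fun x => \sum_(s <- strings k) F (pt s) * chi s x)).
  by move=> x; rewrite (sum_chi (fun s => F (pt s))).
have [m km] : exists m, (k <= m)%N by exists k.
(* The filter on sizes carries the information [size s = k] through the induction on the list, where
   membership in [strings k] is lost. *)
rewrite (_ : (fun x => _) = (fun x => \sum_(s <- strings k | size s == k) F (pt s) * chi s x)); last first.
  apply/funext => x; rewrite [RHS]big_mkcond; apply: eq_big_strings => s ->; by rewrite eqxx.
have {m km} : all (fun s => size s == k) (strings k) by apply/allP => s /size_strings ->.
elim: (strings k) => [_|s l IH /= /andP[/eqP sk /IH {}IH]].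
  by apply: (eq_rcyl _ (rcyl_cst n 0)) => x; rewrite big_nil.
apply: (eq_rcyl _ (rcylD (rcylZ (F (pt s)) (chi_rcyl (n := n) (s := s) _)) IH)) => [x|].
  by rewrite big_cons sk eqxx.
by rewrite sk.
Qed.

Lemma cont_n_trunc n F : cont_n n F -> F \o trunc n = F.
Proof.
move=> cF; apply/funext => x /=.
apply/esym/eqP; rewrite -subr_eq0 -normr_le0; apply/ler_addgt0Pl => e e0; rewrite addr0.
have [d d0 hd] := cF x e e0; apply/ltW/hd => i ni.
by rewrite /trunc ni subrr normr0.
Qed.

(** [F] evaluated at the coded approximation of [x] takes finitely many values on cylinder events
    and converges to [F x]. The code of [trunc n x] is used because the questions about the other
    coordinates would otherwise bring in more than [n] variables. *)
Lemma rcyl_cont n F M : cont_n n F -> (forall x, `|F x| <= M) -> rcyl n F.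
Proof.
move=> cF FM; rewrite -(cont_n_trunc cF).
apply: (@rcyl_cvg _ _ (fun k x => F (trunc n (pt (code (trunc n x) k)))) _ M) => // [k|x].
  exact: (cyl_trunc n (rcyl_code (F \o trunc n) (leqnn k))).
rewrite -[fun k => _]/((fun p => (F \o trunc n) p) \o (fun k => pt (code (trunc n x) k))) cont_n_trunc //.
apply: (cont_n_cvg cF) => i ni.
by rewrite (_ : x i = trunc n x i); [exact: pt_code_cvg|rewrite /trunc ni].
Qed.
End Greedy.

(** * The weak topology of the weighted sequence spaces *)
Section WeakTopology.

Lemma cvg_sum_ord {R : realType} {S : Type} (F : set_system S) {FF : Filter F} n
    (f : nat -> S -> R) (l : nat -> R) : (forall i, f i x @[x --> F] --> l i) ->
  \sum_(i < n) f i x @[x --> F] --> \sum_(i < n) l i.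
Proof.
move=> h; elim: n => [|n IH].
  by rewrite big_ord0; under eq_fun do rewrite big_ord0; exact: cvg_cst.
by rewrite big_ord_recr; under eq_fun do rewrite big_ord_recr; exact: cvgD.
Qed.

Lemma continuous_sum_ord {R : realType} {S : topologicalType} n (f : nat -> S -> R) :
  (forall i, continuous (f i)) -> continuous (fun x => \sum_(i < n) f i x).
Proof.
by move=> cf x; apply: (cvg_sum_ord (f := f) (l := fun i => f i x)) => i; exact: cf.
Qed.

Lemma continuous_scale_sqr {R : realType} {S : topologicalType} (a : R) (f : S -> R) :
  continuous f -> continuous (fun x => a * f x ^+ 2).
Proof.
move=> cf x; apply: cvgMl_tmp.
by apply: (continuous_cvg _ (@exprn_continuous _ 2 _)); exact: cf.
Qed.

Lemma continuous_dist {R : realType} {S : topologicalType} (a : R) (f : S -> R) :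
  continuous f -> continuous (fun x => `|f x - a|).
Proof. by move=> cf x; apply: cvg_norm; apply: cvgB; [exact: cf|exact: cvg_cst]. Qed.

Lemma cvg_initial (S : choiceType) (U : topologicalType) (f : S -> U)
    (F : set_system S) (s : S) : Filter F -> f @ F --> f s -> F --> (s : initial_topology f).
Proof.
move=> FF h A /= [_ [[B Bop <-] Bfs sBfA]].
by apply: filterS sBfA _; apply: h; apply: open_nbhs_nbhs.
Qed.

Lemma cvg_ptws (I : Type) (U : topologicalType) (F : set_system (I -> U)) (l : I -> U) :
  Filter F -> (forall i, f i @[f --> F] --> l i) -> F --> (l : prod_topology (fun _ : I => U)).
Proof. by move=> FF h; apply/cvg_sup => i; apply: cvg_initial; exact: h. Qed.

Context {R : realType} (gamma : R).
Local Notation wp := (l2weight gamma).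
Local Notation wm := (l2weight (- gamma)).
Implicit Types (xi : l2 gamma) (x y : l2 (- gamma)).

Lemma l2weightM i : wp i * wm i = 1.
Proof. by rewrite /l2weight powRN mulfV // gt_eqF // powR_gt0. Qed.

(** The ball of squared radius [N]. Stating it by partial sums makes it a countable intersection of
    conditions on finitely many coordinates, which gives weak closedness and measurability at
    once. *)
Definition ballw (N : R) : set (l2weak gamma) :=
  [set x | forall n, \sum_(i < n) wm i * l2seq x i ^+ 2 <= N].

Lemma series_le_lim (u : nat -> R) n : (forall i, 0 <= u i) -> cvgn (series u) ->
  \sum_(i < n) u i <= limn (series u).
Proof.
move=> u0 cu; have nd : nondecreasing_seq (series u).
  by apply/nondecreasing_seqP => k; rewrite seriesSr lerDl.
by have := nondecreasing_cvgn_le nd cu n; rewrite /series /= big_mkord.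
Qed.

Lemma ballw_exists x : exists k : nat, ballw k%:R x.
Proof.
pose l := limn (series (fun i => wm i * l2seq x i ^+ 2)).
exists (Num.truncn l).+1 => n; apply: (le_trans _ (ltW (truncnS_gt l))).
apply: series_le_lim => [i|]; first by rewrite mulr_ge0 ?l2weight_ge0 ?sqr_ge0.
exact: l2_sqr_cvg.
Qed.

(** The weights of the two dual spaces are inverse to each other. The free parameter [c] serves to
    make the part coming from [b] small when only a bound on it is known. *)
Lemma bracket_AMGM (c a b : R) i : 0 < c -> `|a * b| <= c * (wp i * a ^+ 2) + c^-1 * (wm i * b ^+ 2).
Proof.
move=> c0; set p := c * _; set q := c^-1 * _.
have p0 : 0 <= p by rewrite mulr_ge0 ?(ltW c0) // mulr_ge0 ?sqr_ge0 ?l2weight_ge0.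
have q0 : 0 <= q by rewrite mulr_ge0 ?invr_ge0 ?(ltW c0) // mulr_ge0 ?sqr_ge0 ?l2weight_ge0.
have pq : p * q = `|a * b| ^+ 2.
  rewrite real_normK ?num_real // exprMn -[RHS]mul1r -(l2weightM i) /p /q.
  by field; rewrite gt_eqF.
rewrite -(@ler_pXn2r _ 2) ?nnegrE ?addr_ge0 // -pq.
have := mulr_ge0 p0 q0; clearbody p q; nra.
Qed.

Lemma bracket_cvg xi x : cvgn (series (fun i => l2seq xi i * l2seq x i)).
Proof.
apply: normed_cvg; apply: (@series_le_cvg _ _ (fun i => wp i * l2seq xi i ^+ 2 + wm i * l2seq x i ^+ 2)).
- by move=> i; exact: normr_ge0.
- by move=> i; rewrite addr_ge0 // mulr_ge0 ?l2weight_ge0 ?sqr_ge0.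
- by move=> i; have := @bracket_AMGM 1 (l2seq xi i) (l2seq x i) i ltr01; rewrite invr1 !mul1r.
- have h := is_cvg_seriesD (@l2_sqr_cvg _ _ xi) (@l2_sqr_cvg _ _ x); exact: h.
Qed.

(* On a ball the bracket is uniformly approximated by its partial sums. *)
Lemma bracket_tail xi N (e : R) : 0 < e -> exists n, forall x, ballw N x ->
  `|bracket xi x - \sum_(i < n) l2seq xi i * l2seq x i| <= e.
Proof.
move=> e0.
have [N0|N0] := leP N 0.
  exists 0%N => x hx; suff z i : l2seq x i = 0.
    rewrite big_ord0 subr0 /bracket (_ : (fun _ => _) = fun=> 0); last first.
      by apply/funext => i; rewrite z mulr0.
    rewrite (_ : series _ = fun=> 0); first by rewrite lim_cst // normr0 ltW.
    by apply/funext => n; rewrite /series /= big1.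
  have := le_trans (hx i.+1) N0; rewrite big_ord_recr /=.
  have : 0 <= \sum_(i0 < i) wm i0 * l2seq x i0 ^+ 2.
    by apply: sumr_ge0 => j _; rewrite mulr_ge0 ?l2weight_ge0 ?sqr_ge0.
  have : 0 <= wm i * l2seq x i ^+ 2 by rewrite mulr_ge0 ?l2weight_ge0 ?sqr_ge0.
  move=> h1 h2 h3; have : wm i * l2seq x i ^+ 2 = 0 by lra.
  by move/eqP; rewrite mulf_eq0 gt_eqF ?l2weight_gt0 //= sqrf_eq0 => /eqP.
(* With this [c] the ball contributes at most [c^-1 N = e / 2]. Then [n] is taken so large that the
   tail of [xi] is below [e / (2 c)], which contributes the other half. *)
pose c := 2 * N / e; have c0 : 0 < c by rewrite divr_gt0 // mulr_gt0.
have cv := @l2_sqr_cvg _ _ xi; set u := fun i => wp i * l2seq xi i ^+ 2 in cv.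
have u0 i : 0 <= u i by rewrite mulr_ge0 ?l2weight_ge0 ?sqr_ge0.
have d0 : 0 < e / (2 * c) by rewrite divr_gt0 // mulr_gt0.
have /cvgrPdist_lt /(_ _ d0) [n _ hn] := cv; exists n => x hx.
have P m : (n <= m)%N -> `|series (fun i => l2seq xi i * l2seq x i) m - \sum_(i < n) l2seq xi i * l2seq x i| <= e.
  move=> nm; rewrite -(big_mkord predT (fun i => l2seq xi i * l2seq x i)) /series /=.
  rewrite (big_cat_nat (leq0n n) nm) /= addrAC subrr add0r.
  apply: (le_trans (ler_norm_sum _ _ _)).
  apply: (@le_trans _ _ (\sum_(n <= i < m) (c * u i + c^-1 * (wm i * l2seq x i ^+ 2)))).
    by apply: ler_sum => i _; exact: bracket_AMGM.
  rewrite big_split /= -!mulr_sumr.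
  have h1 : \sum_(n <= i < m) u i <= e / (2 * c).
    have := hn n (leqnn n); rewrite /= => /ltW; apply: le_trans.
    rewrite (le_trans _ (ler_norm _)) // lerBrDr.
    have := series_le_lim m u0 cv; rewrite -(big_mkord predT u) (big_cat_nat (leq0n n) nm) /=.
    by rewrite addrC.
  have h2 : \sum_(n <= i < m) wm i * l2seq x i ^+ 2 <= N.
    apply: le_trans (hx m); rewrite -(big_mkord predT (fun i => wm i * l2seq x i ^+ 2)).
    rewrite (big_cat_nat (leq0n n) nm) /= lerDr sumr_ge0 // => i _.
    by rewrite mulr_ge0 ?l2weight_ge0 ?sqr_ge0.
  have -> : e = c * (e / (2 * c)) + c^-1 * N by rewrite /c; field; rewrite !gt_eqF.
  by rewrite lerD // ler_wpM2l ?invr_ge0 // ltW.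
have cb := @bracket_cvg xi x.
have cn : (fun m => `|series (fun i => l2seq xi i * l2seq x i) m - \sum_(i < n) l2seq xi i * l2seq x i|) @ \oo -->
   `|bracket xi x - \sum_(i < n) l2seq xi i * l2seq x i|.
  by apply: cvg_norm; apply: cvgB => //; exact: cvg_cst.
rewrite -(cvg_lim _ cn) //; apply: limr_le; first by apply/cvg_ex; eexists; exact: cn.
by near=> m; apply: P; near: m; exact: nbhs_infty_ge.
Unshelve. all: by end_near.
Qed.

(** On a ball every bracket is a uniform limit of finite sums of coordinates, so weak convergence
    there is mere coordinatewise convergence, by a three-epsilon argument. *)
Lemma cvg_l2weak (F : set_system (l2weak gamma)) (x : l2weak gamma) N : Filter F ->
  F (ballw N) -> ballw N x -> (forall i, l2seq y i @[y --> F] --> l2seq x i) -> F --> x.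
Proof.
move=> FF FN Nx h.
apply: (@cvg_initial (l2 (- gamma)) (prod_topology (fun _ : l2 gamma => R)) (fun x => fun xi => bracket xi x) F x FF).
have FG : Filter ((fun (x : l2 (- gamma)) (xi : l2 gamma) => bracket xi x) @ F) by exact: fmap_filter.
apply: (@cvg_ptws (l2 gamma) R _ (fun xi => bracket xi x) FG) => xi.
suff : bracket xi y @[y --> F] --> bracket xi x by [].
apply/cvgrPdist_le => e e0.
have [n hn] := @bracket_tail xi N (e / 3) ltac:(by rewrite divr_gt0).
have cs : \sum_(i < n) l2seq xi i * l2seq y i @[y --> F] --> \sum_(i < n) l2seq xi i * l2seq x i.
  by apply: (cvg_sum_ord (f := fun i y => l2seq xi i * l2seq y i) (l := fun i => l2seq xi i * l2seq x i)) => i; apply: cvgMl_tmp; exact: h.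
have /cvgrPdist_le /(_ (e / 3) ltac:(by rewrite divr_gt0)) := cs.
apply: filterS2 FN => y Ny hy.
have := hn x Nx; have := hn y Ny; move: hy; rewrite !ler_norml => /andP[? ?] /andP[? ?] /andP[? ?].
by apply/andP; split; lra.
Qed.

Lemma ballw_closed_coord (F : set_system (l2weak gamma)) (z : nat -> R) N : ProperFilter F ->
  F (ballw N) -> (forall i, l2seq y i @[y --> F] --> z i) ->
  forall n, \sum_(i < n) wm i * z i ^+ 2 <= N.
Proof.
move=> FF FN h n.
have cs : \sum_(i < n) wm i * l2seq y i ^+ 2 @[y --> F] --> \sum_(i < n) wm i * z i ^+ 2.
  apply: (cvg_sum_ord (f := fun i (y : l2weak gamma) => wm i * l2seq y i ^+ 2) (l := fun i => wm i * z i ^+ 2)) => i; apply: cvgMl_tmp.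
  by apply: (continuous_cvg _ (@exprn_continuous _ 2 _)); exact: h.
rewrite -(cvg_lim _ cs) //; apply: limr_le; first by apply/cvg_ex; eexists; exact: cs.
by apply: filterS FN => y; exact.
Qed.

Lemma l2_of_bounded (z : nat -> R) N : (forall n, \sum_(i < n) wm i * z i ^+ 2 <= N) ->
  z \in l2_mem (- gamma).
Proof.
move=> h; apply/l2_memE; apply: nondecreasing_is_cvgn.
  by apply/nondecreasing_seqP => k; rewrite seriesSr lerDl mulr_ge0 ?l2weight_ge0 ?sqr_ge0.
by exists N => _ [n _ <-]; rewrite /series /= big_mkord.
Qed.

(** Along an ultrafilter containing the ball each coordinate stays in a compact interval, hence
    converges. The limits satisfy the same partial-sum bounds, and coordinatewise convergence on the
    ball is weak convergence. *)
Lemma ballw_compact N : compact (ballw N).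
Proof.
rewrite compact_ultra => F UF FN.
have coord i : exists z : R, l2seq y i @[y --> F] --> z.
  (* From [t^2 <= a] follows [t <= a + 1], which avoids a square root in the bound of the
     coordinate. *)
  pose C := Num.max N 0 / wm i + 1.
  have [N0|N0] := leP 0 N; last first.
    exfalso; have [x Nx] := filter_ex FN.
    by have := Nx 0%N; rewrite big_ord0 leNgt N0.
  have cC : compact `[- C, C]%classic by exact: segment_compact.
  have [|z [_ hz]] := cC ((fun y : l2weak gamma => l2seq y i) @ F) (fmap_proper_filter _ _); last first.
    exists z => V Vz; have [//|FV] := in_ultra_setVsetC ((fun y : l2weak gamma => l2seq y i) @^-1` V) UF.
    by have [r [rV nrV]] := hz (~` V) V FV Vz.
  suff : F ((fun y : l2weak gamma => l2seq y i) @^-1` `[- C, C]%classic) by [].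
  apply: filterS FN => y Ny /=; rewrite in_itv /= -ler_norml.
  have h : wm i * l2seq y i ^+ 2 <= N.
    apply: le_trans (Ny i.+1); rewrite big_ord_recr /= lerDr sumr_ge0 // => j _.
    by rewrite mulr_ge0 ?l2weight_ge0 ?sqr_ge0.
  have {}h : `|l2seq y i| ^+ 2 <= N / wm i.
    by rewrite real_normK ?num_real // ler_pdivlMr ?l2weight_gt0 // mulrC.
  rewrite /C max_l //; have := normr_ge0 (l2seq y i); nra.
have [z hz] := choice coord.
have PF : ProperFilter F by exact: ultra_proper.
have zN := ballw_closed_coord PF FN hz.
exists (L2 (l2_of_bounded zN) : l2weak gamma); split; first exact: zN.
by apply: (cvg_l2weak _ FN) => //; exact: zN.
Qed.

Lemma coord_continuous i : continuous (fun x : l2weak gamma => l2seq x i).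
Proof.
move=> x.
have E (y : l2weak gamma) : l2seq y i = bracket (l2unit gamma i) y.
  apply/esym/cvg_lim => //; apply: cvg_near_cst; exists i.+1 => // n /= ni.
  rewrite /series /= big_mkord (bigD1 (Ordinal ni)) //= eqxx mul1r big1 ?addr0 // => j ji.
  by rewrite (_ : (j == i :> nat) = false) ?mul0r //; apply: contraNF ji => /eqP ji; apply/eqP/val_inj.
rewrite /continuous_at E; under eq_fun do rewrite E.
have := @initial_continuous _ (prod_topology (fun _ : l2 gamma => R)) (fun x : l2 (- gamma) => fun xi => bracket xi x) x.
have p := @proj_continuous _ (fun _ : l2 gamma => R) (l2unit gamma i) (fun xi => bracket xi x).
by move=> c; have := cvg_comp _ _ c p.
Qed.

Lemma ballw_closed N : closed (ballw N).
Proof.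
rewrite (_ : ballw N = \bigcap_n [set x : l2weak gamma | \sum_(i < n) wm i * l2seq x i ^+ 2 <= N]); last first.
  by apply/seteqP; split => [x h n _|x h n]; [exact: h|exact: h n I].
apply: closed_bigI => n _.
rewrite (_ : [set x | _] = (fun x : l2weak gamma => \sum_(i < n) wm i * l2seq x i ^+ 2) @^-1` [set r | r <= N]) //.
apply: preimage_closed; last exact: closed_le.
move=> x _; apply: (continuous_sum_ord (f := fun i (x : l2weak gamma) => wm i * l2seq x i ^+ 2)) => i.
exact: continuous_scale_sqr (@coord_continuous i).
Qed.

(* Closed boxes with rational data, cut by balls: a countable family of weakly
   compact sets every weakly open set is a union of. *)
Definition cell (m : nat) : set (l2weak gamma) :=
  let c := odflt (0%N, [::] : seq rat) (unpickle m) in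
  ballw c.1%:R `&` [set x | forall i, (i < size c.2)%N ->
    `|l2seq x i - ratr (nth 0%Q c.2 i)| <= (size c.2).+1%:R^-1].

Lemma cell_closed m : closed (cell m).
Proof.
rewrite /cell; set c := odflt _ _.
apply: closedI; first exact: ballw_closed.
rewrite (_ : [set x | _] = \bigcap_(i in [set i | (i < size c.2)%N])
  [set x : l2weak gamma | `|l2seq x i - ratr (nth 0%Q c.2 i)| <= (size c.2).+1%:R^-1]) //.
apply: closed_bigI => i _.
rewrite (_ : [set x | _] = (fun x : l2weak gamma => `|l2seq x i - ratr (nth 0%Q c.2 i)|) @^-1`
   [set r | r <= (size c.2).+1%:R^-1]) //.
apply: preimage_closed; last exact: closed_le.
move=> x _; exact: continuous_dist (@coord_continuous i) x.
Qed.

(** Around [x], inside a fixed ball, some coordinate box [near n] lies in [U]: otherwise points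
    chosen outside [U] in each box would converge weakly to [x]. The box has radius [2 / (n + 1)] so
    that a rational cell of radius [1 / (n + 1)], with centre within [1 / (n + 1)] of [x], fits in
    it. *)
Lemma open_cells (U : set (l2weak gamma)) : open U ->
  U = \bigcup_(c in [set c | cell c `<=` U]) cell c.
Proof.
move=> oU; apply/seteqP; split => [x Ux|x [c cU cx]]; last exact: cU.
have [k kx] := ballw_exists x.
pose near n := ballw k%:R `&` [set y : l2weak gamma | forall i, (i < n)%N ->
  `|l2seq y i - l2seq x i| <= 2 / n.+1%:R].
have [n hn] : exists n, near n `<=` U.
  apply: contrapT => /forallNP h.
  have {}h n : exists y, near n y /\ ~ U y.
    by have /existsNP[y /not_implyP[? ?]] := h n; exists y.
  have [u hu] := choice h.
  have cu : u @ \oo --> x.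
    have FF : Filter (u @ \oo) by exact: fmap_filter.
    apply: (@cvg_l2weak (u @ \oo) x k%:R FF) => //; first by exists 0%N => // n _; case: (hu n) => -[].
    move=> i; suff : l2seq (u n) i @[n --> \oo] --> l2seq x i by [].
    apply/cvgrPdist_le => e e0; near=> n; have [[_ hn] _] := hu n.
    rewrite /= distrC (le_trans (hn i _)) //; first by near: n; exact: nbhs_infty_gt.
    rewrite ler_pdivrMr // mulrC -ler_pdivrMr // ltW // (@lt_trans _ _ n%:R) ?ltr_nat //.
    by near: n; exact: nbhs_infty_gtr.
  have /cu [m _ hm] : nbhs x U by apply: open_nbhs_nbhs.
  by case: (hu m) => _; apply; exact: (hm m (leqnn m)).
have approx (a e : R) : 0 < e -> exists q : rat, `|a - ratr q| <= e.
  move=> e0; have [q] := rat_in_itvoo (ltr_pwDr e0 (lexx a) : a < a + e).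
  rewrite in_itv /= => /andP[h1 h2]; exists q; rewrite distrC ger0_norm ?subr_ge0 ?(ltW h1) //.
  by rewrite lerBlDl ltW.
have d0 : 0 < n.+1%:R^-1 :> R by rewrite invr_gt0.
have [q hq] := choice (fun i => approx (l2seq x i) _ d0).
exists (pickle (k, mkseq q n)); rewrite /= /cell pickleK /=; last first.
  split => //= i; rewrite size_mkseq => ni; rewrite nth_mkseq //; exact: hq.
move=> y [ky hy]; apply: hn; split => // i ni.
have := hy i; rewrite size_mkseq ni nth_mkseq // => /(_ isT).
have := hq i; move: (n.+1%:R^-1 : R) => r.
by rewrite !ler_norml => /andP[? ?] /andP[? ?]; apply/andP; split; lra.
Unshelve. all: by end_near.
Qed.

Lemma ballw_measurable d (S : measurableType d) (phi : S -> l2 (- gamma)) N :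
  (forall i, measurable_fun setT (fun s => l2seq (phi s) i)) ->
  measurable (phi @^-1` ballw N).
Proof.
move=> mphi; rewrite (_ : _ @^-1` _ = \bigcap_n [set s | \sum_(i < n) wm i * l2seq (phi s) i ^+ 2 <= N]); last first.
  by apply/seteqP; split => [x h n _|x h n]; [exact: h|exact: h n I].
apply: bigcapT_measurable => n; rewrite -[X in measurable X]setTI.
by apply: measurable_fun_le => //; apply: measurable_sum => i; apply: measurable_funM => //; exact: measurable_funX.
Qed.

Lemma cell_measurable d (S : measurableType d) (phi : S -> l2 (- gamma)) m :
  (forall i, measurable_fun setT (fun s => l2seq (phi s) i)) ->
  measurable (phi @^-1` cell m).
Proof.
move=> mphi; rewrite /cell; set c := odflt _ _; rewrite preimage_setI; apply: measurableI; first exact: ballw_measurable.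
rewrite (_ : _ @^-1` _ = \bigcap_(i in [set i | (i < size c.2)%N])
  [set s | `|l2seq (phi s) i - ratr (nth 0%Q c.2 i)| <= (size c.2).+1%:R^-1]) //.
apply: bigcap_measurableType => i _.
rewrite -[X in measurable X]setTI; apply: measurable_fun_le => //.
by apply: measurableT_comp => //; apply: measurable_funB.
Qed.

(** Weakly open sets are countable unions of cells, and cells are defined by coordinates; hence the
    Borel sets of the weak topology are no finer than what the coordinates generate. *)
Lemma measurable_l2borel d (S : measurableType d) (phi : S -> l2 (- gamma)) :
  (forall i, measurable_fun setT (fun s => l2seq (phi s) i)) ->
  measurable_fun setT (phi : S -> l2borel gamma).
Proof.
move=> mphi.
apply: (@measurability _ _ S (l2borel gamma) setT phi (@open (l2weak gamma)) erefl) => _ [U oU <-].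
rewrite setTI (open_cells oU) preimage_bigcup.
by apply: bigcup_measurable => c _; exact: cell_measurable.
Qed.

Lemma open_l2borel (U : set (l2weak gamma)) : open U -> measurable (U : set (l2borel gamma)).
Proof. by move=> oU; apply: sub_sigma_algebra. Qed.

Lemma coord_measurable i : measurable_fun setT (fun x : l2borel gamma => l2seq x i).
Proof.
apply: (measurability _ (RGenOpens.measurableE R)) => // _ [_ [a [b ->]] <-].
rewrite setTI; apply: open_l2borel.
by apply: (open_comp (f := fun x : l2weak gamma => l2seq x i)) => [x _|];
  [exact: coord_continuous | exact: interval_open].
Qed.
End WeakTopology.

(** * Inner regularity of finite Borel measures for the weak topology *)

Section Radon.
Context {R : realType} (gamma : R).
Variable m : {measure set (l2borel gamma) -> \bar R}.
Hypothesis mfin : (m setT < +oo)%E.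

Lemma fin_meas_lt (A : set (l2borel gamma)) : measurable A -> (m A < +oo)%E.
Proof. by move=> mA; apply: le_lt_trans mfin; apply: le_measure; rewrite ?inE. Qed.

Lemma nonincreasing_meas_lt (A : nat -> set (l2borel gamma)) (e : R) :
  (forall n, measurable (A n)) -> nonincreasing_seq A -> (m (\bigcap_n A n) < e%:E)%E ->
  exists n, (m (A n) < e%:E)%E.
Proof.
move=> mA nA h.
have c := nonincreasing_cvg_mu (fin_meas_lt (mA 0%N)) mA (bigcapT_measurable mA) nA.
have o := open_ereal_lt_ereal h.
by have [n _ hn] := c _ o; exists n; exact: (hn n (leqnn n)).
Qed.

(** Approximating [B] and its complement from inside at the same time makes the class trivially
    stable under complements. *)
Definition inner_closed (B : set (l2borel gamma)) := measurable B /\ forall e : R, 0 < e ->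
  exists F G : set (l2weak gamma), [/\ closed F, closed G, F `<=` B, G `<=` ~` B &
    (m (~` (F `|` G)) < e%:E)%E].

Lemma closed_l2borel (F : set (l2weak gamma)) : closed F -> measurable (F : set (l2borel gamma)).
Proof.
move=> cF; rewrite -[F]setCK; apply: measurableC; apply: open_l2borel.
exact: closed_openC.
Qed.

Lemma inner_closed_open (U : set (l2weak gamma)) : open U -> inner_closed U.
Proof.
move=> oU; split=> [|e e0]; first exact: open_l2borel.
pose D := [set k | cell k `<=` U].
pose F N : set (l2weak gamma) := \bigcup_(k in `I_N `&` D) cell k.
have cF N : closed (F N).
  by apply: closed_bigcup => [|k _]; [apply: finite_setIl; exact: finite_II|exact: cell_closed].
have [N hN] : exists N, (m (~` (F N `|` ~` U)) < e%:E)%E.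
  apply: nonincreasing_meas_lt => [N|N1 N2 N12|].
  - apply: measurableC; apply: measurableU; first exact: closed_l2borel.
    by apply: measurableC; exact: open_l2borel.
  - apply/subsetPset/subsetC/setSU => x [k [/= kN Dk] kx]; exists k => //; split => //=.
    exact: leq_trans kN N12.
  - rewrite (_ : \bigcap_n _ = set0) ?measure0 ?lte_fin //.
    apply/seteqP; split => // x h.
    have [Ux|nUx] := pselect (U x); last by apply: (h 0%N I); right.
    move: (Ux); rewrite {1}(open_cells oU) => -[k Dk kx].
    by apply: (h k.+1 I); left; exists k => //; split => /=.
exists (F N), (~` U); split => //; first exact: open_closedC.
by move=> x [k [_ Dk]]; exact: Dk.
Qed.

Lemma inner_closed_sigma : sigma_algebra setT inner_closed.
Proof.
split.
- split=> // e e0; exists set0, setT; split.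
  + exact: (@closed0 (l2weak gamma)).
  + exact: (@closedT (l2weak gamma)).
  + by [].
  + by move=> x _ [].
  + by rewrite setUT setCT measure0 lte_fin.
- move=> B [mB hB]; rewrite setTD; split=> [|e e0]; first exact: measurableC.
  have [F [G [cF cG FB GB h]]] := hB e e0; exists G, F; split => //; last by rewrite setUC.
  by rewrite setCK.
- move=> B hB; split=> [|e e0]; first by apply: bigcupT_measurable => n; case: (hB n).
  (* The errors add up to at most [e / 2], strictly below [e]. The strict inequality is needed
     because a countable union of closed sets must then be cut to a finite one, by continuity from
     above. *)
  have e2 n : 0 < (e / 2) / (2 ^ n.+1)%:R by rewrite !divr_gt0 // ltr0n expn_gt0.
  have /choice[FG hFG] : forall n, exists FG : set (l2weak gamma) * set (l2weak gamma),
    [/\ closed FG.1, closed FG.2, FG.1 `<=` B n, FG.2 `<=` ~` B n &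
      (m (~` (FG.1 `|` FG.2)) < ((e / 2) / (2 ^ n.+1)%:R)%:E)%E].
    by move=> n; have [_ /(_ _ (e2 n)) [F [G h]]] := hB n; exists (F, G).
  pose F N := \bigcup_(n in `I_N) (FG n).1; pose G := \bigcap_n (FG n).2.
  have cF N : closed (F N) by apply: closed_bigcup => [|k _]; [exact: finite_II|case: (hFG k)].
  have cG : closed G by apply: closed_bigI => k _; case: (hFG k).
  have mn n : measurable (~` ((FG n).1 `|` (FG n).2) : set (l2borel gamma)).
    by case: (hFG n) => ? ? _ _ _; apply: measurableC; apply: measurableU; exact: closed_l2borel.
  have [N hN] : exists N, (m (~` (F N `|` G)) < e%:E)%E.
    apply: nonincreasing_meas_lt => [N|N1 N2 N12|].
    + by apply: measurableC; apply: measurableU; exact: closed_l2borel.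
    + apply/subsetPset/subsetC/setSU => x [k /= kN kx]; exists k => //=.
      exact: leq_trans kN N12.
    + apply: (@le_lt_trans _ _ (e / 2)%:E); last by rewrite lte_fin ltr_pdivrMr // ltr_pMr // ltr1n.
      apply: (@le_trans _ _ (\sum_(n <oo) m (~` ((FG n).1 `|` (FG n).2)))%E).
        apply: measure_sigma_subadditive => //.
          by apply: bigcapT_measurable => N; apply: measurableC; apply: measurableU; exact: closed_l2borel.
        move=> x h; have nG : ~ G x by move=> Gx; apply: (h 0%N I); right.
        have /existsNP[n /not_implyP[_ nGn]] := nG; exists n => // -[Fx|//].
        by apply: (h n.+1 I); left; exists n => /=.
      apply: le_trans (epsilon_trick0 xpredT (ltW (divr_gt0 e0 (ltr0n _ 2)))).
      by apply: lee_nneseries => [n *|n *]; [exact: measure_ge0|case: (hFG n) => _ _ _ _ /ltW].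
  exists (F N), G; split => //.
  + by move=> x [k _ kx]; exists k => //; case: (hFG k) => _ _ + _ _; exact.
  + by move=> x Gx [k _ kx]; case: (hFG k) => _ _ _ + _; apply; [exact: (Gx k I)|].
Qed.

(** Weakly compact balls exhaust the space, so a closed inner approximation becomes a compact one by
    intersection with a large ball. Hence strong concentration costs nothing beyond the finiteness
    of the measure on the Borel sets of [l2 (- gamma)]. *)
Lemma finite_weak_radon : weak_radon m.
Proof.
move=> B e mB e0.
have [_ h] : inner_closed B.
  move: mB; apply: smallest_sub; first exact: inner_closed_sigma.
  by move=> U; exact: inner_closed_open.
have e2 : 0 < e / 2 by rewrite divr_gt0.
have [F [G [cF cG FB GB hFG]]] := h _ e2.
have mball N : measurable (ballw N : set (l2borel gamma)).
  exact: closed_l2borel (@ballw_closed _ _ _).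
have [N hN] : exists N : nat, (m (~` ballw N%:R) < (e / 2)%:E)%E.
  apply: nonincreasing_meas_lt => [N|N1 N2 N12|].
  - exact: measurableC.
  - apply/subsetPset/subsetC => x h' n; apply: le_trans (h' n) _.
    by rewrite ler_nat.
  - rewrite (_ : \bigcap_n _ = set0) ?measure0 ?lte_fin //.
    apply/seteqP; split => // x h'; have [k kx] := ballw_exists x.
    exact: (h' k I).
exists (ballw N%:R `&` F); split.
- by apply: compact_closedI => //; exact: ballw_compact.
- by move=> x [_ /FB].
- rewrite (splitr e) EFinD; apply: le_lt_trans (lteD hN hFG).
  have mF := closed_l2borel cF; have mG := closed_l2borel cG.
  apply: (@le_trans _ _ (m (~` ballw N%:R `|` ~` (F `|` G)))).
    apply: le_measure; rewrite ?inE.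
    + by apply: measurableD => //; apply: measurableI.
    + by apply: measurableU; apply: measurableC => //; apply: measurableU.
    + move=> x [Bx nx]; have [Nx|] := pselect (ballw N%:R x); last by left.
      by right => -[Fx|/GB]; [apply: nx|].
  by apply: measureU2; apply: measurableC => //; apply: measurableU.
Qed.
End Radon.

(** * From consistent weights on binary strings to measures on the path space *)

Section FiniteMeasures.
Context d (T : measurableType d) {R : realType}.
Implicit Types m : {measure set T -> \bar R}.

Lemma bounded_rintegrable m D (f : T -> R) M : measurable D -> (m D < +oo)%E ->
  measurable_fun D f -> (forall x, `|f x| <= M) -> m.-integrable D (EFin \o f).
Proof.
move=> mD mfin mf fM; apply: measurable_bounded_integrable => //.
by exists M; split; [exact: num_real|move=> N MN x _; exact: le_trans (fM x) (ltW MN)].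
Qed.

Lemma Rintegral_mrestr m D (mD : measurable D) (f : T -> R) M : (m D < +oo)%E ->
  measurable_fun setT f -> (forall x, `|f x| <= M) ->
  \int[mrestr m mD]_x f x = \int[m]_(x in D) f x.
Proof.
move=> mfin mf fM; rewrite /Rintegral; congr fine.
rewrite (@negligible_integral _ _ _ (mrestr m mD) setT (~` D)) //.
- rewrite setTD setCK; apply: eq_measure_integral => A mA AD.
  by rewrite /= /mrestr setIidl.
- exact: measurableC.
- apply: (bounded_rintegrable (M := M)) => //.
  by rewrite /= /mrestr setTI.
- by rewrite /= /mrestr setICl measure0.
Qed.

Lemma pushforward_measure m d' (T' : measurableType d') (phi : T -> T') :
  measurable_fun setT phi -> (m setT < +oo)%E ->
  exists m' : {measure set T' -> \bar R}, (m' setT < +oo)%E /\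
    forall (f : T' -> R) M, measurable_fun setT f -> (forall x, `|f x| <= M) ->
    \int[m']_x f x = \int[m]_x f (phi x).
Proof.
move=> mphi mfin; unshelve eexists (pushforward m phi); first exact: mphi.
split=> // f M mf fM; rewrite /Rintegral integral_pushforward //; first exact/measurable_EFinP.
rewrite preimage_setT; apply: (bounded_rintegrable (M := M)) => //.
exact: (measurableT_comp mf mphi).
Qed.
End FiniteMeasures.

Section TreeMeasure.
Context {R : realType} (gamma : R).
Local Notation T := (nat -> R).
Local Notation wm := (l2weight (- gamma)).
Local Notation lebesgue := (@lebesgue_measure R).

Definition sqnorm k (p : T) : R := \sum_(i < k) wm i * p i ^+ 2.

Lemma sqnorm_ge0 k p : 0 <= sqnorm k p.
Proof. by apply: sumr_ge0 => i _; rewrite mulr_ge0 ?l2weight_ge0 ?sqr_ge0. Qed.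

Lemma sqnorm_widen k k' p : (k <= k')%N -> sqnorm k p <= sqnorm k' p.
Proof.
move=> kk; rewrite /sqnorm -!(big_mkord predT (fun i => wm i * p i ^+ 2)).
rewrite [leRHS](big_cat_nat (leq0n k) kk) /= lerDl sumr_ge0 // => i _.
by rewrite mulr_ge0 ?l2weight_ge0 ?sqr_ge0.
Qed.

Lemma beyond_sqr (p q : R) : beyond p q -> p ^+ 2 <= q ^+ 2.
Proof. by rewrite /beyond => /orP[] /andP[h1 h2]; nra. Qed.

Lemma sqnorm_beyond k p q : (forall j, beyond (p j) (q j)) -> sqnorm k p <= sqnorm k q.
Proof.
by move=> h; apply: ler_sum => i _; rewrite ler_wpM2l ?l2weight_ge0 // beyond_sqr.
Qed.

Section PositiveTree.
Variable W : seq bool -> R.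
Hypothesis W0 : forall s, 0 <= W s.
Hypothesis WD : forall s, W s = W (true :: s) + W (false :: s).
(** Tightness: little weight sits where [sqnorm] exceeds [1 / t]. The cap by [1] makes the integrand
    a bounded cylinder function, to which the finite-dimensional functionals apply directly. *)
Hypothesis Wtail : forall e : R, 0 < e -> exists2 t : R, 0 < t &
  forall k, \sum_(d <- strings k) W d * Num.min 1 (t * sqnorm k (pt d)) <= e.

(* The node [s] is coded by the interval of length [W s] starting at [pos s]. *)
Fixpoint pos (s : seq bool) : R := if s is b :: s' then
  (if b then pos s' else pos s' + W (true :: s')) else 0.

(** Reads off [t] the descendant of [s], [k] generations below, whose interval contains [t]; the
    child [true] owns the left part. Applied to Lebesgue measure on [[0, W [::][] it produces each
    string with its weight. *)
Fixpoint dig s (t : R) k : seq bool := if k is k'.+1 then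
  let s' := dig s t k' in (t < pos s' + W (true :: s')) :: s' else s.

Lemma digS s t k : dig s t k.+1 = dig ((t < pos s + W (true :: s)) :: s) t k.
Proof.
have E u j : dig u t j.+1 = (t < pos (dig u t j) + W (true :: dig u t j)) :: dig u t j by [].
by elim: k => // k IH; rewrite [LHS]E IH [RHS]E.
Qed.

Lemma dig_measurable s k (G : seq bool -> R) : measurable_fun setT (fun t => G (dig s t k)).
Proof.
elim: k s => [|k IH] s; first by rewrite /=; exact: measurable_cst.
rewrite (_ : (fun _ => _) = (fun t => if t < pos s + W (true :: s) then
  G (dig (true :: s) t k) else G (dig (false :: s) t k))); last first.
  by apply/funext => t; rewrite digS; case: (t < _).
by apply: measurable_fun_ifT => //; apply: measurable_fun_ltr.
Qed.

Definition piece s : set R := `[pos s, pos s + W s[%classic.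

Lemma piece_measure s : lebesgue (piece s) = (W s)%:E.
Proof.
rewrite lebesgue_measure_itv /= lte_fin ltrDl; case: ltP => [_|Ws] /=.
  by rewrite -EFinD addrAC subrr add0r.
by rewrite (_ : W s = 0) //; apply/eqP; rewrite eq_le Ws W0.
Qed.

Lemma piece_fin s : (lebesgue (piece s) < +oo)%E.
Proof. by rewrite piece_measure ltry. Qed.

Lemma integral_dig s k (G : seq bool -> R) M : (forall s, `|G s| <= M) ->
  \int[lebesgue]_(t in piece s) G (dig s t k) = \sum_(d <- strings k) G (d ++ s) * W (d ++ s).
Proof.
move=> GM; elim: k s => [|k IH] s.
  rewrite /= big_seq1 /= Rintegral_cst //; last exact: measurable_itv.
  by congr (_ * _); exact: (congr1 fine (piece_measure s)).
rewrite (sum_strings_shift (fun d => G d * W d)) -!IH.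
set c := pos s + W (true :: s).
have E : piece s = `[pos s, c[%classic `|` `[c, pos s + W s[%classic.
  rewrite -itv_bndbnd_setU //= bnd_simp /c ?lerDl ?lerD2l //.
  by rewrite [leRHS]WD lerDl.
rewrite {1}E Rintegral_setU //.
- congr (_ + _).
  + apply: eq_Rintegral => t; rewrite inE /= in_itv /= => /andP[_ h].
    by rewrite -[_ :: _]/(dig s t k.+1) digS h.
  + rewrite /piece /= -/c -addrA -WD; apply: eq_Rintegral => t; rewrite inE /= in_itv /= => /andP[h _].
    by rewrite -[_ :: _]/(dig s t k.+1) digS ltNge h.
- rewrite -E; apply: (bounded_rintegrable (M := M)) => //; [exact: measurable_itv|exact: piece_fin|].
  exact: measurable_funTS (dig_measurable s k.+1 G).
- apply/disj_set2P/seteqP; split => // t; rewrite /= !in_itv /= => -[/andP[_ h1] /andP[h2 _]].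
  by rewrite ltNge h2 in h1.
Qed.

Local Notation D := (piece [::]).
Let mD : measurable (D : set (measurableTypeR R)). Proof. exact: measurable_itv. Qed.
Local Notation mu0 := (mrestr lebesgue mD).

Let mu0_fin : (mu0 setT < +oo)%E.
Proof. by rewrite /= /mrestr setTI piece_fin. Qed.

Let approx k t : T := pt (dig [::] t k).

Lemma integral_approx k (F : T -> R) M : (forall p, `|F p| <= M) ->
  \int[mu0]_t F (approx k t) = \sum_(d <- strings k) F (pt d) * W d.
Proof.
move=> FM; rewrite (@Rintegral_mrestr _ _ _ lebesgue D mD (fun t => F (approx k t)) M) //; first last.
- exact: dig_measurable (fun s => F (pt s)).
- exact: piece_fin.
rewrite (integral_dig _ _ (G := fun s => F (pt s)) (M := M)) //.
by apply: eq_bigr => d _; rewrite cats0.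
Qed.

Let approx_beyond k t j : beyond (approx k t j) (approx k.+1 t j).
Proof. exact: pt_beyond. Qed.

Let S k t := sqnorm k (approx k t).

Let S_nd t : nondecreasing_seq (S ^~ t).
Proof.
apply/nondecreasing_seqP => k; apply: le_trans (sqnorm_widen _ (leqnSn k)).
by apply: sqnorm_beyond => j; exact: approx_beyond.
Qed.

Let S_meas k : measurable_fun setT (S k).
Proof. exact: dig_measurable (fun s => sqnorm k (pt s)). Qed.

Let good t := exists B : nat, forall k, S k t <= B%:R.

Let good_meas : measurable [set t | good t].
Proof.
rewrite (_ : [set t | _] = \bigcup_B \bigcap_k [set t | S k t <= B%:R]); last first.
  apply/seteqP; split => t; first by move=> [B h]; exists B => // k _; exact: h.
  by move=> [B _ h]; exists B => k; exact: (h k I).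
apply: bigcupT_measurable => B; apply: bigcapT_measurable => k.
by rewrite -[X in measurable X]setTI; apply: measurable_fun_le.
Qed.

Let good_cvg t j : good t -> cvgn (fun k => approx k t j).
Proof.
(* Coordinate [j] enters the norm [S k] only for [k > j]. The approximations of index at most [j]
   are therefore bounded separately, by the finite sum. *)
move=> [B hB]; apply: (@beyond_cvg _ _ (B%:R / wm j + 1 + (\sum_(i < j.+1) `|approx i t j|))) => k.
  exact: approx_beyond.
have [jk|kj] := ltnP j k; last first.
  apply: (@le_trans _ _ (\sum_(i < j.+1) `|approx i t j|)); last first.
    by rewrite lerDr addr_ge0 // divr_ge0 ?l2weight_ge0 ?ler0n.
  by rewrite (bigD1 (Ordinal (kj : (k < j.+1)%N))) //= lerDl sumr_ge0.
apply: (@le_trans _ _ (B%:R / wm j + 1)); last by rewrite lerDl sumr_ge0.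
have h : wm j * approx k t j ^+ 2 <= B%:R.
  apply: le_trans (hB k); rewrite /S /sqnorm (bigD1 (Ordinal jk)) //= lerDl sumr_ge0 // => i _.
  by rewrite mulr_ge0 ?l2weight_ge0 ?sqr_ge0.
have {}h : `|approx k t j| ^+ 2 <= B%:R / wm j.
  by rewrite real_normK ?num_real // ler_pdivlMr ?l2weight_gt0 // mulrC.
have := normr_ge0 (approx k t j); nra.
Qed.

Let lim t : T := fun j => limn (fun k => approx k t j).

Let lim_l2 t : good t -> lim t \in l2_mem (- gamma).
Proof.
move=> gt; have [B hB] := gt; apply: (@l2_of_bounded _ _ _ B%:R) => n.
have c : sqnorm n (approx k t) @[k --> \oo] --> \sum_(i < n) wm i * lim t i ^+ 2.
  apply: (cvg_sum_ord (f := fun i k => wm i * approx k t i ^+ 2) (l := fun i => wm i * lim t i ^+ 2)) => i.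
  by apply: cvgMl_tmp; apply: (continuous_cvg _ (@exprn_continuous _ 2 _)); exact: good_cvg.
rewrite -(cvg_lim _ c) //; apply: limr_le; first by apply/cvg_ex; eexists; exact: c.
near=> k; apply: le_trans (hB k); apply: sqnorm_widen.
by near: k; exact: nbhs_infty_ge.
Unshelve. all: by end_near.
Qed.

Let X t : l2 (- gamma) := if pselect (good t) is left h then L2 (lim_l2 h) else 0.

Let X_good t : good t -> l2seq (X t) = lim t.
Proof. by rewrite /X; case: pselect. Qed.

Let X_meas : measurable_fun setT (X : measurableTypeR R -> l2borel gamma).
Proof.
apply: measurable_l2borel => i.
apply: (@measurable_fun_cvg _ _ _ _ (fun k t => \1_[set t | good t] t * approx k t i)) => [k|t _].
  apply: measurable_funM; first exact: measurable_indic.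
  exact: dig_measurable (fun s => pt s i).
rewrite indicE; have [h|h] := pselect (good t).
  by rewrite mem_set // X_good //; under eq_fun do rewrite mul1r; exact: good_cvg.
rewrite memNset //; under eq_fun do rewrite mul0r.
by rewrite /X; case: pselect => // _; exact: cvg_cst.
Qed.

(** On the bad set [S k] is unbounded, so [min 1 (t * S k)] is eventually [1]. By dominated
    convergence the mass of that set is at most the limit of integrals that [Wtail] keeps below any
    given [e]. *)
Let bad_null : \int[mu0]_t \1_[set t | ~ good t] t = 0.
Proof.
pose I := \1_[set t | ~ good t] : R -> R.
have mI : measurable_fun setT I by apply: measurable_indic; exact: measurableC good_meas.
have I1 t : 0 <= I t <= 1 by rewrite /I indicE; case: (_ \in _); rewrite ?lexx ler01.
apply/eqP; rewrite eq_le Rintegral_ge0 ?andbT; last by move=> t _; case/andP: (I1 t).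
apply/ler_addgt0Pl => e e0; rewrite addr0.
have [t t0 ht] := Wtail e0.
pose h k u := Num.min 1 (t * S k u).
have h01 k u : 0 <= h k u <= 1.
  by rewrite /h ge_min lexx le_min ler01 /= mulr_ge0 ?sqnorm_ge0 // ltW.
have mh k : measurable_fun setT (h k).
  exact: dig_measurable (fun s => Num.min 1 (t * sqnorm k (pt s))).
have Ih01 k u : `|I u * h k u| <= 1.
  have /andP[a1 a2] := I1 u; have /andP[b1 b2] := h01 k u.
  by rewrite ger0_norm ?mulr_ge0 // mulr_ile1.
have c : \int[mu0]_u (I u * h k u) @[k --> \oo] --> \int[mu0]_u I u.
  apply: (@Rintegral_cvg _ _ _ mu0 _ _ (fun=> 1)) => //.
  - by move=> k; exact: (measurable_funM mI (mh k)).
  - by apply: (bounded_rintegrable (M := 1)) => // u; rewrite normr1.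
  - move=> u; rewrite /I indicE; have [gu|bu] := pselect (good u).
      by rewrite memNset; [under eq_fun do rewrite mul0r; exact: cvg_cst|move=> /(_ gu)].
    rewrite mem_set //; under eq_fun do rewrite mul1r.
    have [n hn] : exists n, t^-1 <= S n u.
      apply: contrapT => /forallNP hh; apply: bu; exists (Num.truncn t^-1).+1 => k.
      by rewrite ltW // (lt_trans _ (truncnS_gt _)) // ltNge; apply/negP/hh.
    apply: cvg_near_cst; exists n => // k /= nk; rewrite /h min_l //.
    by rewrite -ler_pdivrMl // mulr1 (le_trans hn) // S_nd.
rewrite -(cvg_lim _ c) //; apply: limr_le; first by apply/cvg_ex; eexists; exact: c.
apply: nearW => k; apply: le_trans (ht k).
have := @integral_approx k (fun p => Num.min 1 (t * sqnorm k p)) 1.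
under [X in _ <= X]eq_bigr do rewrite mulrC.
move=> <-; last first.
  move=> p; rewrite ger0_norm ?ge_min ?lexx // le_min ler01 mulr_ge0 ?sqnorm_ge0 //; exact: ltW.
apply: le_Rintegral => //.
- apply: (bounded_rintegrable (M := 1)) => //; exact: (measurable_funM mI (mh k)).
- apply: (bounded_rintegrable (M := 1)) => // [|u]; first exact: mh.
  by have /andP[? ?] := h01 k u; rewrite ger0_norm.
- move=> u _; have /andP[a1 a2] := I1 u; have /andP[b1 b2] := h01 k u.
  by rewrite -[leRHS]mul1r ler_wpM2r.
Qed.

(** The measure is the image of Lebesgue measure on an interval under the limit [X] of the coded
    approximations. Off the null set where the limit leaves [l2 (- gamma)], [X] takes the harmless
    value [0]. *)
Lemma tree_measure_pos : exists m : {measure set (l2borel gamma) -> \bar R},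
  (m setT < +oo)%E /\ forall n F M, cont_n n F -> (forall x, `|F x| <= M) ->
  \sum_(d <- strings k) F (pt d) * W d @[k --> \oo] --> \int[m]_x F (l2seq x).
Proof.
have [m [mfin hm]] := pushforward_measure X_meas mu0_fin.
exists m; split=> // n F M cF FM.
have mF : measurable_fun setT (fun x : l2borel gamma => F (l2seq x)).
  have := (cyl_meas (@coord_measurable _ gamma) (rcyl_cont cF FM)).1.
  by apply: eq_measurable_fun.
have mFX : measurable_fun setT (fun t => F (l2seq (X t))) by exact: (measurableT_comp mF X_meas).
rewrite (hm _ M) //.
pose G := \1_[set t | good t] : R -> R.
have mG : measurable_fun setT G by exact: measurable_indic.
have split_good (f : R -> R) : measurable_fun setT f -> (forall t, `|f t| <= M) ->
    \int[mu0]_t f t = \int[mu0]_t (G t * f t).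
  move=> mf fM; apply/eqP; rewrite -subr_eq0 -normr_le0.
  have b1 : mu0.-integrable setT (EFin \o f) by exact: (bounded_rintegrable (M := M)).
  have G1 t : `|G t| <= 1 by rewrite /G indicE; case: (_ \in _); rewrite ?normr1 ?normr0.
  have b2 : mu0.-integrable setT (EFin \o (fun t => G t * f t)).
    apply: (bounded_rintegrable (M := M)) => //; first exact: (measurable_funM mG mf).
    by move=> t; rewrite normrM -[leRHS]mul1r ler_pM.
  rewrite -RintegralB //; apply: (le_trans (le_normr_Rintegral _ _)) => //.
    exact: rintegrableB.
  rewrite -(mulr0 M) -bad_null -RintegralZl //; last first.
    apply: (bounded_rintegrable (M := 1)) => //; first by apply: measurable_indic; exact: measurableC good_meas.
    by move=> t; rewrite indicE; case: (_ \in _); rewrite ?normr1 ?normr0.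
  apply: le_Rintegral => //.
  - exact: integrable_norm (rintegrableB b1 b2).
  - apply: rintegrableZ; apply: (bounded_rintegrable (M := 1)) => //; first by apply: measurable_indic; exact: measurableC good_meas.
    by move=> t; rewrite indicE; case: (_ \in _); rewrite ?normr1 ?normr0.
  - move=> t _; rewrite /G !indicE; have [h|h] := pselect (good t).
      by rewrite mem_set // memNset; [rewrite mul1r subrr normr0 mulr0|move=> /(_ h)].
    by rewrite memNset // mem_set // mul0r subr0 mulr1.
rewrite split_good //.
rewrite (_ : (fun k => _) = (fun k => \int[mu0]_t (G t * F (approx k t)))); last first.
  apply/funext => k; rewrite -(integral_approx k FM); apply: split_good => //.
  exact: dig_measurable (fun s => F (pt s)).
apply: (@Rintegral_cvg _ _ _ mu0 _ _ (fun=> M)) => //.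
- by move=> k; apply: measurable_funM => //; exact: dig_measurable (fun s => F (pt s)).
- by apply: (bounded_rintegrable (M := `|M|)) => //; exact: measurable_cst.
- move=> k t; rewrite normrM -[leRHS]mul1r ler_pM //.
  by rewrite /G indicE; case: (_ \in _); rewrite ?normr1 ?normr0.
- move=> t; rewrite /G indicE; have [h|h] := pselect (good t).
    rewrite mem_set // mul1r; under eq_fun do rewrite mul1r.
    by apply: (cont_n_cvg cF) => i _; rewrite X_good //; exact: good_cvg.
  by rewrite memNset // mul0r; under eq_fun do rewrite mul0r; exact: cvg_cst.
Qed.
End PositiveTree.
End TreeMeasure.

Section SignedTree.
Context {R : realType} (gamma : R).
Local Notation T := (nat -> R).
Implicit Types (nu : seq bool -> R) (s : seq bool).

Lemma sum_strings_cat (G : seq bool -> R) j k :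
  \sum_(s <- strings j) \sum_(d <- strings k) G (d ++ s) = \sum_(d <- strings (k + j)) G d.
Proof.
elim: j k => [|j IH] k; first by rewrite addn0 /= big_seq1; apply: eq_bigr => d _; rewrite cats0.
rewrite sum_stringsS addnS -addSn -IH; apply: eq_bigr => s _.
by rewrite sum_strings_shift.
Qed.

Lemma sum_strings_suffix (G : seq bool -> R) s k : (forall s, 0 <= G s) ->
  \sum_(d <- strings k) G (d ++ s) <= \sum_(d <- strings (k + size s)) G d.
Proof.
move=> G0; elim: s k => [|b s IH] k; first by rewrite addn0; under eq_bigr do rewrite cats0.
rewrite addnS -addSn; apply: le_trans (IH k.+1); rewrite sum_strings_shift.
by case: b; rewrite ?lerDl ?lerDr sumr_ge0.
Qed.

Lemma additive_sum_strings nu k s : (forall s, nu s = nu (true :: s) + nu (false :: s)) ->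
  \sum_(d <- strings k) nu (d ++ s) = nu s.
Proof.
move=> h; elim: k s => [|k IH] s; first by rewrite /= big_seq1.
by rewrite sum_strings_shift !IH.
Qed.

Lemma sqnorm_pt_cat k d s : sqnorm gamma k (pt s) <= sqnorm gamma k (pt (d ++ s)).
Proof.
elim: d => //= b d IH; apply: le_trans IH _; apply: sqnorm_beyond => j.
exact: (@pt_beyond _ b (d ++ s) j).
Qed.

(** Positive mass of [s] as seen [k] generations below. It increases with [k], since refining a set
    can only separate mass of opposite signs; the limit is the positive variation of Jordan's
    decomposition. *)
Definition pos_part nu k s : R := \sum_(d <- strings k) Num.max (nu (d ++ s)) 0.

Lemma tree_positive_part nu M : (forall s, nu s = nu (true :: s) + nu (false :: s)) ->
  (forall k, \sum_(d <- strings k) `|nu d| <= M) ->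
  (forall e : R, 0 < e -> exists2 t : R, 0 < t &
     forall k, \sum_(d <- strings k) `|nu d| * Num.min 1 (t * sqnorm gamma k (pt d)) <= e) ->
  exists W : seq bool -> R, [/\ forall s, 0 <= W s,
    forall s, W s = W (true :: s) + W (false :: s),
    forall e : R, 0 < e -> exists2 t : R, 0 < t &
     forall k, \sum_(d <- strings k) W d * Num.min 1 (t * sqnorm gamma k (pt d)) <= e &
    forall s, pos_part nu k s @[k --> \oo] --> W s].
Proof.
move=> nuD nuM nut.
have m0 (a : R) : 0 <= Num.max a 0 by rewrite le_max lexx orbT.
have mn (a : R) : Num.max a 0 <= `|a| by rewrite ge_max ler_norm normr_ge0.
have nd s : nondecreasing_seq (pos_part nu ^~ s).
  apply/nondecreasing_seqP => k; rewrite /pos_part sum_stringsS; apply: ler_sum => d _.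
  rewrite /= [nu (d ++ s)]nuD ge_max addr_ge0 // andbT lerD // le_max lexx //.
have bd k s : pos_part nu k s <= M.
  apply: le_trans (nuM (k + size s)%N); apply: le_trans (sum_strings_suffix s k (G := fun d => `|nu d|) _) => //.
  by apply: ler_sum => d _; exact: mn.
have cv s : cvgn (pos_part nu ^~ s).
  by apply: nondecreasing_is_cvgn => //; exists M => _ [k _ <-]; exact: bd.
exists (fun s => limn (pos_part nu ^~ s)); split => //.
- move=> s; apply: limr_ge => //; apply: nearW => k; exact: sumr_ge0.
- move=> s; apply: cvg_lim => //.
  rewrite -(cvg_shiftS (pos_part nu ^~ s)) /=.
  under eq_fun do rewrite /pos_part (sum_strings_shift (fun d => Num.max (nu d) 0)).
  by apply: cvgD; exact: cv.
- move=> e e0; have [t t0 ht] := nut e e0; exists t => // k.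
  have phi0 l (p : T) : 0 <= Num.min 1 (t * sqnorm gamma l p).
    by rewrite le_min ler01 mulr_ge0 ?sqnorm_ge0 // ltW.
  pose P l := \sum_(d <- strings k) pos_part nu l d * Num.min 1 (t * sqnorm gamma k (pt d)).
  have cP : P l @[l --> \oo] --> \sum_(d <- strings k) limn (pos_part nu ^~ d) * Num.min 1 (t * sqnorm gamma k (pt d)).
    rewrite /P; elim: (strings k) => [|d l IH].
      by rewrite big_nil; under eq_fun do rewrite big_nil; exact: cvg_cst.
    rewrite big_cons; under eq_fun do rewrite big_cons.
    by apply: cvgD => //; apply: cvgMr_tmp; exact: cv.
  rewrite -(cvg_lim _ cP) //; apply: limr_le; first by apply/cvg_ex; eexists; exact: cP.
  apply: nearW => l; apply: le_trans (ht (l + k)%N).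
  (* A string [s] of length [k] with a continuation [d] of length [l] is a string of length [l + k].
     Since approximations only move outwards, [sqnorm] at [s] is at most [sqnorm] at [d ++ s], so
     the tightness of [nu] at level [l + k] bounds the sum at level [k]. *)
  rewrite -(sum_strings_cat (fun d => `|nu d| * Num.min 1 (t * sqnorm gamma (l + k) (pt d)))).
  apply: ler_sum => s _; rewrite /pos_part mulr_suml; apply: ler_sum => d _.
  rewrite ler_pM // le_min ge_min lexx /= ge_min; apply/orP; right.
  rewrite ler_wpM2l ?(ltW t0) //; apply: le_trans (sqnorm_pt_cat _ d s) _.
  by apply: sqnorm_widen; exact: leq_addl.
Qed.

(** Jordan decomposition of the weights: [nu] and [- nu] have positive parts whose difference is
    [nu] already at every finite depth, by additivity, hence also in the limit. *)
Lemma tree_measure nu M : (forall s, nu s = nu (true :: s) + nu (false :: s)) ->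
  (forall k, \sum_(d <- strings k) `|nu d| <= M) ->
  (forall e : R, 0 < e -> exists2 t : R, 0 < t &
     forall k, \sum_(d <- strings k) `|nu d| * Num.min 1 (t * sqnorm gamma k (pt d)) <= e) ->
  exists m1 m2 : {measure set (l2borel gamma) -> \bar R},
  [/\ (m1 setT < +oo)%E, (m2 setT < +oo)%E &
    forall n F B, cont_n n F -> (forall x, `|F x| <= B) ->
    \sum_(d <- strings k) F (pt d) * nu d @[k --> \oo] -->
    \int[m1]_x F (l2seq x) - \int[m2]_x F (l2seq x)].
Proof.
move=> nuD nuM nut.
have [W1 [W10 W1D W1t W1c]] := tree_positive_part nuD nuM nut.
have [||| W2 [W20 W2D W2t W2c]] := @tree_positive_part (fun s => - nu s) M.
- by move=> s; rewrite nuD opprD.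
- by move=> k; under eq_bigr do rewrite normrN.
- by move=> e /nut [t t0 ht]; exists t => // k; under eq_bigr do rewrite normrN.
have [m1 [f1 h1]] := tree_measure_pos W10 W1D W1t.
have [m2 [f2 h2]] := tree_measure_pos W20 W2D W2t.
exists m1, m2; split => // n F B cF FB.
have W12 s : nu s = W1 s - W2 s.
  apply: (@cvg_unique _ _ (nu s @[_ --> \oo])) => //; first exact: cvg_cst.
  rewrite (_ : (fun _ => _) = (fun k => pos_part nu k s - pos_part (fun s => - nu s) k s)).
    by apply: cvgB; [exact: W1c|exact: W2c].
  apply/funext => k; rewrite /pos_part -sumrB -{1}(additive_sum_strings k s nuD).
  apply: eq_bigr => d _; case: (leP (nu (d ++ s)) 0) => h.
    by rewrite max_l ?oppr_ge0 // sub0r opprK.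
  by rewrite max_r ?subr0 // oppr_le0 ltW.
rewrite (_ : (fun k => _) = (fun k => \sum_(d <- strings k) F (pt d) * W1 d - \sum_(d <- strings k) F (pt d) * W2 d)).
  by apply: cvgB; [exact: (h1 n F B)|exact: (h2 n F B)].
by apply/funext => k; rewrite -sumrB; apply: eq_bigr => d _; rewrite W12 mulrBr.
Qed.
End SignedTree.

(** * Gaussian integrals with a quadratic phase *)
Section RealCalculus.
Context {R : realType}.
Local Notation mu := (@lebesgue_measure R).
Implicit Types (f g F : R -> R).

Lemma dvD f g (x a b : R) : is_derive x 1 f a -> is_derive x 1 g b ->
  is_derive x (1 : R) (fun t => f t + g t) (a + b).
Proof. exact: is_deriveD. Qed.

Lemma dvN f (x a : R) : is_derive x 1 f a -> is_derive x (1 : R) (fun t => - f t) (- a).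
Proof. exact: is_deriveN. Qed.

Lemma dvM f g (x a b : R) : is_derive x 1 f a -> is_derive x 1 g b ->
  is_derive x (1 : R) (fun t => f t * g t) (f x * b + g x * a).
Proof. exact: is_deriveM. Qed.

Lemma dvZ f (c x a : R) : is_derive x 1 f a -> is_derive x (1 : R) (fun t => c * f t) (c * a).
Proof. exact: is_deriveZ. Qed.

Lemma dv_comp f g (x a b : R) : is_derive (g x) 1 f a -> is_derive x 1 g b ->
  is_derive x (1 : R) (fun t => f (g t)) (a * b).
Proof. exact: is_derive1_comp. Qed.

Lemma dvX n (x : R) : is_derive x (1 : R) (fun t => t ^+ n) (n%:R * x ^+ n.-1).
Proof.
have := is_deriveX n (is_derive_id x (1 : R)).
by rewrite [_ *: _]mulr1 exprfctE.
Qed.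

Lemma dv_eq f (x a b : R) : is_derive x 1 f a -> a = b -> is_derive x (1 : R) f b.
Proof. by move=> h <-. Qed.

Lemma is_derive_continuous f (df : R -> R) : (forall x, is_derive x (1 : R) f (df x)) -> continuous f.
Proof.
move=> h x; apply: differentiable_continuous; apply/derivable1_diffP.
exact: ex_derive.
Qed.

Lemma FTC_itv f F a b : a <= b -> continuous f -> (forall x, is_derive x (1 : R) F (f x)) ->
  \int[mu]_(x in `[a, b]) f x = F b - F a.
Proof.
rewrite le_eqVlt => /predU1P[->|ab] cf dF.
  by rewrite set_itv1 Rintegral_set1 subrr.
rewrite /Rintegral (@continuous_FTC2 _ f F) //.
- exact: continuous_subspaceT.
- have cF := is_derive_continuous dF; split=> [x _||].
  + by have [] := dF x.
  + exact/cvg_at_right_filter/cF.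
  + exact/cvg_at_left_filter/cF.
- by move=> x _; rewrite derive1E; have [_] := dF x.
Qed.

Lemma FTC_limit f F (A : set R) (a b : nat -> R) (la lb : R) : measurable A ->
  continuous f -> (forall x, is_derive x (1 : R) F (f x)) ->
  mu.-integrable setT (EFin \o (fun x => \1_A x * f x)) ->
  (forall n, a n <= b n) -> (forall n, `[a n, b n]%classic `<=` A) ->
  (forall x, A x -> \forall n \near \oo, a n <= x <= b n) ->
  F (a n) @[n --> \oo] --> la -> F (b n) @[n --> \oo] --> lb ->
  \int[mu]_x (\1_A x * f x) = lb - la.
Proof.
move=> mA cf dF fi ab abA cov ca cb.
have mf : measurable_fun setT f by exact: continuous_measurable_fun.
have cl : F (b n) - F (a n) @[n --> \oo] --> lb - la by exact: cvgB.
rewrite -(cvg_lim _ cl) //; apply/esym/cvg_lim => //.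
rewrite (_ : (fun n => _) = (fun n => \int[mu]_x (\1_`[a n, b n] x * f x))); last first.
  apply/funext => n; rewrite -(FTC_itv (ab n) cf dF) Rintegral_mkcond.
  apply: eq_Rintegral => x _; rewrite /patch indicE; case: ifP => _; rewrite ?mul1r ?mul0r //.
apply: (@Rintegral_cvg _ _ _ mu _ _ (fun x => `|\1_A x * f x|)).
- by move=> n; apply: measurable_funM => //; apply: measurable_indic; exact: measurable_itv.
- exact: (integrable_norm fi).
- move=> n x; rewrite !normrM ler_wpM2r // !indicE.
  have [h|h] := pselect (`[a n, b n]%classic x); first by rewrite !mem_set //; exact: abA h.
  by rewrite memNset // normr0.
- move=> x; rewrite indicE; have [Ax|nAx] := pselect (A x).
    apply: cvg_near_cst; have := cov x Ax; apply: filterS => n h.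
    by rewrite indicE !mem_set //= in_itv.
  rewrite memNset // mul0r; apply: cvg_near_cst; apply: nearW => n.
  by rewrite indicE memNset ?mul0r // => /abA.
Qed.

Lemma integral_derivative0 f F : continuous f -> (forall x, is_derive x (1 : R) F (f x)) ->
  mu.-integrable setT (EFin \o f) ->
  F n%:R @[n --> \oo] --> 0 -> F (- n%:R) @[n --> \oo] --> 0 -> \int[mu]_x f x = 0.
Proof.
move=> cf dF fi F1 F2.
have := @FTC_limit f F setT (fun n => - n%:R) (fun n => n%:R) 0 0 measurableT cf dF.
rewrite subr0; under eq_Rintegral do rewrite indicE in_setT mul1r.
apply => //.
- by apply: eq_integrable fi => // x _; rewrite /= indicE in_setT mul1r.
- by move=> n; rewrite -subr_ge0 opprK addr_ge0.
- move=> x _; near=> n; rewrite -ler_norml; near: n; exact: nbhs_infty_ger.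
Unshelve. all: by end_near.
Qed.

Lemma halfline_integral f F (a l : R) : continuous f -> (forall x, is_derive x (1 : R) F (f x)) ->
  mu.-integrable setT (EFin \o (fun x => \1_`[a, +oo[ x * f x)) ->
  F (a + n%:R) @[n --> \oo] --> l -> \int[mu]_x (\1_`[a, +oo[ x * f x) = l - F a.
Proof.
move=> cf dF fi Fl; apply: (@FTC_limit f F _ (fun=> a) (fun n => a + n%:R)) => //.
- by move=> n; rewrite lerDl.
- by move=> n x /=; rewrite !in_itv /= andbT => /andP[].
- move=> x /=; rewrite in_itv /= andbT => ax; near=> n; rewrite ax /= -lerBlDl.
  by near: n; exact: nbhs_infty_ger.
- exact: cvg_cst.
Unshelve. all: by end_near.
Qed.

Lemma integrable_le f g : measurable_fun setT f -> (forall x, `|f x| <= g x) ->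
  mu.-integrable setT (EFin \o g) -> mu.-integrable setT (EFin \o f).
Proof.
move=> mf fg gi; apply: le_integrable gi => //; first exact/measurable_EFinP.
by move=> x _; rewrite lee_fin (le_trans (fg x)) // ler_norm.
Qed.
End RealCalculus.

Section Fresnel.
Context {R : realType}.
Local Notation mu := (@lebesgue_measure R).
Local Notation E := (@gauss_fun R).

Lemma gauss_moment_bound (t : R) : (1 + t ^+ 2) * E t <= 3 * expR (- (t ^+ 2 / 2)).
Proof.
rewrite /gauss_fun.
have -> : - t ^+ 2 = - (t ^+ 2 / 2) + - (t ^+ 2 / 2) by lra.
rewrite expRD mulrA ler_wpM2r ?expR_ge0 // expRN ler_pdivrMr ?expR_gt0 //.
have h := expR_ge1Dx (t ^+ 2 / 2); have := sqr_ge0 t; lra.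
Qed.

Lemma integrable_gauss_half : mu.-integrable setT (EFin \o (fun t : R => expR (- (t ^+ 2 / 2)))).
Proof.
have h := @integrable_normal_pdf R 0 1.
have p0 : normal_peak (1 : R) != 0 by rewrite gt_eqF // normal_peak_gt0 // oner_eq0.
have := integrableZl measurableT (normal_peak (1 : R))^-1 h.
apply: eq_integrable => // t _ /=.
rewrite -EFinM normal_pdfE ?oner_eq0 // mulrA mulVf // mul1r /normal_fun.
by rewrite subr0 expr1n mulNr.
Qed.

Lemma gauss_poly_integrable (f : R -> R) (c : R) : measurable_fun setT f ->
  (forall t, `|f t| <= c * ((1 + t ^+ 2) * E t)) -> mu.-integrable setT (EFin \o f).
Proof.
move=> mf fE; apply: (@integrable_le _ _ (fun t => `|c| * (3 * expR (- (t ^+ 2 / 2))))) => //.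
  move=> t; apply: le_trans (fE t) _; apply: (@le_trans _ _ (`|c| * ((1 + t ^+ 2) * E t))).
    by rewrite ler_wpM2r ?ler_norm // mulr_ge0 ?addr_ge0 ?sqr_ge0 ?gauss_fun_ge0.
  by rewrite ler_wpM2l // gauss_moment_bound.
by apply: rintegrableZ; apply: rintegrableZ; exact: integrable_gauss_half.
Qed.

Definition phase (lam a t : R) := lam * t ^+ 2 + a * t.

Lemma dv_phase lam a t : is_derive t (1 : R) (phase lam a) (2 * lam * t + a).
Proof.
apply: (dv_eq (dvD (dvZ lam (dvX 2 t)) (dvZ a (is_derive_id t 1)))).
by rewrite /= expr1; ring.
Qed.

Lemma dv_gauss t : is_derive t (1 : R) E (- (2 * t) * E t).
Proof.
have h := dv_comp (is_derive_expR _) (dvN (dvX 2 t)).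
by apply: (dv_eq h); rewrite /gauss_fun /= expr1; ring.
Qed.

(** With [gsin], the real and imaginary parts of [exp (- t^2 + i (lam t^2 + a t))]. They are kept
    apart so that differentiation under the integral and integration by parts stay real. *)
Definition gcos lam a t := E t * cos (phase lam a t).
Definition gsin lam a t := E t * sin (phase lam a t).

Lemma dv_gcos lam a t : is_derive t (1 : R) (gcos lam a)
  (- (2 * t) * gcos lam a t - (2 * lam * t + a) * gsin lam a t).
Proof.
apply: (dv_eq (dvM (dv_gauss t) (dv_comp (is_derive_cos _) (dv_phase lam a t)))).
by rewrite /gcos /gsin; ring.
Qed.

Lemma dv_gsin lam a t : is_derive t (1 : R) (gsin lam a)
  (- (2 * t) * gsin lam a t + (2 * lam * t + a) * gcos lam a t).
Proof.
apply: (dv_eq (dvM (dv_gauss t) (dv_comp (is_derive_sin _) (dv_phase lam a t)))).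
by rewrite /gcos /gsin; ring.
Qed.

Lemma gcos_cont lam a : continuous (gcos lam a).
Proof. by apply: is_derive_continuous => t; exact: dv_gcos. Qed.

Lemma gsin_cont lam a : continuous (gsin lam a).
Proof. by apply: is_derive_continuous => t; exact: dv_gsin. Qed.

Lemma gcos_le lam a t : `|gcos lam a t| <= E t.
Proof.
by rewrite normrM ger0_norm ?gauss_fun_ge0 // ler_piMr ?gauss_fun_ge0 // ler_norml cos_geN1 cos_le1.
Qed.

Lemma gsin_le lam a t : `|gsin lam a t| <= E t.
Proof.
by rewrite normrM ger0_norm ?gauss_fun_ge0 // ler_piMr ?gauss_fun_ge0 // ler_norml sin_geN1 sin_le1.
Qed.

Lemma powXgauss_cvg0 (f : R -> R) k : (forall t, `|f t| <= E t) -> (k <= 1)%N ->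
  (n%:R ^+ k * f n%:R @[n --> \oo] --> 0) /\ ((- n%:R) ^+ k * f (- n%:R) @[n --> \oo] --> 0).
Proof.
move=> fE k1.
have B (t : R) : `|t| ^+ k * E t * (1 + `|t|) <= 3.
  have h : E t * (1 + t ^+ 2) <= 1.
    rewrite /gauss_fun expRN mulrC ler_pdivrMr ?expR_gt0 // mul1r; exact: expR_ge1Dx.
  have E0 := gauss_fun_ge0 t; have T0 := normr_ge0 t.
  have t2 : t ^+ 2 = `|t| ^+ 2 by rewrite real_normK ?num_real.
  by case: k k1 => [|[|//]] _; rewrite ?expr0 ?expr1; rewrite t2 in h; nra.
have c0 : 3 / (1 + n%:R) @[n --> \oo] --> (0 : R).
  rewrite -(mulr0 3); apply: cvgMl_tmp.
  by under eq_fun do rewrite addrC natr1; exact: cvg_harmonic.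
have S (u : nat -> R) : (forall n, `|u n| <= 3 / (1 + n%:R)) -> u n @[n --> \oo] --> 0.
  move=> h; apply/norm_cvg0P; apply: (squeeze_cvgr _ (cvg_cst (0 : R)) c0).
  by apply: nearW => n; rewrite normr_ge0 h.
split; apply: S => n; rewrite normrM normrX ler_pdivlMr ?ltr_pwDl //.
  apply: le_trans (B n%:R); rewrite (ger0_norm (ler0n _ n)) ler_wpM2r ?addr_ge0 // ler_wpM2l ?exprn_ge0 //.
apply: le_trans (B (- n%:R)); rewrite normrN (ger0_norm (ler0n _ n)) ler_wpM2r ?addr_ge0 // ler_wpM2l ?exprn_ge0 //.
Qed.
End Fresnel.

Section FresnelTransform.
Context {R : realType}.
Local Notation mu := (@lebesgue_measure R).
Local Notation E := (@gauss_fun R).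

Lemma is_derive0_eq (f : R -> R) : (forall x, is_derive x (1 : R) f 0) -> forall x, f x = f 0.
Proof. by move=> h x; exact: is_derive_0_is_cst. Qed.

Lemma dv_integral (f df : R -> R -> R) (a : R) :
  (forall a t, is_derive a (1 : R) (f ^~ t) (df a t)) ->
  (forall a, mu.-integrable setT (EFin \o f a)) ->
  (forall a t, `|df a t| <= 1 * ((1 + t ^+ 2) * E t)) ->
  is_derive a (1 : R) (fun a => \int[mu]_t f a t) (\int[mu]_t df a t).
Proof.
move=> fdf fi dfG.
have dE y : (fun t => partial1of2 f y t) = df y.
  by apply/funext => t; rewrite partial1of2E; have [_] := fdf y t.
have I : (`](a - 1), (a + 1)[%classic : set R) a by rewrite /= in_itv /=; apply/andP; split; lra.
have D1 x t : (`](a - 1), (a + 1)[%classic : set R) x -> setT t -> derivable (f ^~ t) x 1.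
  by move=> _ _; have [] := fdf x t.
have G0 t : 0 <= 1 * ((1 + t ^+ 2) * E t) :> R.
  by rewrite mul1r mulr_ge0 ?addr_ge0 ?sqr_ge0 ?gauss_fun_ge0.
have Gi : mu.-integrable setT (EFin \o (fun t => 1 * ((1 + t ^+ 2) * E t))).
  apply: (@gauss_poly_integrable _ _ 1) => [|t]; last by rewrite ger0_norm.
  apply: continuous_measurable_fun => t.
  apply: cvgM; first exact: cvg_cst.
  apply: cvgM; last exact: continuous_gauss_fun.
  by apply: cvgD; [exact: cvg_cst|exact: exprn_continuous].
have GB x t : (`](a - 1), (a + 1)[%classic : set R) x -> setT t ->
    `|partial1of2 f x t| <= 1 * ((1 + t ^+ 2) * E t).
  by move=> _ _; rewrite [partial1of2 f x t](congr1 (@^~ t) (dE x)).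
apply: DeriveDef.
  exact: (derivable_under_integral measurableT I (fun x _ => fi x) D1 G0 Gi GB).
rewrite -derive1E (differentiation_under_integral measurableT I (fun x _ => fi x) D1 G0 Gi GB).
by apply: eq_Rintegral => t _; rewrite [LHS](congr1 (@^~ t) (dE a)).
Qed.

Lemma monomial_gauss_le (f : R -> R) k t : (k <= 2)%N -> `|f t| <= E t ->
  `|t ^+ k * f t| <= 1 * ((1 + t ^+ 2) * E t).
Proof.
move=> k2 fE; rewrite normrM mul1r ler_pM // normrX.
have T0 := normr_ge0 t; have t2 : t ^+ 2 = `|t| ^+ 2 by rewrite real_normK ?num_real.
rewrite t2; case: k k2 => [|[|[|//]]] _; rewrite ?expr0 ?expr1; nra.
Qed.

Lemma monomial_gauss_integrable (f : R -> R) k : continuous f -> (k <= 2)%N ->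
  (forall t, `|f t| <= E t) -> mu.-integrable setT (EFin \o (fun t => t ^+ k * f t)).
Proof.
move=> cf k2 fE; apply: (@gauss_poly_integrable _ _ 1) => [|t]; last exact: monomial_gauss_le.
by apply: continuous_measurable_fun => t; apply: cvgM; [exact: exprn_continuous|exact: cf].
Qed.

Definition mcos k lam a := \int[mu]_t (t ^+ k * gcos lam a t).
Definition msin k lam a := \int[mu]_t (t ^+ k * gsin lam a t).

Lemma mcos_integrable k lam a : (k <= 2)%N ->
  mu.-integrable setT (EFin \o (fun t => t ^+ k * gcos lam a t)).
Proof. by move=> k2; apply: monomial_gauss_integrable => //; [exact: gcos_cont|exact: gcos_le]. Qed.

Lemma msin_integrable k lam a : (k <= 2)%N ->
  mu.-integrable setT (EFin \o (fun t => t ^+ k * gsin lam a t)).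
Proof. by move=> k2; apply: monomial_gauss_integrable => //; [exact: gsin_cont|exact: gsin_le]. Qed.

Lemma dv_mcos_a lam a : is_derive a (1 : R) (mcos 0 lam) (- msin 1 lam a).
Proof.
rewrite (_ : - _ = \int[mu]_t (- (t * gsin lam a t))).
  apply: (@dv_integral (fun a t => t ^+ 0 * gcos lam a t) (fun a t => - (t * gsin lam a t))) => [{}a t|{}a|{}a t].
  - have h := dv_comp (is_derive_cos _) (dvD (is_derive_cst (lam * t ^+ 2) a 1) (dvM (is_derive_id a (1 : R)) (is_derive_cst t a 1))).
    apply: (dv_eq (dvZ (t ^+ 0) (dvZ (E t) h))).
    by rewrite /gsin /phase /cst /=; ring.
  - exact: mcos_integrable.
  - by rewrite normrN; apply: (@monomial_gauss_le _ 1) => //; exact: gsin_le.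
rewrite /msin -mulN1r -RintegralZl //; last exact: msin_integrable.
by apply: eq_Rintegral => t _; rewrite expr1 mulN1r.
Qed.

Lemma dv_msin_a lam a : is_derive a (1 : R) (msin 0 lam) (mcos 1 lam a).
Proof.
apply: (@dv_integral (fun a t => t ^+ 0 * gsin lam a t) (fun a t => t ^+ 1 * gcos lam a t)) => [{}a t|{}a|{}a t].
- have h := dv_comp (is_derive_sin _) (dvD (is_derive_cst (lam * t ^+ 2) a 1) (dvM (is_derive_id a (1 : R)) (is_derive_cst t a 1))).
  apply: (dv_eq (dvZ (t ^+ 0) (dvZ (E t) h))).
  by rewrite /gcos /phase /cst /=; ring.
- exact: msin_integrable.
- by apply: (@monomial_gauss_le _ 1) => //; exact: gcos_le.
Qed.

Lemma dv_mcos_lam lam : is_derive lam (1 : R) (fun l => mcos 0 l 0) (- msin 2 lam 0).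
Proof.
rewrite (_ : - _ = \int[mu]_t (- (t ^+ 2 * gsin lam 0 t))).
  apply: (@dv_integral (fun l t => t ^+ 0 * gcos l 0 t) (fun l t => - (t ^+ 2 * gsin l 0 t))) => [l t|l|l t].
  - have h := dv_comp (is_derive_cos _) (dvD (dvM (is_derive_id l (1 : R)) (is_derive_cst (t ^+ 2) l 1)) (is_derive_cst (0 * t) l 1)).
    apply: (dv_eq (dvZ (t ^+ 0) (dvZ (E t) h))).
    by rewrite /gsin /phase /cst /=; ring.
  - exact: mcos_integrable.
  - by rewrite normrN; apply: (@monomial_gauss_le _ 2) => //; exact: gsin_le.
rewrite /msin -mulN1r -RintegralZl //; last exact: msin_integrable.
by apply: eq_Rintegral => t _; rewrite mulN1r.
Qed.

Lemma dv_msin_lam lam : is_derive lam (1 : R) (fun l => msin 0 l 0) (mcos 2 lam 0).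
Proof.
apply: (@dv_integral (fun l t => t ^+ 0 * gsin l 0 t) (fun l t => t ^+ 2 * gcos l 0 t)) => [l t|l|l t].
- have h := dv_comp (is_derive_sin _) (dvD (dvM (is_derive_id l (1 : R)) (is_derive_cst (t ^+ 2) l 1)) (is_derive_cst (0 * t) l 1)).
  apply: (dv_eq (dvZ (t ^+ 0) (dvZ (E t) h))).
  by rewrite /gcos /phase /cst /=; ring.
- exact: msin_integrable.
- by apply: (@monomial_gauss_le _ 2) => //; exact: gcos_le.
Qed.

(* Integration by parts: the integral of the derivative of [t ^+ k * f t]. *)
Lemma gauss_parts (f df : R -> R) k : (k <= 1)%N -> (forall t, is_derive t (1 : R) f (df t)) ->
  (forall t, `|f t| <= E t) ->
  continuous df -> mu.-integrable setT (EFin \o (fun t => t ^+ k * df t + f t * (k%:R * t ^+ k.-1))) ->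
  \int[mu]_t (t ^+ k * df t + f t * (k%:R * t ^+ k.-1)) = 0.
Proof.
move=> k1 fd fE cdf di; have [h1 h2] := powXgauss_cvg0 fE k1.
apply: (@integral_derivative0 _ _ (fun t => t ^+ k * f t)) => //.
- move=> t; apply: cvgD; apply: cvgM => //; try exact: exprn_continuous; try exact: cdf.
    exact: (is_derive_continuous fd).
  by apply: cvgM; [exact: cvg_cst|exact: exprn_continuous].
- by move=> t; exact: dvM (dvX k t) (fd t).
Qed.

Lemma dgcos_cont lam a : continuous (fun t : R => - (2 * t) * gcos lam a t - (2 * lam * t + a) * gsin lam a t).
Proof.
move=> t; apply: cvgB; apply: cvgM; try exact: gcos_cont; try exact: gsin_cont.
  by apply: cvgN; apply: cvgM; [exact: cvg_cst|exact: cvg_id].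
by apply: cvgD; [apply: cvgM; [exact: cvg_cst|exact: cvg_id]|exact: cvg_cst].
Qed.

Lemma dgsin_cont lam a : continuous (fun t : R => - (2 * t) * gsin lam a t + (2 * lam * t + a) * gcos lam a t).
Proof.
move=> t; apply: cvgD; apply: cvgM; try exact: gcos_cont; try exact: gsin_cont.
  by apply: cvgN; apply: cvgM; [exact: cvg_cst|exact: cvg_id].
by apply: cvgD; [apply: cvgM; [exact: cvg_cst|exact: cvg_id]|exact: cvg_cst].
Qed.

Lemma Rintegral_lin3 (c1 c2 c3 : R) (f1 f2 f3 g : R -> R) :
  mu.-integrable setT (EFin \o f1) -> mu.-integrable setT (EFin \o f2) -> mu.-integrable setT (EFin \o f3) ->
  (forall t, g t = c1 * f1 t + c2 * f2 t + c3 * f3 t) ->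
  mu.-integrable setT (EFin \o g) /\
  \int[mu]_t g t = c1 * \int[mu]_t f1 t + c2 * \int[mu]_t f2 t + c3 * \int[mu]_t f3 t.
Proof.
move=> i1 i2 i3 gE; have -> : g = (fun t => c1 * f1 t + c2 * f2 t + c3 * f3 t) by exact/funext.
have j1 := rintegrableZ c1 i1; have j2 := rintegrableZ c2 i2; have j3 := rintegrableZ c3 i3.
have j12 := rintegrableD j1 j2.
split; first exact: rintegrableD.
by rewrite !RintegralD // !RintegralZl.
Qed.

(** The integrals of the derivatives of [gcos] and [gsin] vanish. The two relations form a linear
    system for the first moments, solvable since [1 + lam^2] does not vanish, and so yield a
    differential equation in [a]. *)
Lemma parts1 lam a :
  2 * mcos 1 lam a + 2 * lam * msin 1 lam a + a * msin 0 lam a = 0 /\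
  2 * msin 1 lam a = 2 * lam * mcos 1 lam a + a * mcos 0 lam a.
Proof.
split.
  have [gi gE] := @Rintegral_lin3 (- 2) (- (2 * lam)) (- a) _ _ _ _
    (@mcos_integrable 1 lam a isT) (@msin_integrable 1 lam a isT) (@msin_integrable 0 lam a isT)
    (fun=> erefl).
  have := @gauss_parts (gcos lam a) _ 0 isT (dv_gcos lam a) (@gcos_le _ lam a) (@dgcos_cont lam a).
  rewrite (_ : (fun t => _) = (fun t => - 2 * (t ^+ 1 * gcos lam a t) + - (2 * lam) * (t ^+ 1 * gsin lam a t) + - a * (t ^+ 0 * gsin lam a t))); last by apply/funext => t; ring.
  by move=> /(_ gi); rewrite gE -/(mcos 1 lam a) -/(msin 1 lam a) -/(msin 0 lam a); lra.
have [gi gE] := @Rintegral_lin3 (- 2) (2 * lam) a _ _ _ _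
    (@msin_integrable 1 lam a isT) (@mcos_integrable 1 lam a isT) (@mcos_integrable 0 lam a isT)
    (fun=> erefl).
have := @gauss_parts (gsin lam a) _ 0 isT (dv_gsin lam a) (@gsin_le _ lam a) (@dgsin_cont lam a).
rewrite (_ : (fun t => _) = (fun t => - 2 * (t ^+ 1 * gsin lam a t) + 2 * lam * (t ^+ 1 * gcos lam a t) + a * (t ^+ 0 * gcos lam a t))); last by apply/funext => t; ring.
by move=> /(_ gi); rewrite gE -/(mcos 1 lam a) -/(msin 1 lam a) -/(mcos 0 lam a); lra.
Qed.

(** The same integration by parts with an extra factor [t] and [a = 0]; it expresses the second
    moments by the zeroth ones and yields a differential equation in [lam]. *)
Lemma parts2 lam :
  mcos 0 lam 0 = 2 * mcos 2 lam 0 + 2 * lam * msin 2 lam 0 /\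
  msin 0 lam 0 = 2 * msin 2 lam 0 - 2 * lam * mcos 2 lam 0.
Proof.
split.
  have [gi gE] := @Rintegral_lin3 (- 2) (- (2 * lam)) 1 _ _ _ _
    (@mcos_integrable 2 lam 0 isT) (@msin_integrable 2 lam 0 isT) (@mcos_integrable 0 lam 0 isT)
    (fun=> erefl).
  have := @gauss_parts (gcos lam 0) _ 1 isT (dv_gcos lam 0) (@gcos_le _ lam 0) (@dgcos_cont lam 0).
  rewrite (_ : (fun t => _) = (fun t => - 2 * (t ^+ 2 * gcos lam 0 t) + - (2 * lam) * (t ^+ 2 * gsin lam 0 t) + 1 * (t ^+ 0 * gcos lam 0 t))); last by apply/funext => t /=; ring.
  by move=> /(_ gi); rewrite gE -/(mcos 2 lam 0) -/(msin 2 lam 0) -/(mcos 0 lam 0); lra.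
have [gi gE] := @Rintegral_lin3 (- 2) (2 * lam) 1 _ _ _ _
    (@msin_integrable 2 lam 0 isT) (@mcos_integrable 2 lam 0 isT) (@msin_integrable 0 lam 0 isT)
    (fun=> erefl).
have := @gauss_parts (gsin lam 0) _ 1 isT (dv_gsin lam 0) (@gsin_le _ lam 0) (@dgsin_cont lam 0).
rewrite (_ : (fun t => _) = (fun t => - 2 * (t ^+ 2 * gsin lam 0 t) + 2 * lam * (t ^+ 2 * gcos lam 0 t) + 1 * (t ^+ 0 * gsin lam 0 t))); last by apply/funext => t /=; ring.
by move=> /(_ gi); rewrite gE -/(mcos 2 lam 0) -/(msin 2 lam 0) -/(msin 0 lam 0); lra.
Qed.
End FresnelTransform.

Section FresnelWeight.
Context {R : realType}.
Local Notation mu := (@lebesgue_measure R).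
Local Notation E := (@gauss_fun R).
Implicit Types lam a t : R.

(** For [Z = mcos 0 + i msin 0] the relations of [parts1] read [Z' = - a / (2 (1 - i lam)) Z], whose
    solution is [Z 0 exp (- a^2 / (4 (1 - i lam)))]. Instead of solving, the proof checks that [Z]
    divided by this exponential has zero derivative; [U] and [V] are its real and imaginary
    parts. *)
Lemma mcosin_transform lam a : let q := lam / (1 + lam ^+ 2) in
  mcos 0 lam a = expR (- (a ^+ 2 / 4 / (1 + lam ^+ 2))) *
    (mcos 0 lam 0 * cos (q * (a ^+ 2 / 4)) + msin 0 lam 0 * sin (q * (a ^+ 2 / 4))) /\
  msin 0 lam a = expR (- (a ^+ 2 / 4 / (1 + lam ^+ 2))) *
    (msin 0 lam 0 * cos (q * (a ^+ 2 / 4)) - mcos 0 lam 0 * sin (q * (a ^+ 2 / 4))).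
Proof.
move=> q; pose p := (1 + lam ^+ 2)^-1.
have l0 : 1 + lam ^+ 2 != 0 by rewrite gt_eqF // ltr_pwDl ?sqr_ge0.
have pE : p * (1 + lam ^+ 2) = 1 by rewrite mulVf.
have qE : q = lam * p by [].
pose A := mcos 0 lam; pose B := msin 0 lam.
pose e x := expR (p / 4 * x ^+ 2); pose c x := cos (q / 4 * x ^+ 2); pose s x := sin (q / 4 * x ^+ 2).
have XE x : mcos 1 lam x = - (x / 2) * (q * A x + p * B x).
  have [h1 h2] := parts1 lam x.
  have -> : mcos 1 lam x = p * ((1 + lam ^+ 2) * mcos 1 lam x) by rewrite mulrA pE mul1r.
  rewrite (_ : (1 + lam ^+ 2) * mcos 1 lam x = - (x / 2) * (lam * A x + B x)); first by rewrite qE; ring.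
  have h3 : lam * (2 * msin 1 lam x) = lam * (2 * lam * mcos 1 lam x + x * A x) by rewrite h2.
  rewrite -/(B x) in h1; lra.
have YE x : msin 1 lam x = x / 2 * (p * A x - q * B x).
  have [_ h2] := parts1 lam x.
  have -> : msin 1 lam x = lam * mcos 1 lam x + x / 2 * A x by rewrite /A; lra.
  have hA : A x = p * (1 + lam ^+ 2) * A x by rewrite pE mul1r.
  by rewrite XE [X in _ + x / 2 * X]hA qE; ring.
have dp (y x : R) : is_derive x (1 : R) (fun x => y / 4 * x ^+ 2) (y / 2 * x).
  by apply: (dv_eq (dvZ (y / 4) (dvX 2 x))); rewrite expr1; lra.
have de x : is_derive x (1 : R) e (p / 2 * x * e x).
  by apply: (dv_eq (dv_comp (is_derive_expR _) (dp p x))); rewrite mulrC.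
have dc x : is_derive x (1 : R) c (- (q / 2 * x * s x)).
  by apply: (dv_eq (dv_comp (is_derive_cos _) (dp q x))); rewrite mulrC mulrN.
have ds x : is_derive x (1 : R) s (q / 2 * x * c x).
  by apply: (dv_eq (dv_comp (is_derive_sin _) (dp q x))); rewrite mulrC.
have U x : e x * (A x * c x + - (B x * s x)) = A 0.
  have [e0 c0 s0] : [/\ e 0 = 1, c 0 = 1 & s 0 = 0].
    by rewrite /e /c /s expr0n /= !mulr0 expR0 cos0 sin0.
  have D y : is_derive y (1 : R) (fun x => e x * (A x * c x + - (B x * s x))) 0.
    apply: (dv_eq (dvM (de y) (dvD (dvM (dv_mcos_a lam y) (dc y)) (dvN (dvM (dv_msin_a lam y) (ds y)))))).
    by rewrite XE YE /A /B; ring.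
  by rewrite (is_derive0_eq D x) e0 c0 s0; lra.
have V x : e x * (A x * s x + B x * c x) = B 0.
  have [e0 c0 s0] : [/\ e 0 = 1, c 0 = 1 & s 0 = 0].
    by rewrite /e /c /s expr0n /= !mulr0 expR0 cos0 sin0.
  have D y : is_derive y (1 : R) (fun x => e x * (A x * s x + B x * c x)) 0.
    apply: (dv_eq (dvM (de y) (dvD (dvM (dv_mcos_a lam y) (ds y)) (dvM (dv_msin_a lam y) (dc y))))).
    by rewrite XE YE /A /B; ring.
  by rewrite (is_derive0_eq D x) e0 c0 s0; lra.
rewrite -/(A a) -/(B a) -/(A 0) -/(B 0).
have -> : q * (a ^+ 2 / 4) = q / 4 * a ^+ 2 by lra.
have -> : a ^+ 2 / 4 / (1 + lam ^+ 2) = p / 4 * a ^+ 2 by rewrite /p; ring.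
rewrite -/(c a) -/(s a) expRN -/(e a).
have e0 : e a != 0 by rewrite gt_eqF // expR_gt0.
have cs : c a ^+ 2 + s a ^+ 2 = 1 by exact: cos2Dsin2.
split; apply: (mulfI e0); rewrite mulrA divff // mul1r -(U a) -(V a).
  rewrite (_ : _ + _ = e a * A a * (c a ^+ 2 + s a ^+ 2)); first by rewrite cs mulr1.
  by ring.
rewrite (_ : _ - _ = e a * B a * (c a ^+ 2 + s a ^+ 2)); first by rewrite cs mulr1.
by ring.
Qed.

(** At [a = 0] the equation in [lam] makes [|Z|^4 (1 + lam^2)] constant. Its value at [lam = 0]
    involves only the Gaussian integral, so neither that integral nor a complex square root has to
    be computed. *)
Lemma mcosin_norm lam :
  (mcos 0 lam 0 ^+ 2 + msin 0 lam 0 ^+ 2) ^+ 2 * (1 + lam ^+ 2) = (\int[mu]_t E t) ^+ 4.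
Proof.
pose A l := mcos 0 l (0 : R); pose B l := msin 0 l (0 : R).
have dA l : is_derive l (1 : R) A (- ((B l + l * A l) / (2 * (1 + l ^+ 2)))).
  apply: (dv_eq (dv_mcos_lam l)); congr (- _).
  have l0 : 2 * (1 + l ^+ 2) != 0 by rewrite mulf_neq0 // gt_eqF // ltr_pwDl ?sqr_ge0.
  apply: (mulIf l0); rewrite mulfVK //; have [h1 h2] := parts2 l.
  rewrite /A /B h1 h2; ring.
have dB l : is_derive l (1 : R) B ((A l - l * B l) / (2 * (1 + l ^+ 2))).
  apply: (dv_eq (dv_msin_lam l)).
  have l0 : 2 * (1 + l ^+ 2) != 0 by rewrite mulf_neq0 // gt_eqF // ltr_pwDl ?sqr_ge0.
  apply: (mulIf l0); rewrite mulfVK //; have [h1 h2] := parts2 l.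
  rewrite /A /B h1 h2; ring.
have dN l := dvD (dvM (dA l) (dA l)) (dvM (dB l) (dB l)).
pose N l := A l * A l + B l * B l.
have D l : is_derive l (1 : R) (fun l => N l * N l * (1 + l ^+ 2)) 0.
  apply: (dv_eq (dvM (dvM (dN l) (dN l)) (dvD (is_derive_cst (1 : R) l (1 : R)) (dvX 2 l)))).
  have l0 : 1 + l ^+ 2 != 0 by rewrite gt_eqF // ltr_pwDl ?sqr_ge0.
  by rewrite /N /cst /= expr1; field; rewrite -?expr2.
have -> : (mcos 0 lam 0 ^+ 2 + msin 0 lam 0 ^+ 2) ^+ 2 * (1 + lam ^+ 2) = N lam * N lam * (1 + lam ^+ 2).
  by rewrite /N /A /B; ring.
rewrite (is_derive0_eq D lam) expr0n addr0 mulr1 /N.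
have -> : B 0 = 0.
  rewrite /B /msin; under eq_Rintegral do rewrite /gsin /phase !mul0r addr0 sin0 !mulr0.
  by rewrite /Rintegral integral0.
have -> : A 0 = \int[mu]_t E t.
  by apply: eq_Rintegral => t _; rewrite /gcos /phase !mul0r addr0 cos0 mulr1 expr0 mul1r.
ring.
Qed.

Definition fresnel_unnormalized lam a t : R[i] := Complex (gcos lam a t) (gsin lam a t).

(** A complex Gaussian kernel of integral [1]; at [lam = 0] it is the probability density
    [gauss_density], which dominates all the others up to a constant. *)
Definition fresnel lam t : R[i] :=
  (cint mu (fresnel_unnormalized lam 0))^-1 * fresnel_unnormalized lam 0 t.

Definition gauss_density t : R := (\int[mu]_s E s)^-1 * E t.

Lemma gauss_fun_integrable : mu.-integrable setT (EFin \o E).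
Proof.
apply: eq_integrable (@monomial_gauss_integrable _ E 0 (@continuous_gauss_fun R) isT _) => //.
  by move=> t _ /=; rewrite mul1r.
by move=> t; rewrite ger0_norm ?gauss_fun_ge0.
Qed.

Lemma gauss_integral_gt0 : 0 < \int[mu]_t E t.
Proof.
have i1 := @integrable_indic_itv R 0 1 true false.
apply: (@lt_le_trans _ _ (\int[mu]_t (expR (-1) * \1_`[0, 1] t))).
  rewrite RintegralZl // mulr_gt0 ?expR_gt0 //.
  rewrite /Rintegral integral_indic ?setIT //.
 
  have h : 0 < fine (mu (`[0, 1]%classic : set R)).
    by rewrite lebesgue_measure_itv /= lte_fin ltr01 oppr0 adde0 ltr01.
  exact: h.
apply: le_Rintegral => //.
- exact: (rintegrableZ (expR (-1)) i1).
- exact: gauss_fun_integrable.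
move=> t _; rewrite indicE; case: (boolP (t \in _)) => [|_]; last by rewrite mulr0 gauss_fun_ge0.
rewrite inE /= in_itv /= mulr1 => /andP[t0 t1].
by rewrite /gauss_fun ler_expR lerN2 expr_le1.
Qed.

Lemma fresnel_unnormalized_integrable lam a : cintegrable mu (fresnel_unnormalized lam a).
Proof.
split => /=.
  by apply: eq_integrable (@mcos_integrable _ 0 lam a isT) => // t _ /=; rewrite mul1r.
by apply: eq_integrable (@msin_integrable _ 0 lam a isT) => // t _ /=; rewrite mul1r.
Qed.

Lemma cint_fresnel_unnormalized lam a :
  cint mu (fresnel_unnormalized lam a) = Complex (mcos 0 lam a) (msin 0 lam a).
Proof.
by apply: complex_eq => /=; apply: eq_Rintegral => t _; rewrite expr0 mul1r.
Qed.

Lemma normc_cint_fresnel lam : 0 < normc (cint mu (fresnel_unnormalized lam 0)) /\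
  normc (cint mu (fresnel_unnormalized lam 0)) ^+ 4 * (1 + lam ^+ 2) = (\int[mu]_t E t) ^+ 4.
Proof.
have h : normc (cint mu (fresnel_unnormalized lam 0)) ^+ 4 * (1 + lam ^+ 2) = (\int[mu]_t E t) ^+ 4.
  rewrite -(mcosin_norm lam) cint_fresnel_unnormalized /= (exprM _ 2 2) sqr_sqrtr //.
  by rewrite addr_ge0 ?sqr_ge0.
split => //; rewrite lt_neqAle normc_ge0 andbT eq_sym; apply/eqP => h0.
move: h; rewrite h0 expr0n mul0r => h.
by have := exprn_gt0 4 gauss_integral_gt0; rewrite -h ltxx.
Qed.

Lemma fresnel_integrable lam : cintegrable mu (fresnel lam).
Proof.
have i0 : cintegrable mu (fun=> 0 : R[i]) by split; exact: integrable0.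
have := cintegrable_lin (cint mu (fresnel_unnormalized lam 0))^-1 (fresnel_unnormalized_integrable lam 0) i0.
by rewrite (_ : (fun x => _) = fresnel lam) //; apply/funext => t; rewrite addr0.
Qed.

Lemma fresnel_fourier lam a : cint mu (fun t => fresnel lam t * cis (t * a)) =
  ((expR (- (a ^+ 2 / 4 / (1 + lam ^+ 2))))%:C)%C * cis (- (lam / (1 + lam ^+ 2) * (a ^+ 2 / 4))).
Proof.
have i0 : cintegrable mu (fun=> 0 : R[i]) by split; exact: integrable0.
set c := cint mu (fresnel_unnormalized lam 0).
have c0 : c != 0.
  by apply/eqP => h; have := (normc_cint_fresnel lam).1; rewrite -/c h Normc.normc0 ltxx.
rewrite (_ : (fun t => _) = (fun t => c^-1 * fresnel_unnormalized lam a t + 0)); last first.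
  apply/funext => t; rewrite addr0 /fresnel -/c -mulrA; congr (_ * _).
  have hc : gcos lam a t = gcos lam 0 t * cos (t * a) - gsin lam 0 t * sin (t * a).
    by rewrite /gcos /gsin /phase mul0r addr0 (mulrC a) cosD; ring.
  have hs : gsin lam a t = gcos lam 0 t * sin (t * a) + gsin lam 0 t * cos (t * a).
    by rewrite /gcos /gsin /phase mul0r addr0 (mulrC a) sinD; ring.
  by apply: complex_eq; rewrite !ReImE /= ?hc ?hs.
rewrite cint_lin //; last exact: fresnel_unnormalized_integrable.
rewrite [X in _ + X](_ : _ = 0); last by apply: complex_eq; rewrite /= /Rintegral integral0.
have [hA hB] := mcosin_transform lam a.
rewrite addr0 (_ : cint mu (fresnel_unnormalized lam a) =
  c * (((expR (- (a ^+ 2 / 4 / (1 + lam ^+ 2))))%:C)%C * cis (- (lam / (1 + lam ^+ 2) * (a ^+ 2 / 4))))) ?mulKf //.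
rewrite /c !cint_fresnel_unnormalized; set e := expR _ in hA hB *.
have M (x y u v : R) : Complex x y * Complex u v = Complex (x * u - y * v) (x * v + y * u) by [].
by rewrite hA hB /cis cosN sinN -[(e%:C)%C]/(Complex e 0) !M; congr Complex; ring.
Qed.

(** By [mcosin_norm] the exact ratio is [(1 + lam^2)^(1/4)]. It is weakened to [sqrt (1 + lam)]
    because products of [1 + lam] over the eigenvalues are bounded through the diagonal entries of
    the matrix in [prod_eigen_le]. *)
Lemma normc_fresnel lam t : 0 <= lam -> normc (fresnel lam t) <= Num.sqrt (1 + lam) * gauss_density t.
Proof.
move=> l0; have [c0 cE] := normc_cint_fresnel lam; have I0 := gauss_integral_gt0.
rewrite /fresnel Normc.normcM Normc.normcV /gauss_density.
set c := normc (cint _ _) in c0 cE *; set I := \int[mu]_s E s in I0 cE *.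
have -> : normc (fresnel_unnormalized lam 0 t) = E t.
  rewrite normcE_ReIm /= /gcos /gsin !exprMn -mulrDr cos2Dsin2 mulr1.
  by rewrite sqrtr_sqr ger0_norm ?gauss_fun_ge0.
rewrite mulrA ler_wpM2r ?gauss_fun_ge0 // -div1r ler_pdivrMr // mulrAC ler_pdivlMr // mul1r.
set r := Num.sqrt _; have r0 : 0 <= r by exact: sqrtr_ge0.
have r2 : r ^+ 2 = 1 + lam by rewrite sqr_sqrtr ?addr_ge0.
have [c1 I1] := (ltW c0, ltW I0).
rewrite -(@ler_pXn2r _ 4) ?nnegrE ?mulr_ge0 // -cE exprMn (exprM r 2 2) r2 mulrC.
by rewrite ler_wpM2r ?exprn_ge0 // sqrrD expr1n mul1r lerD2r lerDl mulrn_wge0.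
Qed.

Lemma gauss_density_ge0 t : 0 <= gauss_density t.
Proof. by rewrite mulr_ge0 ?gauss_fun_ge0 // invr_ge0 ltW // gauss_integral_gt0. Qed.

Lemma gauss_densityE t : ((gauss_density t)%:C)%C = fresnel 0 t.
Proof.
have g0 a : gcos 0 0 a = E a by rewrite /gcos /phase !mul0r addr0 cos0 mulr1.
have s0 a : gsin 0 0 a = 0 by rewrite /gsin /phase !mul0r addr0 sin0 mulr0.
rewrite /fresnel /fresnel_unnormalized g0 s0 -[Complex (E t) 0]/((E t)%:C)%C.
rewrite (_ : cint _ _ = ((\int[mu]_s E s)%:C)%C) -?fmorphV -?rmorphM //.
apply: complex_eq => /=; first by apply: eq_Rintegral => u _; rewrite g0.
by under eq_Rintegral do rewrite s0; rewrite /Rintegral integral0.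
Qed.
End FresnelWeight.

(** * Symmetric matrices *)
Section RealSpectral.
Context {R : realType}.

Lemma dot_mx n (x y : 'rV[R]_n) : (x *m y^T) 0 0 = \sum_j x 0 j * y 0 j.
Proof. by rewrite mxE; apply: eq_bigr => j _; rewrite mxE. Qed.

Lemma dot_mxC n (x y : 'rV[R]_n) : x *m y^T = y *m x^T.
Proof. by rewrite -[RHS]trmxK trmx_mul trmxK; apply/matrixP => i j; rewrite !ord1 [RHS]mxE. Qed.

Lemma dot_mx_ge0 n (x : 'rV[R]_n) : 0 <= (x *m x^T) 0 0.
Proof. by rewrite dot_mx sumr_ge0 // => j _; rewrite -expr2 sqr_ge0. Qed.

Lemma dot_mx_eq0 n (x : 'rV[R]_n) : (x *m x^T) 0 0 = 0 -> x = 0.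
Proof.
rewrite dot_mx => /psumr_eq0P h; apply/matrixP => i j; rewrite ord1 [RHS]mxE.
by apply/eqP; rewrite -sqrf_eq0 expr2 h // => k _; rewrite -expr2 sqr_ge0.
Qed.

(** A complex eigenvector [x + i y] exists since [R[i]] is algebraically closed. Comparing [(x A) y]
    with [x (y A)] shows that the imaginary part of the eigenvalue times [|x|^2 + |y|^2] is [0], so
    the eigenvalue is real and [x] or [y] is a real eigenvector. *)
Lemma symmetric_eigenvector n (A : 'M[R]_n.+1) : A^T = A ->
  exists (a : R) (v : 'rV[R]_n.+1), v *m v^T = 1%:M /\ v *m A = a *: v.
Proof.
move=> sA.
suff [a [v [v0 vA]]] : exists (a : R) (v : 'rV[R]_n.+1), v != 0 /\ v *m A = a *: v.
  have q0 : 0 < (v *m v^T) 0 0.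
    by rewrite lt_neqAle dot_mx_ge0 andbT eq_sym; apply: contra_neq v0; exact: dot_mx_eq0.
  exists a, ((Num.sqrt ((v *m v^T) 0 0))^-1 *: v); split; last first.
    by rewrite -scalemxAl vA !scalerA mulrC.
  rewrite [(_ *: _)^T]linearZ /= -scalemxAl -scalemxAr scalerA -invfM -expr2 sqr_sqrtr ?ltW //.
  apply/matrixP => i j; rewrite !ord1 [LHS]mxE mulVf ?gt_eqF // mxE eqxx //.
have [c /eigenvalueP[z zA z0]] := @eigenvalue_closed R[i] n.+1 (map_mx (fun x : R => (x%:C)%C) A) isT.
pose x : 'rV[R]_n.+1 := map_mx (@complex.Re R) z; pose y : 'rV[R]_n.+1 := map_mx (@complex.Im R) z.
have sumRe (f : 'I_n.+1 -> R[i]) : Re (\sum_j f j) = \sum_j Re (f j).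
  by apply: (big_morph _ (@ReD R)).
have sumIm (f : 'I_n.+1 -> R[i]) : Im (\sum_j f j) = \sum_j Im (f j).
  by apply: (big_morph _ (@ImD R)).
have xA : x *m A = Re c *: x - Im c *: y.
  apply/matrixP => i j; move/matrixP/(_ i j): zA; rewrite !mxE => /(congr1 (@complex.Re R)).
  rewrite sumRe ReImE => <-; apply: eq_bigr => k _.
  by rewrite !mxE ReImE /= mulr0 subr0.
have yA : y *m A = Re c *: y + Im c *: x.
  apply/matrixP => i j; move/matrixP/(_ i j): zA; rewrite !mxE => /(congr1 (@complex.Im R)).
  rewrite sumIm ReImE => <-; apply: eq_bigr => k _.
  by rewrite !mxE ReImE /= mulr0 add0r.
have xyA : (x *m A) *m y^T = x *m (y *m A)^T by rewrite trmx_mul sA mulmxA.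
have b0 : Im c = 0.
  have : Im c * ((x *m x^T) 0 0 + (y *m y^T) 0 0) = 0.
    have tD : (Re c *: y + Im c *: x)^T = Re c *: y^T + Im c *: x^T by rewrite linearD /= !linearZ.
    move: xyA; rewrite xA yA tD mulmxBl mulmxDr -!scalemxAl -!scalemxAr.
    move/matrixP/(_ 0 0); rewrite !mxE; lra.
  move/eqP; rewrite mulf_eq0 => /orP[/eqP //|]; rewrite paddr_eq0 ?dot_mx_ge0 //.
  move=> /andP[/eqP/dot_mx_eq0 hx /eqP/dot_mx_eq0 hy]; case/eqP: z0.
  apply/matrixP => i j; apply: complex_eq; rewrite [in RHS]mxE.
    by move/matrixP/(_ i j): hx; rewrite !mxE.
  by move/matrixP/(_ i j): hy; rewrite !mxE.
rewrite b0 !scale0r subr0 addr0 in xA yA.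
have [hx|hx] := eqVneq x 0; last by exists (Re c), x.
exists (Re c), y; split=> //; apply: contra_neq z0 => hy.
apply/matrixP => i j; apply: complex_eq; rewrite [in RHS]mxE.
  by move/matrixP/(_ i j): hx; rewrite !mxE.
by move/matrixP/(_ i j): hy; rewrite !mxE.
Qed.

(* A Householder reflection exchanging a unit vector and the first basis vector. *)
Lemma householder n (v : 'rV[R]_n.+1) : v *m v^T = 1%:M ->
  exists H : 'M[R]_n.+1, [/\ H^T = H, H *m H = 1%:M & row 0 H = v].
Proof.
move=> v1; pose e : 'rV[R]_n.+1 := delta_mx 0 0.
have e1 : e *m e^T = 1%:M.
  by apply/matrixP => i j; rewrite !ord1 dot_mx (bigD1 0) //= big1 => [|k k0];
    rewrite !mxE ?eqxx ?mulr1 ?addr0 // (negbTE k0) mulr0.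
have [ve|ve] := eqVneq e v.
  exists 1%:M; split; rewrite ?trmx1 ?mulmx1 //.
  by rewrite -ve; apply/matrixP => i j; rewrite !ord1 !mxE eqxx eq_sym.
pose w := e - v; pose q := (w *m w^T) 0 0.
have wq : w *m w^T = q%:M by apply/matrixP => i j; rewrite !ord1 [RHS]mxE eqxx.
have q0 : q != 0.
  by apply/eqP => /dot_mx_eq0 /eqP; rewrite subr_eq0 (negbTE ve).
exists (1%:M - (2 / q) *: (w^T *m w)); split.
- by rewrite linearB /= linearZ /= trmx_mul trmxK trmx1.
- set P := w^T *m w; have PP : P *m P = q *: P.
    by rewrite /P -[LHS]mulmxA [w *m (w^T *m w)]mulmxA wq mul_scalar_mx -scalemxAr.
  have -> : (1%:M - (2 / q) *: P) *m (1%:M - (2 / q) *: P) =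
      1%:M - (2 / q) *: P - ((2 / q) *: P - (2 / q * (2 / q) * q) *: P).
    rewrite mulmxBl mul1mx; congr (_ - _); rewrite mulmxBr mulmx1 -scalemxAl -scalemxAr PP.
    by rewrite !scalerA mulrA.
  rewrite (_ : 2 / q * (2 / q) * q = 2 / q + 2 / q); last by field; exact: q0.
  by rewrite scalerDl opprB addrK subrK.
rewrite rowE mulmxBr mulmx1 -scalemxAr mulmxA -/e.
have ew : e *m w^T = (q / 2)%:M.
  apply/matrixP => i j; rewrite !ord1 [RHS]mxE eqxx mulr1n /q /w [(_ - _)^T]linearB /= mulmxBl !mulmxBr v1 e1 (dot_mxC v e).
  by rewrite !mxE eqxx /=; set z := \sum_(_ < _) _; lra.
rewrite ew mul_scalar_mx scalerA mulrA divfK // mulfV ?scale1r ?pnatr_eq0 //.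
by rewrite /w opprB addrC subrK.
Qed.

(** Deflation: conjugating by the reflection whose first row is a unit eigenvector leaves the
    eigenvalue in the corner, zeros in the rest of the first row and column, and a smaller symmetric
    block. *)
Lemma symmetric_spectral n (A : 'M[R]_n) : A^T = A ->
  exists (U : 'M[R]_n) (d : 'rV[R]_n), U *m U^T = 1%:M /\ A = U^T *m diag_mx d *m U.
Proof.
elim: n A => [|n IH] A sA.
  by exists 0, 0; split; apply/matrixP => -[].
have [a [v [v1 vA]]] := symmetric_eigenvector sA.
have [H [HT HH Hv]] := householder v1.
pose B : 'M[R]_(1 + n) := H *m A *m H.
have sB : B^T = B by rewrite /B !trmx_mul HT sA mulmxA.
have B0 : row 0 B = a *: delta_mx 0 0.
  rewrite /B !row_mul Hv vA -scalemxAl -Hv rowE -mulmxA HH mulmx1 //.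
have Bul : ulsubmx B = a%:M.
  apply/matrixP => i j; rewrite !ord1 !mxE.
  have -> : lshift n 0 = 0 :> 'I_(1 + n) by apply/val_inj.
  by move/matrixP/(_ 0 0): B0; rewrite !mxE !eqxx mulr1.
have Bur : ursubmx B = 0.
  apply/matrixP => i j; rewrite !ord1 !mxE.
  have -> : lshift n 0 = 0 :> 'I_(1 + n) by apply/val_inj.
  by move/matrixP/(_ 0 (rshift 1 j)): B0; rewrite !mxE eqxx mulr0.
have Bdl : dlsubmx B = 0 by rewrite -[B]sB -trmx_ursub Bur trmx0.
have [V [d1 [V1 dE]]] : exists (U : 'M[R]_n) (d : 'rV[R]_n), U *m U^T = 1%:M /\ drsubmx B = U^T *m diag_mx d *m U.
  by apply: IH; rewrite -[in RHS]sB trmx_drsub.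
pose U : 'M[R]_(1 + n) := block_mx 1%:M 0 0 V.
pose d : 'rV[R]_(1 + n) := row_mx (a%:M) d1.
have UU : U *m U^T = 1%:M.
  by rewrite /U tr_block_mx !trmx0 trmx1 mulmx_block !mulmx0 !mul0mx mulmx1 V1 !addr0 add0r -scalar_mx_block.
have BE : B = U^T *m diag_mx d *m U.
  rewrite -[LHS]submxK Bul Bur Bdl dE /U /d diag_mx_row tr_block_mx !trmx0 trmx1 !mulmx_block.
  rewrite !(mul0mx, mulmx1, mul1mx) !mulmx0 !(addr0, add0r, mul0mx).
  by congr block_mx; apply/matrixP => i j; rewrite !ord1 !mxE eqxx.
exists (U *m H), d; split.
  by rewrite trmx_mul HT mulmxA -[U *m H *m H]mulmxA HH mulmx1.
rewrite trmx_mul HT !mulmxA.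
have -> : A = H *m B *m H by rewrite /B !mulmxA HH mul1mx -mulmxA HH mulmx1.
by rewrite BE !mulmxA.
Qed.
End RealSpectral.

(** * Complex Gaussian functionals *)
Section IteratedConvolution.
Context {R : realType}.
Local Notation T := (nat -> R).
Local Notation mu := (@lebesgue_measure R).
Implicit Types (W : nat -> R -> R[i]) (V : nat -> T) (f : T -> R[i]).

Lemma sfun_eval n (x : T) : sfun n (fun f : T -> R[i] => f x).
Proof. by split => [//|F f M _ _ h]; exact: h. Qed.

Lemma sfun_conv n L w v : cintegrable mu w -> sfun n L -> sfun n (fun f => L (conv w v f)).
Proof.
move=> iw [l c]; have S x := @sfun_int _ _ _ mu w (line x v) n (@line_measurable _ x v) iw.
split=> [a f g cf cg|F f M cF FM Ff].
  rewrite -l; [|exact: cyl_conv|exact: cyl_conv].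
  by congr L; apply/funext => x; rewrite /conv (S x).1.
pose I := \int[mu]_t normc (w t).
have iN : mu.-integrable setT (EFin \o (fun t => normc (w t))) by exact: cintegrable_normc.
have iNM : mu.-integrable setT (EFin \o (fun t => M * normc (w t))) by exact: rintegrableZ.
apply: (c _ _ (M * I)) => [k|k x|x].
- exact: cyl_conv.
- have [B hB] := cyl_bounded (cF k).
  rewrite /I -RintegralZl //; apply: normc_cint_le => // [|t].
    apply: cintegrableM => //; last by exists B => t; exact: hB.
    exact: (cyl_meas (@line_measurable _ x v) (cF k)).
  by rewrite Normc.normcM mulrC ler_wpM2r ?normc_ge0.
- exact: (S x).2 cF FM Ff.
Qed.

Fixpoint convs W V m f : T -> R[i] :=
  if m is k.+1 then convs W V k (conv (W k) (V k) f) else f.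

Lemma cyl_convs n W V m f : (forall k, cintegrable mu (W k)) -> cyl n f -> cyl n (convs W V m f).
Proof. by move=> iW; elim: m f => //= m IH f cf; apply: IH; exact: cyl_conv. Qed.

Lemma sfun_convs n W V m x : (forall k, cintegrable mu (W k)) ->
  sfun n (fun f => convs W V m f x).
Proof.
move=> iW; elim: m => [|m IH] /=; first exact: sfun_eval.
exact: (sfun_conv (V m) (iW m) IH).
Qed.

Lemma sfunZ n L a f : sfun n L -> cyl n f -> L (fun x => a * f x) = a * L f.
Proof.
move=> [l _] cf; have z : L (fun=> 0) = 0.
  have := l 1 _ _ (cyl_cst n 0) (cyl_cst n 0); rewrite (_ : (fun _ => _) = (fun=> 0)).
    by rewrite mul1r => h; apply: (addrI (L (fun=> 0))); rewrite addr0; exact/esym.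
  by apply/funext => x; rewrite mulr0 addr0.
have := l a f (fun=> 0) cf (cyl_cst n 0); rewrite z addr0 => <-.
by congr L; apply/funext => x; rewrite addr0.
Qed.

Lemma convs_wave n W V m xi x : (forall k, cintegrable mu (W k)) ->
  convs W V m (cwave n xi) x =
  (\prod_(k < m) cint mu (fun t => W k t * cis (t * \sum_(i < n) xi i * V k i))) * cwave n xi x.
Proof.
move=> iW; elim: m => [|m IH] /=; first by rewrite big_ord0 mul1r.
rewrite (_ : conv _ _ _ = (fun y => cint mu (fun t => W m t * cis (t * \sum_(i < n) xi i * V m i)) * cwave n xi y)).
  rewrite (sfunZ _ (sfun_convs n V m x iW) (cyl_wave n xi)) IH big_ord_recr /=; ring.
by apply/funext => y; rewrite conv_wave.
Qed.

(** Domination passes through one convolution at a time: complex kernels are replaced by positive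
    multiples [c k * rho k], and linearity pulls the constants out. The remaining positive
    functional has total mass known from its kernels. *)
Lemma normc_convs_le n W V m f (g : T -> R) (rho : nat -> R -> R) (c : nat -> R) x :
  (forall k, cintegrable mu (W k)) -> (forall k, cintegrable mu (fun t => ((rho k t)%:C)%C)) ->
  (forall k, 0 <= c k) -> (forall k t, normc (W k t) <= c k * rho k t) ->
  cyl n f -> cyl n (fun y => ((g y)%:C)%C) -> (forall y, normc (f y) <= g y) ->
  normc (convs W V m f x) <=
    (\prod_(k < m) c k) * Re (convs (fun k t => ((rho k t)%:C)%C) V m (fun y => ((g y)%:C)%C) x).
Proof.
move=> iW ir c0 Wr; pose rC k t := ((rho k t)%:C)%C.
elim: m f g => [|m IH] f g cf cg fg /=; first by rewrite big_ord0 mul1r.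
pose G y := Re (conv (rC m) (V m) (fun y => ((g y)%:C)%C) y).
have GE y : conv (rC m) (V m) (fun y => ((g y)%:C)%C) y = ((G y)%:C)%C.
  apply: complex_eq => //=; rewrite /Rintegral (eq_integral (fun=> 0%E)) ?integral0 // => t _.
  by rewrite mulr0 mul0r addr0.
have cG : cyl n (fun y => ((G y)%:C)%C).
  by apply: (eq_cyl GE); exact: (cyl_conv _ (ir m) cg).
have cmG : cyl n (fun y => ((c m * G y)%:C)%C).
  by apply: (eq_cyl _ (cylZ ((c m)%:C)%C cG)) => y; rewrite rmorphM.
have h := IH _ (fun y => c m * G y) (cyl_conv (V m) (iW m) cf) cmG.
apply: le_trans (h _) _ => {h}.
  move=> y; apply: le_trans (@normc_conv_le _ (W m) (V m) n f g y (iW m) cf cg fg) _.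
  have [Bg hBg] := cyl_bounded cg; have mg := (cyl_meas (@line_measurable _ y (V m)) cg).1.
  have i1 : mu.-integrable setT (EFin \o (fun t => rho m t * g (line y (V m) t))).
    apply: (bounded_integrableM (ir m).1 mg (M := Bg)) => t.
    by have := hBg (line y (V m) t); rewrite normc_real.
  have -> : G y = \int[mu]_t (rho m t * g (line y (V m) t)).
    by rewrite /G /conv /=; apply: eq_Rintegral => t _; rewrite mulr0 subr0.
  rewrite -RintegralZl //; apply: le_Rintegral => //.
  - apply: (bounded_integrableM (cintegrable_normc (iW m)) mg (M := Bg)) => t.
    by have := hBg (line y (V m) t); rewrite normc_real.
  - exact: (rintegrableZ (c m) i1).
  - move=> t _; rewrite mulrA ler_wpM2r //; exact: le_trans (normc_ge0 _) (fg _).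
rewrite big_ord_recr /= -mulrA ler_wpM2l ?prodr_ge0 // le_eqVlt; apply/orP; left; apply/eqP.
rewrite (_ : (fun y => ((c m * G y)%:C)%C) = (fun y => ((c m)%:C)%C * ((G y)%:C)%C)); last first.
  by apply/funext => y; rewrite rmorphM.
rewrite (sfunZ _ (sfun_convs n V m x ir) cG) ReImE mul0r subr0 /=; congr (_ * Re (convs _ _ _ _ _)).
by apply/funext => y; rewrite GE.
Qed.
End IteratedConvolution.

Section QuadraticForms.
Context {R : realType}.

Lemma ln_tangent (x m : R) : 0 < x -> 0 < m -> ln x <= ln m + (x / m - 1).
Proof.
move=> x0 m0; rewrite -lerBlDl -ln_div ?posrE //.
have h : 0 < x / m by rewrite divr_gt0.
have := expR_ge1Dx (ln (x / m)); rewrite lnK ?posrE //; lra.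
Qed.

(* Jensen's inequality for the logarithm and the probabilities [U k j ^+ 2]. *)
Lemma prod_eigen_le n (A U : 'M[R]_n) (d : 'rV[R]_n) : U *m U^T = 1%:M ->
  A = U^T *m diag_mx d *m U -> (forall k, 0 <= d 0 k) ->
  \prod_(k < n) (1 + d 0 k) <= \prod_(j < n) (1 + A j j).
Proof.
move=> UU AE d0.
have UU' := mulmx1C UU.
have row1 k : \sum_j U k j ^+ 2 = 1.
  move/matrixP/(_ k k): UU; rewrite !mxE eqxx => h; apply: etrans h.
  by apply: eq_bigr => j _; rewrite mxE expr2.
have col1 j : \sum_k U k j ^+ 2 = 1.
  move/matrixP/(_ j j): UU'; rewrite !mxE eqxx => h; apply: etrans h.
  by apply: eq_bigr => k _; rewrite mxE expr2.
have Ajj j : A j j = \sum_k U k j ^+ 2 * d 0 k.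
  rewrite AE mxE; apply: eq_bigr => k _; rewrite mul_mx_diag !mxE; ring.
have A0 j : 0 < 1 + A j j.
  by rewrite ltr_pwDl // Ajj sumr_ge0 // => k _; rewrite mulr_ge0 ?sqr_ge0.
have l0 k : 0 < 1 + d 0 k by rewrite ltr_pwDl.
have lnprod (F : 'I_n -> R) : (forall i, 0 < F i) -> ln (\prod_i F i) = \sum_i ln (F i).
  move=> F0; suff : 0 < \prod_i F i /\ ln (\prod_i F i) = \sum_i ln (F i) by case.
  elim/big_rec2: _ => [|i y x _ [y0 yE]]; first by rewrite ln1.
  by rewrite mulr_gt0 // lnM ?posrE // yE.
rewrite -ler_ln ?posrE ?prodr_gt0 // !lnprod //.
have -> : \sum_k ln (1 + d 0 k) = \sum_j \sum_k U k j ^+ 2 * ln (1 + d 0 k).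
  by rewrite exchange_big /=; apply: eq_bigr => k _; rewrite -mulr_suml row1 mul1r.
apply: ler_sum => j _.
apply: (@le_trans _ _ (\sum_k U k j ^+ 2 * (ln (1 + A j j) + ((1 + d 0 k) / (1 + A j j) - 1)))).
  by apply: ler_sum => k _; rewrite ler_wpM2l ?sqr_ge0 // ln_tangent.
rewrite le_eqVlt; apply/orP; left; apply/eqP.
rewrite (eq_bigr (fun k => (ln (1 + A j j) - 1 + (1 + A j j)^-1) * U k j ^+ 2 + (1 + A j j)^-1 * (U k j ^+ 2 * d 0 k))).
  by rewrite big_split /= -!mulr_sumr col1 -Ajj; field; rewrite gt_eqF.
by move=> k _; ring.
Qed.

(** [min (i, j)] counts the [l] below both indices, so the form is a sum of squares of tail sums.
    This is the positivity of the Brownian covariance. *)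
Lemma sum_minK_sqr n (z : 'I_n -> R) :
  0 <= \sum_(i < n) \sum_(j < n) minK i j * z i * z j.
Proof.
have hK (i j : 'I_n) : minK i j = \sum_(l < n) ((l <= i)%N%:R * (l <= j)%N%:R : R).
  rewrite /minK (eq_bigr (fun l : 'I_n => ((l < minn i.+1 j.+1)%N%:R : R))) => [|l _]; last first.
    by rewrite -natrM mulnb leq_min.
  rewrite -natr_sum; congr (_%:R).
  rewrite -(big_mkord xpredT (fun l => nat_of_bool (l < minn i.+1 j.+1)%N)).
  have h : (minn i.+1 j.+1 <= n)%N by rewrite geq_min ltn_ord.
  rewrite (big_cat_nat (leq0n _) h) //= big_nat (eq_bigr (fun=> 1%N)) => [|l /andP[_ ->] //].
  rewrite -big_nat sum_nat_const_nat subn0 muln1 big_nat big1 ?addn0 // => l /andP[hl _].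
  by rewrite ltnNge hl.
have -> : \sum_(i < n) \sum_(j < n) minK i j * z i * z j = \sum_(l < n) (\sum_(i < n) (l <= i)%N%:R * z i) ^+ 2.
  rewrite (eq_bigr (fun i : 'I_n => \sum_(l < n) \sum_(j < n) (l <= i)%N%:R * (l <= j)%N%:R * z i * z j)); last first.
    by move=> i _; rewrite exchange_big /=; apply: eq_bigr => j _; rewrite hK !mulr_suml.
  rewrite exchange_big /=; apply: eq_bigr => l _; rewrite expr2 mulr_suml.
  apply: eq_bigr => i _; rewrite mulr_sumr; apply: eq_bigr => j _; ring.
by rewrite sumr_ge0 // => l _; exact: sqr_ge0.
Qed.
End QuadraticForms.

Section GaussianFunctional.
Context {R : realType}.
Local Notation T := (nat -> R).
Local Notation mu := (@lebesgue_measure R).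

Definition mxget n (A : 'M[R]_n) (i j : nat) : R :=
  if (insub i, insub j) is (Some k, Some l) then A k l else 0.

Lemma mxget_ord n (A : 'M[R]_n) (i j : 'I_n) : mxget A i j = A i j.
Proof. by rewrite /mxget !valK. Qed.

(** Bound for the mass of the oscillatory functional with damping [b]; [j.+1] is the diagonal entry
    [minK j j], and [j.+1 / b j] that of the rescaled matrix. *)
Definition gauss_tau n (b : T) : R := \prod_(j < n) Num.sqrt (1 + j.+1%:R / b j).

Definition minK_form n (xi : T) : R := \sum_(i < n) \sum_(j < n) minK i j * xi i * xi j.

(** In the variables [y i = sqrt (b i) * xi i] the exponent is [- (|y|^2 + i A(y, y)) / 2], where
    [A] is [minK] rescaled on both sides. Along an eigenvector the factor is
    [exp (- (1 + i d) eta^2 / 2)], the transform of a [fresnel] kernel; [L] convolves with these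
    kernels. [N] convolves with real Gaussians of the same scale, which gives [(1 + d^2) eta^2] in
    the exponent; the sum of the [d^2 eta^2] is [|A y|^2], whence the row sums of [minK] divided by
    [b j]. *)
Lemma gaussian_functional n (b : T) : (forall j, (j < n)%N -> 0 < b j) ->
  exists L N : (T -> R[i]) -> R[i],
  [/\ sfun n L, sfun n N,
    forall xi, L (cwave n xi) = ((expR (- (\sum_(j < n) b j * xi j ^+ 2) / 2))%:C)%C * cis (- minK_form n xi / 2),
    forall xi, N (cwave n xi) = ((expR (- (\sum_(j < n) b j * xi j ^+ 2 +
      \sum_(j < n) (\sum_(i < n) minK i j * xi i) ^+ 2 / b j) / 2))%:C)%C &
    forall (f : T -> R[i]) (g : T -> R), cyl n f -> cyl n (fun y => ((g y)%:C)%C) ->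
      (forall y, normc (f y) <= g y) ->
      normc (L f) <= gauss_tau n b * Re (N (fun y => ((g y)%:C)%C)) /\
      normc (N f) <= Re (N (fun y => ((g y)%:C)%C))].
Proof.
move=> b0.
have sb0 (j : 'I_n) : Num.sqrt (b j) != 0 by rewrite gt_eqF // sqrtr_gt0 b0.
have sbb (j : 'I_n) : Num.sqrt (b j) ^+ 2 = b j by rewrite sqr_sqrtr // ltW // b0.
pose A : 'M[R]_n := \matrix_(i, j) (minK i j / (Num.sqrt (b i) * Num.sqrt (b j))).
have sA : A^T = A.
  by apply/matrixP => i j; rewrite !mxE /minK minnC mulrC (mulrC (Num.sqrt _)) mulrC.
have [U [d [UU AE]]] := symmetric_spectral sA.
have UU' := mulmx1C UU.
pose y (xi : T) (i : 'I_n) := Num.sqrt (b i) * xi i.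
pose eta xi k := \sum_i U k i * y xi i.
have Aij i j : A i j = \sum_k U k i * U k j * d 0 k.
  rewrite AE mxE; apply: eq_bigr => k _; rewrite mul_mx_diag !mxE; ring.
have dij i j : \sum_k U k i * U k j = (i == j)%:R :> R.
  move/matrixP/(_ i j): UU'; rewrite !mxE => <-; apply: eq_bigr => k _; rewrite mxE; ring.
have dkl k l : \sum_i U k i * U l i = (k == l)%:R :> R.
  move/matrixP/(_ k l): UU; rewrite !mxE => <-; apply: eq_bigr => i _; rewrite mxE; ring.
have quad (z : 'I_n -> R) (w : 'I_n -> R) : \sum_k w k * (\sum_i U k i * z i) ^+ 2 =
    \sum_i \sum_j (\sum_k U k i * U k j * w k) * z i * z j.
  transitivity (\sum_k \sum_i \sum_j U k i * U k j * w k * z i * z j).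
    apply: eq_bigr => k _; rewrite expr2 mulr_suml mulr_sumr; apply: eq_bigr => i _.
    rewrite !mulr_sumr; apply: eq_bigr => j _; ring.
  rewrite exchange_big /=; apply: eq_bigr => i _; rewrite exchange_big /=; apply: eq_bigr => j _.
  by rewrite !mulr_suml.
have diag (z : 'I_n -> R) : \sum_i \sum_j (i == j)%:R * z i * z j = \sum_i z i ^+ 2 :> R.
  apply: eq_bigr => i _; rewrite (bigD1 i) //= eqxx big1 ?addr0 ?mul1r ?expr2 // => j ji.
  by rewrite eq_sym (negbTE ji) !mul0r.
have eta2 xi : \sum_k eta xi k ^+ 2 = \sum_(j < n) b j * xi j ^+ 2.
  transitivity (\sum_k 1 * (\sum_i U k i * y xi i) ^+ 2); first by apply: eq_bigr => k _; rewrite mul1r.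
  rewrite quad (eq_bigr (fun i : 'I_n => \sum_(j < n) (i == j)%:R * y xi i * y xi j)); last first.
    by move=> i _; apply: eq_bigr => j _; rewrite -dij; congr (_ * _ * _); apply: eq_bigr => k _; rewrite mulr1.
  by rewrite diag; apply: eq_bigr => j _; rewrite exprMn sbb.
have etal xi : \sum_k d 0 k * eta xi k ^+ 2 = minK_form n xi.
  rewrite quad; apply: eq_bigr => i _; apply: eq_bigr => j _; rewrite -Aij mxE /y.
  by field; rewrite !sb0.
have etal2 xi : \sum_k d 0 k ^+ 2 * eta xi k ^+ 2 = \sum_(j < n) (\sum_(i < n) minK i j * xi i) ^+ 2 / b j.
  transitivity (\sum_(j < n) (\sum_k U k j * (d 0 k * eta xi k)) ^+ 2).
    transitivity (\sum_k 1 * (\sum_j U^T k j * (d 0 j * eta xi j)) ^+ 2); last first.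
      by apply: eq_bigr => k _; rewrite mul1r; congr (_ ^+ 2); apply: eq_bigr => j _; rewrite mxE.
    transitivity (\sum_i \sum_j (i == j)%:R * (d 0 i * eta xi i) * (d 0 j * eta xi j)).
      by rewrite diag; apply: eq_bigr => k _; rewrite exprMn.
    transitivity (\sum_i \sum_j (\sum_k U i k * U j k) * (d 0 i * eta xi i) * (d 0 j * eta xi j)).
      by apply: eq_bigr => i _; apply: eq_bigr => j _; rewrite dkl.
    transitivity (\sum_k \sum_i \sum_j U i k * U j k * (d 0 i * eta xi i) * (d 0 j * eta xi j)).
      rewrite [RHS]exchange_big /=; apply: eq_bigr => i _; rewrite [RHS]exchange_big /=.
      by apply: eq_bigr => j _; rewrite !mulr_suml.
    apply: eq_bigr => k _; rewrite mul1r expr2 mulr_suml; apply: eq_bigr => i _.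
    rewrite mulr_sumr; apply: eq_bigr => j _; rewrite !mxE; ring.
  apply: eq_bigr => j _.
  have -> : \sum_k U k j * (d 0 k * eta xi k) = (\sum_(i < n) minK i j * xi i) / Num.sqrt (b j).
    transitivity (\sum_i A i j * y xi i); last first.
      by rewrite mulr_suml; apply: eq_bigr => i _; rewrite mxE /y; field; rewrite !sb0.
    transitivity (\sum_k \sum_i U k i * U k j * d 0 k * y xi i).
      by apply: eq_bigr => k _; rewrite !mulr_sumr; apply: eq_bigr => i _; ring.
    rewrite exchange_big /=; apply: eq_bigr => i _; rewrite Aij mulr_suml //.
  by rewrite exprMn exprVn sbb.
(* An eigenvalue is the value of the quadratic form of [A] at its unit eigenvector, and the form is
   nonnegative by [sum_minK_sqr]. *)
have d0 k : 0 <= d 0 k.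
  have -> : d 0 k = \sum_l d 0 l * (\sum_i U l i * U k i) ^+ 2.
    rewrite (bigD1 k) //= dkl eqxx expr1n mulr1 big1 ?addr0 // => l lk.
    by rewrite dkl (negbTE lk) expr0n mulr0.
  rewrite quad; have := @sum_minK_sqr R n (fun i => U k i / Num.sqrt (b i)).
  congr (_ <= _); apply: eq_bigr => i _; apply: eq_bigr => j _; rewrite -Aij mxE.
  by field; rewrite !sb0.
pose lam k := if insub k is Some l then d 0 l else 0.
have lam0 k : 0 <= lam k by rewrite /lam; case: insubP => [l _ _|_].
have lamE (k : 'I_n) : lam k = d 0 k by rewrite /lam valK.
(* The two square roots are tuned to [fresnel_fourier]: the frequency along [V k] has square
   [2 (1 + lam^2) eta^2], so that [a^2 / 4 / (1 + lam^2)] becomes [eta^2 / 2]. *)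
pose V (k i : nat) : R := Num.sqrt 2 * Num.sqrt (1 + lam k ^+ 2) * (Num.sqrt (b i) * mxget U k i).
have Veta (xi : T) (k : 'I_n) : (\sum_(i < n) xi i * V k i) ^+ 2 / 4 = (1 + d 0 k ^+ 2) * eta xi k ^+ 2 / 2.
  have -> : \sum_(i < n) xi i * V k i = Num.sqrt 2 * Num.sqrt (1 + lam k ^+ 2) * eta xi k.
    by rewrite mulr_sumr; apply: eq_bigr => i _; rewrite /V /y mxget_ord; ring.
  by rewrite !exprMn !sqr_sqrtr ?addr_ge0 ?sqr_ge0 // lamE; lra.
have l0 (k : 'I_n) : 1 + d 0 k ^+ 2 != 0 by rewrite gt_eqF // ltr_pwDl ?sqr_ge0.
pose W k := @fresnel R (lam k).
have iW k : cintegrable mu (W k) by exact: fresnel_integrable.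
pose G (k : nat) (t : R) := ((gauss_density t)%:C)%C.
have GE : G = (fun k => @fresnel R 0) by apply/funext => k; apply/funext => t; rewrite /G gauss_densityE.
have iG k : cintegrable mu (G k) by rewrite GE; exact: fresnel_integrable.
have prodexp (F : 'I_n -> R) : \prod_(k < n) ((expR (F k))%:C)%C = ((expR (\sum_k F k))%:C)%C.
  by apply/esym/(big_morph (fun x : R => ((expR x)%:C)%C)) => [u v|]; rewrite ?expRD ?rmorphM // expR0.
have prodcis (F : 'I_n -> R) : \prod_(k < n) cis (F k) = cis (\sum_k F k).
  by apply/esym/(big_morph (@cis R)) => [u v|]; rewrite ?cisD // cis0.
have wave0 xi : cwave n xi (fun=> 0) = 1 :> R[i].
  by rewrite /cwave big1 ?cis0 // => i _; rewrite mulr0.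
exists (fun f => convs W V n f (fun=> 0)), (fun f => convs G V n f (fun=> 0)); split.
- exact: sfun_convs.
- exact: sfun_convs.
- move=> xi; rewrite convs_wave // wave0 mulr1.
  rewrite (eq_bigr (fun k : 'I_n => ((expR (- (eta xi k ^+ 2 / 2)))%:C)%C * cis (- (d 0 k * eta xi k ^+ 2 / 2)))).
    rewrite big_split /= prodexp prodcis !sumrN -!mulr_suml eta2 etal.
    by rewrite !mulNr.
  move=> k _; rewrite fresnel_fourier Veta lamE; congr ((expR _)%:C%C * cis _).
    by field; exact: l0.
  by field; exact: l0.
- move=> xi; rewrite convs_wave // wave0 mulr1.
  rewrite (eq_bigr (fun k : 'I_n => ((expR (- ((eta xi k ^+ 2 + d 0 k ^+ 2 * eta xi k ^+ 2) / 2)))%:C)%C)).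
    by rewrite prodexp sumrN -mulr_suml big_split /= eta2 etal2 mulNr.
  move=> k _; rewrite GE fresnel_fourier Veta mul0r mul0r oppr0 cis0 mulr1 expr0n addr0 divr1.
  by congr ((expR _)%:C)%C; field.
- move=> f g cf cg fg; split.
    apply: le_trans (@normc_convs_le _ n W V n f g (fun=> @gauss_density R) (fun k => Num.sqrt (1 + lam k)) (fun=> 0) iW iG _ _ cf cg fg) _.
    + by move=> k; exact: sqrtr_ge0.
    + by move=> k t; apply: normc_fresnel.
    rewrite ler_wpM2r //.
      rewrite (le_trans (normc_ge0 (convs G V n f (fun=> 0)))) //.
      have := @normc_convs_le _ n G V n f g (fun=> @gauss_density R) (fun=> 1) (fun=> 0) iG iG _ _ cf cg fg.
      rewrite big1 // mul1r; apply=> // k t.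
      by rewrite normc_real ger0_norm ?gauss_density_ge0 // mul1r.
    rewrite /gauss_tau -(@ler_pXn2r _ 2) ?nnegrE ?prodr_ge0 // -!prodrXl.
    rewrite (eq_bigr (fun k : 'I_n => 1 + d 0 k)) => [|k _]; last by rewrite sqr_sqrtr ?addr_ge0 // lamE.
    rewrite (le_trans (prod_eigen_le UU AE d0)) // le_eqVlt; apply/orP; left; apply/eqP.
    apply: eq_bigr => j _; rewrite sqr_sqrtr ?addr_ge0 ?divr_ge0 ?ltW ?b0 //.
    by rewrite mxE -expr2 sbb /minK minnn.
  have := @normc_convs_le _ n G V n f g (fun=> @gauss_density R) (fun=> 1) (fun=> 0) iG iG _ _ cf cg fg.
  rewrite big1 // mul1r; apply=> // k t.
  by rewrite normc_real ger0_norm ?gauss_density_ge0 // mul1r.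
Qed.
End GaussianFunctional.

(** * Mixtures of Gaussian functionals *)
Section MixtureTools.
Context {R : realType}.
Local Notation T := (nat -> R).
Local Notation mu := (@lebesgue_measure R).

(** Telescoping: [d (n + 2)^(- (1 + d))] is at most [(n + 1)^(- d) - (n + 2)^(- d)], from
    [1 / (n + 2) <= ln ((n + 2) / (n + 1))] and [1 + x <= exp x]. *)
Lemma cvg_pseries (d : R) : 0 < d -> cvgn (series (fun i => i.+1%:R `^ (- (1 + d)) : R)).
Proof.
move=> d0; apply: nondecreasing_is_cvgn.
  by apply/nondecreasing_seqP => n; rewrite -subr_ge0 seriesSB powR_ge0.
have step n : d * (n.+2%:R : R) `^ (- (1 + d)) <= n.+1%:R `^ (- d) - n.+2%:R `^ (- d).
  have x0 : 0 < (n.+1%:R : R) by []. have y0 : 0 < (n.+2%:R : R) by [].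
  have -> : (n.+2%:R : R) `^ (- (1 + d)) = n.+2%:R `^ (- d) * n.+2%:R^-1.
    rewrite opprD addrC powRD; last by rewrite pnatr_eq0 implybT.
    by rewrite (powR_inv1 (ler0n _ _)).
  have -> : (n.+1%:R : R) `^ (- d) = n.+2%:R `^ (- d) * expR (d * ln (n.+2%:R / n.+1%:R)).
    rewrite ln_div ?posrE // /powR !pnatr_eq0 -expRD; congr expR; ring.
  have z0 := powR_ge0 (n.+2%:R : R) (- d).
  have h : n.+2%:R^-1 <= ln (n.+2%:R / n.+1%:R : R).
    have := @ln_tangent R (n.+1%:R / n.+2%:R) 1 (divr_gt0 x0 y0) ltr01.
    rewrite -[n.+2%:R / n.+1%:R]invf_div lnV ?posrE ?divr_gt0 // ln1 add0r divr1.
    have E : n.+1%:R / n.+2%:R = 1 - n.+2%:R^-1 :> R.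
      have := gt_eqF y0; rewrite -natr1 => /negbT y1; by field.
    rewrite {2}E; set u := ln _; set v := (n.+2%:R)^-1; lra.
  have h2 := expR_ge1Dx (d * ln (n.+2%:R / n.+1%:R : R)).
  have h3 : d * n.+2%:R^-1 <= d * ln (n.+2%:R / n.+1%:R : R) by rewrite ler_wpM2l // ltW.
  move: h2 h3 z0; set u := expR _; set v := ln _; set z := _ `^ _; set y := (n.+2%:R)^-1 => h2 h3 z0; nra.
have B n : d * series (fun i => i.+1%:R `^ (- (1 + d)) : R) n.+1 <= d + 1 - n.+1%:R `^ (- d).
  elim: n => [|n IH].
    by rewrite /series /= big_nat1 !powR1 addrK mulr1.
  by rewrite seriesSr mulrDr; have := step n; lra.
exists ((d + 1) / d) => _ [n _ <-]; rewrite ler_pdivlMr // mulrC; case: n => [|n].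
  by rewrite /series /= big_geq // mulr0 addr_ge0 // ltW.
by apply: le_trans (B n) _; rewrite gerBl powR_ge0.
Qed.

Lemma continuousM2 (f g : R -> R) : continuous f -> continuous g -> continuous (fun x => f x * g x).
Proof. by move=> cf cg x; apply: cvgM; [exact: cf|exact: cg]. Qed.

Lemma continuousD2 (f g : R -> R) : continuous f -> continuous g -> continuous (fun x => f x + g x).
Proof. by move=> cf cg x; apply: cvgD; [exact: cf|exact: cg]. Qed.

Lemma continuous_comp2 (f g : R -> R) : continuous f -> continuous g -> continuous (fun x => f (g x)).
Proof. by move=> cf cg x; apply: (continuous_comp (cg x)); exact: cf. Qed.

Lemma continuousX2 (f : R -> R) k : continuous f -> continuous (fun x => f x ^+ k).
Proof. by move=> cf; apply: (@continuous_comp2 (fun y => y ^+ k)) => //; exact: exprn_continuous. Qed.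

Lemma cont_n_coord n i (h : R -> R) : (i < n)%N -> continuous h -> cont_n n (fun x : T => h (x i)).
Proof.
move=> ni ch x e e0; have /cvgrPdist_lt/(_ e e0) := ch (x i).
rewrite near_nbhs => /nbhs_ballP[d /= d0 hd]; exists d => // y hy.
by apply: hd; exact: hy.
Qed.

Lemma cont_nD n (F G : T -> R) : cont_n n F -> cont_n n G -> cont_n n (fun x => F x + G x).
Proof.
move=> cF cG x e e0; have e2 : 0 < e / 2 by rewrite divr_gt0.
have [d d0 hd] := cF x _ e2; have [d' d'0 hd'] := cG x _ e2.
exists (Num.min d d') => [|y hy]; first by rewrite lt_min d0.
have h1 : `|F x - F y| < e / 2 by apply: hd => i /hy; rewrite lt_min => /andP[].
have h2 : `|G x - G y| < e / 2 by apply: hd' => i /hy; rewrite lt_min => /andP[].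
rewrite (_ : _ - _ = (F x - F y) + (G x - G y)); last by ring.
by apply: le_lt_trans (ler_normD _ _) _; lra.
Qed.

Lemma cont_n_sum n m (F : nat -> T -> R) : (forall i, (i < m)%N -> cont_n n (F i)) ->
  cont_n n (fun x => \sum_(i < m) F i x).
Proof.
elim: m => [|m IH] h.
  by move=> x e e0; exists 1 => // y _; rewrite !big_ord0 subrr normr0.
rewrite (_ : (fun x => _) = (fun x => \sum_(i < m) F i x + F m x)).
  by apply: cont_nD; [apply: IH => i im; apply: h; exact: ltnW|exact: h].
by apply/funext => x; rewrite big_ord_recr.
Qed.

Lemma cont_n_comp n (h : R -> R) (F : T -> R) : continuous h -> cont_n n F ->
  cont_n n (fun x => h (F x)).
Proof.
move=> ch cF x e e0; have /cvgrPdist_lt/(_ e e0) := ch (F x).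
rewrite near_nbhs => /nbhs_ballP[d /= d0 hd]; have [d' d'0 hd'] := cF x d d0.
by exists d' => // y hy; apply: hd; exact: hd'.
Qed.

Lemma rcyl_coord n i (h : R -> R) B : (i < n)%N -> continuous h -> (forall t, `|h t| <= B) ->
  rcyl n (fun x => h (x i)).
Proof. by move=> ni ch hB; apply: (rcyl_cont (cont_n_coord ni ch)) => x; exact: hB. Qed.

Lemma min1_continuous : continuous (fun y : R => Num.min 1 y).
Proof.
move=> y; rewrite (_ : (fun y : R => Num.min 1 y) = (fun y => (1 + y - `|1 - y|) / 2)).
  apply: cvgM; last exact: cvg_cst.
  apply: cvgB; first by apply: cvgD; [exact: cvg_cst|exact: cvg_id].
  by apply: cvg_norm; apply: cvgB; [exact: cvg_cst|exact: cvg_id].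
by apply/funext => z; rewrite minr_absE; congr (_ / _).
Qed.

(* The second difference quotient of the Fourier transform controls the second moment. *)
Lemma gauss_tail n (N : (T -> R[i]) -> R[i]) (Q : T -> R) (q : T) (w : T) t :
  sfun n N -> (forall xi, N (cwave n xi) = ((expR (- Q xi / 2))%:C)%C) ->
  Q (fun=> 0) = 0 -> (forall i h, (i < n)%N -> Q (fun j => if j == i then h else 0) = h ^+ 2 * q i) ->
  (forall f g : T -> R, rcyl n f -> rcyl n g -> (forall x, f x <= g x) ->
     Re (N (fun x => ((f x)%:C)%C)) <= Re (N (fun x => ((g x)%:C)%C))) ->
  (forall i, 0 <= w i) -> 0 <= t ->
  Re (N (fun x => ((Num.min 1 (t * \sum_(i < n) w i * x i ^+ 2))%:C)%C)) <= t * \sum_(i < n) w i * q i.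
Proof.
move=> sN NE Q0 QE Nmono w0 t0.
pose h m : R := m.+1%:R^-1.
have h0 m : 0 < h m by rewrite invr_gt0.
(* A bounded substitute for [x^2]: it is a combination of three waves, so [N] can be evaluated on
   it, and it equals [((2 / h) sin (h x / 2))^2], which tends to [x^2] as [h] tends to [0]. *)
pose c m (x : R) := 2 / h m ^+ 2 * (1 - cos (h m * x)).
have cc m : continuous (c m).
  move=> x; apply: cvgM; first exact: cvg_cst.
  apply: cvgB; first exact: cvg_cst.
  apply: (@continuous_comp2 (@cos R)) => [|y]; first exact: continuous_cos.
  by apply: cvgM; [exact: cvg_cst|exact: cvg_id].
have c0 m x : 0 <= c m x.
  have := cos_le1 (h m * x); rewrite /c => h1.
  by apply: mulr_ge0; [rewrite divr_ge0 ?sqr_ge0|rewrite subr_ge0].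
have ccv x : c m x @[m --> \oo] --> x ^+ 2.
  have sc : (2 / h m) * sin (h m / 2 * x) @[m --> \oo] --> x.
    have [->|x0] := eqVneq x 0.
      by apply: cvg_near_cst; apply: nearW => m; rewrite mulr0 sin0 mulr0.
    have := @is_derive_sin R 0; rewrite cos0 => -[/cvg_ex[l hl] dl].
    have l1 : l = 1 by rewrite -dl; apply/esym/cvg_lim.
    rewrite l1 in hl.
    have /cvgr_dnbhsP/(_ (fun m => h m / 2 * x)) := hl.
    have hx0 : (forall m, h m / 2 * x != 0) /\ h m / 2 * x @[m --> \oo] --> 0.
      split=> [m|]; first by rewrite mulf_neq0 // mulf_neq0 ?invr_eq0 // gt_eqF.
      have hc : h m @[m --> \oo] --> (0 : R) by exact: cvg_harmonic.
      have H : h m * 2^-1 * x @[m --> \oo] --> 0 * 2^-1 * x.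
        by apply: cvgMr_tmp; apply: cvgMr_tmp.
      by rewrite !mul0r in H.
    move/(_ hx0) => h1.
    have h2 : (h m / 2 * x)^-1 * sin (h m / 2 * x) @[m --> \oo] --> (1 : R).
      rewrite (_ : (fun m => _) = (fun m => (h m / 2 * x)^-1 *: ((@sin R \o shift 0) ((h m / 2 * x) *: 1) - sin 0))).
        exact: h1.
      by apply/funext => m; rewrite /GRing.scale /= sin0 subr0 mulr1 addr0.
    rewrite -[X in _ --> X](mul1r x).
    rewrite (_ : (fun m => _) = (fun m => (h m / 2 * x)^-1 * sin (h m / 2 * x) * x)).
      exact: cvgMr_tmp.
    by apply/funext => m; field; rewrite x0 gt_eqF.
  rewrite (_ : (fun m => c m x) = (fun m => ((2 / h m) * sin (h m / 2 * x)) ^+ 2)); last first.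
    apply/funext => m; rewrite /c.
    have -> : h m * x = h m / 2 * x + h m / 2 * x by field.
    rewrite cosD; have := cos2Dsin2 (h m / 2 * x); set s := sin _; set k := cos _ => hk.
    have -> : k * k = 1 - s ^+ 2 by rewrite -hk; ring.
    by field; rewrite gt_eqF.
  exact: (continuous_cvg _ (@exprn_continuous _ 2 _) sc).
pose S m (x : T) := \sum_(i < n) w i * c m (x i).
have cS m : cont_n n (S m).
  apply: (@cont_n_sum _ _ (fun i x => w i * c m (x i))) => i ni.
  apply: (@cont_n_coord _ _ (fun y => w i * c m y)) => // y.
  by apply: cvgM; [exact: cvg_cst|exact: cc].
have S0 m x : 0 <= S m x by apply: sumr_ge0 => i _; rewrite mulr_ge0.
pose F m (x : T) := Num.min 1 (t * S m x).
have F01 m x : 0 <= F m x <= 1.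
  by rewrite le_min ler01 mulr_ge0 //= ge_min lexx.
have rF m : rcyl n (F m).
  apply: (@rcyl_cont _ _ _ 1) => [|x].
    apply: (@cont_n_comp _ (fun y => Num.min 1 (t * y))) => // y.
    apply: (@continuous_comp2 (fun y : R => Num.min 1 y) (fun y => t * y)) => [|z]; first exact: min1_continuous.
    by apply: cvgM; [exact: cvg_cst|exact: cvg_id].
  by have /andP[a b] := F01 m x; rewrite ger0_norm.
have Fcv x : F m x @[m --> \oo] --> Num.min 1 (t * \sum_(i < n) w i * x i ^+ 2).
  apply: (continuous_cvg _ (@min1_continuous _)).
  apply: cvgMl_tmp; apply: (@cvg_sum_ord _ _ _ _ n (fun i m => w i * c m (x i)) (fun i => w i * x i ^+ 2)) => i.
  by apply: cvgMl_tmp; exact: ccv.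
have NF m : Re (N (fun x => ((F m x)%:C)%C)) <= t * \sum_(i < n) w i * q i.
  pose B : R := \sum_(i < n) w i * (2 / h m ^+ 2 * 2).
  have SB x : `|t * S m x| <= t * B.
    rewrite ger0_norm ?mulr_ge0 // ler_wpM2l // ler_sum // => i _.
    have hk : 1 - cos (h m * x i) <= 2 by have := cos_geN1 (h m * x i); set k := cos _ => k1; lra.
    apply: ler_wpM2l => //; apply: ler_wpM2l hk; by rewrite divr_ge0 ?sqr_ge0.
  have rS : rcyl n (fun x => t * S m x).
    apply: (rcyl_cont (M := t * B)) => //; apply: (@cont_n_comp _ (fun y => t * y)) => // y.
    by apply: cvgM; [exact: cvg_cst|exact: cvg_id].
  apply: le_trans (Nmono _ _ (rF m) rS _) _; first by move=> x; rewrite ge_min lexx orbT.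
  have lin := sN.1.
  have N1 : N (fun=> 1) = 1.
    have -> : (fun _ : T => 1 : R[i]) = cwave n (fun=> 0).
      by apply/funext => x; rewrite /cwave big1 ?cis0 // => i _; rewrite mul0r.
    by rewrite NE Q0 oppr0 mul0r expR0.
  pose wv i s : T -> R[i] := cwave n (fun j => if j == i then s * h m else 0).
  have wvE i s x : (i < n)%N -> wv i s x = cis (s * (h m * x i)).
    move=> ni; rewrite /wv /cwave (bigD1 (Ordinal ni)) //= eqxx big1 ?addr0 ?mulrA // => j nj.
    rewrite ifN ?mul0r //; apply: contra_neq nj => ji; exact: val_inj.
  have Nwv i s : (i < n)%N -> s ^+ 2 = 1 -> N (wv i s) = ((expR (- (h m ^+ 2 * q i) / 2))%:C)%C.
    by move=> ni s1; rewrite NE QE // exprMn s1 mul1r.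
  pose a : R := 2 / h m ^+ 2.
  have fE i x : (i < n)%N -> ((t * (w i * c m (x i)))%:C)%C =
      ((- (t * w i * a / 2))%:C)%C * wv i 1 x + (((- (t * w i * a / 2))%:C)%C * wv i (-1) x + ((t * w i * a)%:C)%C * 1).
    move=> ni; rewrite !wvE // mul1r mulN1r; apply: complex_eq; rewrite !ReImE /= ?cosN ?sinN /c -/a; last by ring.
    have alg (z v d k : R) : z * (v * (d * (1 - k))) = - (z * v * d / 2) * k + (- (z * v * d / 2) * k + z * v * d) by field.
    by rewrite alg; ring.
  have cf : forall i, (i < n)%N -> rcyl n (fun x => t * (w i * c m (x i))).
    move=> i ni; apply: (eq_cyl (f := fun x => ((- (t * w i * a / 2))%:C)%C * wv i 1 x +
        (((- (t * w i * a / 2))%:C)%C * wv i (-1) x + ((t * w i * a)%:C)%C * 1))).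
      by move=> x; rewrite fE.
    by apply: cyl_lin; [exact: cyl_wave|apply: cyl_lin; [exact: cyl_wave|exact: cyl_cst]].
  have Nf : forall i, (i < n)%N -> Re (N (fun x => ((t * (w i * c m (x i)))%:C)%C)) <= t * (w i * q i).
    move=> i ni; rewrite (_ : (fun x => _) = (fun x => ((- (t * w i * a / 2))%:C)%C * wv i 1 x +
        (((- (t * w i * a / 2))%:C)%C * wv i (-1) x + ((t * w i * a)%:C)%C * 1))); last first.
      by apply/funext => x; rewrite fE.
    rewrite lin; [|exact: cyl_wave|by apply: cyl_lin; [exact: cyl_wave|exact: cyl_cst]].
    rewrite lin; [|exact: cyl_wave|exact: cyl_cst].
    rewrite (sfunZ _ sN (cyl_cst n 1)) N1 !Nwv ?expr1n ?sqrrN ?expr1n // !ReImE /=.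
    have e1 := expR_ge1Dx (- (h m ^+ 2 * q i) / 2).
    set e := expR _ in e1 *.
    (* From [1 - exp (- z) <= z] at [z = h^2 q / 2]: the bound does not depend on [h], so it
       survives the limit. *)
    have e2 : a * (1 - e) <= q i.
      rewrite /a mulrAC ler_pdivrMr ?exprn_gt0 //; lra.
    have := ler_wpM2l (mulr_ge0 t0 (w0 i)) e2.
    by rewrite !mul0r !subr0 !mulr1; lra.
  have sumN k (kn : (k <= n)%N) : rcyl n (fun x => \sum_(i < k) t * (w i * c m (x i))) /\
      Re (N (fun x => ((\sum_(i < k) t * (w i * c m (x i)))%:C)%C)) <= \sum_(i < k) t * (w i * q i).
    elim: k kn => [|k IH] kn.
      split; first by apply: (eq_rcyl _ (rcyl_cst n 0)) => x; rewrite big_ord0.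
      rewrite (_ : (fun x => _) = (fun x => 0 * 1)).
        by rewrite (sfunZ _ sN (cyl_cst n 1)) mul0r big_ord0.
      by apply/funext => x; rewrite big_ord0 mul0r.
    have [r1 r2] := IH (ltnW kn); have rk := cf k kn.
    split; first by apply: (eq_rcyl _ (rcylD r1 rk)) => x; rewrite big_ord_recr.
    rewrite (_ : (fun x : T => _) = (fun x : T => 1 * ((\sum_(i < k) t * (w i * c m (x i)))%:C)%C + ((t * (w k * c m (x k)))%:C)%C)).
      by rewrite lin // mul1r ReImE big_ord_recr lerD // Nf.
    by apply/funext => x; rewrite big_ord_recr /= mul1r rmorphD.
  have [_] := sumN n (leqnn n); rewrite -mulr_sumr; apply: le_trans; rewrite le_eqVlt; apply/orP; left; apply/eqP.
  by congr (Re (N _)); apply/funext => x; rewrite /S mulr_sumr.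
have [cv _] : ccvg (fun m => N (fun x => ((F m x)%:C)%C)) (N (fun x => ((Num.min 1 (t * \sum_(i < n) w i * x i ^+ 2))%:C)%C)).
  apply: (sN.2 (fun m x => ((F m x)%:C)%C) _ 1) => [m|m x|x]; first exact: rF.
    by rewrite normc_real; have /andP[u v] := F01 m x; rewrite ger0_norm.
  exact: ccvg_real.
by rewrite -(cvg_lim _ cv) //; apply: limr_le; [apply/cvg_ex; eexists; exact: cv|apply: nearW].
Qed.
End MixtureTools.

Section MixtureIntegrals.
Context {R : realType}.
Local Notation T := (nat -> R).
Local Notation mu := (@lebesgue_measure R).

(** The exponential law [exp (- s) ds] is written with [s = u^20], as [20 u^19 exp (- u^20) du].
    Half of the exponent goes into the weight [halfw], the other half stays with the integrand
    ([mixk1], [mixk2]), which keeps the integrands bounded and continuous. A high even power is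
    chosen so that [u^19] still leaves [u^9] after the factor [1 / sqrt s = u^-10] of the mass
    bound. *)
Definition exp20 (u : R) : R := expR (- (u ^+ 20 / 2)).

Lemma exp20_ge0 u : 0 <= exp20 u. Proof. exact: expR_ge0. Qed.

Lemma exp20_continuous : continuous exp20.
Proof.
apply: (@continuous_comp2 R (@expR R) (fun u => - (u ^+ 20 / 2))); first exact: continuous_expR.
by move=> u; apply: cvgN; apply: cvgM; [exact: exprn_continuous|exact: cvg_cst].
Qed.

Lemma pow_le1D (x : R) k m : 0 <= x -> (k <= m)%N -> x ^+ k <= 1 + x ^+ m.
Proof.
move=> x0 km; have [x1|/ltW x1] := leP x 1.
  by apply: (@le_trans _ _ 1); [rewrite exprn_ile1|rewrite lerDl exprn_ge0].
by apply: (@le_trans _ _ (x ^+ m)); [rewrite ler_weXn2l|rewrite lerDr].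
Qed.

(** With [y = u^20], both [|u|^k <= 1 + y^2] and [exp (y / 2) >= (1 + y / 4)^2] hold, and
    [16 (1 + y / 4)^2 = (4 + y)^2] exceeds [1 + y^2]. *)
Lemma exp20_bound (u : R) k : (k <= 40)%N -> `|u| ^+ k * exp20 u <= 16.
Proof.
move=> k40; rewrite /exp20 expRN ler_pdivrMr ?expR_gt0 //.
apply: le_trans (pow_le1D (normr_ge0 u) k40) _.
have y0 : 0 <= u ^+ 20 / 2 by rewrite divr_ge0 // exprn_even_ge0.
have -> : `|u| ^+ 40 = (u ^+ 20) ^+ 2 by rewrite -exprM -normrX ger0_norm // exprn_even_ge0.
have h1 := expR_ge1Dx (u ^+ 20 / 4).
have h2 : expR (u ^+ 20 / 2) = expR (u ^+ 20 / 4) ^+ 2 by rewrite expr2 -expRD; congr expR; field.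
rewrite h2; set e := expR _ in h1 *; set y := u ^+ 20 in y0 h1 *; nra.
Qed.

Definition halfw (u : R) : R := 20 * (\1_`[0, +oo[ u * exp20 u).

Lemma halfw_ge0 u : 0 <= halfw u.
Proof. by rewrite /halfw mulr_ge0 // mulr_ge0 ?exp20_ge0 // indicE ler0n. Qed.

Lemma halfw_measurable : measurable_fun setT halfw.
Proof.
apply: measurable_funM => //; apply: measurable_funM.
  by apply: measurable_indic; exact: measurable_itv.
by apply: continuous_measurable_fun; exact: exp20_continuous.
Qed.

Lemma halfw_integrable : mu.-integrable setT (EFin \o halfw).
Proof.
apply: (@integrable_le _ _ (fun t => 20 * expR 1 * expR (- (t ^+ 2 / 2)))).
- exact: halfw_measurable.
- move=> t; rewrite ger0_norm ?halfw_ge0 // /halfw -mulrA ler_wpM2l //.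
  apply: (@le_trans _ _ (exp20 t)).
    by rewrite ler_piMl ?exp20_ge0 // indicE lern1 leq_b1.
  rewrite /exp20 -expRD ler_expR.
  have h : t ^+ 2 <= 1 + t ^+ 20.
    have := @pow_le1D `|t| 2 20 (normr_ge0 t) isT.
    by rewrite -!normrX !ger0_norm ?exprn_even_ge0.
  lra.
- by apply: rintegrableZ; exact: integrable_gauss_half.
Qed.

Lemma halfw_integrableM (f : R -> R) B : measurable_fun setT f -> (forall t, `|f t| <= B) ->
  mu.-integrable setT (EFin \o (fun t => halfw t * f t)).
Proof. by move=> mf fB; apply: (bounded_integrableM halfw_integrable mf fB). Qed.

Lemma halfw_integral_le (f g : R -> R) B C : measurable_fun setT f -> (forall t, `|f t| <= B) ->
  measurable_fun setT g -> (forall t, `|g t| <= C) -> (forall t, f t <= g t) ->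
  \int[mu]_t (halfw t * f t) <= \int[mu]_t (halfw t * g t).
Proof.
move=> mf fB mg gC fg; apply: le_Rintegral => //; first exact: halfw_integrableM fB.
  exact: halfw_integrableM gC.
by move=> t _; rewrite ler_wpM2l ?halfw_ge0.
Qed.

Definition mixk1 (u : R) : R := `|u| ^+ 19 * exp20 u.

(** This is [mixk1 u * sqrt (1 + e / u^20)], the density of the variance times the mass bound of one
    direction, in a form continuous at [u = 0]. *)
Definition mixk2 (e u : R) : R := `|u| ^+ 9 * (Num.sqrt (u ^+ 20 + e) * exp20 u).

Lemma normX_continuous k : continuous (fun u : R => `|u| ^+ k).
Proof. by apply: continuousX2; exact: norm_continuous. Qed.

Lemma sqrt20_continuous e : continuous (fun u : R => Num.sqrt (u ^+ 20 + e)).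
Proof.
apply: (@continuous_comp2 R Num.sqrt); first exact: sqrt_continuous.
by move=> u; apply: cvgD; [exact: exprn_continuous|exact: cvg_cst].
Qed.

Lemma mixk1_continuous : continuous mixk1.
Proof. by apply: continuousM2; [exact: normX_continuous|exact: exp20_continuous]. Qed.

Lemma mixk2_continuous e : continuous (mixk2 e).
Proof.
apply: continuousM2; first exact: normX_continuous.
by apply: continuousM2; [exact: sqrt20_continuous|exact: exp20_continuous].
Qed.

Lemma mixk1_ge0 u : 0 <= mixk1 u.
Proof. by rewrite mulr_ge0 ?exprn_ge0 // exp20_ge0. Qed.

Lemma mixk2_ge0 e u : 0 <= mixk2 e u.
Proof. by rewrite mulr_ge0 ?exprn_ge0 // mulr_ge0 ?sqrtr_ge0 // exp20_ge0. Qed.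

Lemma mixk1_le u : `|mixk1 u| <= 16.
Proof. by rewrite ger0_norm ?mixk1_ge0 // exp20_bound. Qed.

Lemma sqrt20_le e (u : R) : 0 <= e <= 1 -> Num.sqrt (u ^+ 20 + e) <= `|u| ^+ 10 + 1.
Proof.
move=> /andP[e0 e1]; have a0 : 0 <= `|u| ^+ 10 by rewrite exprn_ge0.
rewrite -(@ler_pXn2r _ 2) ?nnegrE ?addr_ge0 ?sqrtr_ge0 // sqr_sqrtr ?addr_ge0 ?exprn_even_ge0 //.
have -> : u ^+ 20 = (`|u| ^+ 10) ^+ 2 by rewrite -exprM -normrX ger0_norm // exprn_even_ge0.
by set a := `|u| ^+ 10 in a0 *; nra.
Qed.

Lemma sqrt20_bound e k (u : R) : 0 <= e <= 1 -> (k <= 30)%N ->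
  `|u| ^+ k * (Num.sqrt (u ^+ 20 + e) * exp20 u) <= 32.
Proof.
move=> e01 k30; apply: (@le_trans _ _ (`|u| ^+ k * ((`|u| ^+ 10 + 1) * exp20 u))).
  by rewrite ler_wpM2l ?exprn_ge0 // ler_wpM2r ?sqrt20_le // exp20_ge0.
have h1 : `|u| ^+ (k + 10) * exp20 u <= 16 by apply: exp20_bound; rewrite -(leq_add2r 10) in k30.
have h2 : `|u| ^+ k * exp20 u <= 16 by apply: exp20_bound; exact: leq_trans k30 _.
by rewrite exprD in h1; lra.
Qed.

Lemma mixk2_le e u : 0 <= e <= 1 -> `|mixk2 e u| <= 32.
Proof. by move=> e01; rewrite ger0_norm ?mixk2_ge0 // sqrt20_bound. Qed.

(* The Laplace transform of the exponential law, written in the variable [u ^+ 20]. *)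
Lemma mixk1_laplace (z : R) : 0 <= z ->
  \int[mu]_u (halfw u * (mixk1 u * expR (- (z * u ^+ 20)))) = (1 + z)^-1.
Proof.
move=> z0; have z1 : 1 + z != 0 by rewrite gt_eqF // ltr_pwDl.
pose F (u : R) := - (1 + z)^-1 * expR (- (1 + z) * u ^+ 20).
pose f (u : R) := 20 * u ^+ 19 * expR (- (1 + z) * u ^+ 20).
have dF u : is_derive u (1 : R) F (f u).
  apply: (dv_eq (dvZ _ (dv_comp (is_derive_expR _) (dvZ (- (1 + z)) (dvX 20 u))))).
  by rewrite /f /=; field.
have cf : continuous f.
  apply: continuousM2; first by apply: continuousM2; [exact: cst_continuous|exact: exprn_continuous].
  apply: (@continuous_comp2 R (@expR R)); first exact: continuous_expR.
  by apply: continuousM2; [exact: cst_continuous|exact: exprn_continuous].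
have E u : halfw u * (mixk1 u * expR (- (z * u ^+ 20))) = \1_`[0, +oo[ u * f u.
  rewrite /halfw /mixk1 /f /exp20 indicE; case: (boolP (u \in _)) => [|_]; last by rewrite !mul0r mulr0 mul0r.
  rewrite inE /= in_itv /= andbT => u0; rewrite ger0_norm // !mul1r.
  rewrite (_ : - (1 + z) * u ^+ 20 = - (u ^+ 20 / 2) + - (u ^+ 20 / 2) + - (z * u ^+ 20)); last by field.
  by rewrite !expRD; ring.
have Ei : mu.-integrable setT (EFin \o (fun u => \1_`[0, +oo[ u * f u)).
  have mg : measurable_fun setT (fun u => mixk1 u * expR (- (z * u ^+ 20))).
    apply: continuous_measurable_fun; apply: continuousM2; first exact: mixk1_continuous.
    apply: (@continuous_comp2 R (@expR R)); first exact: continuous_expR.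
    by move=> u; apply: cvgN; apply: cvgM; [exact: cvg_cst|exact: exprn_continuous].
  apply: eq_integrable (@halfw_integrableM _ 16 mg _) => //.
    by move=> u _; rewrite /= E.
  move=> u; rewrite normrM (ger0_norm (expR_ge0 _)) -[leRHS]mulr1 ler_pM ?expR_ge0 ?mixk1_le //.
  by rewrite expR_le1 oppr_le0 mulr_ge0 // exprn_even_ge0.
under eq_Rintegral do rewrite E.
rewrite (@halfline_integral R f F 0 0 cf dF Ei).
  by rewrite /F expr0n /= mulr0 expR0 mulr1; ring.
rewrite /F -[X in _ --> X](mulr0 (- (1 + z)^-1)); apply: cvgMl_tmp.
have c1 : n.+1%:R^-1 @[n --> \oo] --> (0 : R) by exact: cvg_harmonic.
apply: (squeeze_cvgr _ (cvg_cst (0 : R)) c1); apply: nearW => n.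
have E20 : expR (- (1 + z) * (0 + n%:R) ^+ 20) = (expR ((1 + z) * n%:R ^+ 20))^-1 :> R.
  by rewrite add0r mulNr expRN.
rewrite expR_ge0 /= E20 lef_pV2 ?posrE ?expR_gt0 //; apply: le_trans (expR_ge1Dx _).
have h1 : n%:R <= n%:R ^+ 20 :> R.
  by rewrite -natrX ler_nat; case: (n) => // m; rewrite -{1}(expn1 m.+1) leq_pexp2l.
have h2 : n%:R ^+ 20 <= (1 + z) * n%:R ^+ 20 :> R.
  by rewrite mulrDl mul1r lerDl mulr_ge0 // exprn_ge0.
by rewrite -natr1 addrC lerD2l (le_trans h1 h2).
Qed.

Definition mixC : R := \int[mu]_u (halfw u * (`|u| ^+ 4 * exp20 u)).

Lemma exp20_pow_measurable k : measurable_fun setT (fun u : R => `|u| ^+ k * exp20 u).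
Proof.
apply: continuous_measurable_fun; apply: continuousM2; first exact: normX_continuous.
exact: exp20_continuous.
Qed.

Lemma exp20_pow_bound k (u : R) : (k <= 40)%N -> `| `|u| ^+ k * exp20 u| <= 16.
Proof. by move=> k40; rewrite ger0_norm ?exp20_bound // mulr_ge0 ?exprn_ge0 // exp20_ge0. Qed.

Lemma mixC_ge0 : 0 <= mixC.
Proof.
apply: Rintegral_ge0 => u _; rewrite mulr_ge0 ?halfw_ge0 //.
by rewrite mulr_ge0 ?exprn_ge0 // exp20_ge0.
Qed.

(** With [a = |u|^5], so that [u^20 = a^4], the pointwise inequality is
    [a^2 (a^4 + e^4) <= (a^3 + e^3)^2]. The excess over mass [1] is thus of order [e^3], which is
    what must be summable over the coordinates. *)
Lemma mixk2_integral e : 0 <= e <= 1 ->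
  \int[mu]_u (halfw u * mixk2 (e ^+ 4) u) <= 1 + mixC * e ^+ 3.
Proof.
move=> /andP[e0 e1]; have e41 : 0 <= e ^+ 4 <= 1 by rewrite exprn_ge0 //= exprn_ile1.
pose g (u : R) := mixk1 u + e ^+ 3 * (`|u| ^+ 4 * exp20 u).
have -> : 1 + mixC * e ^+ 3 = \int[mu]_u (halfw u * g u).
  have i1 : mu.-integrable setT (EFin \o (fun u => halfw u * mixk1 u)).
    by apply: (halfw_integrableM _ mixk1_le); apply: continuous_measurable_fun; exact: mixk1_continuous.
  have i2 : mu.-integrable setT (EFin \o (fun u => halfw u * (`|u| ^+ 4 * exp20 u))).
    by apply: (@halfw_integrableM _ 16 (exp20_pow_measurable 4)) => u; exact: exp20_pow_bound.
  rewrite /g; under [RHS]eq_Rintegral do rewrite mulrDr (mulrCA _ (e ^+ 3)).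
  rewrite RintegralD //; last exact: (rintegrableZ (e ^+ 3) i2).
  rewrite RintegralZl // mulrC; congr (_ + _).
  have := mixk1_laplace (lexx 0); rewrite addr0 invr1 => <-.
  by apply: eq_Rintegral => u _; rewrite mul0r oppr0 expR0 mulr1.
apply: (@halfw_integral_le _ _ 32 (16 + e ^+ 3 * 16)).
- by apply: continuous_measurable_fun; exact: mixk2_continuous.
- by move=> u; exact: mixk2_le.
- apply: measurable_funD; first by apply: continuous_measurable_fun; exact: mixk1_continuous.
  by apply: measurable_funM => //; exact: exp20_pow_measurable.
- move=> u; apply: le_trans (ler_normD _ _) _; rewrite lerD ?mixk1_le //.
  by rewrite normrM ger0_norm ?exprn_ge0 // ler_wpM2l ?exprn_ge0 // exp20_pow_bound.
move=> u; pose a := `|u| ^+ 5; have a0 : 0 <= a by rewrite exprn_ge0.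
have -> : mixk2 (e ^+ 4) u = `|u| ^+ 4 * exp20 u * (a * Num.sqrt (a ^+ 4 + e ^+ 4)).
  have u20 : u ^+ 20 = a ^+ 4 by rewrite /a -exprM -normrX ger0_norm // exprn_even_ge0.
  rewrite /mixk2 u20 /a; set r := Num.sqrt _; ring.
have -> : g u = `|u| ^+ 4 * exp20 u * (a ^+ 3 + e ^+ 3) by rewrite /g /mixk1 /a; ring.
rewrite ler_wpM2l //; first by rewrite mulr_ge0 ?exprn_ge0 // exp20_ge0.
have r0 : 0 <= a ^+ 4 + e ^+ 4 by rewrite addr_ge0 ?exprn_ge0.
rewrite -(@ler_pXn2r _ 2) ?nnegrE ?mulr_ge0 ?addr_ge0 ?exprn_ge0 ?sqrtr_ge0 // exprMn sqr_sqrtr //.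
have h : a ^+ 2 * e ^+ 4 <= 2 * a ^+ 3 * e ^+ 3 + e ^+ 6.
  have [ae|/ltW ae] := leP a e.
    apply: (@le_trans _ _ (e ^+ 2 * e ^+ 4)); first by rewrite ler_wpM2r ?exprn_ge0 // lerXn2r ?nnegrE.
    by rewrite -exprD lerDr !mulr_ge0 ?exprn_ge0.
  apply: (@le_trans _ _ (a ^+ 3 * e ^+ 3)).
    rewrite (_ : a ^+ 2 * e ^+ 4 = (a ^+ 2 * e ^+ 3) * e); last by ring.
    rewrite (_ : a ^+ 3 * e ^+ 3 = (a ^+ 2 * e ^+ 3) * a); last by ring.
    by rewrite ler_wpM2l // mulr_ge0 ?exprn_ge0.
  have p1 : 0 <= a ^+ 3 * e ^+ 3 by rewrite mulr_ge0 ?exprn_ge0.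
  have p2 : 0 <= e ^+ 6 by rewrite exprn_ge0.
  lra.
rewrite (_ : a ^+ 2 * (a ^+ 4 + e ^+ 4) = a ^+ 6 + a ^+ 2 * e ^+ 4); last by ring.
rewrite (_ : (a ^+ 3 + e ^+ 3) ^+ 2 = a ^+ 6 + (2 * a ^+ 3 * e ^+ 3 + e ^+ 6)); last by ring.
by rewrite lerD2l.
Qed.

Definition axis (k i : nat) : R := (i == k)%:R.

Definition mixw (k : nat) (t : R) : R[i] := ((halfw t)%:C)%C.

Lemma mixw_integrable k : cintegrable mu (mixw k).
Proof.
split; first exact: halfw_integrable.
exact: integrable0.
Qed.

(** Convolving along the coordinate axes integrates a product function one variable at a time; this
    is the only instance of Fubini that the average over the variances requires. *)
Lemma convs_prod n m (phi : nat -> R -> R) : (m <= n)%N ->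
  (forall j, (j < m)%N -> measurable_fun setT (phi j)) ->
  (forall j, (j < m)%N -> exists B, forall t, `|phi j t| <= B) ->
  convs mixw axis m (fun x => ((\prod_(j < n) phi j (x j))%:C)%C) (fun=> 0) =
  ((\prod_(j < n) (if (j < m)%N then \int[mu]_t (halfw t * phi j t) else phi j 0))%:C)%C.
Proof.
elim: m phi => [|m IH] phi mn mphi bphi //=.
pose phi' j := if j == m then fun y => \int[mu]_t (halfw t * phi m (y + t)) else phi j.
have -> : conv (mixw m) (axis m) (fun x => ((\prod_(j < n) phi j (x j))%:C)%C) =
    (fun x => ((\prod_(j < n) phi' j (x j))%:C)%C).
  apply/funext => x; pose P := \prod_(j < n | j != Ordinal mn) phi j (x j).
  have E t : \prod_(j < n) phi j (line x (axis m) t j) = P * phi m (x m + t).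
    rewrite (bigD1 (Ordinal mn)) //= /line /axis eqxx mulr1 mulrC; congr (_ * _).
    by apply: eq_bigr => j nj; rewrite (_ : (nat_of_ord j == m) = false) ?mulr0 ?addr0 //; apply/negP => /eqP jm; case/eqP: nj; exact: val_inj.
  have E' : \prod_(j < n) phi' j (x j) = P * \int[mu]_t (halfw t * phi m (x m + t)).
    rewrite (bigD1 (Ordinal mn)) //= /phi' eqxx mulrC; congr (_ * _).
    by apply: eq_bigr => j nj; rewrite ifN //; apply: contra_neq nj => jm; exact: val_inj.
  rewrite E'; apply: complex_eq => /=; last first.
    by rewrite /Rintegral (eq_integral (fun=> 0%E)) ?integral0 // => t _; rewrite mulr0 mul0r addr0.
  have [B hB] := bphi m (ltnSn m).
  have mt : measurable_fun setT (fun t => phi m (x m + t)).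
    by apply: (measurableT_comp (mphi m (ltnSn m))); apply: measurable_funD.
  rewrite -RintegralZl //; last by apply: (halfw_integrableM mt (B := B)) => t; exact: hB.
  by apply: eq_Rintegral => t _; rewrite E mulr0 subr0; ring.
rewrite IH ?(ltnW mn) //.
- congr ((_ %:C)%C); apply: eq_bigr => j _; rewrite /phi' [in RHS]ltnS [in RHS]leq_eqVlt.
  have [jm|//=] := eqVneq (nat_of_ord j) m.
  by rewrite jm ltnn /=; apply: eq_Rintegral => t _; rewrite add0r.
- by move=> j jm; rewrite /phi' ltn_eqF //; apply: mphi; exact: ltnW.
- by move=> j jm; rewrite /phi' ltn_eqF //; apply: bphi; exact: ltnW.
Qed.
End MixtureIntegrals.

Section Kernels.
Context {R : realType}.
Local Notation T := (nat -> R).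
Local Notation mu := (@lebesgue_measure R).
Implicit Types (L : (T -> R[i]) -> R[i]) (Phi : (T -> R[i]) -> T -> R[i]).

Lemma sfun0 n : sfun n (fun _ : T -> R[i] => 0).
Proof. by split=> [a f g _ _|F f M _ _ _]; [rewrite mulr0 addr0|exact: ccvg_cst]. Qed.

Lemma sfun_scale n c L : sfun n L -> sfun n (fun f => c * L f).
Proof.
move=> [l k]; split=> [a f g cf cg|F f M cF FM Ff].
  by rewrite l //; ring.
by apply: ccvgZ; exact: k cF FM Ff.
Qed.

(** The kernels [Phi] are obtained by choice, so nothing is known a priori about their dependence on
    [u]. It suffices that waves are sent to cylinder functions of [u], where formulas are explicit;
    linearity and bounded limits give the rest. *)
Lemma cyl_kernel n Phi B : (forall u, sfun n (fun f => Phi f u)) ->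
  (forall f M u, cyl n f -> (forall x, normc (f x) <= M) -> normc (Phi f u) <= B * M) ->
  (forall xi, cyl n (Phi (cwave n xi))) -> forall f, cyl n f -> cyl n (Phi f).
Proof.
move=> sP bP wP f; elim=> [xi|a {}f g cf hf cg hg|F {}f M cF hF FM Ff].
- exact: wP.
- by apply: (eq_cyl _ (cyl_lin a hf hg)) => u; rewrite (sP u).1.
- apply: (cyl_lim hF (M := B * M)) => [k u|u]; first exact: bP.
  exact: (sP u).2 cF FM Ff.
Qed.

Lemma sfun_kernel n L Phi B : (forall u, sfun n (fun f => Phi f u)) ->
  (forall f M u, cyl n f -> (forall x, normc (f x) <= M) -> normc (Phi f u) <= B * M) ->
  (forall xi, cyl n (Phi (cwave n xi))) -> sfun n L -> sfun n (fun f => L (Phi f)).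
Proof.
move=> sP bP wP [l k]; have cP := cyl_kernel sP bP wP.
split=> [a f g cf cg|F f M cF FM Ff].
  rewrite -l; [|exact: cP|exact: cP].
  by congr (L _); apply/funext => u; exact: (sP u).1.
apply: (k _ _ (B * M)) => [j|j u|u]; first exact: cP.
  exact: bP.
exact: (sP u).2 cF FM Ff.
Qed.

(** The inverse of [y = u^20] is the limit of [y / (y^2 + del)], also at [y = 0] because the inverse
    of [0] is [0]. These regularised integrands are continuous, with a common bound. *)
Lemma rcyl_mixk2 n j (e a c : R) : (j < n)%N -> 0 <= e <= 1 -> 0 <= a -> 0 <= c ->
  rcyl n (fun u => mixk2 e (u j) * expR (- (a * u j ^+ 20 + c / u j ^+ 20) / 2)).
Proof.
move=> jn e01 a0 c0; have y0 (y : R) : 0 <= y ^+ 20 by exact: exprn_even_ge0.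
pose del k : R := k.+1%:R^-1; have d0 k : 0 < del k by rewrite invr_gt0.
pose q k (y : R) := y ^+ 20 * (y ^+ 20 * y ^+ 20 + del k)^-1.
have den k y : 0 < y ^+ 20 * y ^+ 20 + del k.
  by apply: ltr_wpDl (d0 k); apply: mulr_ge0; exact: y0.
have q0 k y : 0 <= q k y by rewrite mulr_ge0 // invr_ge0 ltW.
have cq k : continuous (q k).
  move=> y; apply: cvgM; first exact: exprn_continuous.
  apply: cvgV; first by rewrite gt_eqF.
  by apply: cvgD; [apply: cvgM; exact: exprn_continuous|exact: cvg_cst].
pose g k y := mixk2 e y * expR (- (a * y ^+ 20 + c * q k y) / 2).
apply: (@rcyl_cvg _ n (fun k u => g k (u j)) _ 32) => [k|k u|u].
- apply: (@rcyl_coord _ n j (g k) 32 jn) => [|y].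
    apply: continuousM2; first exact: mixk2_continuous.
    apply: (@continuous_comp2 R (@expR R)); first exact: continuous_expR.
    move=> y; apply: cvgM; last exact: cvg_cst.
    apply: cvgN; apply: cvgD; apply: cvgM; try exact: cvg_cst; first exact: exprn_continuous.
    exact: cq.
  rewrite normrM (ger0_norm (expR_ge0 _)) -[leRHS]mulr1 ler_pM ?expR_ge0 ?mixk2_le //.
  by rewrite expR_le1 mulNr oppr_le0 divr_ge0 // addr_ge0 // mulr_ge0.
- rewrite /g normrM (ger0_norm (expR_ge0 _)) -[leRHS]mulr1 ler_pM ?expR_ge0 ?mixk2_le //.
  by rewrite expR_le1 mulNr oppr_le0 divr_ge0 // addr_ge0 // mulr_ge0.
- apply: cvgMl_tmp; apply: (continuous_cvg _ (@continuous_expR R _)).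
  apply: cvgMr_tmp; apply: cvgN; apply: cvgD; first exact: cvg_cst.
  apply: cvgMl_tmp; rewrite /q; move: (u j ^+ 20) => y.
  have [->|yn0] := eqVneq y 0.
    by rewrite invr0; apply: cvg_near_cst; apply: nearW => k; rewrite mul0r.
  have -> : y^-1 = y * (y * y + 0)^-1 by rewrite addr0 invfM mulVKf.
  apply: cvgMl_tmp; apply: cvgV; first by rewrite addr0 mulf_neq0.
  by apply: cvgD; [exact: cvg_cst|exact: cvg_harmonic].
Qed.

Definition mixcv n (f : T -> R) : R := Re (convs (@mixw R) axis n (fun u => ((f u)%:C)%C) (fun=> 0)).

Lemma mixw_le k t : normc (@mixw R k t) <= 1 * halfw t.
Proof. by rewrite normc_real ger0_norm ?halfw_ge0 // mul1r. Qed.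

Lemma normc_mix_le n (F : T -> R[i]) g : cyl n F -> rcyl n g -> (forall u, normc (F u) <= g u) ->
  normc (convs (@mixw R) axis n F (fun=> 0)) <= mixcv n g.
Proof.
move=> cF rg Fg.
have := @normc_convs_le R n (@mixw R) axis n F g (fun=> @halfw R) (fun=> 1) (fun=> 0)
  (@mixw_integrable R) (@mixw_integrable R) (fun=> ler01) mixw_le cF rg Fg.
by rewrite big1 // mul1r.
Qed.

Lemma mixcv_lin n a f g : rcyl n f -> rcyl n g -> mixcv n (fun u => a * f u + g u) = a * mixcv n f + mixcv n g.
Proof.
move=> rf rg; have [l _] := sfun_convs n (@axis R) n (fun=> 0) (@mixw_integrable R).
rewrite /mixcv (_ : (fun u => _) = (fun u => (a%:C)%C * ((f u)%:C)%C + ((g u)%:C)%C)).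
  by rewrite l // !ReImE mul0r subr0.
by apply/funext => u; rewrite rmorphD rmorphM.
Qed.

Lemma mixcv_mono n f g : rcyl n f -> rcyl n g -> (forall u, f u <= g u) -> mixcv n f <= mixcv n g.
Proof.
move=> rf rg fg; have rd := rcylB rg rf.
have h : 0 <= mixcv n (fun u => g u - f u).
  apply: le_trans (normc_ge0 _) (normc_mix_le (cyl_cst n 0) rd _) => u.
  by rewrite Normc.normc0 subr_ge0.
have -> : mixcv n g = 1 * mixcv n (fun u => g u - f u) + mixcv n f.
  by rewrite -mixcv_lin //; congr mixcv; apply/funext => u; rewrite mul1r subrK.
by rewrite mul1r lerDr.
Qed.

Lemma mixcv_prod n (phi : nat -> R -> R) : (forall j, measurable_fun setT (phi j)) ->
  (forall j, exists B, forall t, `|phi j t| <= B) ->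
  mixcv n (fun u => \prod_(j < n) phi j (u j)) = \prod_(j < n) \int[mu]_t (halfw t * phi j t).
Proof.
move=> mphi bphi.
rewrite /mixcv (convs_prod (leqnn n) (fun j _ => mphi j) (fun j _ => bphi j)) Re_real.
by apply: eq_bigr => j _; rewrite ltn_ord.
Qed.

Lemma mixcv_sum n m (F : nat -> T -> R) (c : nat -> R) : (forall i, (i < m)%N -> rcyl n (F i)) ->
  rcyl n (fun u => \sum_(i < m) c i * F i u) /\
  mixcv n (fun u => \sum_(i < m) c i * F i u) = \sum_(i < m) c i * mixcv n (F i).
Proof.
elim: m => [|m IH] h.
  split; first by apply: (eq_rcyl _ (rcyl_cst n 0)) => u; rewrite big_ord0.
  rewrite (_ : (fun u => \sum_(i < 0) c i * F i u) = (fun=> 0)); last by apply/funext => u; rewrite big_ord0.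
  rewrite big_ord0; have := mixcv_lin 1 (rcyl_cst n 0) (rcyl_cst n 0).
  rewrite (_ : (fun _ => _) = (fun=> 0)); last by apply/funext => u; rewrite mulr0 addr0.
  lra.
have [r1 e1] := IH (fun i im => h i (ltnW im)); have rm := h m (ltnSn m).
split; first by apply: (eq_rcyl _ (rcylD (rcylZ (c m) rm) r1)) => u; rewrite big_ord_recr addrC.
rewrite (_ : (fun u => _) = (fun u => c m * F m u + \sum_(i < m) c i * F i u)).
  by rewrite mixcv_lin // e1 big_ord_recr addrC.
by apply/funext => u; rewrite big_ord_recr addrC.
Qed.

Lemma mixk12 (e u : R) : 0 <= e -> u != 0 ->
  mixk1 u * Num.sqrt (1 + e / u ^+ 20) = mixk2 e u.
Proof.
move=> e0 u0; have a0 : 0 < `|u| by rewrite normr_gt0.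
have u20 : u ^+ 20 = (`|u| ^+ 10) ^+ 2 by rewrite -exprM -normrX ger0_norm // exprn_even_ge0.
have un0 : u ^+ 20 != 0 by rewrite expf_neq0.
have -> : 1 + e / u ^+ 20 = (u ^+ 20 + e) / u ^+ 20 by rewrite mulrDl mulfV.
rewrite sqrtrM ?addr_ge0 ?exprn_even_ge0 // sqrtrV ?exprn_even_ge0 // {2}u20 sqrtr_sqr ger0_norm ?exprn_ge0 //.
rewrite /mixk1 /mixk2; set s := Num.sqrt _; field.
by rewrite gt_eqF.
Qed.

Lemma min1_add (x y : R) : 0 <= x -> 0 <= y -> Num.min 1 (x + y) <= Num.min 1 x + Num.min 1 y.
Proof.
move=> x0 y0; have [h1|h1] := leP 1 x; have [h2|h2] := leP 1 y; have [h3|h3] := leP 1 (x + y); lra.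
Qed.

Lemma min1_sum m (F : nat -> R) : (forall i, 0 <= F i) ->
  Num.min 1 (\sum_(i < m) F i) <= \sum_(i < m) Num.min 1 (F i).
Proof.
move=> F0; elim: m => [|m IH]; first by rewrite !big_ord0 ge_min lexx orbT.
rewrite !big_ord_recr /=; apply: le_trans (min1_add _ _) _ => //; first exact: sumr_ge0.
by rewrite lerD2r.
Qed.

Lemma min1_pow (z : R) : 0 <= z -> Num.min 1 (z ^+ 20) <= z ^+ 9.
Proof.
move=> z0; have [z1|/ltW z1] := leP z 1.
  by rewrite ge_min (ler_wiXn2l z0 z1 (isT : (9 <= 20)%N)) orbT.
by rewrite ge_min (exprn_ege1 9 z1).
Qed.
End Kernels.

(** * Uniform estimates for the mixture with [beta_i = i^(5/2)] *)

Section PathFunctional.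
Context {R : realType} (gamma : R) (hgamma : 7 / 2 < gamma).
Local Notation T := (nat -> R).
Local Notation mu := (@lebesgue_measure R).
Local Notation wm := (l2weight (- gamma)).

Lemma succ_powD i (a b : R) : (i.+1%:R : R) `^ a * i.+1%:R `^ b = i.+1%:R `^ (a + b).
Proof. by rewrite powRD // pnatr_eq0 implybT. Qed.

Lemma succ_powX i (a : R) k : ((i.+1%:R : R) `^ a) ^+ k = i.+1%:R `^ (a * k%:R).
Proof. by rewrite powRrM powR_mulrn // powR_ge0. Qed.

Lemma succ_pow1 i : (i.+1%:R : R) `^ 1 = i.+1%:R.
Proof. by rewrite powRr1. Qed.

Definition mixbeta (i : nat) : R := i.+1%:R `^ (5 / 2).

Lemma mixbeta_gt0 i : 0 < mixbeta i. Proof. by rewrite powR_gt0. Qed.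

(** Fourth root of [i / beta_i = i^(-3/2)], where [i] stands for the shifted index; its cube
    [i^(-9/8)] is the summable excess of mass given by [mixk2_integral]. *)
Definition mixe (i : nat) : R := i.+1%:R `^ (- (3 / 8)).

Lemma mixe_itv i : 0 <= mixe i <= 1.
Proof.
rewrite powR_ge0 /= -[leRHS](powRr0 (i.+1%:R)) ler_powR ?ler1n //.
Qed.

Lemma mixe4 i : mixe i ^+ 4 = i.+1%:R / mixbeta i.
Proof.
have h := mixbeta_gt0 i; apply: (mulIf (lt0r_neq0 h)); rewrite divfK ?lt0r_neq0 //.
by rewrite /mixe /mixbeta succ_powX succ_powD -[RHS]succ_pow1; congr (_ `^ _); field.
Qed.

Lemma mixe3 i : mixe i ^+ 3 = i.+1%:R `^ (- (1 + 1 / 8)).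
Proof. by rewrite /mixe succ_powX; congr (_ `^ _); field. Qed.

Definition mixS9 : R := limn (series (fun i => i.+1%:R `^ (- (1 + 1 / 8)) : R)).

(** The sum of the [i^(- gamma) beta_i], that is, of the variances measured in the norm of
    [l2 (- gamma)]. The exponent is written so as to show that convergence amounts to
    [gamma > 7 / 2]. *)
Definition mixSB : R := limn (series (fun i => i.+1%:R `^ (- (1 + (gamma - 7 / 2))) : R)).

(** Bounds, uniformly in the column [j], the squared norm in [l2 (- gamma)] of the column [j] of
    [minK], via [minK i j <= i + 1]. *)
Definition mixcK : R := limn (series (fun i => i.+1%:R `^ (- (1 + (gamma - 3))) : R)).

Lemma mixS9_le n : \sum_(i < n) (i.+1%:R : R) `^ (- (1 + 1 / 8)) <= mixS9.
Proof. by apply: series_le_lim => [i|]; [exact: powR_ge0|apply: cvg_pseries]. Qed.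

Lemma mixSB_le n : \sum_(i < n) wm i * mixbeta i <= mixSB.
Proof.
rewrite (eq_bigr (fun i : 'I_n => (i.+1%:R : R) `^ (- (1 + (gamma - 7 / 2))))) => [|i _].
  by apply: series_le_lim => [i|]; [exact: powR_ge0|apply: cvg_pseries; rewrite subr_gt0].
by rewrite /l2weight /mixbeta succ_powD; congr (_ `^ _); field.
Qed.

Lemma mixcK_le n j : \sum_(i < n) wm i * minK i j ^+ 2 <= mixcK.
Proof.
apply: (@le_trans _ _ (\sum_(i < n) (i.+1%:R : R) `^ (- (1 + (gamma - 3))))).
  apply: ler_sum => i _.
  have -> : (i.+1%:R : R) `^ (- (1 + (gamma - 3))) = wm i * (i.+1%:R : R) ^+ 2.
    by rewrite -(succ_pow1 i) succ_powX /l2weight !powRr1 // succ_powD; congr (_ `^ _); field.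
  rewrite ler_wpM2l ?l2weight_ge0 // lerXn2r ?nnegrE ?ler0n //.
  by rewrite /minK ler_nat geq_minl.
by apply: series_le_lim => [i|]; [exact: powR_ge0|apply: cvg_pseries; move: hgamma; lra].
Qed.

Lemma mixS9_ge0 : 0 <= mixS9. Proof. by have := mixS9_le 0; rewrite big_ord0. Qed.

Lemma mixSB_ge0 : 0 <= mixSB. Proof. by have := mixSB_le 0; rewrite big_ord0. Qed.

Lemma mixcK_ge0 : 0 <= mixcK. Proof. by have := mixcK_le 0 0; rewrite big_ord0. Qed.

Definition mixM : R := expR (@mixC R * mixS9).

Lemma mixM_ge n : \prod_(j < n) (1 + @mixC R * mixe j ^+ 3) <= mixM.
Proof.
apply: (@le_trans _ _ (\prod_(j < n) expR (@mixC R * mixe j ^+ 3))).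
  apply: ler_prod => j _; rewrite expR_ge1Dx andbT addr_ge0 // mulr_ge0 ?mixC_ge0 // exprn_ge0 //.
  by have /andP[] := mixe_itv j.
rewrite -expR_sum ler_expR -mulr_sumr ler_wpM2l ?mixC_ge0 //.
by under eq_bigr do rewrite mixe3; exact: mixS9_le.
Qed.

Lemma mixM_gt0 : 0 < mixM. Proof. exact: expR_gt0. Qed.

Definition halfI : R := \int[mu]_t halfw t.

Lemma halfI_ge0 : 0 <= halfI.
Proof. by apply: Rintegral_ge0 => t _; exact: halfw_ge0. Qed.

Lemma halfw_integral_bound (f : R -> R) B : continuous f -> (forall t, 0 <= f t <= B) ->
  0 <= \int[mu]_t (halfw t * f t) <= B * halfI.
Proof.
move=> cf fB; have mf := continuous_measurable_fun cf.
have fb t : `|f t| <= B by have /andP[a b] := fB t; rewrite ger0_norm.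
apply/andP; split.
  by apply: Rintegral_ge0 => t _; rewrite mulr_ge0 ?halfw_ge0 //; have /andP[] := fB t.
rewrite -RintegralZl //; last exact: halfw_integrable.
apply: le_Rintegral => //.
- exact: halfw_integrableM fb.
- exact: (rintegrableZ B (@halfw_integrable R)).
- by move=> t _; rewrite mulrC ler_wpM2r ?halfw_ge0 //; have /andP[] := fB t.
Qed.

Lemma mixk2_integral_itv j : 0 <= \int[mu]_u (halfw u * mixk2 (mixe j ^+ 4) u) <= 1 + @mixC R * mixe j ^+ 3.
Proof.
rewrite mixk2_integral ?mixe_itv // andbT; apply: Rintegral_ge0 => t _.
by rewrite mulr_ge0 ?halfw_ge0 // mixk2_ge0.
Qed.

Lemma mixe4_itv j : 0 <= mixe j ^+ 4 <= 1.
Proof. by have /andP[a b] := mixe_itv j; rewrite exprn_ge0 //= exprn_ile1. Qed.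

(* Product in which the factor of index [i] is replaced. *)
Definition swap1 (i : nat) (f : R -> R) (j : nat) : R -> R :=
  if j == i then f else mixk2 (mixe j ^+ 4).

Lemma swap1_cont i (f : R -> R) j : continuous f -> continuous (swap1 i f j).
Proof. by rewrite /swap1; case: eqP => // _ _; exact: mixk2_continuous. Qed.

Lemma swap1_itv i f j : (forall t, 0 <= f t <= 32) -> forall t, 0 <= swap1 i f j t <= 32.
Proof.
rewrite /swap1; case: eqP => // _ _ t; rewrite mixk2_ge0 /=.
by have := mixk2_le t (mixe4_itv j); rewrite ger0_norm ?mixk2_ge0.
Qed.

Lemma rcyl_swap1 n i (f : R -> R) : continuous f -> (forall t, 0 <= f t <= 32) ->
  rcyl n (fun u => \prod_(j < n) swap1 i f j (u j)).
Proof.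
move=> cf f32; apply: rcyl_prod => j.
apply: (@rcyl_coord R n j (swap1 i f j) 32) => //; first exact: swap1_cont.
by move=> t; have /andP[a b] := swap1_itv i j f32 t; rewrite ger0_norm.
Qed.

Lemma mixcv_swap1 n i (f : R -> R) : continuous f -> (forall t, 0 <= f t <= 32) -> (i < n)%N ->
  mixcv n (fun u => \prod_(j < n) swap1 i f j (u j)) <= 32 * halfI * mixM.
Proof.
move=> cf f32 ni; rewrite mixcv_prod; first last.
- by move=> j; exists 32 => t; have /andP[a b] := swap1_itv i j f32 t; rewrite ger0_norm.
- by move=> j; apply: continuous_measurable_fun; exact: swap1_cont.
rewrite (bigD1 (Ordinal ni)) //= {1}/swap1 eqxx.
have /andP[a b] := halfw_integral_bound cf f32.
have m1 j : 1 <= 1 + @mixC R * mixe j ^+ 3.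
  by rewrite lerDl mulr_ge0 ?mixC_ge0 // exprn_ge0 //; have /andP[] := mixe_itv j.
have h : \prod_(j < n | j != Ordinal ni) \int[mu]_t (halfw t * swap1 i f j t) <= mixM.
  apply: (@le_trans _ _ (\prod_(j < n | j != Ordinal ni) (1 + @mixC R * mixe j ^+ 3))).
    apply: ler_prod => j nj; by rewrite /swap1 ifN ?mixk2_integral_itv.
  apply: le_trans _ (mixM_ge n); rewrite [leRHS](bigD1 (Ordinal ni)) //= ler_peMl ?m1 //.
  by apply: prodr_ge0 => j _; apply: le_trans (m1 j).
apply: ler_pM => //; apply: prodr_ge0 => j _.
by have /andP[] := halfw_integral_bound (@swap1_cont i f j cf) (@swap1_itv i f j f32).
Qed.

Lemma mixcv_k2 n : rcyl n (fun u => \prod_(j < n) mixk2 (mixe j ^+ 4) (u j)) /\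
  mixcv n (fun u => \prod_(j < n) mixk2 (mixe j ^+ 4) (u j)) <= mixM.
Proof.
have b j t : `|mixk2 (mixe j ^+ 4) t| <= 32 := mixk2_le t (mixe4_itv j).
split.
  apply: rcyl_prod => j; apply: (@rcyl_coord R n j _ 32) => //; exact: mixk2_continuous.
rewrite (mixcv_prod n (phi := fun j => mixk2 (mixe j ^+ 4))); first last.
- by move=> j; exists 32; exact: b.
- by move=> j; apply: continuous_measurable_fun; exact: mixk2_continuous.
by apply: le_trans (mixM_ge n); apply: ler_prod => j _; exact: mixk2_integral_itv.
Qed.

Lemma rcyl_min_sqnorm n k t : (k <= n)%N -> 0 <= t -> rcyl n (fun x => Num.min 1 (t * sqnorm gamma k x)).
Proof.
move=> kn t0; apply: (@rcyl_cont _ _ _ 1) => [|x].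
  apply: (@cont_n_comp R n (fun y => Num.min 1 (t * y)) (sqnorm gamma k)) => [y|].
    apply: (@continuous_comp2 R (fun y : R => Num.min 1 y) (fun y => t * y)) => [|z]; first exact: min1_continuous.
    by apply: cvgM; [exact: cvg_cst|exact: cvg_id].
  apply: (@cont_n_sum R n k (fun i x => wm i * x i ^+ 2)) => i ik.
  apply: (@cont_n_coord R n i (fun y => wm i * y ^+ 2)) => [|y]; first exact: leq_trans ik kn.
  by apply: cvgM; [exact: cvg_cst|exact: exprn_continuous].
by rewrite ger0_norm ?ge_min ?lexx // le_min ler01 mulr_ge0 // sqnorm_ge0.
Qed.

Definition mixscale (u : T) (j : nat) : R := mixbeta j * u j ^+ 20.

(** Gaussian functionals exist only for nonzero variances. The remaining [u] carry no weight, since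
    [mixk1] and [mixk2] vanish at [0]. *)
Definition offzero n (u : T) := [forall j : 'I_n, u j != 0].

Lemma offzeroP n u : reflect (forall j, (j < n)%N -> u j != 0) (offzero n u).
Proof.
apply: (iffP forallP) => [h j jn|h j]; first exact: (h (Ordinal jn)).
exact: h.
Qed.

Lemma offzero_prod n u (F : nat -> R -> R) : ~~ offzero n u -> (forall j, F j 0 = 0) ->
  \prod_(j < n) F j (u j) = 0.
Proof.
move=> /forallPn[j]; rewrite negbK => /eqP uj F0.
by rewrite (bigD1 j) //= uj F0 mul0r.
Qed.

Definition minK_row2 n (xi : T) j : R := (\sum_(i < n) minK i j * xi i) ^+ 2.

Definition gaussQ n (b xi : T) : R := \sum_(j < n) b j * xi j ^+ 2 + \sum_(j < n) minK_row2 n xi j / b j.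

Lemma gaussian_kernels n : exists Phi Psi : T -> (T -> R[i]) -> R[i], forall u, offzero n u ->
  [/\ sfun n (Phi u), sfun n (Psi u),
    forall xi, Phi u (cwave n xi) = ((expR (- (\sum_(j < n) mixscale u j * xi j ^+ 2) / 2))%:C)%C * cis (- minK_form n xi / 2),
    forall xi, Psi u (cwave n xi) = ((expR (- gaussQ n (mixscale u) xi / 2))%:C)%C &
    forall (f : T -> R[i]) (g : T -> R), cyl n f -> rcyl n g -> (forall y, normc (f y) <= g y) ->
      normc (Phi u f) <= gauss_tau n (mixscale u) * Re (Psi u (fun y => ((g y)%:C)%C)) /\
      normc (Psi u f) <= Re (Psi u (fun y => ((g y)%:C)%C))].
Proof.
have h u : exists LN : ((T -> R[i]) -> R[i]) * ((T -> R[i]) -> R[i]), offzero n u ->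
  [/\ sfun n LN.1, sfun n LN.2,
    forall xi, LN.1 (cwave n xi) = ((expR (- (\sum_(j < n) mixscale u j * xi j ^+ 2) / 2))%:C)%C * cis (- minK_form n xi / 2),
    forall xi, LN.2 (cwave n xi) = ((expR (- gaussQ n (mixscale u) xi / 2))%:C)%C &
    forall (f : T -> R[i]) (g : T -> R), cyl n f -> rcyl n g -> (forall y, normc (f y) <= g y) ->
      normc (LN.1 f) <= gauss_tau n (mixscale u) * Re (LN.2 (fun y => ((g y)%:C)%C)) /\
      normc (LN.2 f) <= Re (LN.2 (fun y => ((g y)%:C)%C))].
  case: (boolP (offzero n u)) => [/offzeroP hu|_]; last by exists (fun=> 0, fun=> 0).
  have [|L [N [h1 h2 h3 h4 h5]]] := @gaussian_functional R n (mixscale u).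
    by move=> j jn; rewrite mulr_gt0 ?mixbeta_gt0 // exprn_even_gt0 //= hu.
  by exists (L, N).
have [F hF] := choice h.
by exists (fun u => (F u).1), (fun u => (F u).2).
Qed.

Lemma mixk1_tau n u : offzero n u ->
  (\prod_(j < n) mixk1 (u j)) * gauss_tau n (mixscale u) = \prod_(j < n) mixk2 (mixe j ^+ 4) (u j).
Proof.
move=> /offzeroP hu; rewrite /gauss_tau -big_split /=; apply: eq_bigr => j _.
rewrite -(@mixk12 R (mixe j ^+ 4) (u j)) ?hu //; last by have /andP[] := mixe4_itv j.
by rewrite mixe4 /mixscale; congr (_ * Num.sqrt (1 + _)); rewrite invfM mulrA.
Qed.

Lemma mixk1_0 : @mixk1 R 0 = 0. Proof. by rewrite /mixk1 normr0 expr0n mul0r. Qed.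

Lemma mixk2_0 e : @mixk2 R e 0 = 0. Proof. by rewrite /mixk2 normr0 expr0n mul0r. Qed.

Lemma min1_scale_sum n (A B : T) : (forall i, 0 <= A i) -> (forall i, 0 <= B i) ->
  Num.min 1 (\sum_(i < n) (A i + B i)) <= \sum_(i < n) (A i + Num.min 1 (B i)).
Proof.
move=> A0 B0; apply: le_trans (@min1_sum R n (fun i => A i + B i) _) _ => [i|].
  by rewrite addr_ge0.
apply: ler_sum => i _; apply: le_trans (min1_add (A0 i) (B0 i)) _.
by rewrite lerD2r ge_min lexx orbT.
Qed.

(** Twentieth root of [t * mixcK / beta_i]. Only the power 9 of it will be paid for, and
    [beta_i^(-9/20) = i^(-9/8)] is still summable. *)
Definition mixtheta (t : R) i : R := (t * mixcK) `^ (1 / 20) * i.+1%:R `^ (- (1 / 8)).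

Lemma mixtheta20 t i : 0 <= t -> mixtheta t i ^+ 20 = t * mixcK / mixbeta i.
Proof.
move=> t0; rewrite /mixtheta exprMn succ_powX -powR_mulrn ?powR_ge0 // -powRrM.
rewrite (_ : 1 / 20 * 20%:R = 1); last by field.
rewrite powRr1 ?mulr_ge0 ?mixcK_ge0 // /mixbeta -powRN; congr (_ * _ `^ _); lra.
Qed.

Lemma mixtheta9 t i : mixtheta t i ^+ 9 = ((t * mixcK) `^ (1 / 20)) ^+ 9 * i.+1%:R `^ (- (1 + 1 / 8)).
Proof. by rewrite /mixtheta exprMn succ_powX; congr (_ * _ `^ _); field. Qed.

(** [mixk2] multiplied by [y^20], the effect of a moment of the variance; [mixf2] is [mixk2] divided
    by [|y|^9], the effect of an inverse variance. Writing both with a power of [|y|] lets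
    [mixf_cont] and [mixf_itv] serve for the two. *)
Definition mixf1 i (y : R) : R := `|y| ^+ 29 * (Num.sqrt (y ^+ 20 + mixe i ^+ 4) * exp20 y).

Definition mixf2 i (y : R) : R := `|y| ^+ 0 * (Num.sqrt (y ^+ 20 + mixe i ^+ 4) * exp20 y).

Lemma mixf_cont i k : continuous (fun y : R => `|y| ^+ k * (Num.sqrt (y ^+ 20 + mixe i ^+ 4) * exp20 y)).
Proof.
apply: continuousM2; first exact: normX_continuous.
by apply: continuousM2; [exact: sqrt20_continuous|exact: exp20_continuous].
Qed.

Lemma mixf_itv i k (y : R) : (k <= 30)%N ->
  0 <= `|y| ^+ k * (Num.sqrt (y ^+ 20 + mixe i ^+ 4) * exp20 y) <= 32.
Proof.
move=> k30; rewrite sqrt20_bound ?mixe4_itv // andbT.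
by rewrite mulr_ge0 ?exprn_ge0 // mulr_ge0 ?sqrtr_ge0 // exp20_ge0.
Qed.

Definition mixtail n t (u : T) : R :=
  \sum_(i < n) (t * (wm i * mixbeta i) * (\prod_(j < n) swap1 i (mixf1 i) j (u j)) +
    mixtheta t i ^+ 9 * (\prod_(j < n) swap1 i (mixf2 i) j (u j))).

Lemma mixtail_bound n t : 0 <= t -> rcyl n (mixtail n t) /\
  mixcv n (mixtail n t) <= 32 * halfI * mixM * (t * mixSB + ((t * mixcK) `^ (1 / 20)) ^+ 9 * mixS9).
Proof.
move=> t0.
have c1 i := @mixf_cont i 29; have b1 i := fun y => @mixf_itv i 29 y isT.
have c2 i := @mixf_cont i 0; have b2 i := fun y => @mixf_itv i 0 y isT.
pose F1 i (u : T) := \prod_(j < n) swap1 i (mixf1 i) j (u j).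
pose F2 i (u : T) := \prod_(j < n) swap1 i (mixf2 i) j (u j).
have [r1 e1] := @mixcv_sum R n n F1 (fun i => t * (wm i * mixbeta i)) (fun i _ => rcyl_swap1 n i (c1 i) (b1 i)).
have [r2 e2] := @mixcv_sum R n n F2 (fun i => mixtheta t i ^+ 9) (fun i _ => rcyl_swap1 n i (c2 i) (b2 i)).
have E u : mixtail n t u = 1 * (\sum_(i < n) t * (wm i * mixbeta i) * F1 i u) + \sum_(i < n) mixtheta t i ^+ 9 * F2 i u.
  by rewrite mul1r /mixtail big_split.
split; first by apply: (eq_rcyl _ (rcylD (rcylZ 1 r1) r2)) => u; rewrite E.
rewrite (_ : mixtail n t = (fun u => 1 * (\sum_(i < n) t * (wm i * mixbeta i) * F1 i u) + \sum_(i < n) mixtheta t i ^+ 9 * F2 i u)); last exact/funext.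
have C0 : 0 <= 32 * halfI * mixM by rewrite !mulr_ge0 ?halfI_ge0 ?ltW ?mixM_gt0.
have th0 : 0 <= ((t * mixcK) `^ (1 / 20)) ^+ 9 by rewrite exprn_ge0 ?powR_ge0.
have S1 : \sum_(i < n) t * (wm i * mixbeta i) * mixcv n (F1 i) <= 32 * halfI * mixM * (t * mixSB).
  apply: (@le_trans _ _ (\sum_(i < n) t * (wm i * mixbeta i) * (32 * halfI * mixM))).
    apply: ler_sum => i _; apply: ler_wpM2l; last exact: mixcv_swap1 (c1 i) (b1 i) (ltn_ord i).
    apply: mulr_ge0 => //; apply: mulr_ge0; [exact: l2weight_ge0|exact/ltW/mixbeta_gt0].
  by rewrite -mulr_suml -mulr_sumr mulrC ler_wpM2l // ler_wpM2l // mixSB_le.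
have S2 : \sum_(i < n) mixtheta t i ^+ 9 * mixcv n (F2 i) <=
    32 * halfI * mixM * (((t * mixcK) `^ (1 / 20)) ^+ 9 * mixS9).
  apply: (@le_trans _ _ (\sum_(i < n) mixtheta t i ^+ 9 * (32 * halfI * mixM))).
    apply: ler_sum => i _; apply: ler_wpM2l; last exact: mixcv_swap1 (c2 i) (b2 i) (ltn_ord i).
    by rewrite mixtheta9 mulr_ge0 // powR_ge0.
  rewrite -mulr_suml mulrC; apply: ler_wpM2l => //.
  under eq_bigr => i _ do rewrite mixtheta9.
  by rewrite -mulr_sumr ler_wpM2l // mixS9_le.
have -> := mixcv_lin 1 r1 r2.
by rewrite e1 e2 mul1r [leRHS]mulrDr; exact: lerD S1 S2.
Qed.

(** The term with the variance multiplies the factor of index [i] by [u i^20]. The term with the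
    inverse variance is [(theta / |u i|)^20], not integrable against the weight as it stands. Capped
    by [1] it is at most the ninth power, exactly the power of [|u i|] that [mixk2] can absorb. *)
Lemma mixtail_ge n t u : 0 <= t -> offzero n u ->
  (\prod_(j < n) mixk2 (mixe j ^+ 4) (u j)) *
    Num.min 1 (t * \sum_(i < n) (wm i * mixbeta i * u i ^+ 20 + mixcK / (mixbeta i * u i ^+ 20))) <= mixtail n t u.
Proof.
move=> t0 /offzeroP hu; set P := \prod_(j < n) _.
have P0 : 0 <= P by apply: prodr_ge0 => j _; exact: mixk2_ge0.
have y0 (y : R) : 0 <= y ^+ 20 by exact: exprn_even_ge0.
have b0 i : 0 <= mixbeta i by rewrite ltW // mixbeta_gt0.
have cK0 := mixcK_ge0.
have A0 i : 0 <= t * (wm i * mixbeta i * u i ^+ 20).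
  by apply: mulr_ge0 => //; apply: mulr_ge0 => //; apply: mulr_ge0 => //; exact: l2weight_ge0.
have B0 i : 0 <= t * (mixcK / (mixbeta i * u i ^+ 20)) by rewrite mulr_ge0 // divr_ge0 // mulr_ge0.
rewrite mulr_sumr; under eq_bigr do rewrite mulrDr.
apply: (@le_trans _ _ (P * \sum_(i < n) (t * (wm i * mixbeta i * u i ^+ 20) + Num.min 1 (t * (mixcK / (mixbeta i * u i ^+ 20)))))).
  apply: ler_wpM2l => //.
  exact: (@min1_scale_sum n (fun i => t * (wm i * mixbeta i * u i ^+ 20)) (fun i => t * (mixcK / (mixbeta i * u i ^+ 20)))).
rewrite mulr_sumr /mixtail; apply: ler_sum => i _.
have ui : u i != 0 by apply: hu; exact: ltn_ord.
have a0 : 0 < `|u i| by rewrite normr_gt0.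
have u20 : u i ^+ 20 = `|u i| ^+ 20 by rewrite -normrX ger0_norm.
pose Pi := \prod_(j < n | j != i) mixk2 (mixe j ^+ 4) (u j).
have PE : P = mixk2 (mixe i ^+ 4) (u i) * Pi by rewrite /P (bigD1 i).
have Pi0 : 0 <= Pi by apply: prodr_ge0 => j _; exact: mixk2_ge0.
have swapE f : \prod_(j < n) swap1 i f j (u j) = f (u i) * Pi.
  rewrite (bigD1 i) //= /swap1 eqxx; congr (_ * _); apply: eq_bigr => j ji.
  by rewrite ifN.
rewrite !swapE PE mulrDr; set s := Num.sqrt (u i ^+ 20 + mixe i ^+ 4) * exp20 (u i).
have s0 : 0 <= s by rewrite mulr_ge0 ?sqrtr_ge0 // exp20_ge0.
have -> : mixk2 (mixe i ^+ 4) (u i) = `|u i| ^+ 9 * s by [].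
have -> : mixf1 i (u i) = `|u i| ^+ 29 * s by [].
have -> : mixf2 i (u i) = s by rewrite /mixf2 expr0 mul1r.
apply: lerD; first by rewrite u20 le_eqVlt; apply/orP; left; apply/eqP; ring.
have th0 : 0 <= mixtheta t i by rewrite mulr_ge0 ?powR_ge0.
have h : Num.min 1 (t * (mixcK / (mixbeta i * u i ^+ 20))) <= (mixtheta t i / `|u i|) ^+ 9.
  have -> : t * (mixcK / (mixbeta i * u i ^+ 20)) = (mixtheta t i / `|u i|) ^+ 20.
    by rewrite expr_div_n mixtheta20 // -u20 invfM !mulrA.
  by apply: min1_pow; rewrite divr_ge0.
apply: (@le_trans _ _ (`|u i| ^+ 9 * s * Pi * (mixtheta t i / `|u i|) ^+ 9)).
  by apply: ler_wpM2l h; apply: mulr_ge0 => //; apply: mulr_ge0 => //; exact: exprn_ge0.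
rewrite expr_div_n le_eqVlt; apply/orP; left; apply/eqP.
move: (`|u i|) a0 => a a0; field.
by rewrite gt_eqF.
Qed.
End PathFunctional.

Section PathFunctionalExists.
Context {R : realType} (gamma : R) (hgamma : 7 / 2 < gamma).
Local Notation T := (nat -> R).
Local Notation mu := (@lebesgue_measure R).
Local Notation wm := (l2weight (- gamma)).
Local Notation mixbeta := (@mixbeta R).
Local Notation mixe := (@mixe R).

Definition mixtail_rate (t : R) : R :=
  32 * @halfI R * @mixM R * (t * mixSB gamma + ((t * mixcK gamma) `^ (1 / 20)) ^+ 9 * @mixS9 R).

Lemma mixtail_rate_small (e : R) : 0 < e -> exists2 t : R, 0 < t & mixtail_rate t <= e.
Proof.
move=> e0; pose A := 32 * @halfI R * @mixM R.
have A0 : 0 <= A by rewrite !mulr_ge0 ?halfI_ge0 ?ltW ?mixM_gt0.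
have SB0 := @mixSB_ge0 R gamma hgamma; have cK0 := @mixcK_ge0 R gamma hgamma.
have S90 := @mixS9_ge0 R.
(* The added ones keep the denominators positive. Then [t] is small enough for the first term by its
   bound [e / 2 / X], and for the second because [(t * mixcK)^(1/20)] falls below [s <= 1]. *)
pose X := A * mixSB gamma + 1; pose Y := A * @mixS9 R + 1; pose Z := mixcK gamma + 1.
have X0 : 0 < X by rewrite ltr_wpDl // mulr_ge0.
have Y0 : 0 < Y by rewrite ltr_wpDl // mulr_ge0.
have Z0 : 0 < Z by rewrite ltr_wpDl.
pose s := Num.min 1 (e / 2 / Y).
have s0 : 0 < s by rewrite lt_min ltr01 !divr_gt0.
pose t := Num.min (e / 2 / X) (s ^+ 20 / Z).
have t0 : 0 < t by rewrite lt_min !divr_gt0 // exprn_gt0.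
exists t => //; rewrite /mixtail_rate -/A mulrDr.
have h1 : A * (t * mixSB gamma) <= e / 2.
  apply: (@le_trans _ _ (t * X)); first by rewrite /X mulrDr mulr1 mulrCA lerDl ltW.
  by rewrite -ler_pdivlMr // ge_min lexx.
have h2 : (t * mixcK gamma) `^ (1 / 20) <= s.
  have -> : s = (s ^+ 20) `^ (1 / 20).
    by rewrite -powR_mulrn ?ltW // -powRrM (_ : 20%:R * (1 / 20) = 1) ?powRr1 ?ltW //; field.
  apply: ge0_ler_powR => //; rewrite ?nnegrE ?mulr_ge0 ?exprn_ge0 ?(ltW t0) ?(ltW s0) //.
  apply: (@le_trans _ _ (t * Z)); first by rewrite ler_wpM2l ?lerDl // ltW.
  by rewrite -ler_pdivlMr // ge_min lexx orbT.
have h3 : ((t * mixcK gamma) `^ (1 / 20)) ^+ 9 <= s.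
  have p0 := powR_ge0 (t * mixcK gamma) (1 / 20).
  have s1 : s <= 1 by rewrite ge_min lexx.
  apply: (@le_trans _ _ (s ^+ 9)); first by rewrite lerXn2r ?nnegrE ?(ltW s0).
  exact: (ler_wiXn2l (ltW s0) s1 (isT : (1 <= 9)%N)).
have h4 : A * (((t * mixcK gamma) `^ (1 / 20)) ^+ 9 * @mixS9 R) <= e / 2.
  apply: (@le_trans _ _ (A * (s * @mixS9 R))); first by rewrite ler_wpM2l // ler_wpM2r.
  apply: (@le_trans _ _ (s * Y)); first by rewrite /Y mulrDr mulr1 mulrCA lerDl ltW.
  by rewrite -ler_pdivlMr // ge_min lexx orbT.
lra.
Qed.

(** [L] averages the oscillatory Gaussians over independent exponential variances: the Laplace
    transform of the exponential law turns the damping [exp (- beta s xi^2 / 2)] into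
    [1 / (1 + beta xi^2 / 2)], which is the inverse of the symbol of [D]. [D] averages the
    dominating real Gaussians with the mass bounds built into the weight; its total mass and its
    tail are uniform in [n]. *)
Lemma path_functional n : exists (L : (T -> R[i]) -> R[i]) (D : (T -> R) -> R),
  [/\ sfun n L,
    forall xi, L (cwave n xi) = (((\prod_(j < n) (1 + mixbeta j / 2 * xi j ^+ 2))^-1)%:C)%C * cis (- minK_form n xi / 2),
    [/\ forall a f g, rcyl n f -> rcyl n g -> D (fun x => a * f x + g x) = a * D f + D g,
      forall f g, rcyl n f -> rcyl n g -> (forall x, f x <= g x) -> D f <= D g & D (fun=> 1) <= @mixM R],
    forall f g, cyl n f -> rcyl n g -> (forall x, normc (f x) <= g x) -> normc (L f) <= D g &
    forall t, 0 < t -> D (fun x => Num.min 1 (t * sqnorm gamma n x)) <= mixtail_rate t].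
Proof.
have [Phi [Psi sel]] := @gaussian_kernels R n.
pose k1 (u : T) := \prod_(j < n) mixk1 (u j); pose k2 (u : T) := \prod_(j < n) mixk2 (mixe j ^+ 4) (u j).
have k10 u : 0 <= k1 u by apply: prodr_ge0 => j _; exact: mixk1_ge0.
have k20 u : 0 <= k2 u by apply: prodr_ge0 => j _; exact: mixk2_ge0.
have k2b u : k2 u <= 32 ^+ n.
  have -> : 32 ^+ n = \prod_(j < n) 32 :> R by rewrite prodr_const card_ord.
  apply: ler_prod => j _.
  by rewrite mixk2_ge0; have := mixk2_le (u j) (@mixe4_itv R j); rewrite ger0_norm ?mixk2_ge0.
(* The weights [k1] and [k2] are part of the integrands, so that the value [0] outside [offzero]
   agrees with the product formulas [GW] and [HW] there. The domination [dom] is [mixk1_tau]: the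
   mass bound [gauss_tau] turns [k1] into [k2]. *)
pose G f u := if offzero n u then ((k1 u)%:C)%C * Phi u f else 0.
pose H f u := if offzero n u then ((k2 u)%:C)%C * Psi u f else 0.
have sG u : sfun n (fun f => G f u).
  rewrite /G; case: (boolP (offzero n u)) => [/sel[s _ _ _ _]|_]; [exact: sfun_scale|exact: sfun0].
have sH u : sfun n (fun f => H f u).
  rewrite /H; case: (boolP (offzero n u)) => [/sel[_ s _ _ _]|_]; [exact: sfun_scale|exact: sfun0].
have dom f g u : cyl n f -> rcyl n g -> (forall x, normc (f x) <= g x) ->
    normc (G f u) <= Re (H (fun y => ((g y)%:C)%C) u) /\ normc (H f u) <= Re (H (fun y => ((g y)%:C)%C) u).
  move=> cf rg fg; rewrite /G /H; case: (boolP (offzero n u)) => [nz|_]; last by rewrite Normc.normc0 lexx.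
  have [_ _ _ _ /(_ f g cf rg fg)[d1 d2]] := sel u nz.
  rewrite !Normc.normcM !normc_real !(ger0_norm (k10 u)) !(ger0_norm (k20 u)) ReImE mul0r subr0.
  split; last by rewrite ler_wpM2l.
  by apply: le_trans (ler_wpM2l (k10 u) d1) _; rewrite mulrA mixk1_tau.
have Psi1 u : offzero n u -> Psi u (fun=> 1) = 1.
  move=> /sel[_ _ _ w _].
  have -> : (fun _ : T => 1 : R[i]) = cwave n (fun=> 0).
    by apply/funext => x; rewrite /cwave big1 ?cis0 // => i _; rewrite mul0r.
  rewrite w /gaussQ !big1 ?addr0 ?oppr0 ?mul0r ?expR0 // => j _; last by rewrite expr0n mulr0.
  by rewrite /minK_row2 big1 ?expr0n ?mul0r // => i _; rewrite mulr0.
have PsiM u M : offzero n u -> Re (Psi u (fun=> (M%:C)%C)) = M.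
  move=> nz; have [_ s _ _ _] := sel u nz.
  rewrite (_ : (fun _ : T => _) = (fun=> (M%:C)%C * 1)); last by apply/funext => y; rewrite mulr1.
  by rewrite (sfunZ _ s (cyl_cst n 1)) Psi1 // mulr1.
have HM u M : 0 <= M -> Re (H (fun=> (M%:C)%C) u) <= k2 u * M.
  move=> M0; rewrite /H; case: (boolP (offzero n u)) => [nz|_]; last by rewrite mulr_ge0.
  by rewrite ReImE mul0r subr0 PsiM.
have bnd f M u : cyl n f -> (forall x, normc (f x) <= M) ->
    normc (G f u) <= 32 ^+ n * M /\ normc (H f u) <= 32 ^+ n * M.
  move=> cf fM; have M0 : 0 <= M by apply: le_trans (fM (fun=> 0)); exact: normc_ge0.
  have [d1 d2] := dom f (fun=> M) u cf (rcyl_cst n M) fM.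
  have h : Re (H (fun=> (M%:C)%C) u) <= 32 ^+ n * M.
    by apply: le_trans (HM u M M0) _; rewrite ler_wpM2r.
  by split; [apply: le_trans d1 h|apply: le_trans d2 h].
have GW xi u : G (cwave n xi) u = cis (- minK_form n xi / 2) *
    ((\prod_(j < n) (mixk1 (u j) * expR (- (mixbeta j / 2 * xi j ^+ 2 * u j ^+ 20))))%:C)%C.
  rewrite /G; case: (boolP (offzero n u)) => [nz|nz]; last first.
    by rewrite (offzero_prod (F := fun j y => mixk1 y * expR (- (mixbeta j / 2 * xi j ^+ 2 * y ^+ 20)))) ?mulr0 // => j; rewrite mixk1_0 mul0r.
  have [_ _ -> _ _] := sel u nz; rewrite big_split /= -expR_sum rmorphM mulrA [RHS]mulrC; congr (_ * ((expR _)%:C)%C * _).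
  rewrite sumrN mulNr mulr_suml; congr (- _).
  by apply: eq_bigr => j _; rewrite /mixscale; lra.
have HW xi u : H (cwave n xi) u = ((\prod_(j < n) (mixk2 (mixe j ^+ 4) (u j) *
    expR (- (mixbeta j * xi j ^+ 2 * u j ^+ 20 + minK_row2 n xi j / mixbeta j / u j ^+ 20) / 2)))%:C)%C.
  rewrite /H; case: (boolP (offzero n u)) => [nz|nz]; last first.
    by rewrite (offzero_prod (F := fun j y => mixk2 (mixe j ^+ 4) y * expR (- (mixbeta j * xi j ^+ 2 * y ^+ 20 + minK_row2 n xi j / mixbeta j / y ^+ 20) / 2))) // => j; rewrite mixk2_0 mul0r.
  have [_ _ _ -> _] := sel u nz; rewrite big_split /= -expR_sum rmorphM; congr (_ * (expR _)%:C%C).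
  rewrite /gaussQ -mulr_suml sumrN -big_split /=; congr (- _ / _).
  apply: eq_bigr => j _; rewrite /mixscale invfM; congr (_ + _); ring.
have cGW xi : cyl n (G (cwave n xi)).
  apply: (eq_cyl (fun u => esym (GW xi u))); apply: cylZ; apply: rcyl_prod => j.
  have c0 : 0 <= mixbeta j / 2 * xi j ^+ 2 by rewrite mulr_ge0 ?sqr_ge0 // divr_ge0 // ltW // mixbeta_gt0.
  apply: (@rcyl_coord R n j (fun y => mixk1 y * expR (- (mixbeta j / 2 * xi j ^+ 2 * y ^+ 20))) 16) => // [|y].
    apply: continuousM2; first exact: mixk1_continuous.
    apply: (@continuous_comp2 R (@expR R)); first exact: continuous_expR.
    by move=> y; apply: cvgN; apply: cvgM; [exact: cvg_cst|exact: exprn_continuous].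
  rewrite normrM (ger0_norm (expR_ge0 _)) -[leRHS]mulr1 ler_pM ?expR_ge0 ?mixk1_le //.
  by rewrite expR_le1 oppr_le0; apply: mulr_ge0 => //; exact: exprn_even_ge0.
have cHW xi : cyl n (H (cwave n xi)).
  apply: (eq_cyl (fun u => esym (HW xi u))); apply: rcyl_prod => j.
  have b0 := @mixbeta_gt0 R j.
  apply: rcyl_mixk2 => //; first exact: mixe4_itv.
    by rewrite mulr_ge0 ?sqr_ge0 // ltW.
  by rewrite divr_ge0 ?sqr_ge0 // ltW.
have bG f M u := fun cf fM => (bnd f M u cf fM).1; have bH f M u := fun cf fM => (bnd f M u cf fM).2.
have cG := cyl_kernel sG bG cGW; have cH := cyl_kernel sH bH cHW.
pose D g := mixcv n (fun u => Re (H (fun y => ((g y)%:C)%C) u)).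
have rH g : rcyl n g -> rcyl n (fun u => Re (H (fun y => ((g y)%:C)%C) u)) by move=> rg; apply: cyl_Re; exact: cH.
have Hlin a f g u : rcyl n f -> rcyl n g -> Re (H (fun y => ((a * f y + g y)%:C)%C) u) =
    a * Re (H (fun y => ((f y)%:C)%C) u) + Re (H (fun y => ((g y)%:C)%C) u).
  move=> rf rg; have [l _] := sH u.
  rewrite (_ : (fun y => _) = (fun y => (a%:C)%C * ((f y)%:C)%C + ((g y)%:C)%C)).
    by rewrite l // !ReImE mul0r subr0.
  by apply/funext => y; rewrite rmorphD rmorphM.
have Hmono f g u : rcyl n f -> rcyl n g -> (forall x, f x <= g x) ->
    Re (H (fun y => ((f y)%:C)%C) u) <= Re (H (fun y => ((g y)%:C)%C) u).
  move=> rf rg fg; have rd := rcylB rg rf.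
  have [d1 _] := dom (fun=> 0) (fun y => g y - f y) u (cyl_cst n 0) rd
    (fun x => eq_ind_r (fun z => z <= g x - f x) (eq_ind_r (fun b => is_true b) isT (etrans (subr_ge0 _ _) (fg x))) (Normc.normc0 R)).
  have h : 0 <= Re (H (fun y => ((g y - f y)%:C)%C) u) by apply: le_trans d1; exact: normc_ge0.
  have -> : (fun y => ((g y)%:C)%C) = (fun y => ((1 * (g y - f y) + f y)%:C)%C).
    by apply/funext => y; rewrite mul1r subrK.
  by rewrite Hlin // mul1r lerDr.
exists (fun f => convs (@mixw R) axis n (G f) (fun=> 0)), D; split.
- apply: (@sfun_kernel R n (fun f => convs (@mixw R) axis n f (fun=> 0)) G (32 ^+ n) sG bG cGW).
  exact: (sfun_convs n (@axis R) n (fun=> 0) (@mixw_integrable R)).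
- move=> xi; have -> : G (cwave n xi) = (fun u => cis (- minK_form n xi / 2) *
      ((\prod_(j < n) (mixk1 (u j) * expR (- (mixbeta j / 2 * xi j ^+ 2 * u j ^+ 20))))%:C)%C).
    by apply/funext => u; exact: GW.
  have rP : rcyl n (fun u => \prod_(j < n) (mixk1 (u j) * expR (- (mixbeta j / 2 * xi j ^+ 2 * u j ^+ 20)))).
    apply: (eq_cyl _ (cylZ (cis (minK_form n xi / 2)) (cGW xi))) => u.
    by rewrite GW mulrA -cisD mulNr subrr cis0 mul1r.
  rewrite (sfunZ _ (sfun_convs n (@axis R) n (fun=> 0) (@mixw_integrable R)) rP) mulrC; congr (_ * _).
  pose phi j y := mixk1 y * expR (- (mixbeta j / 2 * xi j ^+ 2 * y ^+ 20)).
  have c0 j : 0 <= mixbeta j / 2 * xi j ^+ 2 by rewrite mulr_ge0 ?sqr_ge0 // divr_ge0 // ltW // mixbeta_gt0.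
  rewrite (@convs_prod R n n phi) //.
  + rewrite -prodfV; congr ((_ %:C)%C); apply: eq_bigr => j _; rewrite ltn_ord.
    exact: mixk1_laplace.
  + move=> j _; apply: continuous_measurable_fun; apply: continuousM2; first exact: mixk1_continuous.
    apply: (@continuous_comp2 R (@expR R)); first exact: continuous_expR.
    by move=> y; apply: cvgN; apply: cvgM; [exact: cvg_cst|exact: exprn_continuous].
  + move=> j _; exists 16 => y; rewrite normrM (ger0_norm (expR_ge0 _)) -[leRHS]mulr1 ler_pM ?expR_ge0 ?mixk1_le //.
    by rewrite expR_le1 oppr_le0; apply: mulr_ge0 => //; exact: exprn_even_ge0.
- split.
  + move=> a f g rf rg; rewrite /D -mixcv_lin; [|exact: rH|exact: rH].
    by congr mixcv; apply/funext => u; exact: Hlin.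
  + by move=> f g rf rg fg; apply: mixcv_mono => [||u]; [exact: rH|exact: rH|exact: Hmono].
  + have [r2 m2] := @mixcv_k2 R n; apply: le_trans m2.
    apply: mixcv_mono => [||u]; [exact: (rH (fun=> 1) (rcyl_cst n 1))|exact: r2|].
    by have := HM u 1 ler01; rewrite mulr1.
- move=> f g cf rg fg; apply: normc_mix_le; [exact: cG|exact: rH|].
  by move=> u; exact: (dom f g u cf rg fg).1.
- move=> t /ltW t0; have rphi := @rcyl_min_sqnorm R gamma n n t (leqnn n) t0.
  have [rt mt] := @mixtail_bound R gamma hgamma n t t0; apply: le_trans mt.
  apply: mixcv_mono => [||u]; [exact: rH rphi|exact: rt|].
  case: (boolP (offzero n u)) => [nz|nz]; last first.
    rewrite /H (negbTE nz) /mixtail; apply: sumr_ge0 => i _.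
    have th0 : 0 <= mixtheta gamma t i by rewrite mulr_ge0 ?powR_ge0.
    have P0 k : (k <= 30)%N -> 0 <= \prod_(j < n) swap1 i (fun y => `|y| ^+ k * (Num.sqrt (y ^+ 20 + mixe i ^+ 4) * exp20 y)) j (u j).
      by move=> k30; apply: prodr_ge0 => j _; have /andP[] := @swap1_itv R i _ j (fun y => @mixf_itv R i k y k30) (u j).
    rewrite addr_ge0 // mulr_ge0 ?exprn_ge0 //; [|exact: P0|exact: P0].
    by rewrite !mulr_ge0 ?l2weight_ge0 // ltW // mixbeta_gt0.
  apply: le_trans (@mixtail_ge R gamma hgamma n t u t0 nz); rewrite /H nz ReImE mul0r subr0; apply: ler_wpM2l; first exact: k20.
  have [_ sP _ wP domP] := sel u nz; have hu := offzeroP n u nz.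
  (* Monotonicity is known for [H], which is [k2 u] times [Psi u]; off zero the weight [k2 u] is
     positive and can be divided out. *)
  have Pmono (f g : T -> R) : rcyl n f -> rcyl n g -> (forall x, f x <= g x) ->
      Re (Psi u (fun x => ((f x)%:C)%C)) <= Re (Psi u (fun x => ((g x)%:C)%C)).
    move=> rf rg fg; have := Hmono f g u rf rg fg; rewrite /H nz !ReImE !mul0r !subr0.
    rewrite ler_pM2l // /k2 prodr_gt0 // => j _; rewrite /mixk2 mulr_gt0 ?exprn_gt0 ?normr_gt0 ?hu //.
    rewrite mulr_gt0 ?expR_gt0 // sqrtr_gt0 ltr_wpDl ?exprn_even_ge0 // exprn_gt0 //.
    by rewrite powR_gt0.
  rewrite le_min; apply/andP; split.
    rewrite -[leRHS](PsiM u 1 nz); apply: Pmono => //; first exact: rcyl_cst.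
    by move=> x; rewrite ge_min lexx.
  (* The variance of coordinate [i] under [Psi u], read off as the coefficient of [h^2] when
     [gaussQ] is evaluated at [h] times a unit vector. *)
  pose q i := mixscale u i + \sum_(j < n) minK i j ^+ 2 / mixscale u j.
  apply: le_trans (@gauss_tail R n (Psi u) (gaussQ n (mixscale u)) q wm t sP wP _ _ Pmono (l2weight_ge0 _) t0) _.
  + rewrite /gaussQ !big1 ?addr0 // => j _; last by rewrite expr0n mulr0.
    by rewrite /minK_row2 big1 ?expr0n ?mul0r // => i _; rewrite mulr0.
  + move=> i h ni; rewrite /gaussQ /q mulrDr (bigD1 (Ordinal ni)) //= eqxx big1 => [|j ji]; last first.
      by rewrite (_ : (j == i :> nat) = false) ?expr0n ?mulr0 //; apply: negbTE.
    rewrite addr0 mulrC; congr (_ + _); rewrite mulr_sumr; apply: eq_bigr => j _.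
    rewrite /minK_row2 (bigD1 (Ordinal ni)) //= eqxx big1 => [|k ki]; last first.
      by rewrite (_ : (k == i :> nat) = false) ?mulr0 //; apply: negbTE.
    by rewrite addr0 exprMn mulrC mulrCA mulrA mulrC mulrA.
  rewrite ler_wpM2l // /q; under eq_bigr do rewrite mulrDr; rewrite big_split [leRHS]big_split /=.
  apply: lerD; first by rewrite le_eqVlt; apply/orP; left; apply/eqP; apply: eq_bigr => i _; rewrite /mixscale mulrA.
  under eq_bigr do rewrite mulr_sumr.
  rewrite exchange_big /=; apply: ler_sum => j _.
  under eq_bigr do rewrite mulrA; rewrite -mulr_suml ler_wpM2r ?mixcK_le // invr_ge0.
  by apply: mulr_ge0; [exact/ltW/mixbeta_gt0|exact: exprn_even_ge0].
Qed.
End PathFunctionalExists.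

(** * Complex measures on the path space *)
Section Charges.
Context d (T : measurableType d) {R : realType}.
Implicit Types (m : {measure set T -> \bar R}) (nu : {charge set T -> \bar R}).

(** An alias whose type mentions the proof [h] of finiteness, so that the structure of finite
    measure, and from it a charge, can be attached to it. *)
Definition finite_copy m (h : (m setT < +oo)%E) : set T -> \bar R := m.

Section FiniteCopy.
Variables (m : {measure set T -> \bar R}) (h : (m setT < +oo)%E).

HB.instance Definition _ := isMeasure.Build _ T R (finite_copy h)
  (measure0 m) (measure_ge0 m) (@measure_semi_sigma_additive _ _ _ m).

Lemma finite_copy_fin : fin_num_fun (finite_copy h).
Proof.
move=> A mA; rewrite ge0_fin_numE; last exact: measure_ge0.
by apply: le_lt_trans h; apply: le_measure; rewrite ?inE.
Qed.

HB.instance Definition _ := @Measure_isFinite.Build _ _ _ (finite_copy h) finite_copy_fin.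
End FiniteCopy.

Lemma charge_difference m1 m2 : (m1 setT < +oo)%E -> (m2 setT < +oo)%E ->
  exists nu, forall A, measurable A -> nu A = (m1 A - m2 A)%E.
Proof.
move=> h1 h2; exists (cadd (charge_of_finite_measure (finite_copy h1))
  (cscale (-1) (charge_of_finite_measure (finite_copy h2)))) => A mA.
transitivity (m1 A + (-1)%:E * m2 A)%E; first by [].
by rewrite EFinN mulN1e.
Qed.

Lemma Rintegral_measure_add m1 m2 (f : T -> R) B : (m1 setT < +oo)%E -> (m2 setT < +oo)%E ->
  measurable_fun setT f -> (forall x, `|f x| <= B) ->
  \int[measure_add m1 m2]_x f x = \int[m1]_x f x + \int[m2]_x f x.
Proof.
move=> h1 h2 mf fB.
have i1 := bounded_rintegrable measurableT h1 mf fB.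
have i2 := bounded_rintegrable measurableT h2 mf fB.
rewrite /Rintegral integral_measure_add // fineD //; exact: integrable_fin_num.
Qed.

Section JordanParts.
Variable nu : {charge set T -> \bar R}.
Local Notation jp := (jordan_pos (hahn_pos_neg nu)).
Local Notation jn := (jordan_neg (hahn_pos_neg nu)).

Lemma jordan_pos_finite : (jp setT < +oo)%E.
Proof. by rewrite ltey_eq fin_num_measure. Qed.

Lemma jordan_neg_finite : (jn setT < +oo)%E.
Proof. by rewrite ltey_eq fin_num_measure. Qed.

Lemma total_variation_finite : (total_variation nu setT < +oo)%E.
Proof.
rewrite /total_variation /= /charge_variation lte_add_pinfty //; first exact: jordan_pos_finite.
exact: jordan_neg_finite.
Qed.

(** Any two representations of a charge as a difference of finite measures integrate alike:
    [jp + m2] and [m1 + jn] are the same measure, and all integrals are finite. This frees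
    [charge_int] from the chosen Hahn decomposition. *)
Lemma charge_int_difference m1 m2 (f : T -> R) B : (m1 setT < +oo)%E -> (m2 setT < +oo)%E ->
  (forall A, measurable A -> nu A = (m1 A - m2 A)%E) ->
  measurable_fun setT f -> (forall x, `|f x| <= B) ->
  charge_int nu f = \int[m1]_x f x - \int[m2]_x f x.
Proof.
move=> h1 h2 nuE mf fB; have p1 := jordan_pos_finite; have p2 := jordan_neg_finite.
have E : \int[measure_add jp m2]_x f x = \int[measure_add m1 jn]_x f x.
  rewrite /Rintegral; congr fine; apply: eq_measure_integral => A mA _.
  apply: etrans (measure_addE _ _ _) _; apply: esym; apply: etrans (measure_addE _ _ _) _.
  have f1 : m1 A \is a fin_num := finite_copy_fin h1 mA.
  have f2 : m2 A \is a fin_num := finite_copy_fin h2 mA.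
  have f3 : jp A \is a fin_num := finite_copy_fin p1 mA.
  have f4 : jn A \is a fin_num := finite_copy_fin p2 mA.
  have H : (m1 A - m2 A = jp A - jn A)%E.
    rewrite -nuE // (jordan_decomp (hahn_pos_neg nu) mA).
    transitivity (jp A + (-1)%:E * jn A)%E; first by [].
    by rewrite EFinN mulN1e.
  have := congr1 fine H; rewrite !fineB // => e.
  rewrite -[LHS]/(m1 A + jn A)%E -[RHS]/(jp A + m2 A)%E.
  rewrite -(fineK f1) -(fineK f2) -(fineK f3) -(fineK f4) -!EFinD; congr EFin.
  by move: (fine _) (fine _) (fine _) (fine _) e => x1 x2 x3 x4 e; lra.
rewrite (Rintegral_measure_add p1 h2 mf fB) (Rintegral_measure_add h1 p2 mf fB) in E.
by rewrite /charge_int; lra.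
Qed.

Lemma charge_int_lin (a : R) (f g : T -> R) B C : measurable_fun setT f -> (forall x, `|f x| <= B) ->
  measurable_fun setT g -> (forall x, `|g x| <= C) ->
  charge_int nu (fun x => a * f x + g x) = a * charge_int nu f + charge_int nu g.
Proof.
move=> mf fB mg gC.
have i1 := bounded_rintegrable measurableT jordan_pos_finite mf fB.
have i2 := bounded_rintegrable measurableT jordan_neg_finite mf fB.
have i3 := bounded_rintegrable measurableT jordan_pos_finite mg gC.
have i4 := bounded_rintegrable measurableT jordan_neg_finite mg gC.
rewrite /charge_int !RintegralD // ?RintegralZl //; [ring|exact: (rintegrableZ a i2)|exact: (rintegrableZ a i1)].
Qed.

Lemma charge_int_cvg (F : nat -> T -> R) f M : (forall k, measurable_fun setT (F k)) ->
  (forall k x, `|F k x| <= M) -> (forall x, F k x @[k --> \oo] --> f x) ->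
  charge_int nu (F k) @[k --> \oo] --> charge_int nu f.
Proof.
move=> mF FM Ff; apply: cvgB.
  apply: (@Rintegral_cvg _ _ _ jp _ _ (fun=> M)) => //.
  by apply: (bounded_rintegrable (M := `|M|) measurableT jordan_pos_finite).
apply: (@Rintegral_cvg _ _ _ jn _ _ (fun=> M)) => //.
by apply: (bounded_rintegrable (M := `|M|) measurableT jordan_neg_finite).
Qed.
End JordanParts.

Lemma cmeasure_int_lin (mu : cmeasure T R) (a : R[i]) (f g : T -> R[i]) B C :
  cmeas f -> (forall x, normc (f x) <= B) -> cmeas g -> (forall x, normc (g x) <= C) ->
  cmeasure_int mu (fun x => a * f x + g x) = a * cmeasure_int mu f + cmeasure_int mu g.
Proof.
move=> [mf mf'] fB [mg mg'] gC.
have rB x : `|Re (f x)| <= B by exact: le_trans (Re_le_normc _) (fB x).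
have iB x : `|Im (f x)| <= B by exact: le_trans (Im_le_normc _) (fB x).
have rC x : `|Re (g x)| <= C by exact: le_trans (Re_le_normc _) (gC x).
have iC x : `|Im (g x)| <= C by exact: le_trans (Im_le_normc _) (gC x).
have L nu (c1 c2 : R) (u v w : T -> R) D1 D2 D3 : measurable_fun setT u -> (forall x, `|u x| <= D1) ->
    measurable_fun setT v -> (forall x, `|v x| <= D2) -> measurable_fun setT w -> (forall x, `|w x| <= D3) ->
    charge_int nu (fun x => c1 * u x + (c2 * v x + w x)) = c1 * charge_int nu u + (c2 * charge_int nu v + charge_int nu w).
  move=> mu1 uD mv vD mw wD.
  rewrite (@charge_int_lin nu c1 u (fun x => c2 * v x + w x) D1 (`|c2| * D2 + D3)) //.
  - by rewrite (@charge_int_lin nu c2 v w D2 D3).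
  - by apply: measurable_funD => //; apply: measurable_funM.
  - by move=> x; apply: le_trans (ler_normD _ _) _; rewrite lerD // normrM ler_wpM2l.
have eR : (fun x => Re (a * f x + g x)) = (fun x => Re a * Re (f x) + (- Im a * Im (f x) + Re (g x))).
  by apply/funext => x; rewrite !ReImE; ring.
have eI : (fun x => Im (a * f x + g x)) = (fun x => Re a * Im (f x) + (Im a * Re (f x) + Im (g x))).
  by apply/funext => x; rewrite !ReImE; ring.
have cE (h : T -> R[i]) : cmeasure_int mu h = Complex
    (charge_int (cmeasure_re mu) (fun x => Re (h x)) - charge_int (cmeasure_im mu) (fun x => Im (h x)))
    (charge_int (cmeasure_re mu) (fun x => Im (h x)) + charge_int (cmeasure_im mu) (fun x => Re (h x))) by [].
have RI (x y x' y' : R) : a * Complex x y + Complex x' y' = Complex (Re a * x - Im a * y + x') (Re a * y + Im a * x + y').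
  by case: (a).
rewrite !cE eR eI RI; congr Complex;
  rewrite !(L _ _ _ _ _ _ B B C) //; ring.
Qed.

Lemma cmeasure_int_cvg (mu : cmeasure T R) (F : nat -> T -> R[i]) f M : (forall k, cmeas (F k)) ->
  (forall k x, normc (F k x) <= M) -> (forall x, ccvg (F ^~ x) (f x)) ->
  ccvg (fun k => cmeasure_int mu (F k)) (cmeasure_int mu f).
Proof.
move=> mF FM Ff.
have hR nu : charge_int nu (fun x => Re (F k x)) @[k --> \oo] --> charge_int nu (fun x => Re (f x)).
  apply: (@charge_int_cvg nu _ _ M) => [k|k x|x]; [exact: (mF k).1| |exact: (Ff x).1].
  exact: le_trans (Re_le_normc _) (FM k x).
have hI nu : charge_int nu (fun x => Im (F k x)) @[k --> \oo] --> charge_int nu (fun x => Im (f x)).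
  apply: (@charge_int_cvg nu _ _ M) => [k|k x|x]; [exact: (mF k).2| |exact: (Ff x).2].
  exact: le_trans (Im_le_normc _) (FM k x).
by split=> /=; [apply: cvgB|apply: cvgD].
Qed.
End Charges.

(** * Waves as test functions and eigenfunctions of the operator [D] *)

Section PathWaves.
Context {R : realType} (gamma : R).
Local Notation X := (l2 (- gamma)).
Local Notation T := (nat -> R).
Implicit Types (xi : l2 gamma) (x : X) (u : X -> R).

Lemma sfun_cmeasure (mu : cmeasure (l2borel gamma) R) n :
  sfun n (fun f => cmeasure_int mu (fun x : l2borel gamma => f (l2seq x))).
Proof.
split=> [a f g cf cg|F f M cF FM Ff].
  have [B hB] := cyl_bounded cf; have [C hC] := cyl_bounded cg.
  apply: (@cmeasure_int_lin _ _ _ mu a (fun x : l2borel gamma => f (l2seq x)) (fun x : l2borel gamma => g (l2seq x)) B C) => //.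
    exact: (cyl_meas (@coord_measurable _ gamma) cf).
  exact: (cyl_meas (@coord_measurable _ gamma) cg).
apply: (@cmeasure_int_cvg _ _ _ mu (fun k (x : l2borel gamma) => F k (l2seq x)) _ M) => // k.
exact: (cyl_meas (@coord_measurable _ gamma) (cF k)).
Qed.

Lemma l2seq_lin (h : R) (v x : X) i : l2seq (h *: v + x) i = h * l2seq v i + l2seq x i.
Proof. by []. Qed.

Lemma bracket_psum xi x : \sum_(i < n) l2seq xi i * l2seq x i @[n --> \oo] --> bracket xi x.
Proof.
have := @bracket_cvg _ gamma xi x => /cvg_ex[l hl].
rewrite /bracket (cvg_lim _ hl) //; move: hl; rewrite /series /=.
by under eq_fun do rewrite big_mkord.
Qed.

Lemma bracket_lin xi (h : R) (v x : X) : bracket xi (h *: v + x) = h * bracket xi v + bracket xi x.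
Proof.
apply: (cvg_unique _ (@bracket_psum xi (h *: v + x))) => //.
rewrite (_ : (fun n => _) = (fun n => h * (\sum_(i < n) l2seq xi i * l2seq v i) + \sum_(i < n) l2seq xi i * l2seq x i)).
  by apply: cvgD; [apply: cvgMl_tmp|]; exact: bracket_psum.
apply/funext => n; rewrite mulr_sumr -big_split; apply: eq_bigr => i _.
transitivity (l2seq xi i * (h * l2seq v i + l2seq x i)); first by [].
by rewrite mulrDr mulrCA.
Qed.

Lemma bracket_unit xi i : bracket xi (l2unit (- gamma) i) = l2seq xi i.
Proof.
apply/cvg_lim => //; apply: cvg_near_cst; exists i.+1 => // n /= ni.
rewrite /series /= big_mkord (bigD1 (Ordinal ni)) //= eqxx mulr1 big1 ?addr0 // => j ji.
by rewrite (_ : (j == i :> nat) = false) ?mulr0 //; apply: negbTE.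
Qed.

Lemma bracket_line xi (h : R) i x : bracket xi (h *: l2unit (- gamma) i + x) = h * l2seq xi i + bracket xi x.
Proof. by rewrite bracket_lin bracket_unit. Qed.

Lemma l2norm_sqr x : \sum_(i < n) l2weight (- gamma) i * l2seq x i ^+ 2 @[n --> \oo] --> `|x| ^+ 2.
Proof.
have -> : `|x| ^+ 2 = l2inner x x by rewrite sqr_sqrtr // l2inner_ge0.
have := @l2inner_cvg _ _ x x => /cvg_ex[l hl].
rewrite /l2inner (cvg_lim _ hl) //; move: hl; rewrite /series /=.
by under eq_fun do rewrite big_mkord.
Qed.

Lemma l2norm_psum x n : \sum_(i < n) l2weight (- gamma) i * l2seq x i ^+ 2 <= `|x| ^+ 2.
Proof.
have h := @l2norm_sqr x; rewrite -(cvg_lim _ h) //.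
apply: nondecreasing_cvgn_le; last by apply/cvg_ex; eexists; exact: h.
by apply/nondecreasing_seqP => k; rewrite big_ord_recr lerDl mulr_ge0 ?l2weight_ge0 ?sqr_ge0.
Qed.

Lemma bracket_continuous xi : continuous (fun x : X => bracket xi x).
Proof.
pose A := limn (series (fun i => l2weight gamma i * l2seq xi i ^+ 2)).
have A0 n : \sum_(i < n) l2weight gamma i * l2seq xi i ^+ 2 <= A.
  apply: series_le_lim => [i|]; last exact: l2_sqr_cvg.
  by rewrite mulr_ge0 ?l2weight_ge0 ?sqr_ge0.
have Age : 0 <= A by have := A0 0%N; rewrite big_ord0.
have B x (c : R) : 0 < c -> `|bracket xi x| <= c * A + c^-1 * `|x| ^+ 2.
  move=> c0; have h := @bracket_psum xi x.
  have hn : `|\sum_(i < n) l2seq xi i * l2seq x i| @[n --> \oo] --> `|bracket xi x| by exact: cvg_norm.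
  rewrite -(cvg_lim _ hn) //; apply: limr_le; first by apply/cvg_ex; eexists; exact: hn.
  apply: nearW => n; apply: le_trans (ler_norm_sum _ _ _) _.
  apply: (@le_trans _ _ (\sum_(i < n) (c * (l2weight gamma i * l2seq xi i ^+ 2) + c^-1 * (l2weight (- gamma) i * l2seq x i ^+ 2)))).
    by apply: ler_sum => i _; exact: bracket_AMGM.
  rewrite big_split /= -!mulr_sumr; apply: lerD; first exact: ler_wpM2l (ltW c0) _ _ (A0 n).
  by apply: ler_wpM2l; [rewrite invr_ge0 ltW|exact: l2norm_psum].
move=> x P /nbhs_ballP[e /= e0 eP].
suff: nbhs x (fun y => P (bracket xi y)) by [].
(* The parameter of the weighted inequality [B] makes the contribution [c * A] of [xi] less than
   [e / 2], and the radius [del] does the same for that of [x - y]; [del <= 1] allows the square to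
   be bounded by the distance. *)
pose c := e / 2 / (A + 1); have c0 : 0 < c by rewrite !divr_gt0 // ltr_wpDl.
pose del := Num.min 1 (c * (e / 2)); have del0 : 0 < del by rewrite lt_min ltr01 mulr_gt0 // divr_gt0.
apply/nbhs_ballP; exists del => //= y; rewrite -ball_normE /= => xy; apply: eP.
rewrite -ball_normE /=.
have E : bracket xi x - bracket xi y = bracket xi (x - y).
  have := bracket_lin xi (-1) y x; rewrite scaleN1r addrC => ->; ring.
rewrite E; apply: le_lt_trans (B _ c c0) _.
have h1 : c * A < e / 2.
  rewrite /c mulrAC ltr_pdivrMr ?ltr_wpDl // ltr_pM2l ?divr_gt0 //; lra.
have h2 : c^-1 * `|x - y| ^+ 2 <= e / 2.
  rewrite mulrC ler_pdivrMr // mulrC.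
  have z0 := normr_ge0 (x - y); move: xy; rewrite lt_min => /andP[z1 z2].
  by set z := `|x - y| in z0 z1 z2 *; nra.
lra.
Qed.

Lemma is_derive_line u (g : R -> R) (d : R) x (v : X) : (forall h, u (h *: v + x) = g h) ->
  is_derive (0 : R) 1 g d -> is_derive x v u d.
Proof.
move=> ug [dg dv].
have u0 : u x = g 0 by rewrite -ug scale0r add0r.
have E : (fun h : R => h^-1 *: ((u \o shift x) (h *: v) - u x)) =
    (fun h : R => h^-1 *: ((g \o shift 0) (h *: 1) - g 0)).
  by apply/funext => h; rewrite /= ug u0 addr0 [h *: 1]mulr1.
split; first by rewrite /derivable E.
by rewrite /derive E.
Qed.

(** The smallest convenient family containing the real and imaginary parts of a wave and stable
    under partial derivatives: differentiating multiplies the amplitude and shifts the phase by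
    [pi / 2]. Two derivatives restore the function up to a negative factor. *)
Definition coswave xi (c theta : R) : X -> R := fun x => c * cos (bracket xi x + theta).

Lemma dv_coswave xi c theta i x :
  is_derive x (l2unit (- gamma) i) (coswave xi c theta) (coswave xi (c * l2seq xi i) (theta + pi / 2) x).
Proof.
apply: (@is_derive_line _ (fun h => c * cos (h * l2seq xi i + (bracket xi x + theta)))) => [h|].
  by rewrite /coswave bracket_line addrA.
have h1 := dvD (dvM (is_derive_id (0 : R) 1) (is_derive_cst (l2seq xi i) (0 : R) (1 : R))) (is_derive_cst (bracket xi x + theta) (0 : R) (1 : R)).
apply: (dv_eq (dvZ c (dv_comp (is_derive_cos _) h1))).
by rewrite /coswave /cst mul0r add0r addrA (cosD _ (pi / 2)) cos_pihalf sin_pihalf; ring.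
Qed.

Lemma pderiv_coswave xi c theta i :
  pderiv i (coswave xi c theta) = coswave xi (c * l2seq xi i) (theta + pi / 2).
Proof. by apply/funext => x; have [_] := dv_coswave xi c theta i x. Qed.

Lemma coswave_smooth2 xi c theta : smooth2 (coswave xi c theta).
Proof.
move=> s _; have [c' [t' ->]] : exists c' t' : R, foldr (@pderiv R gamma) (coswave xi c theta) s = coswave xi c' t'.
  elim: s => [|i s [c' [t' E]]] /=; first by exists c, theta.
  by rewrite E pderiv_coswave; do 2!eexists.
split.
- move=> x; apply: (@continuous_comp _ _ _ (fun y : X => bracket xi y) (fun r : R => c' * cos (r + t')) x).
    exact: bracket_continuous.
  apply: cvgM; first exact: cvg_cst.
  apply: (continuous_cvg _ (@continuous_cos R _)); apply: cvgD; [exact: cvg_id|exact: cvg_cst].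
- exists `|c'| => x; rewrite normrM -[leRHS]mulr1 ler_wpM2l // ler_norml cos_geN1 cos_le1 //.
- by move=> i _ x; have [] := dv_coswave xi c' t' i x.
Qed.

Definition wave_factor (beta : T) xi n : R := \prod_(i < n) (1 + beta i / 2 * l2seq xi i ^+ 2).

Lemma D_partial_coswave beta n xi c theta :
  D_partial beta n (coswave xi c theta) = coswave xi (wave_factor beta xi n * c) theta.
Proof.
rewrite /D_partial; elim: n => [|n IH] /=; first by rewrite /wave_factor big_ord0 mul1r.
rewrite IH /D_factor !pderiv_coswave; apply/funext => x; rewrite /wave_factor big_ord_recr /=.
rewrite /coswave (_ : theta + pi / 2 + pi / 2 = theta + pi); last by lra.
by rewrite addrA cosDpi; ring.
Qed.

Lemma uniform_cvgP (F : nat -> X -> R) (f : X -> R) :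
  {uniform, F n @[n --> \oo] --> f} <->
  (forall e : R, 0 < e -> \forall n \near \oo, forall x, `|f x - F n x| < e).
Proof.
split=> [h e e0|h P].
  have : nbhs (f : {uniform X -> R}) [set g | forall x, `|f x - g x| < e].
    apply/uniform_nbhs; exists [set xy : R * R | ball xy.1 e xy.2]; split; first by rewrite -entourage_ballE; exists e.
    by move=> g hg x; have := hg x I; rewrite -ball_normE.
  by move/h.
move=> /uniform_nbhs[E [entE EP]].
move: entE; rewrite -entourage_ballE => -[e /= e0 eE].
have := h e e0; apply: filterS => n hn; apply: EP => x _; apply: eE.
by rewrite /= -ball_normE; exact: hn.
Qed.

Lemma coswave_suitable beta xi c theta (P : R) : wave_factor beta xi n @[n --> \oo] --> P ->
  suitable_real beta (coswave xi c theta) /\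
  D_prod beta (coswave xi c theta) = coswave xi (P * c) theta.
Proof.
move=> hP.
have E : D_prod beta (coswave xi c theta) = coswave xi (P * c) theta.
  apply/funext => x; apply/cvg_lim => //; under eq_fun do rewrite D_partial_coswave.
  by apply: cvgMr_tmp; apply: cvgMr_tmp.
split=> //; split; first exact: coswave_smooth2.
rewrite E; apply/uniform_cvgP => e e0.
have hc : wave_factor beta xi n * c @[n --> \oo] --> P * c by apply: cvgMr_tmp.
have /cvgrPdist_lt/(_ e e0) := hc; apply: filterS => n hn x.
rewrite D_partial_coswave /coswave -mulrBl normrM; apply: le_lt_trans hn.
by rewrite ler_piMr // ler_norml cos_geN1 cos_le1.
Qed.

Lemma wave_Re xi : (fun x => Re (wave xi x)) = coswave xi 1 0.
Proof. by apply/funext => x; rewrite /coswave mul1r addr0. Qed.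

Lemma wave_Im xi : (fun x => Im (wave xi x)) = coswave xi 1 (- (pi / 2)).
Proof.
by apply/funext => x; rewrite /coswave mul1r /= cosD cosN sinN cos_pihalf sin_pihalf; ring.
Qed.

Lemma D_op_wave beta xi (P : R) : wave_factor beta xi n @[n --> \oo] --> P ->
  suitable beta (wave xi) /\ D_op beta (wave xi) = (fun x => (P%:C)%C * wave xi x).
Proof.
move=> hP; have [s1 e1] := coswave_suitable 1 0 hP; have [s2 e2] := coswave_suitable 1 (- (pi / 2)) hP.
split; first by split; rewrite ?wave_Re ?wave_Im.
apply/funext => x; rewrite /D_op wave_Re wave_Im e1 e2 /coswave mulr1 addr0.
have M t : (P%:C)%C * cis t = Complex (P * cos t) (P * sin t).
  by apply: complex_eq; rewrite /= ?mul0r ?subr0 ?addr0.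
by rewrite cosD cosN sinN cos_pihalf sin_pihalf /wave M; congr Complex; ring.
Qed.
End PathWaves.

(** * The complex measure on the path space and its Fourier transform *)

Section Existence.
Context {R : realType} (gamma : R) (hgamma : 7 / 2 < gamma).
Local Notation X := (l2 (- gamma)).
Local Notation T := (nat -> R).
Local Notation mixbeta := (@mixbeta R).

Lemma pt_code_coord (x y : T) i k : x i = y i -> @pt R (code x k) i = @pt R (code y k) i.
Proof.
move=> xy; elim: k => [|k IH] //.
rewrite [code x k.+1]/= [code y k.+1]/= [@pt R (test _ x :: _)]/= [@pt R (test _ y :: _)]/= !size_code /test !size_code.
have [ij|ij] := eqVneq i (qi k); last first.
  by case: ifP => _; case: ifP => _; rewrite /upd ?(negbTE ij).
by rewrite -ij IH xy; case: ifP => _; rewrite /upd ?eqxx ?IH.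
Qed.

Lemma minK_form_trunc n k (xi : T) : (n <= k)%N -> minK_form k (trunc n xi) = minK_form n xi.
Proof.
move=> nk; have E (F : nat -> R) : (forall i, (n <= i)%N -> F i = 0) -> \sum_(i < k) F i = \sum_(i < n) F i.
  move=> F0; rewrite -!(big_mkord predT F) (big_cat_nat (leq0n n) nk) /= [X in _ + X]big_nat_cond [X in _ + X]big1 ?addr0 ?big_mkord //.
  by move=> i; rewrite andbT => /andP[ni _]; exact: F0.
rewrite /minK_form (E (fun i => \sum_(j < k) minK i j * trunc n xi i * trunc n xi j)) => [|i ni]; last first.
  by apply: big1 => j _; rewrite /trunc ltnNge ni /= mulr0 mul0r.
apply: eq_bigr => i _; rewrite (E (fun j => minK i j * trunc n xi i * trunc n xi j)) => [|j nj]; last first.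
  by rewrite {2}/trunc ltnNge nj /= mulr0.
by apply: eq_bigr => j _; rewrite /trunc !ltn_ord.
Qed.

Lemma wave_product_trunc n k (xi : T) : (n <= k)%N ->
  \prod_(j < k) (1 + mixbeta j / 2 * trunc n xi j ^+ 2) = \prod_(j < n) (1 + mixbeta j / 2 * xi j ^+ 2).
Proof.
move=> nk; pose F j := 1 + mixbeta j / 2 * trunc n xi j ^+ 2.
rewrite -(big_mkord predT F) (big_cat_nat (leq0n n) nk) /= [X in _ * X]big_nat_cond [X in _ * X]big1 ?mulr1.
  by rewrite big_mkord; apply: eq_bigr => j _; rewrite /F /trunc ltn_ord.
by move=> j; rewrite andbT => /andP[nj _]; rewrite /F /trunc ltnNge nj /= expr0n mulr0 addr0.
Qed.

(* The coherent family of functionals given by [path_functional] is integration against a complex measure. *)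
Lemma path_measure : exists mu : cmeasure (l2borel gamma) R, forall n (xi : T),
  cmeasure_int mu (fun x : l2borel gamma => cwave n xi (l2seq x)) =
  (((\prod_(j < n) (1 + mixbeta j / 2 * xi j ^+ 2))^-1)%:C)%C * cis (- minK_form n xi / 2).
Proof.
have [L hL] := choice (path_functional hgamma); have [D {}hL] := choice hL.
have sL n : sfun n (L n) by have [] := hL n.
have wL n xi : L n (cwave n xi) = (((\prod_(j < n) (1 + mixbeta j / 2 * xi j ^+ 2))^-1)%:C)%C * cis (- minK_form n xi / 2).
  by have [_ h] := hL n.
(* Coherence is checked on waves only: a wave in [n] variables is one in [k] variables with the last
   frequencies [0], and these contribute trivially to both the product and the quadratic form. *)
have coh n k f : (n <= k)%N -> cyl n f -> L k f = L n f.
  move=> nk; apply: (sfun_uniq (sfun_widen nk (sL k)) (sL n)) => xi.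
  rewrite (_ : cwave n xi = cwave k (trunc n xi)); last by apply/funext => x; rewrite cwave_widen.
  by rewrite wL wave_product_trunc // minK_form_trunc // (_ : cwave k (trunc n xi) = cwave n xi) ?wL //; apply/funext => x; rewrite cwave_widen.
have Dsum n m (r : seq m) (c : m -> R) (F : m -> T -> R) : (forall s, rcyl n (F s)) ->
    rcyl n (fun x => \sum_(s <- r) c s * F s x) /\ D n (fun x => \sum_(s <- r) c s * F s x) = \sum_(s <- r) c s * D n (F s).
  have [_ _ [lin _ _] _ _] := hL n; move=> rF.
  have D0 : D n (fun=> 0) = 0.
    have := lin 1 (fun=> 0) (fun=> 0) (rcyl_cst n 0) (rcyl_cst n 0).
    by rewrite (_ : (fun _ : T => _) = (fun=> 0)); [lra|apply/funext => x; rewrite mulr0 addr0].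
  elim: r => [|s r [r1 e1]].
    split; first by apply: (eq_rcyl _ (rcyl_cst n 0)) => x; rewrite big_nil.
    by rewrite (_ : (fun x : T => _) = (fun=> 0)) ?big_nil //; apply/funext => x; rewrite big_nil.
  split; first by apply: (eq_rcyl _ (rcylD (rcylZ (c s) (rF s)) r1)) => x; rewrite big_cons.
  rewrite (_ : (fun x : T => _) = (fun x => c s * F s x + \sum_(s <- r) c s * F s x)).
    by rewrite lin // e1 big_cons.
  by apply/funext => x; rewrite big_cons.
(* The weight of a node is the functional applied to its indicator; [p] stands for [Re] or [Im], so
   that real and imaginary parts are treated together. The level [size s] is immaterial by
   coherence. *)
pose nu (p : R[i] -> R) s := p (L (size s) (fun x => ((chi s x)%:C)%C)).
have nuD p : (forall a b, p (a + b) = p a + p b) -> forall s, nu p s = nu p (true :: s) + nu p (false :: s).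
  move=> pD s; rewrite /nu /= -pD; congr p.
  have c1 b : rcyl (size s).+1 (chi (b :: s)) by exact: chi_rcyl.
  rewrite -(coh _ _ _ (leqnSn (size s))); last exact: chi_rcyl.
  have [l _] := sL (size s).+1.
  rewrite (_ : (fun x => ((chi s x)%:C)%C) = (fun x => 1 * ((chi (true :: s) x)%:C)%C + ((chi (false :: s) x)%:C)%C)).
    by rewrite l ?mul1r //; exact: c1.
  by apply/funext => x; rewrite mul1r -rmorphD -chi_split.
have nu_le p s : (forall a, `|p a| <= normc a) -> `|nu p s| <= D (size s) (chi s).
  move=> pn; apply: le_trans (pn _) _; have [_ _ _ dom _] := hL (size s).
  by apply: dom; [exact: chi_rcyl|exact: chi_rcyl|move=> x; rewrite normc_real ger0_norm ?chi_ge0].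
(* On strings of length [k] the truncation changes nothing; on the others it makes membership in
   [cyl k] unconditional, as [Dsum] demands. *)
have rchi k s : rcyl k (@chi R (take k s)) by apply: chi_rcyl; rewrite size_take; case: ltnP.
have nu_sum p k (c : seq bool -> R) : (forall a, `|p a| <= normc a) -> (forall s, 0 <= c s) ->
    rcyl k (fun x => c (code x k)) /\ \sum_(d <- strings k) `|nu p d| * c d <= D k (fun x => c (code x k)).
  move=> pn c0; have [r1 e1] := Dsum k _ (strings k) c (fun s => chi (take k s)) (rchi k).
  have E : (fun x => \sum_(s <- strings k) c s * chi (take k s) x) = (fun x => c (code x k)).
    apply/funext => x; rewrite -(sum_chi c); apply: eq_big_strings => s ss.
    by rewrite take_oversize ?ss.
  rewrite -E e1; split=> //; apply: ler_sum_strings => s ss.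
  rewrite mulrC ler_wpM2l // take_oversize ?ss //.
  by have := nu_le p s pn; rewrite ss.
have var p : (forall a, `|p a| <= normc a) -> forall k, \sum_(d <- strings k) `|nu p d| <= @mixM R.
  move=> pn k; have [_ _ [_ _ D1] _ _] := hL k; apply: le_trans D1.
  by have [_] := nu_sum p k (fun=> 1) pn (fun=> ler01); under eq_bigr do rewrite mulr1.
(* The coded approximation never lies beyond [x], so its [sqnorm] is at most that of [x], and the
   tail estimate of the dominating functional applies. *)
have tail p : (forall a, `|p a| <= normc a) -> forall e : R, 0 < e -> exists2 t : R, 0 < t &
    forall k, \sum_(d <- strings k) `|nu p d| * Num.min 1 (t * sqnorm gamma k (pt d)) <= e.
  move=> pn e e0; have [t t0 ht] := mixtail_rate_small hgamma e0; exists t => // k.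
  have c0 s : 0 <= Num.min 1 (t * sqnorm gamma k (pt s)) by rewrite le_min ler01 mulr_ge0 ?sqnorm_ge0 // ltW.
  have [rc h] := nu_sum p k (fun s => Num.min 1 (t * sqnorm gamma k (pt s))) pn c0.
  apply: le_trans h _; have [_ _ [_ mono _] _ tl] := hL k.
  apply: le_trans (le_trans (tl t t0) ht); apply: mono => //.
    by apply: rcyl_min_sqnorm => //; exact: ltW.
  move=> x; rewrite le_min !ge_min lexx /=; apply/orP; right.
  rewrite ler_wpM2l ?(ltW t0) //; apply: sqnorm_beyond => j; exact: pt_code_beyond.
(* The sum over strings is the functional at level [k] of [F] evaluated at the coded approximation.
   That function depends on [n] coordinates only, because the approximation of a coordinate is
   driven by that coordinate alone; so the level drops to [n], where continuity gives the limit. *)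
have lim p n (F : T -> R) B : (forall a b, p (a + b) = p a + p b) -> (forall (a : R) b, p ((a%:C)%C * b) = a * p b) ->
    (forall u z, ccvg u z -> p (u k) @[k --> \oo] --> p z) -> cont_n n F -> (forall x, `|F x| <= B) ->
    \sum_(d <- strings k) F (pt d) * nu p d @[k --> \oo] --> p (L n (fun x => ((F x)%:C)%C)).
  move=> pD pZ pc cF FB.
  pose Fk k (x : T) := F (pt (code x k)).
  have FkE k x : Fk k (trunc n x) = Fk k x.
    rewrite /Fk -[F]((cont_n_trunc cF)) /=; congr F; apply/funext => i; rewrite /trunc; case: ifP => // ni.
    by apply: pt_code_coord; rewrite ni.
  have rk k : rcyl k (Fk k) by exact: (rcyl_code F (leqnn k)).
  have rn k : rcyl n (Fk k).
    apply: (eq_cyl _ (cyl_trunc n (rk k))) => x; by rewrite /= FkE.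
  have cv : ccvg (fun k => L n (fun x => ((Fk k x)%:C)%C)) (L n (fun x => ((F x)%:C)%C)).
    apply: ((sL n).2 (fun k x => ((Fk k x)%:C)%C) _ B) => [k|k x|x]; first exact: rn.
      by rewrite normc_real; exact: FB.
    by apply: ccvg_real; apply: (cont_n_cvg cF) => i _; exact: pt_code_cvg.
  have := pc _ _ cv; apply: cvg_trans; apply: near_eq_cvg; exists n => // k /= nk.
  rewrite -(coh n k _ nk (rn k)).
  have [l _] := sL k.
  have pS (r : seq (seq bool)) : (forall s, s \in r -> size s = k) ->
      p (L k (fun x => ((\sum_(s <- r) F (pt s) * chi (take k s) x)%:C)%C)) = \sum_(s <- r) F (pt s) * nu p s.
    have L0 : p (L k (fun=> 0)) = 0.
      have Z := sfunZ 0 (sL k) (cyl_cst k 0).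
      have E : (fun _ : T => 0 * 0 : R[i]) = (fun=> 0) by apply/funext => x; rewrite mul0r.
      by rewrite E mul0r in Z; rewrite Z; have := pZ 0 0; rewrite mulr0 mul0r.
    elim: r => [|s r IH] hr.
      rewrite big_nil (_ : (fun x : T => _) = (fun=> 0)) //; apply/funext => x; by rewrite big_nil.
    rewrite big_cons -IH => [|s' hs']; last by apply: hr; rewrite inE hs' orbT.
    have ss : size s = k by apply: hr; rewrite inE eqxx.
    rewrite (_ : (fun x : T => _) = (fun x => ((F (pt s))%:C)%C * ((chi (take k s) x)%:C)%C + ((\sum_(s <- r) F (pt s) * chi (take k s) x)%:C)%C)).
      rewrite l; [|exact: rchi|by apply: rcyl_sum => s'; apply: rcylZ; exact: rchi].
      by rewrite pD pZ /nu ss take_oversize ?ss.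
    by apply/funext => x; rewrite big_cons rmorphD rmorphM.
  rewrite -(pS (strings k)) => [|s]; last exact: size_strings.
  congr (p (L k _)); apply/funext => x; congr ((_ %:C)%C).
  rewrite /Fk -(sum_chi (fun s => F (pt s))); apply: eq_big_strings => s ss.
  by rewrite take_oversize ?ss.
have [m1 [m2 [f1 f2 hr]]] := tree_measure (nuD _ (@ReD R)) (var _ (@Re_le_normc R)) (tail _ (@Re_le_normc R)).
have [m3 [m4 [f3 f4 hi]]] := tree_measure (nuD _ (@ImD R)) (var _ (@Im_le_normc R)) (tail _ (@Im_le_normc R)).
have [re hre] := charge_difference f1 f2; have [im him] := charge_difference f3 f4.
exists (CMeasure re im) => n xi.
have intE n' (F : T -> R) B : cont_n n' F -> (forall x, `|F x| <= B) ->
    charge_int re (fun x => F (l2seq x)) = Re (L n' (fun x => ((F x)%:C)%C)) /\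
    charge_int im (fun x => F (l2seq x)) = Im (L n' (fun x => ((F x)%:C)%C)).
  move=> cF FB; have mF : measurable_fun setT (fun x : l2borel gamma => F (l2seq x)).
    exact: (cyl_meas (@coord_measurable _ gamma) (rcyl_cont cF FB)).1.
  rewrite (charge_int_difference f1 f2 hre mF (fun x => FB _)) (charge_int_difference f3 f4 him mF (fun x => FB _)).
  split.
    apply: (cvg_unique _ (hr n' F B cF FB)) => //.
    by apply: (lim _ _ _ B) => // [a b|a b|u z []//]; rewrite ?ReImE ?mul0r ?subr0.
  apply: (cvg_unique _ (hi n' F B cF FB)) => //.
  by apply: (lim _ _ _ B) => // [a b|a b|u z []//]; rewrite ?ReImE ?mul0r ?addr0.
pose S (x : T) : R := \sum_(i < n) xi i * x i.
have cS : cont_n n S.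
  apply: (@cont_n_sum R n n (fun i x => xi i * x i)) => i ni.
  apply: (@cont_n_coord R n i (fun y => xi i * y)) => // y.
  by apply: cvgM; [exact: cvg_cst|exact: cvg_id].
have cc := cont_n_comp (@continuous_cos R) cS; have cs := cont_n_comp (@continuous_sin R) cS.
have bc x : `|cos (S x)| <= 1 by rewrite ler_norml cos_geN1 cos_le1.
have bs x : `|sin (S x)| <= 1 by rewrite ler_norml sin_geN1 sin_le1.
have [c1 c2] := intE n _ 1 cc bc; have [s1 s2] := intE n _ 1 cs bs.
rewrite -wL /cmeasure_int /= -/(S _).
have -> : cwave n xi = (fun x => (Complex 0 1) * ((sin (S x))%:C)%C + ((cos (S x))%:C)%C).
  have M (s c : R) : Complex 0 1 * (s%:C)%C + (c%:C)%C = Complex c s.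
    by rewrite -[LHS]/(Complex (0 * s - 1 * 0 + c) (0 * 0 + 1 * s + 0)); congr Complex; ring.
  by apply/funext => x; rewrite M.
rewrite (sL n).1; [|exact: (rcyl_cont cs bs)|exact: (rcyl_cont cc bc)].
rewrite c1 c2 s1 s2; move: (L n _) (L n _) => [p q] [r s].
by apply: complex_eq => /=; rewrite !(mul0r, mul1r, add0r) // addrC.
Qed.

(** The square sum and the bracket differ by the row remainders [r n i], bounded uniformly in [i] by
    the tail of the convergent series of [b]. As [|xi_i| <= b i] too, the total error is at most the
    sum of [b] times its tail. *)
Lemma minK_form_cvg (xi : l2 gamma) :
  minK_form n (l2seq xi) @[n --> \oo] --> bracket xi (minK_map hgamma xi).
Proof.
pose b j : R := j.+1%:R `^ (- (gamma - 2)) + l2weight gamma j * l2seq xi j ^+ 2.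
have b0 j : 0 <= b j by rewrite addr_ge0 ?powR_ge0 // mulr_ge0 ?l2weight_ge0 ?sqr_ge0.
have bc : cvgn (series b) := @minK_bound_cvg R gamma hgamma xi.
pose Bs := limn (series b).
have kle i j : `|minK i j * l2seq xi j| <= b j := @minK_row_le R gamma xi i j.
have xle j : `|l2seq xi j| <= b j.
  by have := kle 0%N j; rewrite /minK (_ : minn 1 j.+1 = 1%N) ?mul1r // minnSS min0n.
pose r n i : R := minK_row (l2seq xi) i - \sum_(j < n) minK i j * l2seq xi j.
have ble n : \sum_(j < n) b j <= Bs by exact: series_le_lim.
have rle n i : `|r n i| <= Bs - \sum_(j < n) b j.
  have c1 : \sum_(j < m) minK i j * l2seq xi j @[m --> \oo] --> minK_row (l2seq xi) i.
    have := normed_cvg (@minK_row_cvg R gamma hgamma xi i) => /cvg_ex[l hl].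
    rewrite /minK_row (cvg_lim _ hl) //; move: hl; rewrite /series /=.
    by under eq_fun do rewrite big_mkord.
  have hn : `|\sum_(j < m) minK i j * l2seq xi j - \sum_(j < n) minK i j * l2seq xi j| @[m --> \oo] --> `|r n i|.
    by apply: cvg_norm; apply: cvgB => //; exact: cvg_cst.
  rewrite -(cvg_lim _ hn) //; apply: limr_le; first by apply/cvg_ex; eexists; exact: hn.
  exists n => // m /= nm.
  have E (F : nat -> R) : \sum_(j < m) F j - \sum_(j < n) F j = \sum_(n <= j < m) F j.
    by rewrite -!(big_mkord predT F) (big_cat_nat (leq0n n) nm) /= addrAC subrr add0r.
  rewrite (E (fun j => minK i j * l2seq xi j)); apply: le_trans (ler_norm_sum _ _ _) _.
  apply: (@le_trans _ _ (\sum_(n <= j < m) b j)); first by apply: ler_sum => j _; exact: kle.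
  by rewrite -E lerB.
have h1 : \sum_(i < n) l2seq xi i * minK_row (l2seq xi) i @[n --> \oo] --> bracket xi (minK_map hgamma xi).
  exact: bracket_psum.
have bS : \sum_(j < n) b j @[n --> \oo] --> Bs.
  have -> : (fun n : nat => \sum_(j < n) b j) = series b; last exact: bc.
  by apply/funext => n; rewrite /series /= big_mkord.
have h2 : Bs * (Bs - \sum_(j < n) b j) @[n --> \oo] --> (0 : R).
  rewrite -[X in _ --> X](mulr0 Bs); apply: cvgMl_tmp; rewrite -[X in _ --> X](subrr Bs).
  by apply: cvgB bS; exact: cvg_cst.
have h3 : \sum_(i < n) l2seq xi i * r n i @[n --> \oo] --> (0 : R).
  apply/norm_cvg0P; apply: (squeeze_cvgr _ (cvg_cst (0 : R)) h2); apply: nearW => n.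
  rewrite normr_ge0 /=; apply: le_trans (ler_norm_sum _ _ _) _.
  apply: (@le_trans _ _ (\sum_(i < n) b i * (Bs - \sum_(j < n) b j))).
    by apply: ler_sum => i _; rewrite normrM ler_pM.
  by rewrite -mulr_suml ler_wpM2r // subr_ge0.
rewrite (_ : (fun n => _) = (fun n => \sum_(i < n) l2seq xi i * minK_row (l2seq xi) i - \sum_(i < n) l2seq xi i * r n i)).
  by rewrite -[X in _ --> X]subr0; exact: cvgB.
apply/funext => n; rewrite /minK_form -sumrB; apply: eq_bigr => i _.
rewrite /r -mulrBr opprB addrC subrK mulr_sumr; apply: eq_bigr => j _; ring.
Qed.

Lemma path_distribution_exists :
  exists (beta : T) (beta_gt0 : forall i, 0 < beta i) (mu : cmeasure (l2borel gamma) R),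
    strongly_concentrated mu /\
    has_fourier (PathDistribution beta_gt0 mu)
      (fun xi : l2 gamma => cis (- (bracket xi (minK_map hgamma xi) / 2))).
Proof.
have [mu hmu] := path_measure.
exists mixbeta, (@mixbeta_gt0 R), mu; split.
  by split; apply: finite_weak_radon; exact: total_variation_finite.
move=> xi.
pose a i := mixbeta i / 2 * l2seq xi i ^+ 2.
have a0 i : 0 <= a i by rewrite mulr_ge0 ?sqr_ge0 // divr_ge0 // ltW // mixbeta_gt0.
(* Since [5 / 2 <= gamma], the coefficients [beta_i / 2] stay below the weights of [l2 gamma]; with
   [1 + a <= exp a] this bounds the symbol of [D] on every wave. *)
have ac n : \sum_(i < n) a i <= limn (series (fun i => l2weight gamma i * l2seq xi i ^+ 2)).
  apply: (@le_trans _ _ (\sum_(i < n) l2weight gamma i * l2seq xi i ^+ 2)).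
    apply: ler_sum => i _; rewrite ler_wpM2r ?sqr_ge0 //.
    apply: (@le_trans _ _ (mixbeta i)); first by have := @mixbeta_gt0 R i; lra.
    by rewrite ler_powR ?ler1n //; move: hgamma; lra.
  by apply: series_le_lim => [i|]; [rewrite mulr_ge0 ?l2weight_ge0 ?sqr_ge0|exact: l2_sqr_cvg].
have Pnd : nondecreasing_seq (wave_factor mixbeta xi).
  apply/nondecreasing_seqP => n; rewrite /wave_factor big_ord_recr /=.
  apply: ler_peMr; last by rewrite lerDl; exact: a0.
  by apply: prodr_ge0 => i _; exact: addr_ge0 ler01 (a0 i).
have Pcv : cvgn (wave_factor mixbeta xi).
  apply: (nondecreasing_is_cvgn Pnd).
  exists (expR (limn (series (fun i => l2weight gamma i * l2seq xi i ^+ 2)))) => _ [n _ <-].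
  apply: (@le_trans _ _ (\prod_(i < n) expR (a i))).
    by apply: ler_prod => i _; apply/andP; split; [exact: addr_ge0 ler01 (a0 i)|exact: expR_ge1Dx].
  by rewrite -expR_sum ler_expR.
pose P := limn (wave_factor mixbeta xi).
have hP : wave_factor mixbeta xi n @[n --> \oo] --> P by [].
have P1 n : 1 <= wave_factor mixbeta xi n.
  by have := Pnd 0%N n (leq0n n); rewrite {1}/wave_factor big_ord0.
have P0 : P != 0.
  rewrite gt_eqF // (lt_le_trans ltr01) //; apply: limr_ge => //; exact: nearW.
have [suit opE] := D_op_wave hP.
split; first exact: suit.
rewrite /pd_act /= opE.
have mw n : cmeas (fun x : l2borel gamma => cwave n (l2seq xi) (l2seq x)).
  exact: (cyl_meas (@coord_measurable _ gamma) (cyl_wave n (l2seq xi))).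
have wc (x : l2borel gamma) : ccvg (fun n => cwave n (l2seq xi) (l2seq x)) (wave xi x).
  by apply: ccvg_cis; exact: bracket_psum.
have mwave : cmeas (fun x : l2borel gamma => wave xi x) := cmeas_cvg mw wc.
have c1 := @cmeasure_int_cvg _ _ _ mu _ _ 1 mw (fun n x => eq_ind_r (fun z => z <= 1) (lexx 1) (normc_cis _)) wc.
have mz : cmeas (fun _ : l2borel gamma => 0 : R[i]) by split; exact: measurable_cst.
have -> : cmeasure_int mu (fun x => (P%:C)%C * wave xi x) = (P%:C)%C * cmeasure_int mu (wave xi).
  have := @cmeasure_int_lin _ _ _ mu (P%:C)%C (fun x : l2borel gamma => wave xi x) (fun=> 0) 1 0 mwave
    (fun x => eq_ind_r (fun z => z <= 1) (lexx 1) (normc_cis _)) mz (fun x => eq_ind_r (fun z => z <= 0) (lexx 0) (Normc.normc0 R)).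
  have z0 : cmeasure_int mu (fun _ : l2borel gamma => 0) = 0.
    have := @cmeasure_int_lin _ _ _ mu 1 (fun _ : l2borel gamma => 0) (fun=> 0) 0 0 mz (fun x => eq_ind_r (fun z => z <= 0) (lexx 0) (Normc.normc0 R)) mz (fun x => eq_ind_r (fun z => z <= 0) (lexx 0) (Normc.normc0 R)).
    rewrite (_ : (fun _ : l2borel gamma => _) = (fun=> 0)); last by apply/funext => x; rewrite mulr0 addr0.
    by rewrite mul1r => h; apply: (addrI (cmeasure_int mu (fun=> 0))); rewrite addr0; exact/esym.
  rewrite z0 addr0 => <-; congr cmeasure_int; apply/funext => x; by rewrite addr0.
apply: (ccvg_unique (u := fun n => (P%:C)%C * cmeasure_int mu (fun x : l2borel gamma => cwave n (l2seq xi) (l2seq x)))).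
  exact: ccvgZ.
under eq_fun do rewrite hmu.
rewrite (_ : cis _ = (P%:C)%C * (((P^-1)%:C)%C * cis (- bracket xi (minK_map hgamma xi) / 2))); last first.
  by rewrite mulrA -rmorphM mulfV // rmorph1 mul1r mulNr.
apply: ccvgZ; apply: ccvgM.
  by apply: ccvg_real; apply: cvgV.
apply: ccvg_cis; apply: cvgMr_tmp; apply: cvgN; exact: minK_form_cvg.
Qed.
End Existence.

Local Arguments D_factor : simpl never.

(** * Directional calculus on the path space *)
Section DirectionalCalculus.
Context {R : realType} (gamma : R).
Local Notation X := (l2 (- gamma)).
Local Notation e_ := (l2unit (- gamma)).
Implicit Types (u v w : X -> R) (x y : X).

Definition ncont v := forall x (e : R), 0 < e -> exists2 d : R, 0 < d & forall y, `|x - y| < d -> `|v x - v y| < e.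

Lemma continuous_ncont v : continuous v -> ncont v.
Proof.
move=> cv x e e0.
have : nbhs (v x) (ball (v x) e) by exact: nbhsx_ballx.
move=> /(cv x) h; have /nbhs_ballP[d /= d0 hd] : nbhs x (v @^-1` ball (v x) e) by exact: h.
by exists d => // y xy; have := hd y; rewrite -!ball_normE /=; exact.
Qed.

Lemma ncontBZ v w (c : R) : ncont v -> ncont w -> ncont (fun x => v x - c * w x).
Proof.
move=> cv cw x e e0; have [|d1 d10 h1] := cv x (e / 2); first by rewrite divr_gt0.
have c0 : 0 < `|c| + 1 by rewrite ltr_wpDl.
have [|d2 d20 h2] := cw x (e / 2 / (`|c| + 1)); first by rewrite !divr_gt0.
exists (Num.min d1 d2) => [|y]; first by rewrite lt_min d10.
rewrite lt_min => /andP[/h1 l1 /h2 l2].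
rewrite (_ : _ - _ = (v x - v y) - c * (w x - w y)); last by ring.
apply: le_lt_trans (ler_normB _ _) _; rewrite normrM.
have l3 : `|c| * `|w x - w y| <= e / 2.
  apply: (@le_trans _ _ (`|c| * (e / 2 / (`|c| + 1)))); first by rewrite ler_wpM2l // ltW.
  rewrite mulrA ler_pdivrMr // mulrC ler_wpM2l ?lerDl //; by rewrite divr_ge0 // ltW.
lra.
Qed.

Lemma line_derive u (du : X -> R) (v : X) : (forall y, is_derive y v u (du y)) ->
  forall x (t : R), is_derive t (1 : R) (fun h => u (h *: v + x)) (du (t *: v + x)).
Proof.
move=> ud x t; have [hd hv] := ud (t *: v + x).
have E : (fun h : R => h^-1 *: (((fun h => u (h *: v + x)) \o shift t) (h *: 1) - u (t *: v + x))) =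
    (fun h : R => h^-1 *: ((u \o shift (t *: v + x)) (h *: v) - u (t *: v + x))).
  by apply/funext => h; rewrite /= [h *: 1]mulr1 scalerDl addrA.
split; first by rewrite /derivable E.
by rewrite /derive E.
Qed.

Lemma is_derive_comb u w (a b c : R) x (v : X) : (forall y, exists d, is_derive y v u d) ->
  (forall y, exists d, is_derive y v w d) -> is_derive x v u a -> is_derive x v w b ->
  is_derive x v (fun y => u y - c * w y) (a - c * b).
Proof.
move=> /choice[du hu] /choice[dw hw] ua wb.
apply: (@is_derive_line _ _ _ (fun h => u (h *: v + x) + - (c * w (h *: v + x)))) => [h //|].
have E y : 0 *: v + y = y by rewrite scale0r add0r.
have h1 := line_derive hu x 0; have h2 := line_derive hw x 0.
rewrite E in h1; rewrite E in h2.
have [_ d1] := hu x; have [_ d2] := ua; have [_ d3] := hw x; have [_ d4] := wb.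
by apply: (dv_eq (dvD h1 (dvN (dvZ c h2)))); rewrite -d1 -d3 d2 d4.
Qed.

Lemma MVT_origin (f df : R -> R) (h : R) : 0 < h -> (forall t, is_derive t (1 : R) f (df t)) ->
  exists c, [/\ 0 < c, c < h & f h - f 0 = df c * h].
Proof.
move=> h0 fd; have cf := is_derive_continuous fd.
have [c] := @MVT R f df 0 h h0 (fun t _ => fd t) (continuous_subspaceT cf).
by rewrite in_itv /= subr0 => /andP[c0 ch] E; exists c.
Qed.

Lemma mixed_difference v (vi vji : X -> R) i j x (h : R) : 0 < h ->
  (forall y, is_derive y (e_ i) v (vi y)) -> (forall y, is_derive y (e_ j) vi (vji y)) ->
  exists c d, [/\ 0 < c, c < h, 0 < d & d < h] /\
    v (h *: e_ i + (h *: e_ j + x)) - v (h *: e_ i + x) - (v (h *: e_ j + x) - v x) =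
    vji (d *: e_ j + (c *: e_ i + x)) * h * h.
Proof.
move=> h0 dv dvi.
have d1 t := dvD (line_derive dv (h *: e_ j + x) t) (dvN (line_derive dv x t)).
have [c [c0 ch]] := MVT_origin h0 d1.
rewrite !scale0r !add0r => E.
have [d [d0 dh]] := MVT_origin h0 (line_derive dvi (c *: e_ i + x)).
rewrite scale0r add0r => E2.
exists c, d; split=> //; rewrite -E2 (addrCA (h *: e_ j)) -E; ring.
Qed.

(** Only directional derivatives are available, so the classical argument is run on the plane
    spanned by two unit vectors. The second difference over a small square equals [h^2] times either
    mixed derivative at some nearby point, and norm continuity of both concludes. *)
Lemma schwarz v (vi vj vij vji : X -> R) i j :
  (forall y, is_derive y (e_ i) v (vi y)) -> (forall y, is_derive y (e_ j) v (vj y)) ->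
  (forall y, is_derive y (e_ j) vi (vji y)) -> (forall y, is_derive y (e_ i) vj (vij y)) ->
  ncont vij -> ncont vji -> vji = vij.
Proof.
move=> hi hj hji hij cij cji; apply/funext => x; apply/eqP; rewrite -subr_eq0 -normr_le0.
apply/ler_addgt0Pl => e e0; rewrite addr0.
have [|d1 d10 h1] := cij x (e / 2); first by rewrite divr_gt0.
have [|d2 d20 h2] := cji x (e / 2); first by rewrite divr_gt0.
pose M := `|e_ i| + `|e_ j| + 1; have M0 : 0 < M by rewrite ltr_wpDl ?addr_ge0.
pose d := Num.min d1 d2; have d0 : 0 < d by rewrite lt_min d10.
pose h := d / M; have h0 : 0 < h by rewrite divr_gt0.
have small (s t : R) (k l : nat) : 0 < s -> s < h -> 0 < t -> t < h -> `|e_ k| + `|e_ l| + 1 = M ->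
    `|x - (s *: e_ k + (t *: e_ l + x))| < d.
  move=> s0 sh t0 th ME.
  have -> : x - (s *: e_ k + (t *: e_ l + x)) = - (s *: e_ k + t *: e_ l).
    by rewrite addrA opprD addrCA subrr addr0.
  rewrite normrN; apply: le_lt_trans (ler_normD _ _) _; rewrite !normrZ !gtr0_norm //.
  apply: (@le_lt_trans _ _ (h * (`|e_ k| + `|e_ l|))).
    by rewrite mulrDr lerD // ler_wpM2r // ltW.
  by rewrite /h mulrAC ltr_pdivrMr // ltr_pM2l // -ME ltrDl.
have [c [k [[c0 ch k0 kh] E1]]] := mixed_difference x h0 hi hji.
have [c' [k' [[c'0 c'h k'0 k'h] E2]]] := mixed_difference x h0 hj hij.
have E : vji (k *: e_ j + (c *: e_ i + x)) = vij (k' *: e_ i + (c' *: e_ j + x)).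
  have hh : h * h != 0 by rewrite mulf_neq0 // gt_eqF.
  apply: (mulIf hh); rewrite -[LHS]/(_ * (h * h)) -[RHS]/(_ * (h * h)) !(mulrA _ h h).
  by rewrite -[LHS]E1 -[RHS]E2 (addrCA (h *: e_ i)); ring.
have s1 := small k c j i k0 kh c0 ch; rewrite {1}/M (addrC `|e_ j|) in s1; have {}s1 := s1 erefl.
have s2 := small k' c' i j k'0 k'h c'0 c'h erefl.
have l2 : `|vji x - vji (k *: e_ j + (c *: e_ i + x))| < e / 2.
  by apply: h2; apply: lt_le_trans s1 _; rewrite ge_min lexx orbT.
have l1 : `|vij x - vij (k' *: e_ i + (c' *: e_ j + x))| < e / 2.
  by apply: h1; apply: lt_le_trans s2 _; rewrite ge_min lexx.
rewrite E in l2; set z := vij (k' *: _ + _) in l1 l2.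
rewrite (_ : vji x - vij x = (vji x - z) - (vij x - z)); last by ring.
by apply: le_trans (ler_normB _ _) _; rewrite [leRHS]splitr lerD // ltW.
Qed.

(** A list is a multi-index of partial derivatives; [A] collects the variables whose two derivatives
    have already been spent by an applied factor of [D]. *)
Definition budget (A : nat -> bool) (r : seq nat) := forall j, (count_mem j r <= (if A j then 0 else 2))%N.

(* [v] has continuous bounded derivatives, of order at most 2 in each variable outside [A]. *)
Definition smooth_off (A : nat -> bool) v := forall r, budget A r ->
  [/\ ncont (foldr (@pderiv R gamma) v r), exists M, forall x, `|foldr (@pderiv R gamma) v r x| <= M &
      forall i, ~~ A i -> (count_mem i r < 2)%N ->
        forall x, is_derive x (e_ i) (foldr (@pderiv R gamma) v r) (foldr (@pderiv R gamma) v (i :: r) x)].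

Lemma smooth2_off v : smooth2 v -> smooth_off (fun=> false) v.
Proof.
move=> sv r br; have [c b d] := sv r br; split=> //; first exact: continuous_ncont.
by move=> i _ ri x; split => //; exact: d.
Qed.

Lemma budget_cons A i r : budget A (i :: r) -> [/\ ~~ A i, (count_mem i r < 2)%N & budget A r].
Proof.
move=> b; have := b i; rewrite /= eqxx add1n; case: (boolP (A i)) => // _ h; split=> // j.
by apply: leq_trans (b j); rewrite /= leq_addl.
Qed.

Lemma budget_cat A i r : budget (fun j => (j == i) || A j) r -> ~~ A i -> budget A (r ++ [:: i; i]).
Proof.
move=> b Ai j; have := b j; rewrite count_cat /= addn0 (eq_sym i j).
have [->|ji] /= := eqVneq j i; first by rewrite leqn0 => /eqP ->; rewrite (negbTE Ai).
by rewrite !addn0.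
Qed.

(** The second derivative of the factor acts first, hence stands at the end of the list. The outer
    derivatives thus distribute over the difference without being commuted with it. *)
Lemma foldr_factor A v beta i r : smooth_off A v -> ~~ A i -> budget (fun j => (j == i) || A j) r ->
  foldr (@pderiv R gamma) (D_factor beta i v) r =
  (fun x => foldr (@pderiv R gamma) v r x - beta i / 2 * foldr (@pderiv R gamma) v (r ++ [:: i; i]) x).
Proof.
move=> sv Ai; elim: r => [|j r IH] b //=.
have [Aj rj br] := budget_cons b; move: Aj; rewrite negb_or => /andP[ji Aj].
rewrite IH //; apply/funext => x.
have br' := budget_cat br Ai.
have bA : budget A r by move=> k; have := br' k; rewrite count_cat; apply: leq_trans; exact: leq_addr.
have [_ _ d1] := sv r bA; have [_ _ d2] := sv _ br'.
have rj' : (count_mem j (r ++ [:: i; i]) < 2)%N by rewrite count_cat /= !(eq_sym i) (negbTE ji) !addn0.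
have h1 := d1 j Aj rj; have h2 := d2 j Aj rj'.
have h := @is_derive_comb _ _ _ _ (beta i / 2) x _ (fun y => ex_intro _ _ (h1 y)) (fun y => ex_intro _ _ (h2 y)) (h1 x) (h2 x).
by have [_] := h.
Qed.

Lemma smooth_factor A v beta i : smooth_off A v -> ~~ A i ->
  smooth_off (fun j => (j == i) || A j) (D_factor beta i v).
Proof.
move=> sv Ai r b; have b' := budget_cat b Ai.
have bA : budget A r by move=> k; have := b' k; rewrite count_cat; apply: leq_trans; exact: leq_addr.
have [c1 [M1 m1] d1] := sv r bA; have [c2 [M2 m2] d2] := sv _ b'.
rewrite (foldr_factor beta sv Ai b); split.
- exact: ncontBZ.
- exists (M1 + `|beta i / 2| * M2) => x; apply: le_trans (ler_normB _ _) _.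
  by rewrite lerD // normrM ler_wpM2l.
move=> j; rewrite negb_or => /andP[ji Aj] rj x.
have rj' : (count_mem j (r ++ [:: i; i]) < 2)%N by rewrite count_cat /= !(eq_sym i) (negbTE ji) !addn0.
have h1 := d1 j Aj rj; have h2 := d2 j Aj rj'.
have bj : budget (fun j => (j == i) || A j) (j :: r).
  move=> k /=; have [<-|jk] := eqVneq j k; last by rewrite add0n; exact: b.
  by rewrite (negbTE ji) (negbTE Aj) /= add1n.
rewrite (foldr_factor beta sv Ai bj).
exact: (@is_derive_comb _ _ _ _ (beta i / 2) x _ (fun y => ex_intro _ _ (h1 y)) (fun y => ex_intro _ _ (h2 y)) (h1 x) (h2 x)).
Qed.

Lemma pderiv_swap A v i j r : smooth_off A v -> i != j -> budget A (i :: j :: r) ->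
  foldr (@pderiv R gamma) v (i :: j :: r) = foldr (@pderiv R gamma) v (j :: i :: r).
Proof.
move=> sv ij b; have [Ai ri bj] := budget_cons b; have [Aj rj br] := budget_cons bj.
have ji : j != i by rewrite eq_sym.
have ri' : (count_mem i r < 2)%N by move: ri; rewrite /= (negbTE ji).
have rj' : (count_mem j (i :: r) < 2)%N by rewrite /= (negbTE ij).
have bi : budget A (i :: r).
  by move=> k; apply: leq_trans (b k); rewrite /= leq_add2l leq_addl.
have bji : budget A (j :: i :: r) by move=> k; have := b k; rewrite /= addnCA.
have [_ _ d0] := sv r br; have [_ _ di] := sv _ bi; have [_ _ dj] := sv _ bj.
have [cij _ _] := sv _ b; have [cji _ _] := sv _ bji.
exact: (schwarz (d0 j Aj rj) (d0 i Ai ri') (dj i Ai ri) (di j Aj rj') cji cij).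
Qed.

Lemma pderiv2_comm A v i j : smooth_off A v -> i != j -> ~~ A i -> ~~ A j ->
  foldr (@pderiv R gamma) v [:: i; i; j; j] = foldr (@pderiv R gamma) v [:: j; j; i; i].
Proof.
move=> sv ij Ai Aj; have ji : j != i by rewrite eq_sym.
have B r : (count_mem i r <= 2)%N -> (count_mem j r <= 2)%N -> all (fun k => (k == i) || (k == j)) r -> budget A r.
  move=> h1 h2 /allP h k; have [->|ki] := eqVneq k i; first by rewrite (negbTE Ai).
  have [->|kj] := eqVneq k j; first by rewrite (negbTE Aj).
  rewrite (_ : count_mem k r = 0%N) //; apply/count_memPn/negP => /h.
  by rewrite (negbTE ki) (negbTE kj).
have S p k l r : k != l -> budget A (k :: l :: r) ->
    foldr (@pderiv R gamma) v (p ++ k :: l :: r) = foldr (@pderiv R gamma) v (p ++ l :: k :: r).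
  by move=> kl b; rewrite !foldr_cat (pderiv_swap sv kl b).
rewrite (S [:: i] i j [:: j] ij); last by apply: B; rewrite /= ?eqxx ?(negbTE ij) ?(negbTE ji) ?orbT.
rewrite (S [::] i j [:: i; j] ij); last by apply: B; rewrite /= ?eqxx ?(negbTE ij) ?(negbTE ji) ?orbT.
rewrite (S [:: j; i] i j [::] ij); last by apply: B; rewrite /= ?eqxx ?(negbTE ij) ?(negbTE ji) ?orbT.
by rewrite (S [:: j] i j [:: i] ij) //; apply: B; rewrite /= ?eqxx ?(negbTE ij) ?(negbTE ji) ?orbT.
Qed.

Lemma D_factor_comm A v (beta beta' : nat -> R) i j : smooth_off A v -> i != j -> ~~ A i -> ~~ A j ->
  D_factor beta i (D_factor beta' j v) = D_factor beta' j (D_factor beta i v).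
Proof.
move=> sv ij Ai Aj; have ji : j != i by rewrite eq_sym.
apply/funext => x.
have bi : budget (fun k => (k == j) || A k) [:: i; i].
  move=> k /=; rewrite addn0 eq_sym; have [->|ki] //= := eqVneq k i; first by rewrite (negbTE ij) (negbTE Ai).
have bj : budget (fun k => (k == i) || A k) [:: j; j].
  move=> k /=; rewrite addn0 eq_sym; have [->|ki] //= := eqVneq k j; first by rewrite (negbTE ji) (negbTE Aj).
have alg (a b b' c d p q : R) : p = q -> a - b' * c - b * (d - b' * p) = a - b * d - b' * (c - b * q).
  by move=> ->; ring.
pose V s := foldr (@pderiv R gamma) v s.
have h1 := congr1 (@^~ x) (foldr_factor beta' sv Aj bi).
have h2 := congr1 (@^~ x) (foldr_factor beta sv Ai bj).
have h3 : V [:: i; i; j; j] x = V [:: j; j; i; i] x by exact: (congr1 (@^~ x) (pderiv2_comm sv ij Ai Aj)).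
transitivity (v x - beta' j / 2 * V [:: j; j] x - beta i / 2 * (V [:: i; i] x - beta' j / 2 * V [:: i; i; j; j] x)).
  exact: (congr1 (fun z => D_factor beta' j v x - beta i / 2 * z) h1).
transitivity (v x - beta i / 2 * V [:: i; i] x - beta' j / 2 * (V [:: j; j] x - beta i / 2 * V [:: j; j; i; i] x)).
  exact: (alg (v x) (beta i / 2) (beta' j / 2) (V [:: j; j] x) (V [:: i; i] x) _ _ h3).
exact: esym (congr1 (fun z => D_factor beta i v x - beta' j / 2 * z) h2).
Qed.

Fixpoint factor_range beta k n v : X -> R :=
  if n is n'.+1 then D_factor beta (k + n') (factor_range beta k n' v) else v.

Lemma factor_range0 beta n v : factor_range beta 0 n v = D_partial beta n v.
Proof. by elim: n => [//|n IH]; exact: (congr1 (D_factor beta n) IH). Qed.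

Lemma factor_range_recl beta k n v :
  factor_range beta k n.+1 v = factor_range beta k.+1 n (D_factor beta k v).
Proof.
elim: n => [|n IH]; first by rewrite /= addn0.
by rewrite -[LHS]/(D_factor beta (k + n.+1) (factor_range beta k n.+1 v)) IH addnS -addSn.
Qed.

Lemma smooth_off_ext A A' v : A =1 A' -> smooth_off A v -> smooth_off A' v.
Proof. by move=> /funext ->. Qed.

Lemma smooth_factor_range A beta k n v : smooth_off A v -> (forall j, (k <= j)%N -> ~~ A j) ->
  smooth_off (fun j => A j || (k <= j < k + n)%N) (factor_range beta k n v).
Proof.
move=> sv h; elim: n => [|n IH] /=.
  apply: smooth_off_ext sv => j; rewrite addn0; case: (A j) => //=.
  by apply/esym/negbTE; rewrite negb_and -leqNgt -ltnNge; case: (leqP k j) => //= _; rewrite ?orbT.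
have nA : ~~ (A (k + n)%N || (k <= k + n < k + n)%N) by rewrite ltnn andbF orbF h // leq_addr.
apply: smooth_off_ext (smooth_factor beta IH nA) => j /=.
rewrite addnS ltnS orbCA; congr (_ || _); rewrite (leq_eqVlt j).
by have [->|jn] /= := eqVneq j (k + n)%N; rewrite ?leq_addr.
Qed.

(** Moves the factor of index [k] to the outside of the product, where it can be exchanged; inside,
    it was applied before the factors of higher index. *)
Lemma factor_range_comm A beta beta' k n v : smooth_off A v -> (forall j, (k <= j)%N -> ~~ A j) ->
  factor_range beta k.+1 n (D_factor beta' k v) = D_factor beta' k (factor_range beta k.+1 n v).
Proof.
move=> sv h; elim: n => [//|n IH].
have h' j : (k.+1 <= j)%N -> ~~ A j by move=> kj; apply: h; exact: ltnW.
transitivity (D_factor beta (k.+1 + n) (D_factor beta' k (factor_range beta k.+1 n v))).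
  exact: (congr1 (D_factor beta (k.+1 + n)) IH).
apply: (D_factor_comm (A := fun j => A j || (k.+1 <= j < k.+1 + n)%N)).
- exact: smooth_factor_range.
- by rewrite addSn gtn_eqF // ltnS leq_addr.
- by rewrite ltnn andbF orbF h' // addSn ltnS leq_addr.
- by rewrite ltnn orbF h.
Qed.
End DirectionalCalculus.

(** * Inverting a second-order factor by a two-sided exponential average *)
Section LaplaceAverage.
Context {R : realType}.
Local Notation T := (nat -> R).
Local Notation mu := (@lebesgue_measure R).

(** One half of the two-sided kernel; the other half is obtained by averaging along the opposite
    vector. *)
Definition lapw (c t : R) : R := \1_`[0, +oo[ t * (c / 2 * expR (- c * t)).

Lemma lapw_integrable c : 0 < c -> mu.-integrable setT (EFin \o lapw c).
Proof.
move=> c0; have E : lapw c = fun t => 2^-1 * exponential_pdf c t.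
  apply/funext => t; rewrite /lapw /exponential_pdf patchE indicE.
  case: (t \in _); last by rewrite mul0r mulr0.
  by rewrite mul1r; field.
rewrite E; apply: rintegrableZ; apply/integrableP; split.
  by apply/measurable_EFinP; exact: measurable_exponential_pdf.
under eq_integral => t _ do rewrite /= ger0_norm ?(exponential_pdf_ge0 (ltW c0)) //.
by rewrite integral_exponential_pdf // ltry.
Qed.

Lemma expRn_cvg0 c : 0 < c -> expR (- c * (0 + n%:R)) @[n --> \oo] --> (0 : R).
Proof.
move=> c0; rewrite (_ : (fun n => _) = (fun n : nat => expR (- c) ^+ n)).
  by apply: cvg_expr; rewrite ger0_norm ?expR_ge0 // expR_lt1 oppr_lt0.
by apply/funext => n; rewrite add0r mulrC expRM_natl.
Qed.

(** [- exp (- c t) (g + g1 / c) / 2] is a primitive of [(c / 2) exp (- c t) (g - g2 / c^2)]. It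
    vanishes at infinity by boundedness; for the reflected function the term with [g1] changes sign,
    so the two halves add up to [g 0]. *)
Lemma lap_half (c M : R) (g g1 g2 : R -> R) : 0 < c ->
  (forall t, is_derive t (1 : R) g (g1 t)) -> (forall t, is_derive t (1 : R) g1 (g2 t)) ->
  continuous g2 -> (forall t, [/\ `|g t| <= M, `|g1 t| <= M & `|g2 t| <= M]) ->
  \int[mu]_t (lapw c t * (g t - g2 t / c ^+ 2)) = (g 0 + g1 0 / c) / 2.
Proof.
move=> c0 d0 d1 c2 bM; have cn0 : c != 0 by rewrite gt_eqF.
have cg : continuous g := is_derive_continuous d0.
pose h t := g t - g2 t / c ^+ 2.
have ch : continuous h.
  by move=> t; apply: cvgB; [exact: cg|apply: cvgM; [exact: c2|exact: cvg_cst]].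
pose F t := - (expR (- c * t) * (g t + g1 t / c)) / 2.
pose f t := (c / 2 * expR (- c * t)) * h t.
have dF t : is_derive t (1 : R) F (f t).
  have e : is_derive t (1 : R) (fun t => expR (- c * t)) (expR (- c * t) * (- c)).
    apply: (dv_eq (dv_comp (is_derive_expR _) (dvZ (- c) (dvX 1 t)))).
    by rewrite /= expr0 !mulr1.
  have := dvZ (- 2^-1) (dvM e (dvD (d0 t) (dvZ c^-1 (d1 t)))).
  rewrite (_ : (fun t => _) = F); last by apply/funext => s; rewrite /F; field.
  by move=> hd; apply: (dv_eq hd); rewrite /f /h; field.
have ce : continuous (fun t => expR (- c * t)).
  apply: (@continuous_comp2 R (@expR R)); first exact: continuous_expR.
  by move=> t; apply: cvgM; [exact: cvg_cst|exact: cvg_id].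
have cf : continuous f.
  by apply: continuousM2 ch; apply: continuousM2 ce => t; exact: cvg_cst.
have E t : lapw c t * h t = \1_`[0, +oo[ t * f t by rewrite /lapw /f !mulrA.
under eq_Rintegral => t _ do rewrite -/(h t) E.
have hb t : `|h t| <= M + M / c ^+ 2.
  have [b0 _ b2] := bM t; apply: le_trans (ler_normB _ _) _; rewrite lerD //.
  by rewrite normrM (ger0_norm (x := (c ^+ 2)^-1)) ?invr_ge0 ?sqr_ge0 // ler_wpM2r // invr_ge0 sqr_ge0.
rewrite (halfline_integral (l := 0) cf dF).
- by rewrite /F mulr0 expR0; field.
- rewrite (_ : (fun t => _) = (fun t => lapw c t * h t)); last by apply/funext => t; rewrite E.
  apply: bounded_integrableM (lapw_integrable c0) _ hb.
  exact: continuous_measurable_fun.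
have M0 : 0 <= M by have [b _ _] := bM 0; exact: le_trans b.
have Mc : 0 <= M + M / c by rewrite addr_ge0 // divr_ge0 // ltW.
have cv := expRn_cvg0 c0.
apply/cvgr0Pnorm_lt => e e0.
have e1 : 0 < e / (M + M / c + 1) by rewrite divr_gt0 // ltr_wpDl.
have /cvgr0Pnorm_lt/(_ _ e1) := cv; apply: filterS => n.
rewrite ger0_norm ?expR_ge0 // ltr_pdivlMr ?ltr_wpDl // => hn.
apply: le_lt_trans hn; rewrite /F normrM normrN normrM ger0_norm ?expR_ge0 // -mulrA ler_wpM2l ?expR_ge0 //.
set y := g _ + _; have hy : `|y| <= M + M / c.
  have [b0 b1 _] := bM (0 + n%:R); apply: le_trans (ler_normD _ _) _; rewrite lerD // normrM.
  by rewrite (ger0_norm (x := c^-1)) ?invr_ge0 ?(ltW c0) // ler_wpM2r // invr_ge0 ltW.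
rewrite (ger0_norm (x := 2^-1)) // ?invr_ge0 //.
have := normr_ge0 y; lra.
Qed.

Definition laprate (b : R) : R := Num.sqrt (2 / b).

Lemma laprate_gt0 b : 0 < b -> 0 < laprate b.
Proof. by move=> b0; rewrite sqrtr_gt0 divr_gt0. Qed.

(* [(1 - (b/2) d^2/dt^2)^-1] is the convolution with [c/2 e^(-c|t|)], [c^2 = 2/b]. *)
Lemma lap_pair (b M : R) (g g1 g2 : R -> R) : 0 < b ->
  (forall t, is_derive t (1 : R) g (g1 t)) -> (forall t, is_derive t (1 : R) g1 (g2 t)) ->
  continuous g2 -> (forall t, [/\ `|g t| <= M, `|g1 t| <= M & `|g2 t| <= M]) ->
  \int[mu]_t (lapw (laprate b) t * (g t - b / 2 * g2 t)) +
  \int[mu]_t (lapw (laprate b) t * (g (- t) - b / 2 * g2 (- t))) = g 0.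
Proof.
move=> b0 d0 d1 c2 bM; have c0 := laprate_gt0 b0.
have E z : b / 2 * z = z / laprate b ^+ 2.
  by rewrite /laprate sqr_sqrtr ?divr_ge0 ?(ltW b0) // invf_div mulrC.
have dn (f f1 : R -> R) : (forall t, is_derive t (1 : R) f (f1 t)) ->
    forall t, is_derive t (1 : R) (fun t => f (- t)) (- f1 (- t)).
  move=> fd t; apply: (dv_eq (dv_comp (fd (- t)) (dvN (dvX 1 t)))).
  by rewrite /= expr0 mulr1 mulrN1.
have d1' t : is_derive t (1 : R) (fun t => - g1 (- t)) (g2 (- t)).
  by apply: (dv_eq (dvN (dn _ _ d1 t))); rewrite opprK.
have cg2 : continuous (fun t => g2 (- t)).
  by move=> t; apply: (@continuous_comp2 R g2 (fun t => - t)) => // s; apply: cvgN; exact: cvg_id.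
under eq_Rintegral => t _ do rewrite E.
under [X in _ + X]eq_Rintegral => t _ do rewrite E.
rewrite (lap_half c0 d0 d1 c2 bM) (lap_half (M := M) c0 (dn _ _ d0) d1' cg2).
  by rewrite oppr0; field; rewrite gt_eqF.
by move=> t; have [? ? ?] := bM (- t); rewrite normrN.
Qed.

Definition lapc (b t : R) : R[i] := ((lapw (laprate b) t)%:C)%C.

Lemma lapc_integrable b : 0 < b -> cintegrable mu (lapc b).
Proof. by move=> b0; split; [exact: lapw_integrable (laprate_gt0 b0)|exact: integrable0]. Qed.

Lemma conv_real (r : R -> R) v (G : T -> R) x :
  conv (fun t => ((r t)%:C)%C) v (fun y => ((G y)%:C)%C) x =
  ((\int[mu]_t (r t * G (line x v t)))%:C)%C.
Proof.
apply: complex_eq; first by apply: eq_Rintegral => t _; rewrite ReImE /= mul0r subr0.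
transitivity (\int[mu]_t (0 : R)); last by rewrite /Rintegral integral0_eq.
by apply: eq_Rintegral => t _; rewrite ReImE /= mul0r mulr0 addr0.
Qed.

(* Maps [(1 - b/2 d_k^2) z] to [(1 - b0/2 d_k^2) z]. *)
Definition exchange (b0 b : R) k (f : T -> R[i]) x : R[i] :=
  ((b0 / b)%:C)%C * f x + ((1 - b0 / b)%:C)%C *
    (conv (lapc b) (axis k) f x + conv (lapc b) (fun i => - axis k i) f x).

(** Origin of the formula: [1 - (b0/2) d^2 = (b0/b) (1 - (b/2) d^2) + (1 - b0/b)], where the last
    identity operator is rewritten as the average applied to [1 - (b/2) d^2]. Averages of bounded
    functions make sense for any [f], so no derivative of [f] is taken. *)
Lemma exchange_factor (b0 b M : R) k (G G1 G2 : T -> R) x : 0 < b ->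
  (forall t, is_derive t (1 : R) (fun t => G (line x (axis k) t)) (G1 (line x (axis k) t))) ->
  (forall t, is_derive t (1 : R) (fun t => G1 (line x (axis k) t)) (G2 (line x (axis k) t))) ->
  continuous (fun t => G2 (line x (axis k) t)) ->
  (forall y, [/\ `|G y| <= M, `|G1 y| <= M & `|G2 y| <= M]) ->
  exchange b0 b k (fun y => ((G y - b / 2 * G2 y)%:C)%C) x = ((G x - b0 / 2 * G2 x)%:C)%C.
Proof.
move=> bp d0 d1 c2 bM.
have L0 : line x (axis k) 0 = x by apply/funext => i; rewrite /line mul0r addr0.
have Ln t : line x (fun i => - axis k i) t = line x (axis k) (- t).
  by apply/funext => i; rewrite /line mulrN mulNr.
have h := @lap_pair b M _ _ _ bp d0 d1 c2 (fun t => bM _); rewrite L0 in h.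
rewrite /exchange /lapc !conv_real.
under [X in _ + _ * (_ + (X%:C)%C)]eq_Rintegral => t _ do rewrite Ln.
apply: complex_eq; rewrite ?ReImE /= ?(mul0r, mulr0, subr0, addr0) //.
by rewrite h; field; rewrite gt_eqF.
Qed.

(** [lap_pair] for the cosine, an eigenfunction of the second derivative, gives the real part
    without computing an integral; the sine parts of the two half-lines cancel. *)
Lemma lap_cos (b eta : R) : 0 < b ->
  cint mu (fun t => lapc b t * cis (t * eta)) + cint mu (fun t => lapc b t * cis (t * - eta)) =
  (((1 + b / 2 * eta ^+ 2)^-1)%:C)%C.
Proof.
move=> b0; have p0 : 1 + b / 2 * eta ^+ 2 != 0.
  by rewrite gt_eqF // ltr_pwDl // mulr_ge0 ?sqr_ge0 // divr_ge0 // ltW.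
have dc (f f1 : R -> R) : (forall y, is_derive y (1 : R) f (f1 y)) -> forall (t a : R),
    is_derive t (1 : R) (fun t => a * f (t * eta)) (a * eta * f1 (t * eta)).
  move=> fd t a; rewrite (_ : (fun t => _) = fun t => a * f (eta * t)); last by apply/funext => s; rewrite mulrC (mulrC s) mulrC.
  apply: (dv_eq (dvZ a (dv_comp (fd (eta * t)) (dvZ eta (dvX 1 t))))).
  by rewrite /= expr0 (mulrC eta t); ring.
have sn y : is_derive y (1 : R) (fun z : R => - sin z) (- cos y) by exact: dvN (is_derive_sin y).
pose g t := 1 * cos (t * eta); pose g1 t := 1 * eta * - sin (t * eta).
pose g2 t := 1 * eta * eta * - cos (t * eta).
have d0 t : is_derive t (1 : R) g (g1 t) := dc _ _ (fun y => is_derive_cos y) t 1.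
have d1 t : is_derive t (1 : R) g1 (g2 t) := dc _ _ sn t (1 * eta).
have c2 : continuous g2.
  have cg : continuous g := is_derive_continuous d0.
  rewrite (_ : g2 = fun t => - (eta * eta) * g t); last by apply/funext => t; rewrite /g2 /g; ring.
  by move=> t; apply: cvgM; [exact: cvg_cst|exact: cg].
have bM t : [/\ `|g t| <= 1 + `|eta| + `|eta| * `|eta|, `|g1 t| <= 1 + `|eta| + `|eta| * `|eta|
    & `|g2 t| <= 1 + `|eta| + `|eta| * `|eta|].
  have c1 : `|cos (t * eta)| <= 1 by rewrite ler_norml cos_geN1 cos_le1.
  have s1 : `|sin (t * eta)| <= 1 by rewrite ler_norml sin_geN1 sin_le1.
  have n0 := normr_ge0 eta; have nn : 0 <= `|eta| * `|eta| by rewrite mulr_ge0.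
  have a1 : `|eta| * `|sin (t * eta)| <= `|eta| by rewrite ler_piMr.
  have a2 : `|eta| * `|eta| * `|cos (t * eta)| <= `|eta| * `|eta| by rewrite ler_piMr.
  by rewrite /g /g1 /g2 !mul1r !normrM !normrN; split; lra.
have h := lap_pair b0 d0 d1 c2 bM.
have iw := lapw_integrable (laprate_gt0 b0).
pose C := \int[mu]_t (lapw (laprate b) t * cos (t * eta)).
have ic : mu.-integrable setT (EFin \o (fun t => lapw (laprate b) t * cos (t * eta))).
  apply: (bounded_integrableM (M := 1) iw) => [|t]; last by rewrite ler_norml cos_geN1 cos_le1.
  have cg : continuous g := is_derive_continuous d0.
  by apply: continuous_measurable_fun => t; have := cg t; rewrite /g (_ : (fun t => 1 * _) = (fun t => cos (t * eta))) //; apply/funext => s; rewrite mul1r.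
have CE (f : R -> R) : (forall t, f t = (1 + b / 2 * eta ^+ 2) * (lapw (laprate b) t * cos (t * eta))) ->
    \int[mu]_t f t = (1 + b / 2 * eta ^+ 2) * C.
  by move=> fE; rewrite /C -RintegralZl //; apply: eq_Rintegral => t _.
move: h; rewrite (CE _) => [|t]; last by rewrite /g /g2; ring.
rewrite (CE _) => [|t]; last by rewrite /g /g2 mulNr cosN; ring.
rewrite /g mul0r cos0 => h.
have is_ : mu.-integrable setT (EFin \o (fun t => lapw (laprate b) t * sin (t * eta))).
  apply: (bounded_integrableM (M := 1) iw) => [|t]; last by rewrite ler_norml sin_geN1 sin_le1.
  apply: continuous_measurable_fun; apply: (@continuous_comp2 R (@sin R)); first exact: continuous_sin.
  by move=> t; apply: cvgM; [exact: cvg_id|exact: cvg_cst].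
have R1 : Re (cint mu (fun t => lapc b t * cis (t * eta))) = C.
  by apply: eq_Rintegral => t _; rewrite ReImE /= mul0r subr0.
have R2 : Re (cint mu (fun t => lapc b t * cis (t * - eta))) = C.
  by apply: eq_Rintegral => t _; rewrite ReImE /= mul0r subr0 mulrN cosN.
have I1 : Im (cint mu (fun t => lapc b t * cis (t * eta))) = \int[mu]_t (lapw (laprate b) t * sin (t * eta)).
  by apply: eq_Rintegral => t _; rewrite ReImE /= mul0r addr0.
have I2 : Im (cint mu (fun t => lapc b t * cis (t * - eta))) = -1 * \int[mu]_t (lapw (laprate b) t * sin (t * eta)).
  rewrite -RintegralZl //; apply: eq_Rintegral => t _.
  by rewrite ReImE /= mul0r addr0 mulrN sinN mulrN mulN1r.
apply: complex_eq; rewrite ReImE.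
  by rewrite R1 R2 -[RHS]/((1 + b / 2 * eta ^+ 2)^-1); apply: (mulfI p0); rewrite /= mulfV // mulrDr h mulr1.
by rewrite I1 I2 mulN1r subrr.
Qed.

Definition symfactor (b : T) (m : nat) (xi : T) : R := \prod_(i < m) (1 + b i / 2 * xi i ^+ 2).

Lemma symfactor_gt0 b m xi : (forall i, 0 < b i) -> 0 < symfactor b m xi.
Proof.
move=> b0; apply: prodr_gt0 => i _.
by rewrite ltr_pwDl // mulr_ge0 ?sqr_ge0 // divr_ge0 // ltW.
Qed.

Lemma exchange_wave (b0 b : R) k m xi x : 0 < b -> (k < m)%N ->
  exchange b0 b k (cwave m xi) x =
  (((1 + b0 / 2 * xi k ^+ 2) / (1 + b / 2 * xi k ^+ 2))%:C)%C * cwave m xi x.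
Proof.
move=> bp km; have p0 : 1 + b / 2 * xi k ^+ 2 != 0.
  by rewrite gt_eqF // ltr_pwDl // mulr_ge0 ?sqr_ge0 // divr_ge0 // ltW.
have S : \sum_(i < m) xi i * axis k i = xi k.
  rewrite (bigD1 (Ordinal km)) //= /axis eqxx mulr1 big1 ?addr0 // => i ik.
  by rewrite (_ : (i == k :> nat) = false) ?mulr0 //; apply/negbTE.
have S' : \sum_(i < m) xi i * - axis k i = - xi k.
  by rewrite -S -sumrN; apply: eq_bigr => i _; rewrite mulrN.
have iw := lapc_integrable bp.
rewrite /exchange !conv_wave // S S' -mulrDl lap_cos // mulrA -mulrDl; congr (_ * _).
apply: complex_eq; rewrite ?ReImE /= ?(mul0r, mulr0, subr0, addr0) //.
by apply: (mulIf p0); rewrite mulrDl !divfK //; field; rewrite gt_eqF.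
Qed.

Lemma sfun_exchange m L b0 b k : 0 < b -> sfun m L -> sfun m (fun f => L (exchange b0 b k f)).
Proof.
move=> bp sL; have iw := lapc_integrable bp.
have s1 := sfun_conv (axis k) iw sL; have s2 := sfun_conv (fun i => - axis k i) iw sL.
have E f : cyl m f -> L (exchange b0 b k f) = ((b0 / b)%:C)%C * L f + ((1 - b0 / b)%:C)%C *
    (L (conv (lapc b) (axis k) f) + L (conv (lapc b) (fun i => - axis k i) f)).
  move=> cf; have c1 := cyl_conv (axis k) iw cf; have c2 := cyl_conv (fun i => - axis k i) iw cf.
  rewrite /exchange sL.1 //; last by apply: cylZ; exact: cylD.
  congr (_ + _); rewrite (sfunZ _ sL); last exact: cylD.
  congr (_ * _).
  have := sL.1 1 _ _ c1 c2; rewrite mul1r => <-; congr L.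
  by apply/funext => y; rewrite mul1r.
split=> [a f g cf cg|F f M cF FM Ff].
  rewrite !E //; last by apply: cylD => //; exact: cylZ.
  rewrite sL.1 // s1.1 // s2.1 //; ring.
have cf : cyl m f := cyl_lim cF FM Ff.
rewrite E // (_ : (fun k0 => _) = (fun j => ((b0 / b)%:C)%C * L (F j) + ((1 - b0 / b)%:C)%C *
    (L (conv (lapc b) (axis k) (F j)) + L (conv (lapc b) (fun i => - axis k i) (F j))))); last first.
  by apply/funext => j; exact: E.
by apply: ccvgD; apply: ccvgZ; [exact: sL.2 cF FM Ff|apply: ccvgD; [exact: s1.2 cF FM Ff|exact: s2.2 cF FM Ff]].
Qed.

(** Each exchange is absorbed into the functional: after [k] steps its transform has the first [k]
    factors of [b0] in place of those of [b]. After [m] steps it has the transform of [L'], hence is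
    [L'] on [cyl m]. *)
Lemma exchange_chain m L L' (b0 b : T) (psi : T -> R[i]) (Z : nat -> T -> R[i]) : (forall i, 0 < b0 i) ->
  (forall i, 0 < b i) -> sfun m L -> sfun m L' ->
  (forall xi, ((symfactor b0 m xi)%:C)%C * L (cwave m xi) = psi xi) ->
  (forall xi, ((symfactor b m xi)%:C)%C * L' (cwave m xi) = psi xi) ->
  (forall k x, (k < m)%N -> Z k x = exchange (b0 k) (b k) k (Z k.+1) x) -> cyl m (Z m) ->
  L (Z 0%N) = L' (Z m).
Proof.
move=> b00 bp sL sL' w w' hZ cZ.
have chain k : (k <= m)%N -> exists Lk, [/\ sfun m Lk, forall xi, ((symfactor b k xi)%:C)%C * Lk (cwave m xi) =
    ((symfactor b0 k xi)%:C)%C * L (cwave m xi) & L (Z 0%N) = Lk (Z k)].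
  elim: k => [|k IH] km.
    by exists L; split=> // xi; rewrite /symfactor !big_ord0.
  have [Lk [sk wk ek]] := IH (ltnW km).
  exists (fun f => Lk (exchange (b0 k) (b k) k f)); split; first exact: sfun_exchange.
    move=> xi; rewrite (_ : exchange _ _ _ _ = fun x => (((1 + b0 k / 2 * xi k ^+ 2) / (1 + b k / 2 * xi k ^+ 2))%:C)%C * cwave m xi x).
      rewrite (sfunZ _ sk (cyl_wave m xi)) /symfactor !big_ord_recr /= -!/(symfactor _ k xi).
      have p0 : 1 + b k / 2 * xi k ^+ 2 != 0.
        by rewrite gt_eqF // ltr_pwDl // mulr_ge0 ?sqr_ge0 // divr_ge0 // ltW.
      rewrite mulrA -rmorphM (_ : symfactor b k xi * (1 + b k / 2 * xi k ^+ 2) *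
        ((1 + b0 k / 2 * xi k ^+ 2) / (1 + b k / 2 * xi k ^+ 2)) = (1 + b0 k / 2 * xi k ^+ 2) * symfactor b k xi).
        by rewrite rmorphM -mulrA wk mulrA -rmorphM (mulrC (symfactor b0 k xi)).
      by rewrite -mulrA (mulrC (1 + b k / 2 * _)) divfK // mulrC.
    by apply/funext => x; exact: exchange_wave.
  by rewrite ek; congr Lk; apply/funext => x; exact: hZ.
have [Lm [sm wm em]] := chain m (leqnn m).
rewrite em; apply: (sfun_uniq sm sL') => // xi.
have p0 : ((symfactor b m xi)%:C)%C != 0.
  by apply/eqP => /(congr1 (@Re R)) /= h; have := symfactor_gt0 m xi bp; rewrite h ltxx.
by apply: (mulfI p0); rewrite wm w w'.
Qed.
End LaplaceAverage.

(** * Uniqueness *)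
Section FinitePaths.
Context {R : realType} (a : R).
Local Notation T := (nat -> R).
Implicit Types (x y : T).

Definition emb m x : l2 a := \sum_(i < m) x i *: l2unit a i.

Lemma l2seqD (u v : l2 a) i : l2seq (u + v) i = l2seq u i + l2seq v i.
Proof. by []. Qed.

Lemma l2seq_emb m x j : l2seq (emb m x) j = trunc m x j.
Proof.
rewrite /emb; elim: m => [|m IH]; first by rewrite big_ord0.
rewrite big_ord_recr l2seqD IH -[l2seq (_ *: _) j]/(x m * (j == m)%:R) /trunc (ltnS j) (leq_eqVlt j).
have [->|jm] := eqVneq j m; first by rewrite ltnn /= ?mulr1n add0r mulr1.
by rewrite /= ?mulr0n mulr0 addr0.
Qed.

Lemma emb_line m x k t : (k < m)%N -> emb m (line x (axis k) t) = t *: l2unit a k + emb m x.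
Proof.
move=> km; rewrite /emb /line; under eq_bigr do rewrite scalerDl.
rewrite big_split addrC /=; congr (_ + _).
rewrite (bigD1 (Ordinal km)) //= /axis eqxx mulr1 big1 ?addr0 // => i ik.
by rewrite (_ : (i == k :> nat) = false) ?mulr0 ?scale0r //; apply/negbTE.
Qed.

Lemma emb_dist m x y : `|emb m x - emb m y| <= \sum_(i < m) `|x i - y i| * `|l2unit a i|.
Proof.
rewrite /emb -sumrB; apply: le_trans (ler_norm_sum _ _ _) _.
by apply: ler_sum => i _; rewrite -scalerBl normrZ.
Qed.
End FinitePaths.

Section Uniqueness.
Context {R : realType} (gamma : R).
Local Notation X := (l2 (- gamma)).
Local Notation T := (nat -> R).
Local Notation e_ := (l2unit (- gamma)).
Local Notation embX := (@emb R (- gamma)).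
Implicit Types (u v : X -> R) (x : X).

Lemma ncont_emb v m : ncont v -> cont_n m (fun y => v (embX m y)).
Proof.
move=> cv y e e0; have [d d0 hd] := cv (embX m y) e e0.
pose S := \sum_(i < m) `|e_ i|; have S0 : 0 <= S by apply: sumr_ge0.
have S1 : 0 < S + 1 by rewrite ltr_wpDl.
exists (d / (S + 1)) => [|z hz]; first by rewrite divr_gt0.
apply: hd; apply: le_lt_trans (emb_dist _ _ _ _) _.
apply: (@le_lt_trans _ _ (d / (S + 1) * S)).
  by rewrite /S mulr_sumr; apply: ler_sum => i _; rewrite ler_wpM2r // ltW // hz.
by rewrite mulrAC ltr_pdivrMr // ltr_pM2l // ltrDl.
Qed.

Lemma ncont_line v x (w : X) : ncont v -> continuous (fun t : R => v (t *: w + x)).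
Proof.
move=> cv t; apply/cvgrPdist_lt => e e0; have [d d0 hd] := cv (t *: w + x) e e0.
have w1 : 0 < `|w| + 1 by rewrite ltr_wpDl.
near=> s; apply: hd.
rewrite opprD addrACA subrr addr0 -scalerBl normrZ.
have ts : `|t - s| < d / (`|w| + 1).
  near: s; apply/nbhs_ballP; exists (d / (`|w| + 1)); first by rewrite /= divr_gt0.
  by move=> z hz; exact: hz.
apply: (@le_lt_trans _ _ (d / (`|w| + 1) * `|w|)); first by rewrite ler_wpM2r // ltW.
by rewrite mulrAC ltr_pdivrMr // ltr_pM2l // ltrDl.
Unshelve. all: by end_near. Qed.

Lemma emb_cvg x (d : R) : 0 < d -> \forall m \near \oo, `|x - embX m (l2seq x)| < d.
Proof.
move=> d0; have /cvgrPdist_lt h := @l2norm_sqr R gamma x.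
have [|N _ hN] := h (d ^+ 2); first by rewrite exprn_gt0.
exists N => // m Nm; have := hN m Nm.
set S := \sum_(i < m) _ => hS.
have xE i : l2seq (x - embX m (l2seq x)) i = l2seq x i - trunc m (l2seq x) i.
  by rewrite -(l2seq_emb (- gamma)).
have l1 : \sum_(i < n) l2weight (- gamma) i * (l2seq x i - trunc m (l2seq x) i) ^+ 2 @[n --> \oo] -->
    `|x - embX m (l2seq x)| ^+ 2.
  by have := @l2norm_sqr R gamma (x - embX m (l2seq x)); under eq_fun do under eq_bigr do rewrite xE.
have l2 : \sum_(i < n) l2weight (- gamma) i * l2seq x i ^+ 2 - S @[n --> \oo] --> `|x| ^+ 2 - S.
  by apply: cvgB; [exact: l2norm_sqr|exact: cvg_cst].
have E : `|x - embX m (l2seq x)| ^+ 2 <= `|x| ^+ 2 - S.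
  apply: (ler_cvg_to l1 l2); exists m => // n /= mn.
  rewrite le_eqVlt; apply/orP; left; apply/eqP.
  rewrite -(subnKC mn); elim: (n - m)%N => [|k IH].
    rewrite addn0 subrr big1 // => i _; by rewrite /trunc ltn_ord subrr expr0n mulr0.
  by rewrite addnS !big_ord_recr /= IH /trunc ltnNge leq_addr subr0 addrAC.
rewrite -(@ltr_pXn2r _ 2) ?nnegrE ?(ltW d0) //.
by apply: le_lt_trans E _; apply: le_lt_trans (ler_norm _) hS.
Qed.

Lemma smooth2_D_partial beta n u : smooth2 u -> smooth_off (fun j => (j < n)%N) (D_partial beta n u).
Proof.
move=> su; rewrite -factor_range0.
have := @smooth_factor_range R gamma _ beta 0 n _ (smooth2_off su) (fun _ _ => isT).
by apply: smooth_off_ext => j; rewrite add0n.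
Qed.

Lemma smooth_off_val A v : smooth_off A v -> ncont v /\ exists M, forall x, `|v x| <= M.
Proof. by move=> sv; have [|c b _] := sv [::]; first by move=> j. Qed.

(** At stage [k] the factors below [k] carry [beta'] and those from [k] to [m - 1] carry [beta].
    Both sides are a factor of index [k] applied to the same [z], in which variable [k] still has
    its two derivatives; restricted to finite paths this is the setting of [exchange_factor]. *)
Lemma exchange_step (beta beta' : T) u m k y : (forall i, 0 < beta' i) -> smooth2 u -> (k < m)%N ->
  ((factor_range beta k (m - k) (D_partial beta' k u) (embX m y))%:C)%C =
  exchange (beta k) (beta' k) k
    (fun y => ((factor_range beta k.+1 (m - k.+1) (D_partial beta' k.+1 u) (embX m y))%:C)%C) y.
Proof.
move=> b0 su km; have sv := @smooth2_D_partial beta' k _ su.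
have nk j : (k <= j)%N -> ~~ (j < k)%N by rewrite -leqNgt.
have nk' j : (k.+1 <= j)%N -> ~~ (j < k)%N by move=> kj; apply: nk; exact: ltnW.
pose z := factor_range beta k.+1 (m - k.+1) (D_partial beta' k u).
have sz := @smooth_factor_range R gamma _ beta k.+1 (m - k.+1) _ sv nk'; rewrite -/z in sz.
set A := (fun j => _) in sz; have Ak : ~~ A k by rewrite /A !ltnn.
have bud r : (count_mem k r <= 2)%N -> all (pred1 k) r -> budget A r.
  move=> h1 /allP h j; have [->|jk] := eqVneq j k; first by rewrite (negbTE Ak).
  by rewrite (_ : count_mem j r = 0%N) //; apply/count_memPn/negP => /h /=; rewrite (negbTE jk).
have [|c0 [M0 m0] d0] := sz [::]; first exact: bud.
have [|c1 [M1 m1] d1] := sz [:: k]; first by apply: bud; rewrite /= eqxx.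
have [|c2 [M2 m2] _] := sz [:: k; k]; first by apply: bud; rewrite /= eqxx.
have {}d0 := d0 k Ak isT; have {}d1 : forall x, is_derive x (e_ k) (pderiv k z) (pderiv k (pderiv k z) x).
  by apply: (d1 k Ak); rewrite /= eqxx.
have E1 : factor_range beta k (m - k) (D_partial beta' k u) = D_factor beta k z.
  by rewrite -(factor_range_comm _ _ _ sv nk) -factor_range_recl subnSK.
have E2 : factor_range beta k.+1 (m - k.+1) (D_partial beta' k.+1 u) = D_factor beta' k z.
  exact: (factor_range_comm _ _ _ sv nk).
rewrite E1 E2.
have L t : embX m (line y (axis k) t) = t *: e_ k + embX m y by exact: emb_line.
apply/esym; apply: (@exchange_factor R (beta k) (beta' k) (`|M0| + `|M1| + `|M2|) k (fun y => z (embX m y))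
  (fun y => pderiv k z (embX m y)) (fun y => pderiv k (pderiv k z) (embX m y)) y (b0 k)).
- move=> t; under eq_fun do rewrite L; rewrite L; exact: line_derive.
- move=> t; under eq_fun do rewrite L; rewrite L; exact: line_derive.
- under eq_fun do rewrite L; exact: ncont_line.
- move=> y'; have := m0 (embX m y'); have := m1 (embX m y'); have := m2 (embX m y') => /= h2 h1 h0.
  have := ler_norm M0; have := ler_norm M1; have := ler_norm M2.
  have := normr_ge0 M0; have := normr_ge0 M1; have := normr_ge0 M2.
  by split; lra.
Qed.

Lemma D_partial_exchange m L L' (beta beta' : T) (psi : T -> R[i]) u : (forall i, 0 < beta i) ->
  (forall i, 0 < beta' i) -> sfun m L -> sfun m L' ->
  (forall xi, ((symfactor beta m xi)%:C)%C * L (cwave m xi) = psi xi) ->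
  (forall xi, ((symfactor beta' m xi)%:C)%C * L' (cwave m xi) = psi xi) -> smooth2 u ->
  L (fun y => ((D_partial beta m u (embX m y))%:C)%C) = L' (fun y => ((D_partial beta' m u (embX m y))%:C)%C).
Proof.
move=> b0 b0' sL sL' w w' su.
have := @exchange_chain R m L L' beta beta' psi
  (fun k y => ((factor_range beta k (m - k) (D_partial beta' k u) (embX m y))%:C)%C) b0 b0' sL sL' w w'.
rewrite subn0 subnn factor_range0; apply.
- by move=> k x km; exact: exchange_step.
- have [c [M hM]] := smooth_off_val (@smooth2_D_partial beta' m _ su).
  by apply: (rcyl_cont (M := M)) => [|y]; [exact: ncont_emb|exact: hM].
Qed.

Lemma cwave_emb m (xi : T) x : wave (emb gamma m xi) x = cwave m xi (l2seq x).
Proof.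
rewrite /wave /cwave; congr cis; have h := @bracket_psum R gamma (emb gamma m xi) x.
apply: (cvg_unique _ h) => //=.
rewrite -(cvg_shiftn m (fun n => \sum_(i < n) l2seq (emb gamma m xi) i * l2seq x i)) /=.
rewrite (_ : (fun n => _) = fun=> \sum_(i < m) xi i * l2seq x i); first exact: cvg_cst.
apply/funext; elim=> [|n IH]; last first.
  rewrite addSn big_ord_recr /= IH l2seq_emb /trunc ltnNge leq_addl mul0r addr0 //.
by rewrite add0n; apply: eq_bigr => i _; rewrite l2seq_emb /trunc ltn_ord.
Qed.

Lemma wave_factor_emb beta m (xi : T) : wave_factor beta (emb gamma m xi) n @[n --> \oo] --> symfactor beta m xi.
Proof.
rewrite -(cvg_shiftn m) /=; rewrite (_ : (fun n => _) = fun=> symfactor beta m xi); first exact: cvg_cst.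
rewrite /wave_factor /symfactor; apply/funext; elim=> [|n IH]; last first.
  by rewrite addSn big_ord_recr /= IH l2seq_emb /trunc ltnNge leq_addl expr0n /= mulr0 addr0 mulr1.
by rewrite add0n; apply: eq_bigr => i _; rewrite l2seq_emb /trunc ltn_ord.
Qed.

Lemma fourier_cylinder (beta : T) (b0 : forall i, 0 < beta i) mu (psi : l2 gamma -> R[i]) m (xi : T) :
  has_fourier (PathDistribution b0 mu) psi ->
  ((symfactor beta m xi)%:C)%C * cmeasure_int mu (fun x : l2borel gamma => cwave m xi (l2seq x)) = psi (emb gamma m xi).
Proof.
move=> hf; have [_ <-] := hf (emb gamma m xi).
have [_ E] := D_op_wave (@wave_factor_emb beta m xi).
rewrite /pd_act /= E.
rewrite -(sfunZ _ (sfun_cmeasure mu m) (cyl_wave m xi)); congr cmeasure_int.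
by apply/funext => x; rewrite cwave_emb.
Qed.

Lemma D_prod_ncont beta u : suitable_real beta u -> ncont (D_prod beta u).
Proof.
move=> [su /uniform_cvgP cu] x e e0.
have [|N _ hN] := cu (e / 3); first by rewrite divr_gt0.
have [cN _] := smooth_off_val (@smooth2_D_partial beta N _ su).
have [|d d0 hd] := cN x (e / 3); first by rewrite divr_gt0.
exists d => // y /hd h; have h1 := hN N (leqnn N) x; have h2 := hN N (leqnn N) y.
rewrite (_ : _ - _ = (D_prod beta u x - D_partial beta N u x) + (D_partial beta N u x - D_partial beta N u y)
  - (D_prod beta u y - D_partial beta N u y)); last by ring.
apply: le_lt_trans (ler_normB _ _) _; have := ler_normD (D_prod beta u x - D_partial beta N u x) (D_partial beta N u x - D_partial beta N u y).
move: h h1 h2; lra.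
Qed.

(** [D_partial n u] may depend on all coordinates, so it is evaluated at the truncated path, which
    makes it a cylinder function. Convergence then needs the continuity of the limit besides the
    uniformity of the products. The common bound holds only from [N] on, where the products are
    within [1] of their limit. *)
Lemma D_prod_approx beta u : suitable_real beta u -> exists N M,
  [/\ forall n y, (N <= n)%N -> `|D_partial beta n u y| <= M, forall x, `|D_prod beta u x| <= M &
     forall x, D_partial beta n u (embX n (l2seq x)) @[n --> \oo] --> D_prod beta u x].
Proof.
move=> sr; have cD := D_prod_ncont sr; have [su /uniform_cvgP cu] := sr.
have [//|N _ hN] := cu 1.
have [_ [M hM]] := smooth_off_val (@smooth2_D_partial beta N _ su).
have hD x : `|D_prod beta u x| <= 1 + M.
  have h1 := hN N (leqnn N) x; have h2 := hM x.
  have := ler_normD (D_prod beta u x - D_partial beta N u x) (D_partial beta N u x).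
  by rewrite subrK; move: h1 h2; lra.
exists N, (2 + M); split=> [n y Nn|x|x].
- have h1 := hN n Nn y; have h2 := hD y.
  have := ler_normB (D_prod beta u y) (D_prod beta u y - D_partial beta n u y).
  by rewrite opprB addrC subrK; move: h1 h2; lra.
- by apply: le_trans (hD x) _; rewrite lerD2r; lra.
apply/cvgrPdist_lt => e e0; have [|d d0 hd] := cD x (e / 2); first by rewrite divr_gt0.
have [|N1 _ h1] := cu (e / 2); first by rewrite divr_gt0.
have [N2 _ h2] := emb_cvg x d0.
exists (maxn N1 N2) => // n; rewrite /= geq_max => /andP[n1 n2].
have l1 := h1 n n1 (embX n (l2seq x)); have l2 := hd _ (h2 n n2).
rewrite (_ : _ - _ = (D_prod beta u x - D_prod beta u (embX n (l2seq x))) +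
  (D_prod beta u (embX n (l2seq x)) - D_partial beta n u (embX n (l2seq x)))); last by ring.
apply: le_lt_trans (ler_normD _ _) _; move: l1 l2; lra.
Qed.

Lemma D_prod_limit beta u mu : suitable_real beta u ->
  [/\ cmeas (fun x : l2borel gamma => ((D_prod beta u x)%:C)%C), cbounded (fun x : l2borel gamma => ((D_prod beta u x)%:C)%C) &
    exists N, ccvg (fun n => cmeasure_int mu (fun x : l2borel gamma =>
      ((D_partial beta (n + N)%N u (embX (n + N)%N (l2seq x)))%:C)%C))
      (cmeasure_int mu (fun x : l2borel gamma => ((D_prod beta u x)%:C)%C))].
Proof.
move=> sr; have [N [M [h1 h2 h3]]] := D_prod_approx sr; have [su _] := sr.
have m1 n : cmeas (fun x : l2borel gamma => ((D_partial beta (n + N)%N u (embX (n + N)%N (l2seq x)))%:C)%C).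
  apply: (@cyl_meas R _ (l2borel gamma) (@l2seq R _) (n + N)%N (fun y => ((D_partial beta (n + N)%N u (embX (n + N)%N y))%:C)%C)).
    exact: coord_measurable.
  have [c [M' hM]] := smooth_off_val (@smooth2_D_partial beta (n + N)%N _ su).
  by apply: (rcyl_cont (M := M')) => [|y]; [exact: ncont_emb|exact: hM].
have c3 (x : l2borel gamma) : ccvg (fun n => ((D_partial beta (n + N)%N u (embX (n + N)%N (l2seq x)))%:C)%C) ((D_prod beta u x)%:C)%C.
  by apply: ccvg_real; have := h3 x; rewrite -(cvg_shiftn N).
split; first exact: cmeas_cvg m1 c3.
- by exists M => x; rewrite normc_real.
exists N; refine (cmeasure_int_cvg mu (M := M) m1 _ c3) => k x.
by rewrite normc_real h1 // leq_addl.
Qed.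

(** For a test function suitable for both presentations, the truncated products have equal integrals
    at every level [m], and each side tends to its own action. Real and imaginary parts of [phi] are
    treated separately, as [D_op] does. *)
Lemma pd_unique (F G : path_distribution gamma) psi : has_fourier F psi -> has_fourier G psi -> pd_eq F G.
Proof.
case: F => beta b0 mu; case: G => beta' b0' mu' hF hG phi [/= s1 s2] [/= t1 t2].
have real u : suitable_real beta u -> suitable_real beta' u ->
    cmeasure_int mu (fun x : l2borel gamma => ((D_prod beta u x)%:C)%C) =
    cmeasure_int mu' (fun x : l2borel gamma => ((D_prod beta' u x)%:C)%C).
  move=> su tu; have [_ _ [N cN]] := D_prod_limit mu su; have [_ _ [N' cN']] := D_prod_limit mu' tu.
  (* Each presentation has its own starting index, [N] or [N']; both sequences are shifted by the
     other's index so as to be compared at the same level [m]. *)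
  have shift (w : nat -> R[i]) z k : ccvg w z -> ccvg (fun n => w (n + k)%N) z.
    by move=> [c1 c2]; split; [rewrite (cvg_shiftn k (fun n => Re (w n)))|rewrite (cvg_shiftn k (fun n => Im (w n)))].
  have {}cN := shift _ _ N' cN; have {}cN' := shift _ _ N cN'.
  apply: ccvg_unique cN _; rewrite (_ : (fun n => _) = (fun n => cmeasure_int mu' (fun x : l2borel gamma =>
    ((D_partial beta' (n + N + N')%N u (embX (n + N + N')%N (l2seq x)))%:C)%C))) //.
  apply/funext => n; rewrite (addnAC n N N'); set m := (n + N' + N)%N.
  have [su' _] := su.
  exact: (D_partial_exchange b0 b0' (sfun_cmeasure mu m) (sfun_cmeasure mu' m)
    (fun xi => fourier_cylinder m xi hF) (fun xi => fourier_cylinder m xi hG) su').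
have E b (nu : cmeasure (l2borel gamma) R) : suitable_real b (fun x => Re (phi x)) -> suitable_real b (fun x => Im (phi x)) ->
    cmeasure_int nu (D_op b phi) =
    'i%C * cmeasure_int nu (fun x : l2borel gamma => ((D_prod b (fun x => Im (phi x)) x)%:C)%C) +
    cmeasure_int nu (fun x : l2borel gamma => ((D_prod b (fun x => Re (phi x)) x)%:C)%C).
  move=> r i; have [m1 [B hB] _] := D_prod_limit nu i; have [m2 [C hC] _] := D_prod_limit nu r.
  rewrite -(cmeasure_int_lin nu 'i%C m1 hB m2 hC); congr cmeasure_int; apply/funext => x.
  by apply: complex_eq; rewrite ?ReImE /= ?(mul0r, mul1r, mulr0, mulr1, subrr, add0r, addr0, subr0).
by rewrite /pd_act /= !E // !real.
Qed.
End Uniqueness.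

Theorem theorem3p1 (R : realType) (gamma : R) (hgamma : 7 / 2 < gamma) :
  let K := minK_map hgamma in
  let psi := fun xi : l2 gamma => cis (- (bracket xi (K xi) / 2)) in
  (exists (beta : nat -> R) (beta_gt0 : forall i, 0 < beta i)
          (mu : cmeasure (l2borel gamma) R),
     strongly_concentrated mu /\
     has_fourier (PathDistribution beta_gt0 mu) psi) /\
  (forall F G : path_distribution gamma,
     has_fourier F psi -> has_fourier G psi -> pd_eq F G).
Proof.
move=> K psi; split; first exact: path_distribution_exists.
by move=> F G; exact: pd_unique.
Qed.
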